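(* Let $B=(B_s)_{s\ge 0}$ be a standard Brownian motion and, for $\delta>0$, define \[ F(\delta)=\mathbb{P}\Big(\sup_{t\ge 0}\Big|\int_0^1 e^{-st}\,dB_s\Big|\le \delta\Big). \] Then $F$ is continuous and strictly increasing on $(0,\infty)$, and hence admits an inverse $F^{-1}:(0,1)\to(0,\infty)$. Furthermore, let $(\varepsilon_k)_{k\ge 0}$ be i.i.d. Rademacher random variables (uniform on $\{-1,1\}$), and set $f_n(x)=\sum_{k=0}^n\varepsilon_k x^k$ and $\|f_n\|_\infty=\max_{x\in[-1,1]}|f_n(x)|$. Then, almost surely, \[ \liminf_{n\to\infty}\frac{\|f_n\|_\infty}{\sqrt n\,F^{-1}\big((\log n)^{-1/2}\big)}=1 . \]
   Context: The process $t\mapsto \int_0^1 e^{-st}\,dB_s$ (Wiener integrals), $t\ge 0$, is taken in its version with continuous sample paths. All logarithms are natural; the ratio is considered for $n\ge 3$, so that $(\log n)^{-1/2}\in(0,1)$. *)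

(* Defs.v *)
From HB Require Import structures.
From mathcomp Require Import all_boot all_order all_algebra.
From mathcomp Require Import all_classical all_reals all_analysis.

Set Implicit Arguments.
Unset Strict Implicit.
Unset Printing Implicit Defensive.

Import Order.TTheory GRing.Theory Num.Theory.
Import numFieldNormedType.Exports.

Local Open Scope classical_set_scope.
Local Open Scope ring_scope.

Definition mutually_independent (R : realType) (d : measure_display)
    (T : measurableType d) (P : probability T R) (I : choiceType)
    (X : I -> T -> R) : Prop :=
  forall (s : seq I) (A : I -> set R), uniq s -> (forall i, measurable (A i)) ->
    P (\bigcap_(i in [set` s]) (X i @^-1` A i)) =
    (\prod_(i <- s) P (X i @^-1` A i))%E.

(* Only the times t >= 0 are constrained; normal_prob takes the standard
   deviation as its second parameter, so the increments have variance t - s. *)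
Record standard_brownian_motion (R : realType) (d : measure_display)
    (T : measurableType d) (P : probability T R) (B : R -> {RV P >-> R}) :
    Prop := {
  bm_start : {ae P, forall w, B 0 w = 0} ;
  bm_indep : forall t : nat -> R, 0 <= t 0%N -> nondecreasing_seq t ->
    mutually_independent P (fun n => B (t n.+1) \- B (t n)) ;
  bm_normal : forall s t : R, 0 <= s -> s < t ->
    forall A : set R, measurable A ->
      P ((B t \- B s) @^-1` A) = normal_prob 0 (Num.sqrt (t - s)) A ;
  bm_continuous : {ae P, forall w, {within `[0, +oo[, continuous (B ^~ w)}}
}.

(* The step function on [0, 1] equal to height i on ]node i, node i.+1] for
   i < nsteps, and to 0 elsewhere. *)
Record stepfun (R : realType) := Stepfun {
  nsteps : nat ;
  node : nat -> R ;
  height : nat -> R ;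
  node_itv : forall i, 0 <= node i <= 1 ;
  node_nondecreasing : nondecreasing_seq node
}.

Definition stepfun_eval (R : realType) (g : stepfun R) (s : R) : R :=
  \sum_(i < nsteps g) height g i * \1_(`]node g i, node g i.+1]%classic) s.

Definition stepfun_integral (R : realType) (d : measure_display)
    (T : measurableType d) (P : probability T R) (B : R -> {RV P >-> R})
    (g : stepfun R) (w : T) : R :=
  \sum_(i < nsteps g) height g i * (B (node g i.+1) w - B (node g i) w).

(* J is (a version of) the Wiener integral of f against B over [0, 1]: the
   L^2(P)-limit of the integrals of step functions that converge to f in
   L^2([0, 1]).  By the Ito isometry J is unique up to a.s. equality. *)
Definition is_wiener_integral (R : realType) (d : measure_display)
    (T : measurableType d) (P : probability T R) (B : R -> {RV P >-> R})
    (f : R -> R) (J : {RV P >-> R}) : Prop :=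
  exists g : nat -> stepfun R,
    ((\int[lebesgue_measure]_(s in `[0%R, 1%R])
        ((f s - stepfun_eval (g m) s) ^+ 2)%:E)%E @[m --> \oo] --> 0%E) /\
    (('E_P[fun w => ((J w - stepfun_integral B (g m) w) ^+ 2)%R])%E
        @[m --> \oo] --> 0%E).

(* Continuity is required on every path, which makes the event in
   sup_ball_prob measurable. *)
Definition continuous_laplace_process (R : realType) (d : measure_display)
    (T : measurableType d) (P : probability T R)
    (B X : R -> {RV P >-> R}) : Prop :=
  (forall t : R, 0 <= t ->
     is_wiener_integral B (fun s => expR (- (s * t))) (X t)) /\
  (forall w : T, {within `[0, +oo[, continuous (X ^~ w)}).

Definition sup_ball_prob (R : realType) (d : measure_display)
    (T : measurableType d) (P : probability T R) (X : R -> {RV P >-> R})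
    (delta : R) : R :=
  fine (P [set w | (ereal_sup [set `|X t w|%:E | t in `[0%R, +oo[%classic]
                    <= delta%:E)%E]).

Definition inverse_between (S U : Type) (A : set S) (B : set U)
    (F : S -> U) (G : U -> S) : Prop :=
  [/\ set_fun A B F, set_fun B A G, {in A, cancel F G} & {in B, cancel G F}].

Definition iid_rademacher (R : realType) (d : measure_display)
    (T : measurableType d) (P : probability T R) (eps : nat -> {RV P >-> R}) :
    Prop :=
  mutually_independent P (fun k => eps k : T -> R) /\
  (forall k, P (eps k @^-1` [set 1]) = (2^-1)%:E /\
             P (eps k @^-1` [set -1]) = (2^-1)%:E).

Definition random_poly (R : realType) (d : measure_display)
    (T : measurableType d) (P : probability T R) (eps : nat -> {RV P >-> R})
    (n : nat) (w : T) (x : R) : R :=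
  \sum_(k < n.+1) eps k w * x ^+ k.

(* For continuous f the supremum is attained, so this is the maximum. *)
Definition sup_norm (R : realType) (f : R -> R) : R :=
  sup [set `|f x| | x in `[-1, 1]%classic].

(* Main.v *)
Require Import Defs.
From HB Require Import structures.
From mathcomp Require Import all_boot all_order all_algebra.
From mathcomp Require Import all_classical all_reals all_analysis.
From mathcomp Require Import measurable_realfun ring lra zify.

Set Implicit Arguments.
Unset Strict Implicit.
Unset Printing Implicit Defensive.

Import Order.TTheory GRing.Theory Num.Theory.
Import numFieldNormedType.Exports.

Local Open Scope classical_set_scope.
Local Open Scope ring_scope.

(* Pairing the coefficients of x^(2l) and x^(2l+1) turns ||f_n|| <= b, up to a bounded
   change of b, into the event that both polynomials sum_l (e_(2l) + e_(2l+1)) y^l and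
   sum_l (e_(2l) - e_(2l+1)) y^l are bounded by b on [0, 1].  A Lindeberg replacement at
   geometrically spaced points y = exp (- t / L) compares them with two independent
   Gaussian polynomials, whose suprema approximate that of the Laplace process; so
   P(||f_n|| <= a sqrt n) is F(a)^2 up to (log n)^-3 and a factor 1 +- eps on a.
   With F(delta)^2 = 1 / log n both Borel-Cantelli arguments are borderline.
   For the upper bound, blocks of coefficients ending at N_k with log N_k of order k log k
   are independent and sum 1 / (k log k) diverges.
   For the lower bound, Ottaviani's inequality on [m, (1 + theta) m] with theta of order
   delta^2 leaves about delta^-2 events per dyadic scale.  This is compensated by
   F((1 - eps) delta) <= delta^2 F(delta): about log (1 / delta) disjoint shifts of bounded
   cost each raise the small ball probability by a fixed factor, by Cameron-Martin.
   Finally F(delta) >= exp (- delta^(-3/2)) makes the remaining series converge. *)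

(** * Independence and product laws *)

(** On the Brownian side everything is finite dimensional: the increments of [B] over a mesh 1/n
    form an i.i.d. Gaussian vector, the Wiener integrals are replaced by the polynomial
    [laplace_sum] in these increments, and the estimates of F come from finite grids and arbitrarily
    large n, at the price of an arbitrarily small change of radius. The supremum over [0, 1] is
    reached from a grid by Abel summation: between z < y a polynomial varies by at most 4 (y - z) /
    (1 - z) times its largest partial sum. A grid that is geometric in 1 - y therefore needs only a
    power of log n many points, and the Lindeberg error, cubic in that number, is beaten by the
    factor n^(-1/2). Small radii are written delta = u^-8 to keep exponents integral: F(delta) >=
    exp (- u^12), while the tails of the Cameron-Martin densities are of order exp (- c u^14), so
    that they can be neglected. The sum and the difference of two signs are uncorrelated but
    dependent; this is why the replacement treats both at once, pair by pair. *)

Section independence.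
Context (R : realType) (d : measure_display) (T : measurableType d)
  (P : probability T R) (X : nat -> {RV P >-> R}).

(** A pi-system for the events that depend on the coordinates selected by [p]. A predicate rather
    than a finite list also covers infinite families, such as all coordinates after a given
    index. *)
Definition cyl (p : pred nat) : set (set T) :=
  [set A | exists s B, [/\ uniq s, all p s, forall i : nat, measurable (B i) &
     A = \bigcap_(i in [set` s]) (X i @^-1` B i)]].

Lemma cyl_measurable p : cyl p `<=` measurable.
Proof.
move=> _ [s [B [us _ mB ->]]]; rewrite bigcap_seq.
by apply: bigsetI_measurable => i _; rewrite -[X in measurable X]setTI;
  exact: measurable_funP.
Qed.

Lemma cyl_setI p : setI_closed (cyl p).
Proof.
move=> _ _ [s [B [us ps mB ->]]] [s' [B' [us' ps' mB' ->]]].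
exists (undup (s ++ s')), (fun i => (if i \in s then B i else setT) `&`
  (if i \in s' then B' i else setT)); split.
- exact: undup_uniq.
- rewrite (eq_all_r (mem_undup _)) all_cat ps ps' //.
- by move=> i; apply: measurableI; case: ifP.
- rewrite predeqE => w; split => [[h1 h2] i /=|h].
    move=> _; split; case: ifP => // ii; [exact: h1|exact: h2].
  split=> i /= ii; have /h[] : [set` undup (s ++ s')] i.
  + by rewrite /= mem_undup mem_cat ii.
  + by rewrite ii.
  + by rewrite /= mem_undup mem_cat ii orbT.
  + by rewrite ii.
Qed.

Lemma cyl_preim (p : pred nat) i B : p i -> measurable B ->
  cyl p (X i @^-1` B).
Proof.
move=> pi mB; exists [:: i], (fun=> B); split => //; first by rewrite /= pi.
rewrite predeqE => w; split => [h j /= | ].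
  by rewrite inE => /eqP ->.
by apply; rewrite /= inE.
Qed.

(* The carrier is T itself, with only the events determined by the X i with
   p i declared measurable. *)
Definition sub_space (p : pred nat) := g_sigma_algebraType (cyl p).

Lemma sub_space_measurable p A : measurable (A : set (sub_space p)) ->
  measurable (A : set T).
Proof.
apply: smallest_sub; first exact: sigma_algebra_measurable.
exact: cyl_measurable.
Qed.

Lemma sub_space_measurable_fun p : measurable_fun setT
  (fun w : T => w : sub_space p).
Proof. by move=> _ A mA; rewrite setTI; exact: (@sub_space_measurable p). Qed.

Lemma sub_space_RV (p : pred nat) i : p i -> measurable_fun setT (X i : sub_space p -> R).
Proof.
by move=> pi _ A mA; rewrite setTI; apply: sub_sigma_algebra; exact: cyl_preim.
Qed.

Lemma sub_space_le (p q : pred nat) A : subpred p q ->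
  measurable (A : set (sub_space p)) -> measurable (A : set (sub_space q)).
Proof.
move=> pq; apply: smallest_sub; first exact: sigma_algebra_measurable.
move=> B [s [C [us ps mC ->]]]; apply: sub_sigma_algebra.
by exists s, C; split => //; exact: sub_all ps.
Qed.

Hypothesis hX : mutually_independent P (fun i => X i : T -> R).

Lemma indep_cyl (p q : pred nat) A B : (forall i, p i -> ~~ q i) ->
  cyl p A -> cyl q B -> P (A `&` B) = (P A * P B)%E.
Proof.
move=> pq [s [C [us ps mC ->]]] [s' [C' [us' qs' mC' ->]]].
pose D i := if p i then C i else C' i.
have mD i : measurable (D i) by rewrite /D; case: ifP.
have usD : uniq (s ++ s').
  rewrite cat_uniq us us' andbT; apply/hasPn => i /(allP qs') qi.
  by apply/negP => /(allP ps) /pq; rewrite qi.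
have e1 : \bigcap_(i in [set` s]) (X i @^-1` C i) =
    \bigcap_(i in [set` s]) (X i @^-1` D i).
  by apply: eq_bigcapr => i /= /(allP ps) pi; rewrite /D pi.
have e2 : \bigcap_(i in [set` s']) (X i @^-1` C' i) =
    \bigcap_(i in [set` s']) (X i @^-1` D i).
  apply: eq_bigcapr => i /= /(allP qs') qi; rewrite /D ifF //.
  by apply/negP => /pq; rewrite qi.
rewrite e1 e2 (hX us mD) (hX us' mD) -big_cat /= -hX //; congr (P _).
rewrite predeqE => w; split => [[h1 h2] i /=|h].
  by rewrite mem_cat => /orP[]; [exact: h1|exact: h2].
by split=> i /= ii; apply: h; rewrite /= mem_cat ii ?orbT.
Qed.

(** For fixed [B] the events independent of it form a Dynkin class. The pi-lambda theorem, used once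
    in each factor, then carries independence from cylinders to the generated sigma-algebras. *)
Let lambda_indep (B : set T) : measurable B ->
  lambda_system setT [set A | measurable A /\ P (A `&` B) = (P A * P B)%E].
Proof.
move=> mB; split => //=.
- by split => //; rewrite setTI probability_setT mul1e.
- move=> A A' A'A [mA hA] [mA' hA']; split; first exact: measurableD.
  have fP C : measurable C -> (P C < +oo)%E.
    by move=> mC; rewrite ltey_eq fin_num_measure.
  have mAB := measurableI _ _ mA mB.
  have -> : (A `\` A') `&` B = (A `&` B) `\` A' by rewrite setIC setIDA (setIC B).
  rewrite measureD ?fP // measureD ?fP //.
  have -> : A `&` B `&` A' = A' `&` B.
    by rewrite setIAC (setIidr A'A).
  rewrite (setIidr A'A) muleBl //; last 2 first.
  + exact: fin_num_measure.
  + by rewrite fin_num_adde_defr //; exact: fin_num_measure.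
  by congr (_ - _)%E; [exact: hA|exact: hA'].
- move=> F ndF hF; split; first by apply: bigcup_measurable => i _; case: (hF i).
  have c1 : P (F i) @[i --> \oo] --> P (\bigcup_i F i).
    apply: nondecreasing_cvg_mu => //; first by move=> i; case: (hF i).
    by apply: bigcup_measurable => i _; case: (hF i).
  have c2 : P (F i `&` B) @[i --> \oo] --> P ((\bigcup_i F i) `&` B).
    rewrite setI_bigcupl; apply: nondecreasing_cvg_mu => //.
    + by move=> i; apply: measurableI => //; case: (hF i).
    + apply: bigcup_measurable => i _; apply: measurableI => //.
      by case: (hF i).
    + by move=> i j ij; apply/subsetPset; apply: setSI; apply/subsetPset/ndF.
  have c3 : (P (F i) * P B)%E @[i --> \oo] --> (P (\bigcup_i F i) * P B)%E.
    by apply: cvgeZr => //; exact: fin_num_measure.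
  apply: (cvg_unique _ c2); first exact: ereal_hausdorff.
  rewrite (_ : (fun i => P (F i `&` B)) = (fun i => (P (F i) * P B)%E)) //.
  by apply/funext => i; case: (hF i).
Qed.

Lemma indep_sub_space (p q : pred nat) (A B : set T) :
  (forall i, p i -> ~~ q i) ->
  measurable (A : set (sub_space p)) -> measurable (B : set (sub_space q)) ->
  P (A `&` B) = (P A * P B)%E.
Proof.
move=> pq mA mB.
have H1 (C : set T) : cyl q C -> <<s cyl p >> `<=`
    [set A | measurable A /\ P (A `&` C) = (P A * P C)%E].
  move=> qC; apply: lambda_system_subset => //; first exact: cyl_setI.
  - by apply: lambda_indep; exact: cyl_measurable qC.
  - by move=> D pD /=; split; [exact: cyl_measurable pD|exact: indep_cyl pq pD qC].
have H2 : <<s cyl q >> `<=`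
    [set B | measurable B /\ P (B `&` A) = (P B * P A)%E].
  apply: lambda_system_subset => //; first exact: cyl_setI.
  - by apply: lambda_indep; exact: (@sub_space_measurable p).
  - move=> D qD /=; split; first exact: cyl_measurable qD.
    by rewrite setIC (H1 _ qD _ mA).2 muleC.
by rewrite setIC (H2 _ mB).2 muleC.
Qed.

Lemma decoupling (p q : pred nat) (f : sub_space p * sub_space q -> \bar R) :
  (forall i, p i -> ~~ q i) -> measurable_fun setT f ->
  (forall x, (0 <= f x)%E) ->
  (\int[P]_w f (w, w) = \int[P]_w \int[P]_v f (w, v))%E.
Proof.
move=> pq mf f0.
pose U : {mfun T >-> sub_space p} := HB.pack (fun w : T => w : sub_space p)
  (isMeasurableFun.Build _ _ _ _ _ (@sub_space_measurable_fun p)).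
pose V : {mfun T >-> sub_space q} := HB.pack (fun w : T => w : sub_space q)
  (isMeasurableFun.Build _ _ _ _ _ (@sub_space_measurable_fun q)).
have mUV : measurable_fun setT (fun w : T => (w, w) : sub_space p * sub_space q).
  by apply/measurable_fun_pairP; split; [exact: (@sub_space_measurable_fun p)|
    exact: (@sub_space_measurable_fun q)].
pose UV : {mfun T >-> (sub_space p * sub_space q)%type} :=
  HB.pack (fun w : T => (w, w) : sub_space p * sub_space q)
  (isMeasurableFun.Build _ _ _ _ _ mUV).
have E A : measurable A -> (distribution P U \x distribution P V)%E A =
    distribution P UV A.
  apply: product_measure_unique => B C mB mC.
  exact: (indep_sub_space pq mB mC).
rewrite -(@ge0_integral_distribution _ _ _ _ _ P UV f) //.
transitivity (\int[distribution P U \x distribution P V]_y f y)%E.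
  by apply/esym/eq_measure_integral => A mA _; exact: E.
rewrite fubini_tonelli1 // ge0_integral_distribution //; last 2 first.
- exact: measurable_fun_fubini_tonelli_F.
- by move=> x; apply: integral_ge0.
apply: eq_integral => w _; rewrite /fubini_F.
apply: (@ge0_integral_distribution _ _ _ _ _ P V (fun y => f (w, y))) => //.
apply: (measurableT_comp mf).
exact: (@pair1_measurable _ _ (sub_space p) (sub_space q) w).
Qed.

Lemma decoupling_measurable (p q : pred nat)
    (f : sub_space p * sub_space q -> \bar R) :
  measurable_fun setT f -> (forall x, (0 <= f x)%E) ->
  measurable_fun setT (fun w : T => \int[P]_v f (w, v))%E.
Proof.
move=> mf f0.
pose V : {mfun T >-> sub_space q} := HB.pack (fun w : T => w : sub_space q)
  (isMeasurableFun.Build _ _ _ _ _ (@sub_space_measurable_fun q)).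
have mF := @measurable_fun_fubini_tonelli_F _ _ _ _ _ (distribution P V) f mf f0.
have := measurableT_comp mF (@sub_space_measurable_fun p).
apply: eq_measurable_fun => w _; rewrite /fubini_F /=.
apply: (@ge0_integral_distribution _ _ _ _ _ P V (fun y => f (w, y))) => //.
apply: (measurableT_comp mf).
exact: (@pair1_measurable _ _ (sub_space p) (sub_space q) w).
Qed.

End independence.

(** * Laws of finite samples and change of density *)

Section tuple_law.
Context (R : realType).

Definition box n (B : nat -> set R) : set (n.-tuple R) :=
  [set x | forall i : 'I_n, B i (tnth x i)].

Definition boxes n : set (set (n.-tuple R)) :=
  [set A | exists2 B, (forall i : nat, measurable (B i)) & A = @box n B].

Lemma boxes_setI n : setI_closed (@boxes n).
Proof.
move=> _ _ [B mB ->] [C mC ->]; exists (fun i => B i `&` C i).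
  by move=> i; exact: measurableI.
rewrite predeqE => x; split => [[h1 h2] i|h]; first by split; [exact: h1|exact: h2].
by split=> i; have [] := h i.
Qed.

Lemma boxesT n : @boxes n setT.
Proof. by exists (fun=> setT) => //; rewrite predeqE => x; split. Qed.

Lemma box_measurable n B : (forall i : nat, measurable (B i)) ->
  measurable (@box n B).
Proof.
move=> mB; have -> : @box n B =
    \bigcap_(i in [set: 'I_n]) ((@tnth n R ^~ i) @^-1` B i).
  by rewrite predeqE => x; split => [h i _|h i]; exact: h.
apply: fin_bigcap_measurable => // i _; rewrite -[X in measurable X]setTI.
exact: measurable_tnth.
Qed.

Lemma tuple_measurableE n : @measurable _ (n.-tuple R) = <<s @boxes n >>.
Proof.
apply/seteqP; split; apply: smallest_sub.
- exact: smallest_sigma_algebra.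
- rewrite -bigcup_seq => A [i _ [B mB <-]].
  apply: sub_sigma_algebra; exists (fun k : nat => if k == i :> nat then B else setT).
    by move=> k; case: ifP.
  rewrite setTI predeqE => x; split => [h j|/(_ i)]; last by rewrite eqxx.
  by case: eqP => // /val_inj ->.
- exact: sigma_algebra_measurable.
- by move=> _ [B mB ->]; exact: box_measurable.
Qed.

Lemma tuple_measure_unique n (m1 m2 : {measure set (n.-tuple R) -> \bar R}) :
  (m1 setT < +oo)%E ->
  (forall B, (forall i : nat, measurable (B i)) -> m1 (box B) = m2 (box B)) ->
  forall A, measurable A -> m1 A = m2 A.
Proof.
move=> m1T h A mA; apply: (measure_unique (@boxes n) (fun=> setT)) => //.
- exact: tuple_measurableE.
- exact: boxes_setI.
- by move=> _; exact: boxesT.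
- by rewrite bigcup_const.
- by move=> _ [B mB ->]; exact: h.
Qed.

End tuple_law.

Section density_measure.
Context (R : realType) (d : measure_display) (T : measurableType d)
  (P : {measure set T -> \bar R}) (h : T -> R).
Hypothesis mh : measurable_fun setT h.
Hypothesis h0 : forall w, 0 <= h w.

(** The proofs of measurability and positivity are arguments of the term, so that the measure
    instance built below can be inferred from the term alone. *)
Definition density_measure of measurable_fun setT h & (forall w, 0 <= h w) :=
  fun A : set T => (\int[P]_(w in A) (h w)%:E)%E.

Let mu := density_measure mh h0.

Let density0 : mu set0 = 0%E.
Proof. by rewrite /mu /density_measure integral_set0. Qed.

Let density_ge0 A : (0 <= mu A)%E.
Proof. by apply: integral_ge0 => w _; rewrite lee_fin. Qed.

Let density_sigma_additive : semi_sigma_additive mu.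
Proof.
move=> F mF tF mUF; rewrite /mu /density_measure ge0_integral_bigcup //=.
- apply: is_cvg_ereal_nneg_natsum_cond => n _ _.
  by apply: integral_ge0 => w _; rewrite lee_fin.
- by apply/measurable_EFinP; exact: measurable_funTS.
- by move=> w _; rewrite lee_fin.
Qed.

HB.instance Definition _ := isMeasure.Build _ _ _ (density_measure mh h0)
  density0 density_ge0 density_sigma_additive.

End density_measure.

Section law.
Context (R : realType) (d : measure_display) (T : measurableType d)
  (P : probability T R) (X : nat -> {RV P >-> R}).
Hypothesis hX : mutually_independent P (fun i => X i : T -> R).

Lemma integral_prod n (f : nat -> R -> R) :
  (forall k, measurable_fun setT (f k)) -> (forall k x, 0 <= f k x) ->
  (\int[P]_w (\prod_(k < n) f k (X k w))%:E =
   \prod_(k < n) \int[P]_w (f k (X k w))%:E)%E.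
Proof.
move=> mf f0; elim: n => [|n IH].
  under eq_integral do rewrite big_ord0.
  by rewrite big_ord0 integral_cst //= probability_setT mul1e.
under eq_integral do rewrite big_ord_recr /=.
rewrite big_ord_recr /= -IH.
pose p : pred nat := fun k => (k < n)%N.
pose q : pred nat := fun k => (k == n)%N.
pose F (z : sub_space X p * sub_space X q) : \bar R :=
  ((\prod_(k < n) f k (X k z.1)) * f n (X n z.2))%:E.
have mprod : measurable_fun setT
    (fun w : sub_space X p => \prod_(k < n) f k (X k w)).
  apply: measurable_prod => k _; apply: measurableT_comp => //.
  by apply: (@sub_space_RV _ _ _ _ X p); exact: ltn_ord.
have mlast : measurable_fun setT (fun w : sub_space X q => f n (X n w)).
  apply: measurableT_comp => //.
  by apply: (@sub_space_RV _ _ _ _ X q); rewrite /q eqxx.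
have mF : measurable_fun setT F.
  apply/measurable_EFinP; apply: measurable_funM.
    exact: (measurableT_comp mprod (measurable_fst)).
  exact: (measurableT_comp mlast (measurable_snd)).
have pr0 w : 0 <= \prod_(k < n) f k (X k w) by apply: prodr_ge0.
have F0 z : (0 <= F z)%E by rewrite lee_fin mulr_ge0.
rewrite -[LHS]/(\int[P]_w F (w, w))%E (decoupling hX _ mF F0); last first.
  by move=> i; rewrite /p /q; case: ltngtP.
rewrite /F /=.
have mf' k : measurable_fun setT (fun w => f k (X k w)).
  by apply: measurableT_comp => //; exact: measurable_funP.
under eq_integral => w _.
  under eq_integral do rewrite EFinM.
  rewrite ge0_integralZl //; last 3 first.
  - exact/measurable_EFinP.
  - by move=> v _; rewrite lee_fin.
  - by rewrite lee_fin.
  over.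
rewrite /= ge0_integralZr //.
- by apply/measurable_EFinP; apply: measurable_prod => k _; exact: mf'.
- by move=> w _; rewrite lee_fin.
- by apply: integral_ge0 => v _; rewrite lee_fin.
Qed.

Definition sample n (w : T) : n.-tuple R := [tuple X i w | i < n].

Lemma measurable_sample n : measurable_fun setT (@sample n).
Proof.
apply/measurable_fun_tnthP => i.
by rewrite (_ : _ \o _ = X i) //; apply/funext => w /=; rewrite tnth_mktuple.
Qed.

Lemma sample_box n B : (@sample n) @^-1` (box B) =
  \bigcap_(i in [set` iota 0 n]) (X i @^-1` B i).
Proof.
rewrite predeqE => w; split => [h i /= | h i]; last first.
  by rewrite tnth_mktuple; apply: (h i); rewrite /= mem_iota add0n leq0n ltn_ord.
rewrite mem_iota add0n leq0n /= => ilt.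
by have := h (Ordinal ilt); rewrite tnth_mktuple.
Qed.

End law.

Section change_of_law.
Context (R : realType) (d d' : measure_display) (T : measurableType d)
  (T' : measurableType d') (P : probability T R) (P' : probability T' R)
  (X : nat -> {RV P >-> R}) (X' : nat -> {RV P' >-> R}) (r : nat -> R -> R).
Hypotheses (hX : mutually_independent P (fun i => X i : T -> R))
  (hX' : mutually_independent P' (fun i => X' i : T' -> R))
  (mr : forall k, measurable_fun setT (r k)) (r0 : forall k x, 0 <= r k x)
  (hr : forall k A, measurable A -> P' (X' k @^-1` A) =
    (\int[P]_(w in X k @^-1` A) (r k (X k w))%:E)%E).

(** Both sides are measures in [A], so it is enough to compare boxes, where [integral_prod] reduces
    the claim to the one-dimensional [hr]. It serves with [r = 1] for equality of laws and with
    exponential densities for Cameron-Martin. *)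
Theorem change_of_law n (A : set (n.-tuple R)) : measurable A ->
  P' (sample X' n @^-1` A) =
  (\int[P]_(w in sample X n @^-1` A) (\prod_(k < n) r k (X k w))%:E)%E.
Proof.
move=> mA.
pose h w := \prod_(k < n) r k (X k w).
have mrX k : measurable_fun setT (fun w => r k (X k w)).
  by apply: measurableT_comp => //; exact: measurable_funP.
have mh : measurable_fun setT h by apply: measurable_prod.
have h0 w : 0 <= h w by apply: prodr_ge0.
pose U : {mfun T' >-> n.-tuple R} := HB.pack (sample X' n)
  (isMeasurableFun.Build _ _ _ _ _ (@measurable_sample _ _ _ _ X' n)).
pose m1 : {measure set (n.-tuple R) -> \bar R} := distribution P' U.
pose V := sample X n; have mV : measurable_fun setT V.
  exact: measurable_sample.
pose m2 : {measure set (n.-tuple R) -> \bar R} := pushforward (density_measure P mh h0) V.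
apply: (@tuple_measure_unique _ n m1 (m2 mV)) => //.
  by rewrite (_ : m1 setT = 1%E) ?ltry //; exact: (@probability_setT _ _ _ (distribution P' U)).
move=> B mB; rewrite /m1 /m2 /= /distribution /pushforward /density_measure /=.
rewrite !sample_box (hX' (iota_uniq 0 n) mB).
have iotaE : iota 0 n = index_iota 0 n by rewrite /index_iota subn0.
rewrite {1}iotaE big_mkord.
pose f k x := r k x * \1_(B k) x.
transitivity (\prod_(k < n) \int[P]_w (f k (X k w))%:E)%E.
  apply: eq_bigr => k _; rewrite hr // integral_mkcond.
  apply: eq_integral => w _; rewrite patchE /f indicE.
  have -> : (w \in X k @^-1` B k) = (X k w \in B k).
    by apply/idP/idP; rewrite !inE.
  by case: ifP => _; rewrite ?mulr1 ?mulr0.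
rewrite -(integral_prod hX); last 2 first.
- by move=> k; apply: measurable_funM => //; exact: measurable_indic.
- by move=> k x; rewrite mulr_ge0 // indicE ler0n.
rewrite [RHS]integral_mkcond; apply: eq_integral => w _; rewrite patchE.
case: ifPn => [/set_mem h1|/negP h1].
  rewrite /h; congr EFin; apply: eq_bigr => k _; rewrite /f indicE mem_set ?mulr1//.
  by apply: h1; rewrite /= mem_iota add0n leq0n /= ltn_ord.
have [k /= kn Bk] : exists2 k, (k < n)%N & ~ B k (X k w).
  apply: contrapT => h2; apply: h1; rewrite inE => k /=.
  rewrite mem_iota add0n leq0n /= => kn.
  by apply: contrapT => h3; apply: h2; exists k.
rewrite (bigD1 (Ordinal kn)) //= /f indicE memNset // mulr0 mul0r //.
Qed.

End change_of_law.

(** * Maximal inequalities *)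

Section abel.
Context (R : realType).
Implicit Types (x w : nat -> R) (n : nat) (M y z : R).

Lemma telescope_sumN w n : \sum_(i < n) (w i - w i.+1) = w 0%N - w n.
Proof.
elim: n => [|n IH]; first by rewrite big_ord0 subrr.
by rewrite big_ord_recr /= IH; ring.
Qed.

Lemma abel_sum x w n : \sum_(i < n) w i * x i =
  w n * \sum_(i < n) x i +
  \sum_(i < n) (w i - w i.+1) * \sum_(j < i.+1) x j.
Proof.
elim: n => [|n IH]; first by rewrite !big_ord0 mulr0 addr0.
rewrite big_ord_recr /= IH [X in _ = _ + X]big_ord_recr /= (big_ord_recr n) /=.
ring.
Qed.

(** Summation by parts: the weights enter only through their last value and their total variation,
    the coefficients only through their partial sums, which are what a maximal inequality
    controls. *)
Lemma abel_bound w x n M :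
  (forall k, (k <= n)%N -> `|\sum_(i < k) x i| <= M) ->
  `|\sum_(i < n) w i * x i| <= (`|w n| + \sum_(i < n) `|w i - w i.+1|) * M.
Proof.
move=> hM; have M0 : 0 <= M.
  by have := hM 0%N isT; rewrite big_ord0 normr0.
rewrite abel_sum (le_trans (ler_normD _ _)) // mulrDl lerD //.
  by rewrite normrM ler_wpM2l // hM.
rewrite (le_trans (ler_norm_sum _ _ _)) // mulr_suml ler_sum // => i _.
by rewrite normrM ler_wpM2l // hM.
Qed.

Lemma abel_bound_decr x w n M :
  (forall k, (k <= n)%N -> `|\sum_(i < k) x i| <= M) ->
  (forall i, 0 <= w i) -> (forall i, w i.+1 <= w i) ->
  `|\sum_(i < n) w i * x i| <= w 0%N * M.
Proof.
move=> hM w0 wd; apply: (le_trans (abel_bound w hM)).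
rewrite ler_wpM2r //; first by have := hM 0%N isT; rewrite big_ord0 normr0.
rewrite ger0_norm //.
under eq_bigr => i _ do rewrite ger0_norm ?subr_ge0 //.
rewrite telescope_sumN.
lra.
Qed.

Definition pev x n (y : R) := \sum_(k < n) x k * y ^+ k.

Lemma pevE x n y : pev x n y = \sum_(k < n) y ^+ k * x k.
Proof. by apply: eq_bigr => k _; rewrite mulrC. Qed.

Lemma pev_bound x n M y :
  (forall k, (k <= n)%N -> `|\sum_(i < k) x i| <= M) -> 0 <= y <= 1 ->
  `|pev x n y| <= M.
Proof.
move=> hM /andP[y0 y1]; rewrite pevE.
have := @abel_bound_decr x (fun i => y ^+ i) n M hM.
rewrite expr0 mul1r; apply=> i; first exact: exprn_ge0.
by rewrite exprS ler_piMl // exprn_ge0.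
Qed.

(** This is [pev_bound] for the coefficients [x i * y0 ^+ i] at the point [y / y0]: partial sums at
    a single point [y0] control all of [0, y0]. It disposes of the arguments beyond the last node of
    a grid. *)
Lemma pev_bound_le x n M (y0 : R) y : 0 < y0 ->
  (forall k, (k <= n)%N -> `|pev x k y0| <= M) -> 0 <= y <= y0 ->
  `|pev x n y| <= M.
Proof.
move=> y0p hM /andP[yp yy0].
have hM' k : (k <= n)%N -> `|\sum_(i < k) (fun i => x i * y0 ^+ i) i| <= M.
  by move/hM.
have := @pev_bound (fun i => x i * y0 ^+ i) n M (y / y0) hM'.
rewrite divr_ge0 ?(ltW y0p) // ler_pdivrMr // mul1r yy0 => /(_ isT).
rewrite (_ : pev _ n (y / y0) = pev x n y) //.
apply: eq_bigr => k _; rewrite expr_div_n -mulrA (mulrC (y0 ^+ k)) divfK //.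
by rewrite expf_neq0 ?gt_eqF.
Qed.

Lemma sum_geom n (y : R) : (1 - y) * \sum_(i < n) y ^+ i = 1 - y ^+ n.
Proof.
elim: n => [|n IH]; first by rewrite big_ord0 mulr0 expr0 subrr.
by rewrite big_ord_recr /= mulrDr IH exprS; ring.
Qed.

(** Each increment equals (1 - y) (y^i - z^i) - (y - z) z^i, a difference of two nonnegative terms;
    adding instead of subtracting them leaves two geometric sums. *)
Lemma pow_diff_variation n (y z : R) : 0 <= z -> z <= y -> y <= 1 -> z < 1 ->
  \sum_(i < n) `|(y ^+ i - z ^+ i) - (y ^+ i.+1 - z ^+ i.+1)|
    <= 2 * ((y - z) / (1 - z)).
Proof.
move=> z0 zy y1 z1.
have y0 : 0 <= y by exact: le_trans zy.
have dpos : 0 < 1 - z by lra.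
apply: (@le_trans _ _ (\sum_(i < n) ((1 - y) * (y ^+ i - z ^+ i) + (y - z) * z ^+ i))).
  apply: ler_sum => i _; have yz : z ^+ i <= y ^+ i by rewrite lerXn2r ?nnegrE.
  have zi : 0 <= z ^+ i by exact: exprn_ge0.
  rewrite !exprS ler_norml; apply/andP; split; nra.
have e1 := sum_geom n y; have e2 := sum_geom n z.
rewrite big_split /= -!mulr_sumr sumrB mulrBr e1.
set s := \sum_(i < n) z ^+ i in e2 *.
have -> : s = (1 - z ^+ n) / (1 - z) by rewrite -e2 mulrC mulKf ?gt_eqF.
have yz : z ^+ n <= y ^+ n by rewrite lerXn2r ?nnegrE.
have zi : 0 <= z ^+ n by exact: exprn_ge0.
have -> : 1 - y ^+ n - (1 - y) * ((1 - z ^+ n) / (1 - z)) +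
    (y - z) * ((1 - z ^+ n) / (1 - z)) =
    (z ^+ n - y ^+ n) + (1 - z ^+ n) * (2 * ((y - z) / (1 - z))).
  by field; rewrite gt_eqF.
have q0 : 0 <= (y - z) / (1 - z) by rewrite divr_ge0 ?subr_ge0 // ltW.
nra.
Qed.

(** The bound involves only the relative change of 1 - y, which is why grids geometric in 1 - y are
    the right ones. *)
Lemma pev_diff x n M y z :
  (forall k, (k <= n)%N -> `|\sum_(i < k) x i| <= M) ->
  0 <= z -> z <= y -> y <= 1 -> z < 1 ->
  `|pev x n y - pev x n z| <= 4 * ((y - z) / (1 - z)) * M.
Proof.
move=> hM z0 zy y1 z1.
have M0 : 0 <= M by have := hM 0%N isT; rewrite big_ord0 normr0.
have -> : pev x n y - pev x n z = \sum_(i < n) (y ^+ i - z ^+ i) * x i.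
  by rewrite !pevE -sumrB; apply: eq_bigr => i _; rewrite mulrBl.
apply: (le_trans (abel_bound (fun i => y ^+ i - z ^+ i) hM)); rewrite ler_wpM2r //.
have tv := @pow_diff_variation n y z z0 zy y1 z1.
have : `|y ^+ n - z ^+ n| <=
  \sum_(i < n) `|(y ^+ i - z ^+ i) - (y ^+ i.+1 - z ^+ i.+1)|.
  have -> : y ^+ n - z ^+ n =
      - \sum_(i < n) ((y ^+ i - z ^+ i) - (y ^+ i.+1 - z ^+ i.+1)).
    by rewrite (telescope_sumN (fun i => y ^+ i - z ^+ i)) !expr0; ring.
  by rewrite normrN; exact: ler_norm_sum.
lra.
Qed.

(** At y = 1 the bound of [pev_diff] no longer gains anything; here the weights 1 - z^i are monotone
    and their total variation is 1 - z^n, small when z is within h / n of 1. *)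
Lemma pev1_diff x n M z :
  (forall k, (k <= n)%N -> `|\sum_(i < k) x i| <= M) -> 0 <= z <= 1 ->
  `|pev x n 1 - pev x n z| <= 2 * (1 - z ^+ n) * M.
Proof.
move=> hM /andP[z0 z1].
have M0 : 0 <= M by have := hM 0%N isT; rewrite big_ord0 normr0.
have -> : pev x n 1 - pev x n z = \sum_(i < n) (1 - z ^+ i) * x i.
  by rewrite !pevE -sumrB; apply: eq_bigr => i _; rewrite mulrBl expr1n.
apply: (le_trans (abel_bound (fun i => 1 - z ^+ i) hM)); rewrite ler_wpM2r //.
have zn k : z ^+ k.+1 <= z ^+ k by rewrite exprS ler_piMl // exprn_ge0.
have zn1 : z ^+ n <= 1 by exact: exprn_ile1.
under eq_bigr => i _.
  rewrite (_ : 1 - z ^+ i - (1 - z ^+ i.+1) = - (z ^+ i - z ^+ i.+1)); last by ring.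
  rewrite normrN ger0_norm ?subr_ge0 //.
  over.
rewrite (telescope_sumN (fun i => z ^+ i)).
rewrite expr0 ger0_norm ?subr_ge0 //; lra.
Qed.

End abel.

Lemma prob_indic (R : realType) (d : measure_display) (T : measurableType d)
    (P : probability T R) (A : set T) : measurable A ->
  P A = (\int[P]_w (\1_A w)%:E)%E.
Proof. by move=> mA; rewrite integral_indic // setIT. Qed.

Section kolmogorov.
Context (R : realType) (d : measure_display) (T : measurableType d)
  (P : probability T R) (X : nat -> {RV P >-> R}).

(** Independence, centring and a common variance, without a common law: one maximal inequality then
    serves signs, pair sums, pair differences and Gaussian increments. *)
Definition std_seq (v : R) := mutually_independent P (fun i => X i : T -> R) /\
  forall k, [/\ P.-integrable setT (fun w => (X k w)%:E),
    (\int[P]_w (X k w)%:E = 0)%E & (\int[P]_w (X k w ^+ 2)%:E = v%:E)%E].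

Variable v : R.
Hypothesis hX : std_seq v.

Let v0 : 0 <= v.
Proof.
have [_ _ vX] := hX.2 0%N; rewrite -lee_fin -vX.
by apply: integral_ge0 => w _; rewrite lee_fin sqr_ge0.
Qed.

Lemma std_quad k (s a : R) :
  (\int[P]_w ((s + a * X k w) ^+ 2)%:E = (s ^+ 2 + a ^+ 2 * v)%:E)%E.
Proof.
have [iX mX vX] := hX.2 k.
have mXk : measurable_fun setT (X k) by exact: measurable_funP.
have iX2 : P.-integrable setT (fun w => (X k w ^+ 2)%:E).
  apply/integrableP; split; first by apply/measurable_EFinP; exact: measurable_funX.
  under eq_integral => w _ do rewrite gee0_abs ?lee_fin ?sqr_ge0 //.
  by rewrite vX ltry.
transitivity (\int[P]_w ((s ^+ 2)%:E + ((2 * s * a)%:E * (X k w)%:E +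
    (a ^+ 2)%:E * (X k w ^+ 2)%:E)))%E.
  apply: eq_integral => w _; rewrite -!EFinM -!EFinD; congr EFin; ring.
have i1 := integrableZl measurableT (2 * s * a) iX.
have i2 := integrableZl measurableT (a ^+ 2) iX2.
rewrite integralD //=; last 2 first.
- exact: finite_measure_integrable_cst.
- exact: integrableD.
rewrite integral_cst //= probability_setT mule1 integralD //=.
rewrite !integralZl // mX vX mule0 add0e -EFinM -EFinD //.
Qed.

Definition psum (a x : nat -> R) m j := \sum_(m <= i < m + j) a i * x i.

Lemma psumS a x m j : psum a x m j.+1 = a m * x m + psum a x m.+1 j.
Proof. by rewrite /psum addnS -addSn big_ltn // addSn ltnS leq_addr. Qed.

Lemma psum0 a x m : psum a x m 0 = 0.
Proof. by rewrite /psum addn0 big_geq. Qed.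

Definition exceed (a : nat -> R) (lam : R) m s n : set T :=
  [set w | exists2 j, (j <= n)%N & lam <= `|s + psum a (X ^~ w) m j|].

Lemma exceedE a lam m s n : exceed a lam m s n =
  \bigcup_(j in `I_n.+1) [set w | lam <= `|s + psum a (X ^~ w) m j|].
Proof. by rewrite predeqE => w; split => -[j]; exists j. Qed.

Lemma measurable_psum d' (T' : measurableType d') (Y : nat -> T' -> R) a m j :
  (forall i, (m <= i < m + j)%N -> measurable_fun setT (Y i)) ->
  measurable_fun setT (fun w => psum a (Y ^~ w) m j).
Proof.
move=> mY; rewrite /psum.
under eq_fun do rewrite big_nat_cond big_mkcond /=.
apply: (@measurable_sum _ _ _ setT _ (index_iota m (m + j))
  (fun i w => if (m <= i < m + j)%N && true then a i * Y i w else 0)) => i.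
case b: ((m <= i < m + j)%N && true); last exact: measurable_cst.
case/andP: b => ii _; by apply: measurable_funM => //; exact: mY.
Qed.

Lemma measurable_exceed a (lam : R) m s n : measurable (exceed a lam m s n).
Proof.
rewrite exceedE; apply: bigcup_measurable => j _.
rewrite -[X in measurable X]setTI; apply: measurable_fun_le => //.
apply: measurableT_comp => //; apply: measurable_funD => //.
by apply: measurable_psum => i _; exact: measurable_funP.
Qed.

(* Induction on the number of summands, peeling off the first one: if s is
   already large there is nothing to prove, otherwise condition on it. *)
Theorem kolmogorov_maximal a (lam : R) m s n : 0 < lam ->
  ((lam ^+ 2)%:E * P (exceed a lam m s n) <=
   (s ^+ 2 + (\sum_(m <= i < m + n) a i ^+ 2) * v)%:E)%E.
Proof.
move=> lam0; elim: n m s => [|n IH] m s.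
  have [ls|ls] := leP lam `|s|.
    apply: (@le_trans _ _ ((lam ^+ 2)%:E * 1)%E).
      by rewrite lee_pmul2l ?probability_le1 ?lte_fin ?exprn_gt0 //;
        exact: measurable_exceed.
    rewrite mule1 lee_fin addn0 big_geq // mul0r addr0 -(real_normK (num_real s)).
    by rewrite ler_sqr ?nnegrE // ltW.
  rewrite (_ : exceed _ _ _ _ _ = set0) ?measure0 ?mule0 ?lee_fin.
    by rewrite addr_ge0 ?sqr_ge0 // mulr_ge0 // sumr_ge0 // => i _; exact: sqr_ge0.
  rewrite predeqE => w; split => // -[j]; rewrite leqn0 => /eqP ->.
  by rewrite psum0 addr0 leNgt ls.
have [ls|ls] := leP lam `|s|.
  apply: (@le_trans _ _ ((lam ^+ 2)%:E * 1)%E).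
    by rewrite lee_pmul2l ?probability_le1 ?lte_fin ?exprn_gt0 //;
      exact: measurable_exceed.
  rewrite mule1 lee_fin; apply: (@le_trans _ _ (s ^+ 2)).
    by rewrite -(real_normK (num_real s)) ler_sqr ?nnegrE // ltW.
  by rewrite lerDl mulr_ge0 // sumr_ge0 // => i _; exact: sqr_ge0.
pose p : pred nat := pred1 m.
pose q : pred nat := fun i => (m < i)%N.
pose E : set (sub_space X p * sub_space X q) := [set z | exists2 j, (j <= n)%N &
  lam <= `|s + a m * X m z.1 + psum a (X ^~ z.2) m.+1 j|].
have mE : measurable E.
  have -> : E = \bigcup_(j in `I_n.+1)
    [set z | lam <= `|s + a m * X m z.1 + psum a (X ^~ z.2) m.+1 j|].
    by rewrite predeqE => w; split => -[j]; exists j.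
  apply: bigcup_measurable => j _.
  rewrite -[X in measurable X]setTI; apply: measurable_fun_le => //.
  apply: measurableT_comp => //; apply: measurable_funD => //.
    apply: measurable_funD => //; apply: measurable_funM => //.
    have mXm : measurable_fun setT (X m : sub_space X p -> R).
      by apply: sub_space_RV; rewrite /p /= eqxx.
    exact: (measurableT_comp mXm (measurable_fst)).
  have mq : measurable_fun setT
    (fun w : sub_space X q => psum a (X ^~ w) m.+1 j).
    apply: measurable_psum => i /andP[mi _].
    exact: sub_space_RV.
  exact: (measurableT_comp mq (measurable_snd)).
have mf : measurable_fun setT (fun z => (lam ^+ 2 * \1_E z)%:E : \bar R).
  by apply/measurable_EFinP; apply: measurable_funM.
have lamE A : measurable A -> ((lam ^+ 2)%:E * P A =
    \int[P]_w (lam ^+ 2 * \1_A w)%:E)%E.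
  move=> mA; rewrite (prob_indic P mA) -ge0_integralZl //.
  by apply/measurable_EFinP; exact: measurable_indic.
  by rewrite lee_fin sqr_ge0.
have PE : ((lam ^+ 2)%:E * P (exceed a lam m s n.+1) =
    \int[P]_w ((lam ^+ 2)%:E * P (exceed a lam m.+1 (s + a m * X m w)%R n)))%E.
  rewrite lamE; last exact: measurable_exceed.
  transitivity (\int[P]_w (lam ^+ 2 * \1_E (w, w))%:E)%E.
    apply: eq_integral => w _; rewrite !indicE; congr (_ * (nat_of_bool _)%:R)%:E.
    apply/idP/idP; rewrite !inE /exceed /E /= => -[j jn hj].
      case: j jn hj => [|j] jn hj; first by move: hj; rewrite psum0 addr0 leNgt ls.
      by exists j => //; rewrite -addrA -psumS.
    by exists j.+1 => //; rewrite psumS addrA.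
  rewrite (decoupling hX.1 _ mf); last 2 first.
  - by move=> i; rewrite /p /q /= => /eqP ->; rewrite ltnn.
  - by move=> z; rewrite lee_fin mulr_ge0 ?sqr_ge0.
  apply: eq_integral => w _; rewrite lamE //.
  exact: measurable_exceed.
rewrite PE.
apply: (@le_trans _ _ (\int[P]_w ((s + a m * X m w) ^+ 2 +
    (\sum_(m.+1 <= i < m.+1 + n) a i ^+ 2) * v)%:E)%E).
  apply: ge0_le_integral => //.
  - by move=> w _; rewrite mule_ge0 // lee_fin sqr_ge0.
  - have := @decoupling_measurable _ _ _ P X p q _ mf.
    have f0 z : (0 <= (lam ^+ 2 * \1_E z)%:E)%E by rewrite lee_fin mulr_ge0 ?sqr_ge0.
    move/(_ f0); apply: eq_measurable_fun => w _; rewrite lamE //.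
    exact: measurable_exceed.
  - apply/measurable_EFinP; apply: measurable_funD => //.
    apply: measurable_funX; apply: measurable_funD => //.
    by apply: measurable_funM => //; exact: measurable_funP.
under eq_integral do rewrite EFinD.
rewrite ge0_integralD //; last 3 first.
- by move=> w _; rewrite lee_fin sqr_ge0.
- apply/measurable_EFinP.
  apply: measurable_funX; apply: measurable_funD => //.
  by apply: measurable_funM => //; exact: measurable_funP.
- by move=> w _; rewrite lee_fin mulr_ge0 // sumr_ge0 // => i _; exact: sqr_ge0.
rewrite std_quad integral_cst //= probability_setT mule1 -EFinD lee_fin.
by rewrite addnS -addSn [X in _ <= _ + X * _]big_ltn ?mulrDl ?addrA // addSn ltnS leq_addr.
Qed.

Corollary kolmogorov_partial_sums (a : nat -> R) (lam : R) n : 0 < lam ->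
  fine (P [set w : T | exists2 j, (j <= n)%N &
    lam <= `|\sum_(i < j) a i * X i w|]) <= (\sum_(i < n) a i ^+ 2) * v / lam ^+ 2.
Proof.
move=> lam0; rewrite (_ : [set w : T | _] = exceed a lam 0 0 n); last first.
  rewrite predeqE => w; split => -[j jn hj]; exists j => //;
    by move: hj; rewrite /psum add0r add0n big_mkord.
have mE := measurable_exceed a lam 0 0 n.
have := kolmogorov_maximal a 0 0 n lam0.
rewrite -(fineK (fin_num_measure P _ mE)) -EFinM lee_fin expr0n add0r add0n.
by rewrite big_mkord ler_pdivlMr ?exprn_gt0 // mulrC.
Qed.

End kolmogorov.

(** * Normal laws *)

Section integral_density.
Context (R : realType) (d : measure_display) (T : measurableType d)
  (P : {measure set T -> \bar R}) (h : T -> R).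
Hypotheses (mh : measurable_fun setT h) (h0 : forall w, 0 <= h w).
Local Open Scope ereal_scope.

Import HBNNSimple.

Let nu := density_measure P mh h0.

Let integral_density_indic E : measurable E ->
  \int[nu]_x (\1_E x)%:E = \int[P]_x ((\1_E x)%:E * (h x)%:E).
Proof.
move=> mE; rewrite integral_indic // setIT.
transitivity (\int[P]_(x in E) (h x)%:E) => //; rewrite integral_mkcond.
apply: eq_integral => x _; rewrite patchE indicE.
by case: ifP => _; rewrite ?mul1e ?mul0e.
Qed.

Let integral_density_nnsfun (f : {nnsfun T >-> R}) :
  \int[nu]_x (f x)%:E = \int[P]_x ((f x)%:E * (h x)%:E).
Proof.
under [LHS]eq_integral do rewrite fimfunE -fsumEFin//.
rewrite [LHS]ge0_integral_fsum//; last 2 first.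
  - by move=> r; exact/measurable_EFinP/measurableT_comp.
  - by move=> n x _; rewrite EFinM nnfun_muleindic_ge0.
under [RHS]eq_integral.
  move=> x xD; rewrite fimfunE -fsumEFin// muleC ge0_mule_fsumr; last first.
    by move=> r; rewrite EFinM nnfun_muleindic_ge0.
  over.
rewrite [RHS]ge0_integral_fsum//; last 2 first.
  - move=> r; apply: emeasurable_funM; first exact/measurable_EFinP.
    by apply/measurable_EFinP; do 2 apply/measurableT_comp => //.
  - move=> n x _; apply: mule_ge0; first by rewrite lee_fin.
    by rewrite EFinM nnfun_muleindic_ge0.
apply: eq_fsbigr => r _.
have [r0|r0] := leP 0%R r.
  under eq_integral do rewrite EFinM.
  under [RHS]eq_integral do rewrite EFinM muleCA.
  rewrite !ge0_integralZl ?lee_fin//.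
  - by rewrite integral_density_indic//; congr (_ * _); apply: eq_integral => x _; rewrite muleC.
  - by apply: emeasurable_funM; exact/measurable_EFinP.
  - by move=> x _; rewrite mule_ge0 ?lee_fin.
  - exact/measurable_EFinP.
rewrite preimage_nnfun0 //.
under eq_integral do rewrite indic0 mulr0.
under [RHS]eq_integral do rewrite indic0 mulr0 mule0.
by rewrite !integral0.
Qed.

Lemma integral_density (f : T -> \bar R) :
  measurable_fun setT f -> (forall x, 0 <= f x) ->
  \int[nu]_x f x = \int[P]_x (f x * (h x)%:E).
Proof.
move=> mf f0.
pose f_ := nnsfun_approx measurableT mf.
transitivity (lim (\int[nu]_x (f_ n x)%:E @[n --> \oo])).
  rewrite -monotone_convergence//=.
  - apply: eq_integral => ? /[!inE] xD; apply/esym/cvg_lim => //=.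
    exact: cvg_nnsfun_approx.
  - by move=> n; exact/measurable_EFinP/measurable_funTS.
  - by move=> n ? _; rewrite lee_fin.
  - by move=> ? _ ? ? mn; rewrite lee_fin; exact/lefP/nd_nnsfun_approx.
rewrite [X in _ = X](_ : _ = lim
    (\int[P]_x ((f_ n x)%:E * (h x)%:E) @[n --> \oo])); last first.
  rewrite -monotone_convergence//=.
  - apply: eq_integral => x /[!inE] xD; apply/esym/cvg_lim => //.
    apply: cvgeZr => //; exact: cvg_nnsfun_approx.
  - by move=> n; apply: emeasurable_funM; exact/measurable_EFinP/measurable_funTS.
  - by move=> n ? _; rewrite mule_ge0 // lee_fin.
  - move=> ? _ ? ? ?; rewrite lee_wpmul2r ?lee_fin //.
    exact/lefP/nd_nnsfun_approx.
by apply: congr_lim; apply/funext => n /=; exact: integral_density_nnsfun.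
Qed.

End integral_density.

Section lebesgue_isometry.
Context (R : realType).
Notation mu := (@lebesgue_measure R).

Lemma lebesgue_measure_shift (c : R) (A : set R) : measurable A ->
  mu [set x | A (x + c)] = mu A.
Proof.
move=> mA.
have mc : measurable_fun setT (fun x : measurableTypeR R => x + c : measurableTypeR R).
  exact: measurable_funD.
pose m : {measure set (measurableTypeR R) -> \bar R} :=
  pushforward mu (fun x : measurableTypeR R => x + c : measurableTypeR R).
rewrite -[LHS]/(m mc A); apply/esym; apply: lebesgue_measure_unique mA => X.
move=> [[a b] _ <-]; rewrite /m /= /pushforward.
rewrite (_ : _ @^-1` _ = `]a - c, b - c]%classic); last first.
  by rewrite predeqE => x; rewrite /= !in_itv /= ltrBlDr lerBrDr.
rewrite !lebesgue_measure_itv /= !lte_fin ltrD2r; case: ifP => // _.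
by rewrite -!EFinB; congr EFin; ring.
Qed.

Lemma lebesgue_measure_opp (A : set R) : measurable A ->
  mu [set x | A (- x)] = mu A.
Proof.
move=> mA.
have mc : measurable_fun setT (fun x : measurableTypeR R => - x : measurableTypeR R).
  exact: oppr_measurable.
pose m : {measure set (measurableTypeR R) -> \bar R} :=
  pushforward mu (fun x : measurableTypeR R => - x : measurableTypeR R).
rewrite -[LHS]/(m mc A); apply/esym; apply: lebesgue_measure_unique mA => X.
move=> [[a b] _ <-]; rewrite /m /= /pushforward.
rewrite (_ : _ @^-1` _ = `[- b, - a[%classic); last first.
  by rewrite predeqE => x; rewrite /= !in_itv /= lerNl ltrNr andbC.
rewrite !lebesgue_measure_itv /= !lte_fin ltrN2; case: ifP => // _.
by rewrite -!EFinB; congr EFin; ring.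
Qed.

Lemma ge0_integral_shift (c : R) (A : set R) (f : R -> \bar R) : measurable A ->
  measurable_fun setT f -> (forall x, (0 <= f x)%E) ->
  (\int[mu]_(x in [set x : R | A (x + c)%R]) f x = \int[mu]_(x in A) f (x - c)%R)%E.
Proof.
move=> mA mf f0.
have mc : measurable_fun setT (fun x : measurableTypeR R => x + c : measurableTypeR R).
  exact: measurable_funD.
pose m : {measure set (measurableTypeR R) -> \bar R} :=
  pushforward mu (fun x : measurableTypeR R => x + c : measurableTypeR R).
transitivity (\int[m mc]_(x in A) f (x - c)%R)%E; last first.
  by apply: eq_measure_integral => B mB _; exact: lebesgue_measure_shift.
rewrite ge0_integral_pushforward //; last first.
  by apply: measurable_funTS; apply: measurableT_comp => //; exact: measurable_funD.
by apply: eq_integral => x _ /=; rewrite addrK.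
Qed.

Lemma ge0_integral_opp (A : set R) (f : R -> \bar R) : measurable A ->
  measurable_fun setT f -> (forall x, (0 <= f x)%E) ->
  (\int[mu]_(x in [set x : R | A (- x)%R]) f x = \int[mu]_(x in A) f (- x)%R)%E.
Proof.
move=> mA mf f0.
have mc : measurable_fun setT (fun x : measurableTypeR R => - x : measurableTypeR R).
  exact: oppr_measurable.
pose m : {measure set (measurableTypeR R) -> \bar R} :=
  pushforward mu (fun x : measurableTypeR R => - x : measurableTypeR R).
transitivity (\int[m mc]_(x in A) f (- x)%R)%E; last first.
  by apply: eq_measure_integral => B mB _; exact: lebesgue_measure_opp.
rewrite ge0_integral_pushforward //; last first.
  by apply: measurable_funTS; apply: measurableT_comp => //; exact: oppr_measurable.
by apply: eq_integral => x _ /=; rewrite opprK.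
Qed.

End lebesgue_isometry.

Section gaussian.
Context (R : realType) (s : R).
Hypothesis s0 : 0 < s.
Notation mu := (@lebesgue_measure R).
Notation N := (normal_prob 0 s).
Notation p := (normal_pdf 0 s).

Let sN0 : s != 0. Proof. by rewrite gt_eqF. Qed.

Let mp : measurable_fun setT p. Proof. exact: measurable_normal_pdf. Qed.

Let p0 x : 0 <= p x. Proof. exact: normal_pdf_ge0. Qed.

Lemma integral_normal (A : set R) (f : R -> \bar R) : measurable A ->
  measurable_fun setT f -> (forall x, (0 <= f x)%E) ->
  (\int[N]_(x in A) f x = \int[mu]_(x in A) (f x * (p x)%:E))%E.
Proof.
move=> mA mf f0.
rewrite [LHS]integral_mkcond [RHS]integral_mkcond.
transitivity (\int[density_measure mu mp p0]_x (f \_ A) x)%E.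
  by apply: eq_measure_integral => B mB _.
rewrite integral_density.
- apply: eq_integral => x _; rewrite !patchE; case: ifP => // _.
  by rewrite mul0e.
- by apply/(measurable_restrictT _ mA); exact: measurable_funTS.
- by move=> x; rewrite patchE; case: ifP.
Qed.

Lemma normal_pdfN x : p (- x) = p x.
Proof. by rewrite !normal_pdfE // /normal_fun !subr0 sqrrN. Qed.

Let mpE : measurable_fun setT (fun x => (p x)%:E).
Proof. exact/measurable_EFinP. Qed.

Let pE0 x : (0 <= (p x)%:E)%E. Proof. by rewrite lee_fin. Qed.

Lemma normal_probN (A : set R) : measurable A -> N [set x | A (- x)] = N A.
Proof.
move=> mA; rewrite /normal_prob (ge0_integral_opp mA mpE pE0).
by apply: eq_integral => x _; rewrite normal_pdfN.
Qed.

(** The density of the normal law with mean [c] and standard deviation [s] with respect to the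
    centred one. *)
Definition shift_density (c x : R) := expR ((c * x - c ^+ 2 / 2) / s ^+ 2).

Lemma measurable_shift_density c : measurable_fun setT (shift_density c).
Proof.
apply: measurableT_comp => //; apply: measurable_funM => //.
by apply: measurable_funB => //; apply: measurable_funM.
Qed.

Lemma normal_shift c (A : set R) : measurable A ->
  N [set x | A (x + c)] = (\int[N]_(x in A) (shift_density c x)%:E)%E.
Proof.
move=> mA; rewrite integral_normal //; last 2 first.
- by apply/measurable_EFinP; exact: measurable_shift_density.
- by move=> x; rewrite lee_fin expR_ge0.
rewrite /normal_prob (ge0_integral_shift c mA mpE pE0).
apply: eq_integral => x _; rewrite -EFinM; congr EFin.
rewrite !normal_pdfE // /normal_fun /shift_density mulrCA; congr (_ * _).
rewrite -expRD; congr expR; rewrite !subr0 -mulr_natr; field.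
exact: sN0.
Qed.

Lemma integral_shift_density c : (\int[N]_x (shift_density c x)%:E = 1)%E.
Proof.
have := @normal_shift c setT measurableT.
rewrite (_ : [set x | _] = setT) ?probability_setT //.
Qed.

Let is_derive_pdf (x : R) : is_derive x 1 p (- (x / s ^+ 2) * p x).
Proof.
have pE : p = fun x => normal_peak s *: expR (- (s ^+ 2 *+ 2)^-1 *: x ^+ 2).
  apply/funext => y; rewrite normal_pdfE // /normal_fun subr0.
  by congr (_ * expR _); rewrite /GRing.scale /= !mulNr (mulrC (y ^+ 2)).
have d1 : is_derive x 1 (fun y : R => - (s ^+ 2 *+ 2)^-1 *: y ^+ 2)
    (- (s ^+ 2 *+ 2)^-1 *: (2%:R * x ^+ 1 *: 1)).
  apply: is_deriveZ; exact: (@is_deriveX _ _ id 2 x 1 _ (is_derive_id x 1)).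
have d2 := @is_derive1_comp _ expR _ x _ _ (is_derive_expR _) d1.
have := @is_deriveZ _ _ _ _ (normal_peak s) x 1 _ d2.
rewrite [X in is_derive x 1 X _ -> _](_ : _ = p); last by rewrite pE.
move=> h; apply: (@is_derive_eq _ _ _ _ _ _ _ _ h).
rewrite pE /GRing.scale /= expr1 mulr1 -mulr_natr; field; exact: sN0.
Qed.

Let cvg_boundary : 2 * s ^+ 2 * (n.+1%:R * p n.+1%:R) @[n --> \oo] --> (0 : R).
Proof.
pose C := 4 * s ^+ 4 * normal_peak s.
have h n : 0 <= 2 * s ^+ 2 * (n.+1%:R * p n.+1%:R) <= C * (n.+1%:R)^-1.
  have m0 : 0 < n.+1%:R :> R by rewrite ltr0n.
  apply/andP; split.
    by rewrite !mulr_ge0 ?ler0n ?p0 ?exprn_ge0 ?ltW.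
  rewrite normal_pdfE // /normal_fun subr0 /C; set m : R := n.+1%:R in m0 *.
  have e1 : expR (- m ^+ 2 / (s ^+ 2 *+ 2)) <= 2 * s ^+ 2 / m ^+ 2.
    rewrite mulNr expRN -[leRHS]invrK lef_pV2 ?posrE ?expR_gt0 //; last first.
      by rewrite invr_gt0 divr_gt0 ?mulr_gt0 ?exprn_gt0.
    rewrite (le_trans _ (expR_ge1Dx _)) // invf_div mulr2n.
    rewrite -mulr2n -mulr_natl lerDr //.
  have pk : 0 <= normal_peak s by exact: normal_peak_ge0.
  apply: (@le_trans _ _ (2 * s ^+ 2 * (m * (normal_peak s * (2 * s ^+ 2 / m ^+ 2))))).
    apply: ler_wpM2l; first by rewrite mulr_ge0 ?sqr_ge0.
    by apply: ler_wpM2l; [exact: ltW|exact: ler_wpM2l].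
  rewrite le_eqVlt; apply/orP; left; apply/eqP; field; exact: lt0r_neq0.
apply: (@squeeze_cvgr _ _ _ _ (fun=> 0) (fun n => C * (n.+1%:R)^-1)).
- by near=> n; exact: h.
- exact: cvg_cst.
- rewrite [X in _ --> X](_ : 0 = C * 0); last by rewrite mulr0.
  by apply: cvgMr; exact: cvg_harmonic.
Unshelve. all: by end_near. Qed.

Let I n : set R := `[(- n.+1%:R : R), n.+1%:R]%classic.

Let I_bigcup : \bigcup_n I n = setT.
Proof.
rewrite predeqE => x; split => // _; exists (Num.truncn `|x|) => //.
by rewrite /I /= in_itv /= -ler_norml ltW //; exact: Num.Theory.truncnS_gt.
Qed.

Let I_nondecreasing : nondecreasing_seq I.
Proof.
move=> m n mn; apply/subsetPset => x; rewrite /I /= !in_itv /= => /andP[h1 h2].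
have : m.+1%:R <= n.+1%:R :> R by rewrite ler_nat ltnS.
by move=> h; apply/andP; split; lra.
Qed.

Let mI n : measurable (I n). Proof. exact: measurable_itv. Qed.

Let mx2p : measurable_fun setT (fun x : R => ((x ^+ 2)%:E * (p x)%:E)%E).
Proof.
by apply: emeasurable_funM => //; apply/measurable_EFinP; exact: measurable_funX.
Qed.

Let cont_p : continuous p. Proof. exact: continuous_normal_pdf. Qed.

(** From p' = - (x / s^2) p one gets (s^2 x p)' = s^2 p - x^2 p; the last term is the boundary
    contribution at both ends of the interval. *)
Let integration_by_parts n :
  (\int[mu]_(x in I n) ((x ^+ 2)%:E * (p x)%:E) =
   (s ^+ 2)%:E * \int[mu]_(x in I n) (p x)%:E -
     (2 * s ^+ 2 * (n.+1%:R * p n.+1%:R))%:E)%E.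
Proof.
have cx2p : continuous (fun x : R => x ^+ 2 * p x : R).
  by move=> x; apply: cvgM; [exact: exprn_continuous|exact: cont_p].
have csp : continuous (fun x : R => s ^+ 2 * p x : R).
  by move=> x; apply: cvgM; [exact: cvg_cst|exact: cont_p].
have mN : - n.+1%:R < n.+1%:R :> R by rewrite -subr_gt0 opprK addr_gt0 ?ltr0n.
have int f : continuous f -> mu.-integrable (I n) (fun x => (f x)%:E).
  move=> cf; apply: continuous_compact_integrable; first exact: segment_compact.
  exact: continuous_subspaceT.
pose F (x : R) := s ^+ 2 *: (x *: p x).
pose f (x : R) := s ^+ 2 * p x - x ^+ 2 * p x.
have dF (x : R) : is_derive x 1 F (f x).
  have d1 := @is_deriveM _ _ _ _ x 1 _ _ (is_derive_id x 1) (is_derive_pdf x).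
  have := @is_deriveZ _ _ _ _ (s ^+ 2) x 1 _ d1.
  move=> h; apply: (@is_derive_eq _ _ _ _ _ _ _ _ h).
  rewrite /f /GRing.scale /=; field; exact: sN0.
have cF : continuous F.
  by move=> x; apply: differentiable_continuous; apply/derivable1_diffP; case: (dF x).
have FTC : (\int[mu]_(x in `[(- n.+1%:R)%R, n.+1%:R]) (f x)%:E =
    (F n.+1%:R)%:E - (F (- n.+1%:R))%:E)%E.
  apply: continuous_FTC2 => //.
  - by apply: continuous_subspaceT => x; apply: cvgB; [exact: csp|exact: cx2p].
  - split; first by move=> x _; case: (dF x).
    + by apply: cvg_at_right_filter; exact: cF.
    + by apply: cvg_at_left_filter; exact: cF.
  - by move=> x _; rewrite derive1E; case: (dF x).
have fE : (\int[mu]_(x in `[(- n.+1%:R)%R, n.+1%:R]) (f x)%:E =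
    (s ^+ 2)%:E * \int[mu]_(x in I n) (p x)%:E -
    \int[mu]_(x in I n) ((x ^+ 2)%:E * (p x)%:E))%E.
  under eq_integral do rewrite /f EFinB.
  rewrite integralB //; [|exact: (int _ csp)|exact: (int _ cx2p)].
  by under eq_integral do rewrite EFinM; rewrite integralZl //; exact: (int _ cont_p).
have fin1 : (\int[mu]_(x in I n) ((x ^+ 2)%:E * (p x)%:E))%E \is a fin_num.
  move: (int _ cx2p) => /integrable_fin_num -/(_ (mI n)).
  by under eq_integral do rewrite EFinM.
have fin2 : (\int[mu]_(x in I n) (p x)%:E)%E \is a fin_num.
  by move: (int _ cont_p) => /integrable_fin_num -/(_ (mI n)).
move: FTC; rewrite fE /F normal_pdfN /GRing.scale /=.
move: fin1 fin2 => /fineK <- /fineK <-.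
rewrite -!EFinM -!EFinB => -[h]; congr EFin; move: h; lra.
Qed.

Lemma normal_second_moment : (\int[N]_x (x ^+ 2)%:E = (s ^+ 2)%:E)%E.
Proof.
rewrite integral_normal //; last 2 first.
- by apply/measurable_EFinP; exact: measurable_funX.
- by move=> x; rewrite lee_fin sqr_ge0.
have c1 : (\int[mu]_(x in I n) ((x ^+ 2)%:E * (p x)%:E))%E @[n --> \oo] -->
    (\int[mu]_x ((x ^+ 2)%:E * (p x)%:E))%E.
  rewrite -I_bigcup; apply: ge0_nondecreasing_set_cvg_integral => //.
  - by move=> n; exact: measurable_funTS.
  - by move=> n x _; rewrite -EFinM lee_fin mulr_ge0 ?sqr_ge0.
have c2 : (\int[mu]_(x in I n) (p x)%:E)%E @[n --> \oo] --> 1%E.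
  rewrite -(integral_normal_pdf 0 s) -I_bigcup.
  apply: ge0_nondecreasing_set_cvg_integral => //.
  by move=> n; exact: measurable_funTS.
have c3 : (\int[mu]_(x in I n) ((x ^+ 2)%:E * (p x)%:E))%E @[n --> \oo] -->
    ((s ^+ 2)%:E * 1 - 0%:E)%E.
  under eq_fun do rewrite integration_by_parts.
  apply: cvgeB => //; first by apply: cvgeZl.
  by apply: cvg_EFin; [near=> n|exact: cvg_boundary].
rewrite -(cvg_lim _ c1) // (cvg_lim _ c3) // mule1 sube0 //.
Unshelve. all: by end_near. Qed.

Lemma normal_integrable_sqr : N.-integrable setT (fun x => (x ^+ 2)%:E).
Proof.
apply/integrableP; split; first by apply/measurable_EFinP; exact: measurable_funX.
under eq_integral => x _ do rewrite gee0_abs ?lee_fin ?sqr_ge0 //.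
by rewrite normal_second_moment ltry.
Qed.

Lemma normal_integrable_id : N.-integrable setT (fun x => x%:E).
Proof.
apply: (@le_integrable _ _ _ N setT measurableT _ (fun x => (1 + x ^+ 2)%:E)) => //.
- exact/measurable_EFinP.
- move=> x _; rewrite !abse_EFin lee_fin [leRHS]ger0_norm; last by rewrite addr_ge0 ?sqr_ge0.
  have := sqr_ge0 (`|x| - 1); rewrite -(real_normK (num_real x)).
  by have := normr_ge0 x; nra.
- rewrite (_ : (fun x => (1 + x ^+ 2)%:E) = (fun x => 1%:E + (x ^+ 2)%:E)%E) //.
  apply: integrableD => //; last exact: normal_integrable_sqr.
  exact: finite_measure_integrable_cst.
Qed.

(** The integrand is a constant multiple of [shift_density (c * s ^+ 2)], whose total mass is 1. *)
Lemma normal_exp c :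
  (\int[N]_x (expR (c * x))%:E = (expR (c ^+ 2 * s ^+ 2 / 2))%:E)%E.
Proof.
transitivity (\int[N]_x ((expR (c ^+ 2 * s ^+ 2 / 2))%:E *
    (shift_density (c * s ^+ 2) x)%:E))%E.
  apply: eq_integral => x _; rewrite -EFinM -expRD; congr (expR _)%:E.
  by field; exact: sN0.
rewrite ge0_integralZl //; last 2 first.
- by apply/measurable_EFinP; exact: measurable_shift_density.
- by move=> x _; rewrite lee_fin expR_ge0.
by rewrite integral_shift_density mule1.
Qed.

(** A crude constant, enough for an error term: with y = |x| / s, y^4 <= 4! exp y and exp y <= exp
    (x / s) + exp (- x / s). Each exponential has mean exp (1/2) <= 2, hence 96 = 24 * 4. *)
Lemma normal_fourth_moment : (\int[N]_x (x ^+ 4)%:E <= (96 * s ^+ 4)%:E)%E.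
Proof.
have mexp (a : R) : measurable_fun setT (fun x : R => (expR (a * x))%:E).
  by apply/measurable_EFinP; apply: measurableT_comp.
have e1 : (\int[N]_x (expR (s^-1 * x))%:E = (expR (2^-1))%:E)%E.
  by rewrite normal_exp; congr (expR _)%:E; field; exact: sN0.
have e2 : (\int[N]_x (expR (- s^-1 * x))%:E = (expR (2^-1))%:E)%E.
  by rewrite normal_exp; congr (expR _)%:E; field; exact: sN0.
apply: (@le_trans _ _ (\int[N]_x ((24 * s ^+ 4)%:E *
    ((expR (s^-1 * x))%:E + (expR (- s^-1 * x))%:E)))%E).
  apply: ge0_le_integral => //.
  - by move=> x _; rewrite lee_fin exprn_even_ge0.
  - by apply/measurable_EFinP; exact: measurable_funX.
  - by apply: measurable_funeM; exact: (emeasurable_funD (mexp _) (mexp _)).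
  - move=> x _; rewrite -EFinD -EFinM lee_fin.
    pose y := `|x| / s.
    have y0 : 0 <= y by rewrite divr_ge0 ?(ltW s0).
    have hy : y ^+ 4 <= 24 * expR y.
      have := @expR_ge1Dxn R y 3 y0; rewrite (_ : 4`!%:R = 24) //.
      by rewrite -(ler_pM2l (_ : 0 < 24)) // mulrDr mulrCA divff // mulr1; lra.
    have -> : x ^+ 4 = s ^+ 4 * y ^+ 4.
      rewrite /y expr_div_n mulrCA divff ?mulr1 ?expf_neq0 //.
      by rewrite [RHS](exprM _ 2 2) real_normK ?num_real // -exprM.
    have hy2 : expR y <= expR (s^-1 * x) + expR (- s^-1 * x).
      rewrite /y; have [x0|x0] := leP 0 x.
        by rewrite ger0_norm // mulrC lerDl expR_ge0.
      by rewrite ltr0_norm // mulNr mulrC mulNr lerDr expR_ge0.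
    have s4 : 0 <= s ^+ 4 by rewrite exprn_ge0 // ltW.
    by nra.
rewrite ge0_integralZl //; last 3 first.
- exact: (emeasurable_funD (mexp _) (mexp _)).
- by move=> x _; rewrite -EFinD lee_fin addr_ge0 ?expR_ge0.
- by rewrite lee_fin mulr_ge0 // exprn_ge0 // ltW.
rewrite ge0_integralD //; last 2 first.
- exact: mexp.
- exact: mexp.
rewrite e1 e2 -EFinD -EFinM lee_fin.
have : expR (2^-1) <= 2 :> R.
  have := expR_ge1Dx (- 2^-1 : R); rewrite expRN => h.
  rewrite -[leLHS]invrK -[leRHS]invrK lef_pV2 ?posrE ?invr_gt0 ?expR_gt0 //; lra.
have s4 : 0 <= s ^+ 4 by rewrite exprn_ge0 // ltW.
nra.
Qed.

Lemma normal_mean : (\int[N]_x x%:E = 0)%E.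
Proof.
have mc : measurable_fun setT (fun x : measurableTypeR R => - x : measurableTypeR R).
  exact: oppr_measurable.
pose m : {measure set (measurableTypeR R) -> \bar R} :=
  pushforward N (fun x : measurableTypeR R => - x : measurableTypeR R).
have h : (\int[N]_x x%:E = \int[N]_x - x%:E)%E.
  transitivity (\int[m mc]_x x%:E)%E.
    by apply: eq_measure_integral => B mB _; apply/esym; exact: normal_probN.
  rewrite integral_pushforward //.
  have := integrableN normal_integrable_id.
  by apply: eq_integrable => // x _ /=; rewrite EFinN.
have fin := integrable_fin_num measurableT normal_integrable_id.
have e : (\int[N]_x - x%:E = (-1)%:E * \int[N]_x x%:E)%E.
  rewrite -(integralZl measurableT normal_integrable_id).
  by apply: eq_integral => x _; rewrite EFinN mulN1e.
move: h; rewrite e; move: fin => /fineK <-; rewrite -EFinM => -[h].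
by congr EFin; lra.
Qed.

End gaussian.

(** The density is at most (2 pi)^(-1/2) <= 1/2, and the interval has length 2 t. *)
Lemma normal_small_ball (R : realType) (t : R) : 0 <= t ->
  (normal_prob 0 1 [set x : R | (`|x| <= t)%R] <= t%:E)%E.
Proof.
move=> t0; rewrite (_ : [set x | _] = `[(- t), t]%classic); last first.
  by rewrite predeqE => x; rewrite /= in_itv /= ler_norml.
apply: (@le_trans _ _ (\int[lebesgue_measure]_(x in `[(- t)%R, t]) (normal_peak 1)%:E)%E).
  apply: ge0_le_integral => //.
  - by move=> x _; rewrite lee_fin normal_pdf_ge0.
  - by apply: measurable_funTS; apply/measurable_EFinP; exact: measurable_normal_pdf.
  - by move=> x _; rewrite lee_fin normal_pdf_ub.
rewrite integral_cst //= lebesgue_measure_itv /= lte_fin.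
case: ifP => [_|_]; last by rewrite mule0 lee_fin.
rewrite -EFinB -EFinM lee_fin opprK.
have : normal_peak 1 <= 2^-1 :> R.
  rewrite /normal_peak lef_pV2 ?posrE // ?sqrtr_gt0 ?expr1n ?mul1r; last first.
    by rewrite pmulrn_lgt0 // pi_gt0.
  rewrite -{1}(ger0_norm (ler0n R 2)) -sqrtr_sqr ler_wsqrtr //.
  by have := pi_ge2 R; rewrite -mulr_natr; nra.
nra.
Qed.

(** * Shifts of Gaussian sequences *)

Section real_probability.
Context (R : realType) (d : measure_display) (T : measurableType d)
  (P : probability T R).
Implicit Types A B : set T.

Definition pr A : R := fine (P A).

Lemma prE A : measurable A -> P A = (pr A)%:E.
Proof. by move=> mA; rewrite /pr fineK // fin_num_measure. Qed.

Lemma pr_ge0 A : 0 <= pr A.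
Proof. by rewrite fine_ge0. Qed.

Lemma pr_le1 A : measurable A -> pr A <= 1.
Proof. by move=> mA; rewrite -lee_fin -prE // probability_le1. Qed.

Lemma prT : pr setT = 1.
Proof. by rewrite /pr probability_setT. Qed.

Lemma pr_le A B : measurable A -> measurable B -> A `<=` B -> pr A <= pr B.
Proof.
by move=> mA mB AB; rewrite -lee_fin -!prE // le_measure // inE.
Qed.

Lemma pr_setU A B : measurable A -> measurable B -> pr (A `|` B) <= pr A + pr B.
Proof.
move=> mA mB; rewrite -lee_fin EFinD -!prE //; last exact: measurableU.
exact: measureU2.
Qed.

Lemma pr_setU_disjoint A B : measurable A -> measurable B -> A `&` B = set0 ->
  pr (A `|` B) = pr A + pr B.
Proof.
move=> mA mB AB; apply: EFin_inj; rewrite EFinD -!prE //; last exact: measurableU.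
exact: measureU.
Qed.

Lemma pr_setC A : measurable A -> pr (~` A) = 1 - pr A.
Proof.
move=> mA; have := pr_setU_disjoint mA (measurableC mA) (setICr A).
by rewrite setUCr prT; lra.
Qed.

Lemma pr_bigcup n (F : nat -> set T) : (forall i, measurable (F i)) ->
  pr (\bigcup_(i in `I_n) F i) <= \sum_(i < n) pr (F i).
Proof.
move=> mF; elim: n => [|n IH].
  by rewrite II0 bigcup_set0 big_ord0 /pr measure0.
rewrite (_ : \bigcup_(i in `I_n.+1) F i = (\bigcup_(i in `I_n) F i) `|` F n).
  rewrite big_ord_recr /=; apply: (le_trans (pr_setU _ _)) => //.
    exact: bigcup_measurable.
  by rewrite lerD2r.
rewrite predeqE => w; split => [[i /=]|[[i /= ni Fi]|Fn]].
- by rewrite ltnS leq_eqVlt => /orP[/eqP ->|ni] Fi; [right|left; exists i].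
- by exists i => //=; rewrite ltnS ltnW.
- by exists n => /=.
Qed.

Lemma pr_subU A B C : measurable A -> measurable B -> measurable C ->
  A `<=` B `|` C -> pr A <= pr B + pr C.
Proof.
move=> mA mB mC h; apply: le_trans (pr_setU mB mC).
by apply: pr_le => //; exact: measurableU.
Qed.

End real_probability.

(** [normal_prob] is a measure on the alias [measurableTypeR R]; this identity transports it to [R],
    where the random variables take their values. *)
Lemma measurable_id_normal_display (R : realType) :
  measurable_fun setT (fun x : measurableTypeR R => x : R).
Proof. by move=> _ A mA; rewrite setTI. Qed.

Lemma normal_law_ge0_integral (R : realType) (d : measure_display)
    (T : measurableType d) (P : probability T R) (s : R) (Y : {RV P >-> R})
    (f : R -> \bar R) :
  (forall A : set R, measurable A -> P (Y @^-1` A) = normal_prob 0 s A) ->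
  measurable_fun setT f -> (forall x, (0 <= f x)%E) ->
  (\int[P]_w f (Y w) = \int[normal_prob 0 s]_x f x)%E.
Proof.
move=> hY mf f0; rewrite -(@ge0_integral_distribution _ _ _ _ _ P Y) //.
pose m : {measure set R -> \bar R} :=
  pushforward (normal_prob 0 s) (fun x : measurableTypeR R => x : R).
transitivity (\int[m (@measurable_id_normal_display R)]_x f x)%E.
  by apply: eq_measure_integral => A mA _; exact: hY.
rewrite ge0_integral_pushforward //; exact: measurable_id_normal_display.
Qed.

Section gauss_seq.
Context (R : realType) (d : measure_display) (T : measurableType d)
  (P : probability T R) (X : nat -> {RV P >-> R}) (s : R).

Definition gauss_seq := mutually_independent P (fun i => X i : T -> R) /\
  forall k (A : set R), measurable A -> P (X k @^-1` A) = normal_prob 0 s A.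

Hypotheses (s0 : 0 < s) (hX : gauss_seq).
Notation pr := (pr P).
Notation N := (normal_prob 0 s).

Lemma gauss_ge0_integral k (f : R -> \bar R) : measurable_fun setT f ->
  (forall x, (0 <= f x)%E) -> (\int[P]_w f (X k w) = \int[N]_x f x)%E.
Proof. exact: normal_law_ge0_integral (hX.2 k). Qed.

Lemma gauss_std_seq : std_seq X (s ^+ 2).
Proof.
split; first exact: hX.1.
move=> k.
have i1 : P.-integrable setT (fun w => (X k w)%:E).
  apply/integrableP; split; first by apply/measurable_EFinP; exact: measurable_funP.
  rewrite (@gauss_ge0_integral k (fun x : R => `|x%:E|)%E) //; last first.
    by apply: measurableT_comp.
  by case/integrableP : (normal_integrable_id s0).
split => //.
- rewrite -(normal_mean s0).
  rewrite -(@integral_distribution _ _ _ _ _ P (X k) EFin) //.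
  pose m : {measure set R -> \bar R} := pushforward N (fun x : measurableTypeR R => x : R).
  transitivity (\int[m (@measurable_id_normal_display R)]_x x%:E)%E.
    by apply: eq_measure_integral => A mA _; exact: hX.2.
  rewrite (integral_pushforward (@measurable_id_normal_display R)) //.
  exact: normal_integrable_id.
- rewrite (@gauss_ge0_integral k (fun x : R => (x ^+ 2)%:E)).
  + exact: normal_second_moment.
  + by apply/measurable_EFinP; exact: measurable_funX.
  + by move=> x; rewrite lee_fin sqr_ge0.
Qed.

Definition shift_RV (c : nat -> R) (k : nat) : {RV P >-> R} :=
  [the {mfun T >-> R} of X k \+ cst (c k)].

Lemma shift_RV_indep c : mutually_independent P (fun i => shift_RV c i : T -> R).
Proof.
move=> t A ut mA.
have mA' i : measurable [set x | A i (x + c i)].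
  rewrite -[X in measurable X]setTI.
  have : measurable_fun setT (fun x : R => x + c i) by exact: measurable_funD.
  by apply.
exact: (hX.1 t (fun i => [set x | A i (x + c i)]) ut mA').
Qed.

Definition tshift (c : nat -> R) n (x : n.-tuple R) : n.-tuple R :=
  [tuple tnth x i + c i | i < n].

Lemma measurable_tshift c n : measurable_fun setT (@tshift c n).
Proof.
apply/measurable_fun_tnthP => i.
rewrite (_ : _ \o _ = fun x => tnth x i + c i).
  by apply: measurable_funD => //; exact: measurable_tnth.
by apply/funext => x /=; rewrite tnth_mktuple.
Qed.

Lemma sample_shift c n w : sample (shift_RV c) n w = tshift c (sample X n w).
Proof. by apply: eq_from_tnth => i; rewrite !tnth_mktuple. Qed.

Lemma cameron_martin c n (A : set (n.-tuple R)) : measurable A ->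
  P [set w | A (tshift c (sample X n w))] =
  (\int[P]_(w in sample X n @^-1` A)
    (\prod_(k < n) shift_density s (c k) (X k w))%:E)%E.
Proof.
move=> mA.
have := @change_of_law R d d T T P P X (shift_RV c)
  (fun k => shift_density s (c k)) hX.1 (@shift_RV_indep c)
  (fun k => measurable_shift_density s (c k)) (fun k x => expR_ge0 _) _ n A mA.
move=> <-; first by congr (P _); apply/funext => w /=; rewrite /preimage /= sample_shift.
move=> k B mB.
have mB' : measurable [set x | B (x + c k)].
  rewrite -[X in measurable X]setTI.
  have : measurable_fun setT (fun x : R => x + c k) by exact: measurable_funD.
  by apply.
rewrite -[LHS]/(P (X k @^-1` [set x | B (x + c k)])) hX.2 //.
rewrite (normal_shift s0 (c k)) // [LHS]integral_mkcond [RHS]integral_mkcond.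
rewrite -(@gauss_ge0_integral k).
- by apply: eq_integral => w _; rewrite !patchE; congr (if _ then _ else _);
    apply/idP/idP; rewrite !inE.
- apply/(measurable_restrictT _ mB); apply: measurable_funTS.
  by apply/measurable_EFinP; exact: measurable_shift_density.
- by move=> x; rewrite patchE; case: ifP => // _; rewrite lee_fin expR_ge0.
Qed.

Lemma gauss_exp_sum (a : nat -> R) n :
  (\int[P]_w (expR (\sum_(k < n) a k * X k w))%:E =
   (expR (s ^+ 2 / 2 * \sum_(k < n) a k ^+ 2))%:E)%E.
Proof.
under eq_integral do rewrite expR_sum.
have := @integral_prod _ _ _ P X hX.1 n (fun k x => expR (a k * x)).
move=> ->; last 2 first.
- by move=> k; apply: measurableT_comp => //; exact: measurable_funM.
- by move=> k x; exact: expR_ge0.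
rewrite mulr_sumr expR_sum; elim: n => [|n IH]; first by rewrite !big_ord0.
rewrite !big_ord_recr /= EFinM -IH; congr (_ * _)%E.
rewrite (@gauss_ge0_integral n (fun x : R => (expR (a n * x))%:E)).
- by rewrite (normal_exp s0); congr (expR _)%:E; ring.
- by apply/measurable_EFinP; apply: measurableT_comp => //; exact: measurable_funM.
- by move=> x; rewrite lee_fin expR_ge0.
Qed.

(** The squared Cameron-Martin norm of the shift, which is also the variance under [P] of the
    logarithm of the density in [cameron_martin]. *)
Definition shift_cost (c : nat -> R) n : R := (\sum_(k < n) c k ^+ 2) / s ^+ 2.

(* Chernoff: the density exceeds e^r only with probability e^(-r^2/(8q)),
   even under the shifted law. *)
Lemma shift_upper c n (A : set (n.-tuple R)) (r : R) : measurable A ->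
  0 < shift_cost c n -> shift_cost c n <= r ->
  pr [set w | A (tshift c (sample X n w))] <=
    expR r * pr (sample X n @^-1` A) + expR (- (r ^+ 2 / (8 * shift_cost c n))).
Proof.
move=> mA; set q := shift_cost c n => q0 qr.
have sN0 : s != 0 by rewrite gt_eqF.
pose L w := \sum_(k < n) (c k / s ^+ 2) * X k w.
have densE w : \prod_(k < n) shift_density s (c k) (X k w) = expR (L w - q / 2).
  rewrite -expR_sum; congr expR; rewrite /L /q /shift_cost mulr_suml mulr_suml.
  rewrite -sumrB; apply: eq_bigr => k _; field; exact: sN0.
have mL : measurable_fun setT L.
  apply: measurable_sum => k; apply: measurable_funM => //; exact: measurable_funP.
(* Chernoff parameter. The exponent becomes r / 4 - 3 r^2 / (8 q), and q <= r lets two of the three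
   units r^2 / (8 q) absorb r / 4. *)
pose th := r / (2 * q).
have r0 : 0 < r := lt_le_trans q0 qr.
have th0 : 0 < th by rewrite divr_gt0 // mulr_gt0.
have mtA : measurable (sample X n @^-1` A).
  by rewrite -[X in measurable X]setTI; exact: (measurable_sample X).
have msA : measurable [set w | A (tshift c (sample X n w))].
  rewrite -[X in measurable X]setTI.
  exact: (measurableT_comp (@measurable_tshift c n) (@measurable_sample _ _ _ _ X n)).
have key w : expR (L w - q / 2) <= expR r +
    expR ((1 + th) * (L w - q / 2) - th * r).
  have [h|h] := leP (L w - q / 2) r.
    by apply: (@le_trans _ _ (expR r)); rewrite ?ler_expR // lerDl expR_ge0.
  apply: (@le_trans _ _ (expR ((1 + th) * (L w - q / 2) - th * r))).
    by rewrite ler_expR; nra.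
  by rewrite lerDr expR_ge0.
have m2 : measurable_fun setT (fun w => (expR ((1 + th) * (L w - q / 2) - th * r))%:E).
  apply/measurable_EFinP; apply: measurableT_comp => //.
  by apply: measurable_funB => //; apply: measurable_funM => //; exact: measurable_funB.
rewrite -lee_fin EFinD EFinM -!prE // cameron_martin //.
apply: (@le_trans _ _ (\int[P]_(w in sample X n @^-1` A) ((expR r)%:E +
    (expR ((1 + th) * (L w - q / 2) - th * r))%:E))%E).
  apply: ge0_le_integral => //.
  - move=> w _; rewrite lee_fin prodr_ge0 // => k _; exact: expR_ge0.
  - apply: measurable_funTS; apply/measurable_EFinP; apply: measurable_prod => k _.
    by apply: measurableT_comp; [exact: measurable_shift_density|exact: measurable_funP].
  - by apply: measurable_funTS; apply: emeasurable_funD.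
  - by move=> w _; rewrite densE -EFinD lee_fin.
rewrite ge0_integralD //; last exact: measurable_funTS.
rewrite integral_cst //= leeD2l //.
apply: (@le_trans _ _ (\int[P]_w (expR ((1 + th) * (L w - q / 2) - th * r))%:E)%E).
  exact: ge0_subset_integral.
have -> : (\int[P]_w (expR ((1 + th) * (L w - q / 2) - th * r))%:E =
   \int[P]_w ((expR (- ((1 + th) * q / 2 + th * r)))%:E *
     (expR (\sum_(k < n) ((1 + th) * (c k / s ^+ 2)) * X k w))%:E))%E.
  apply: eq_integral => w _; rewrite -EFinM -expRD; congr (expR _)%:E.
  have -> : \sum_(k < n) (1 + th) * (c k / s ^+ 2) * X k w = (1 + th) * L w.
    by rewrite /L mulr_sumr; apply: eq_bigr => k _; rewrite -mulrA.
  by field.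
rewrite ge0_integralZl //; last first.
  apply/measurable_EFinP; apply: measurableT_comp => //.
  apply: measurable_sum => k; apply: measurable_funM => //; exact: measurable_funP.
rewrite (gauss_exp_sum (fun k => (1 + th) * (c k / s ^+ 2))) -EFinM -expRD lee_fin ler_expR.
have -> : \sum_(k < n) ((1 + th) * (c k / s ^+ 2)) ^+ 2 = (1 + th) ^+ 2 * q / s ^+ 2.
  rewrite /q /shift_cost !mulr_suml mulr_sumr mulr_suml; apply: eq_bigr => k _.
  by field; exact: sN0.
have -> : s ^+ 2 / 2 * ((1 + th) ^+ 2 * q / s ^+ 2) = (1 + th) ^+ 2 * q / 2.
  by field; exact: sN0.
have qN0 : q != 0 by rewrite gt_eqF.
have -> : - ((1 + th) * q / 2 + th * r) + (1 + th) ^+ 2 * q / 2 =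
    - (3 * (r ^+ 2 / (8 * q))) + r / 4.
  by rewrite /th; field; exact: qN0.
have : r / 4 <= 2 * (r ^+ 2 / (8 * q)).
  rewrite (_ : 2 * (r ^+ 2 / (8 * q)) = r / 4 * (r / q)); last by field; exact: qN0.
  by rewrite ler_peMr ?divr_ge0 ?(ltW (lt_le_trans q0 qr)) // ler_pdivlMr // mul1r.
lra.
Qed.

Lemma shift_upper_le c n (A : set (n.-tuple R)) (Q r : R) : measurable A ->
  0 < shift_cost c n -> shift_cost c n <= Q -> Q <= r ->
  pr [set w | A (tshift c (sample X n w))] <=
    expR r * pr (sample X n @^-1` A) + expR (- (r ^+ 2 / (8 * Q))).
Proof.
move=> mA q0 qQ Qr; apply: (le_trans (shift_upper mA q0 (le_trans qQ Qr))).
have Q0 : 0 < Q := lt_le_trans q0 qQ.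
have h : (8 * Q)^-1 <= (8 * shift_cost c n)^-1.
  by rewrite lef_pV2 ?posrE ?ler_pM2l //; apply: mulr_gt0.
by rewrite lerD2l ler_expR lerN2; apply: ler_wpM2l => //; exact: sqr_ge0.
Qed.

Lemma shift_cost_scale (k : R) c n :
  shift_cost (fun i => k * c i) n = k ^+ 2 * shift_cost c n.
Proof.
by rewrite /shift_cost mulrA mulr_sumr; congr (_ / _); apply: eq_bigr => i _;
  rewrite exprMn.
Qed.

Lemma tshift_add c c' n (x : n.-tuple R) :
  tshift c (tshift c' x) = tshift (fun i => c' i + c i) x.
Proof. by apply: eq_from_tnth => i; rewrite !tnth_mktuple addrA. Qed.

Lemma tshift0 n (x : n.-tuple R) : tshift (fun=> 0) x = x.
Proof. by apply: eq_from_tnth => i; rewrite tnth_mktuple addr0. Qed.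

Lemma measurable_tshift_preim c n (A : set (n.-tuple R)) : measurable A ->
  measurable [set x | A (tshift c x)].
Proof.
by move=> mA; rewrite -[X in measurable X]setTI; exact: measurable_tshift.
Qed.

Lemma measurable_sample_preim n (A : set (n.-tuple R)) : measurable A ->
  measurable (sample X n @^-1` A).
Proof.
move=> mA; rewrite -[X in measurable X]setTI.
by apply: (@measurable_sample _ _ _ _ X n).
Qed.

Lemma pr_disjoint_sum m (F : nat -> set T) : (forall j, measurable (F j)) ->
  (forall i j, (i < j)%N -> F i `&` F j = set0) -> \sum_(j < m) pr (F j) <= 1.
Proof.
move=> mF dF.
have mU k : measurable (\bigcup_(j in `I_k) F j) by exact: bigcup_measurable.
suff -> : \sum_(j < m) pr (F j) = pr (\bigcup_(j in `I_m) F j) by exact: pr_le1.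
elim: m => [|m IH]; first by rewrite big_ord0 II0 bigcup_set0 /pr measure0.
rewrite big_ord_recr /= IH -pr_setU_disjoint //.
  congr pr; rewrite predeqE => w; split => [[[i /= ni Fi]|Fn]|[i /=]].
  - by exists i => //=; rewrite ltnS ltnW.
  - by exists m => /=.
  - by rewrite ltnS leq_eqVlt => /orP[/eqP ->|ni] Fi; [right|left; exists i].
rewrite setI_bigcupl bigcup0 // => i /= im; exact: dF.
Qed.

(* The translates by multiples of c are disjoint and have comparable
   probabilities. *)
Lemma disjoint_shift_bound c n (A : set (n.-tuple R)) (m : nat) (r : R) :
  measurable A -> (0 < m)%N -> 0 < shift_cost c n ->
  m%:R ^+ 2 * shift_cost c n <= r ->
  (forall x i j, (i < j)%N -> A (tshift (fun k => - (i%:R * c k)) x) ->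
    ~ A (tshift (fun k => - (j%:R * c k)) x)) ->
  pr (sample X n @^-1` A) <=
    expR r / m%:R + expR (- (r ^+ 2 / (8 * (m%:R ^+ 2 * shift_cost c n)))).
Proof.
move=> mA m0 q0 mq dis.
pose F j := [set w | A (tshift (fun k => - (j%:R * c k)) (sample X n w))].
have mF j : measurable (F j).
  by apply: (measurable_sample_preim (measurable_tshift_preim _ mA)).
have dF i j : (i < j)%N -> F i `&` F j = set0.
  move=> ij; rewrite predeqE => w; split => // -[h1 h2].
  exact: (dis _ _ _ ij h1 h2).
pose tau := expR (- (r ^+ 2 / (8 * (m%:R ^+ 2 * shift_cost c n)))).
(* [A] is the translate [F j.+1] moved back by the opposite shift, whose cost is at most m^2 times
   that of [c]. *)
have key j : (j < m)%N -> pr (sample X n @^-1` A) <= expR r * pr (F j.+1) + tau.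
  move=> jm.
  have := @shift_upper_le (fun k => j.+1%:R * c k) n
    [set x | A (tshift (fun k => - (j.+1%:R * c k)) x)] (m%:R ^+ 2 * shift_cost c n)
    r (measurable_tshift_preim _ mA).
  rewrite shift_cost_scale => h.
  have {}h := h (mulr_gt0 (exprn_gt0 2 (ltr0Sn R j)) q0).
  have {}h := h _ mq.
  have e : [set w | [set x | A (tshift (fun k => - (j.+1%:R * c k)) x)]
      (tshift (fun k => j.+1%:R * c k) (sample X n w))] = sample X n @^-1` A.
    rewrite predeqE => w; rewrite /= tshift_add.
    rewrite (_ : (fun i => _) = fun=> 0) ?tshift0 //.
    by apply/funext => k; rewrite subrr.
  rewrite e in h; apply: h.
  by rewrite ler_pM2r // lerXn2r ?nnegrE ?ler0n // ler_nat.
have s1 : \sum_(j < m) pr (sample X n @^-1` A) <=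
    \sum_(j < m) (expR r * pr (F j.+1) + tau).
  by apply: ler_sum => j _; exact: key.
have s2 : \sum_(j < m) pr (F j.+1) <= 1.
  apply: (@pr_disjoint_sum m (fun j => F j.+1)) => // i j ij; exact: dF.
have m0' : 0 < m%:R :> R by rewrite ltr0n.
have cst (x : R) : \sum_(j < m) x = m%:R * x by rewrite sumr_const card_ord mulr_natl.
move: s1; rewrite big_split /= -mulr_sumr (cst tau) cst => s1.
rewrite -(ler_pM2l m0'); apply: (le_trans s1).
rewrite mulrDr (mulrCA m%:R (expR r)) divff ?gt_eqF // mulr1.
by rewrite lerD2r -[leRHS]mulr1 ler_pM2l ?expR_gt0.
Qed.

(* Starting from A, at most m steps of size c lead outside A, so that a
   non-negligible part of A lies one step away from its complement. *)
Lemma shift_gain c n (A : set (n.-tuple R)) (m : nat) (r : R) :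
  measurable A -> (0 < m)%N -> 0 < shift_cost c n ->
  m%:R ^+ 2 * shift_cost c n <= r ->
  (forall x, A x -> exists2 j, (j < m)%N & ~ A (tshift (fun k => j.+1%:R * c k) x)) ->
  pr (sample X n @^-1` A) + expR (- r) * (pr (sample X n @^-1` A) / m%:R -
    expR (- (r ^+ 2 / (8 * (m%:R ^+ 2 * shift_cost c n))))) <=
  pr (sample X n @^-1` (A `|` [set x | A (tshift (fun k => - c k) x)])).
Proof.
move=> mA m0 q0 mq ex.
set tau := expR (- (_ / _)).
pose A' : set (n.-tuple R) := [set x | A (tshift (fun k => - c k) x)].
have mA' : measurable A' by exact: measurable_tshift_preim.
pose D := A' `\` A.
have mD : measurable D by exact: measurableD.
pose F j := [set w | D (tshift (fun k => j.+1%:R * c k) (sample X n w))].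
have mF j : measurable (F j).
  exact: (measurable_sample_preim (measurable_tshift_preim _ mD)).
have cover : sample X n @^-1` A `<=` \bigcup_(j in `I_m) F j.
  move=> w Aw; have [j jm nA] := ex _ Aw.
  (* First exit from [A]: one step earlier the point is still in [A] (it is [x] itself when [i] is
     0), so the translate at the exit time lies in [D]. *)
  have [i iP imin] : exists2 i, ~ A (tshift (fun k => i.+1%:R * c k) (sample X n w)) &
      forall i', ~ A (tshift (fun k => i'.+1%:R * c k) (sample X n w)) -> (i <= i')%N.
    pose Q := fun i => `[< ~ A (tshift (fun k => i.+1%:R * c k) (sample X n w)) >].
    have exQ : exists i, Q i by exists j; apply/asboolP.
    exists (ex_minn exQ); first by case: ex_minnP => i /asboolP.
    by move=> i' h; case: ex_minnP => i _; apply; apply/asboolP.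
  exists i; first by rewrite /= (leq_ltn_trans (imin j nA)).
  split => //; rewrite /A' /= tshift_add.
  have -> : (fun k => i.+1%:R * c k + - c k) = fun k => i%:R * c k.
    by apply/funext => k; rewrite -natr1; ring.
  case: i iP imin => [|i] iP imin.
    rewrite (_ : (fun k => _) = fun=> 0) ?tshift0 //.
    by apply/funext => k; rewrite mul0r.
  by apply: contrapT => h; have := imin _ h; rewrite ltnn.
have m0' : 0 < m%:R :> R by rewrite ltr0n.
have key j : (j < m)%N -> pr (F j) <= expR r * pr (sample X n @^-1` D) + tau.
  move=> jm; apply: shift_upper_le => //; rewrite shift_cost_scale.
    by rewrite mulr_gt0 // exprn_gt0 // ltr0n.
  by rewrite ler_pM2r // lerXn2r ?nnegrE ?ler0n // ler_nat.
have s1 : pr (sample X n @^-1` A) <= m%:R * (expR r * pr (sample X n @^-1` D) + tau).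
  apply: (@le_trans _ _ (pr (\bigcup_(j in `I_m) F j))).
    by apply: pr_le => //; [exact: measurable_sample_preim|exact: bigcup_measurable].
  apply: (le_trans (@pr_bigcup _ _ _ P m F mF)).
  apply: (@le_trans _ _ (\sum_(j < m) (expR r * pr (sample X n @^-1` D) + tau))).
    by apply: ler_sum => j _; exact: key.
  by rewrite sumr_const card_ord mulr_natl.
have -> : sample X n @^-1` (A `|` A') = sample X n @^-1` A `|` sample X n @^-1` D.
  rewrite predeqE => w; rewrite /preimage /D /=; split => [[Aw|A'w]|[Aw|[A'w _]]].
  - by left.
  - by have [Aw|nAw] := pselect (A (sample X n w)); [left|right].
  - by left.
  - by right.
rewrite pr_setU_disjoint; last 3 first.
- exact: measurable_sample_preim.
- exact: measurable_sample_preim.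
- by rewrite predeqE => w; split => // -[? [_]].
rewrite lerD2l expRN mulrC ler_pdivrMr ?expR_gt0 // lerBlDr mulrC.
by rewrite ler_pdivrMl // (mulrC _ (expR r)).
Qed.

End gauss_seq.

(** * Wiener integrals of exponentials *)

Section increments.
Context (R : realType) (d : measure_display) (T : measurableType d)
  (mu : {measure set T -> \bar R}) (D : set T).
Hypothesis mD : measurable D.

Lemma integral_gram n (c : nat -> R) (f : nat -> T -> R) (K : nat -> nat -> R) :
  (forall i j, mu.-integrable D (fun x => (f i x * f j x)%:E)) ->
  (forall i j, (\int[mu]_(x in D) (f i x * f j x)%:E = (K i j)%:E)%E) ->
  (\int[mu]_(x in D) ((\sum_(i < n) c i * f i x) ^+ 2)%:E =
   (\sum_(i < n) \sum_(j < n) c i * c j * K i j)%:E)%E.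
Proof.
move=> fi fK.
transitivity (\int[mu]_(x in D) (\sum_(i < n) (\sum_(j < n)
   (c i * c j)%:E * (f i x * f j x)%:E)))%E.
  apply: eq_integral => x _; rewrite expr2 mulr_suml -sumEFin.
  apply: eq_bigr => i _; rewrite mulr_sumr -sumEFin.
  by apply: eq_bigr => j _; rewrite -EFinM; congr EFin; ring.
have h i j : mu.-integrable D (fun x => (c i * c j)%:E * (f i x * f j x)%:E)%E.
  exact: integrableZl.
rewrite integral_sum //; last first.
  by move=> i; apply: (integrable_sum mD) => j _; exact: h.
rewrite -sumEFin; apply: eq_bigr => i _.
rewrite integral_sum // -sumEFin; apply: eq_bigr => j _.
by rewrite integralZl // fK.
Qed.

(* Polarization of [E (Z u - Z v)^2 = |u - v|]. *)
Definition increment_cov (a b a' b' : R) : R :=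
  (`|b - a'| + `|a - b'| - `|b - b'| - `|a - a'|) / 2.

Variable Z : R -> T -> R.
Hypothesis mZ : forall u, 0 <= u <= 1 -> measurable_fun D (Z u).
Hypothesis hZ : forall u v, 0 <= u <= 1 -> 0 <= v <= 1 ->
  (\int[mu]_(x in D) ((Z u x - Z v x) ^+ 2)%:E = `|u - v|%:E)%E.

Let iZ u v : 0 <= u <= 1 -> 0 <= v <= 1 ->
  mu.-integrable D (fun x => ((Z u x - Z v x) ^+ 2)%:E).
Proof.
move=> hu hv; apply/integrableP; split.
  apply/measurable_EFinP; apply: measurable_funX; apply: measurable_funB; exact: mZ.
under eq_integral do rewrite gee0_abs ?lee_fin ?sqr_ge0 //.
by rewrite hZ // ltry.
Qed.

Let polar a b a' b' x : ((Z b x - Z a x) * (Z b' x - Z a' x))%:E =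
  ((2^-1)%:E * (((Z b x - Z a' x) ^+ 2)%:E + ((Z a x - Z b' x) ^+ 2)%:E -
     ((Z b x - Z b' x) ^+ 2)%:E - ((Z a x - Z a' x) ^+ 2)%:E))%E.
Proof. by rewrite -?EFinN -?EFinD -?EFinN -?EFinD -EFinM; congr EFin; field. Qed.

Lemma integrable_increments a b a' b' : 0 <= a <= 1 -> 0 <= b <= 1 ->
  0 <= a' <= 1 -> 0 <= b' <= 1 ->
  mu.-integrable D (fun x => ((Z b x - Z a x) * (Z b' x - Z a' x))%:E).
Proof.
move=> ha hb ha' hb'; under eq_fun do rewrite polar.
apply: integrableZl => //; do 2 (apply: integrableB => //; last exact: iZ).
by apply: integrableD => //; exact: iZ.
Qed.

Lemma integral_increments a b a' b' : 0 <= a <= 1 -> 0 <= b <= 1 ->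
  0 <= a' <= 1 -> 0 <= b' <= 1 ->
  (\int[mu]_(x in D) ((Z b x - Z a x) * (Z b' x - Z a' x))%:E =
   (increment_cov a b a' b')%:E)%E.
Proof.
move=> ha hb ha' hb'; under eq_integral do rewrite polar.
have i1 : mu.-integrable D (fun x => ((Z b x - Z a' x) ^+ 2)%:E +
    ((Z a x - Z b' x) ^+ 2)%:E)%E by apply: integrableD => //; exact: iZ.
have i2 : mu.-integrable D (fun x => ((Z b x - Z a' x) ^+ 2)%:E +
    ((Z a x - Z b' x) ^+ 2)%:E - ((Z b x - Z b' x) ^+ 2)%:E)%E.
  by apply: integrableB => //; exact: iZ.
rewrite integralZl //; last by apply: integrableB => //; exact: iZ.
rewrite integralB //; last exact: iZ.
rewrite integralB //; last exact: iZ.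
rewrite integralD //; try exact: iZ.
by rewrite !hZ // -?EFinN -?EFinD -EFinM; congr EFin; rewrite /increment_cov mulrC.
Qed.

(** The right side depends on [Z] only through [hZ]. Brownian motion in L^2(P) and the indicators of
    ]0, u] in L^2([0, 1]) both satisfy it, and comparing the two gives the Ito isometry. *)
Lemma integral_increments_sqr n (c a b : nat -> R) :
  (forall i, 0 <= a i <= 1) -> (forall i, 0 <= b i <= 1) ->
  (\int[mu]_(x in D) ((\sum_(i < n) c i * (Z (b i) x - Z (a i) x)) ^+ 2)%:E =
   (\sum_(i < n) \sum_(j < n) c i * c j * increment_cov (a i) (b i) (a j) (b j))%:E)%E.
Proof.
move=> ha hb; apply: (@integral_gram n c (fun i x => Z (b i) x - Z (a i) x)
  (fun i j => increment_cov (a i) (b i) (a j) (b j))).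
  by move=> i j; exact: integrable_increments.
by move=> i j; exact: integral_increments.
Qed.

End increments.

Section unit_interval.
Context (R : realType).
Notation lam := (@lebesgue_measure R).

Lemma indic_itv_sqr (u v : R) : 0 <= u <= 1 -> 0 <= v <= 1 ->
  (\int[lam]_(s in `[0%R, 1%R])
    ((\1_(`]0, u]%classic) s - \1_(`]0, v]%classic) s) ^+ 2)%:E = `|u - v|%:E)%E.
Proof.
wlog uv : u v / u <= v.
  move=> h hu hv; have [uv|/ltW vu] := leP u v; first exact: h.
  rewrite distrC -(h v u) //; apply: eq_integral => s _; congr EFin; ring.
move=> /andP[u0 u1] /andP[v0 v1].
transitivity (\int[lam]_(s in `[0%R, 1%R]) (\1_(`]u, v]%classic) s)%:E)%E.
  apply: eq_integral => s _; congr EFin; rewrite !indicE.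
  rewrite !(mem_setE, in_itv) /=.
  have [us|us] := leP s u; have [vs|vs] := leP s v; have [s0|s0] := ltP 0 s; 
    rewrite /= ?mulr1n ?mulr0n; try ring; exfalso; lra.
rewrite integral_indic //= setIidl; last first.
  by move=> s /=; rewrite !in_itv /= => /andP[h1 h2]; apply/andP; split; lra.
rewrite lebesgue_measure_itv /= lte_fin -EFinD.
have [uv'|vu] := ltP u v; first by rewrite ltr0_norm ?subr_lt0 // opprB.
by have -> : u = v; [lra|rewrite subrr normr0].
Qed.

End unit_interval.

Section stepfun_isometry.
Context (R : realType).
Implicit Types (g h : stepfun R) (G : R -> R -> R).

Lemma sum_append (f g : nat -> R) m n : \sum_(i < m) f i + \sum_(i < n) g i =
  \sum_(i < m + n) (if (i < m)%N then f i else g (i - m)%N).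
Proof.
rewrite big_split_ord /=; congr (_ + _); apply: eq_bigr => i _.
  by rewrite ltn_ord.
by rewrite ltnNge leq_addr addKn.
Qed.

(** The difference of two step functions is encoded by concatenating their lists of steps, with
    negated heights for the second. No common refinement is needed, because
    [integral_increments_sqr] accepts overlapping intervals. *)
Definition sub_height g h i :=
  if (i < nsteps g)%N then height g i else - height h (i - nsteps g).
Definition sub_left g h i :=
  if (i < nsteps g)%N then node g i else node h (i - nsteps g).
Definition sub_right g h i :=
  if (i < nsteps g)%N then node g i.+1 else node h (i - nsteps g).+1.

Lemma sub_stepfun g h G :
  \sum_(i < nsteps g) height g i * G (node g i) (node g i.+1) -
  \sum_(i < nsteps h) height h i * G (node h i) (node h i.+1) =
  \sum_(i < nsteps g + nsteps h)
    sub_height g h i * G (sub_left g h i) (sub_right g h i).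
Proof.
rewrite -sumrN (sum_append (fun i => height g i * G (node g i) (node g i.+1))
  (fun i => - (height h i * G (node h i) (node h i.+1)))).
apply: eq_bigr => i _; rewrite /sub_height /sub_left /sub_right.
by case: ifP => // _; rewrite mulNr.
Qed.

Lemma stepfun_eval_indic g (s : R) : stepfun_eval g s =
  \sum_(i < nsteps g) height g i *
    (\1_(`]0, node g i.+1]%classic) s - \1_(`]0, node g i]%classic) s).
Proof.
apply: eq_bigr => i _; congr (_ * _); rewrite !indicE !(mem_setE, in_itv) /=.
have /andP[a0 a1] := node_itv g i; have /andP[b0 b1] := node_itv g i.+1.
have ab : node g i <= node g i.+1 by apply: node_nondecreasing.
have [us|us] := leP s (node g i); have [vs|vs] := leP s (node g i.+1);
  have [s0|s0] := ltP 0 s; rewrite /= ?mulr1n ?mulr0n; try ring; exfalso; lra.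
Qed.

Lemma measurable_stepfun_eval g : measurable_fun setT (stepfun_eval g).
Proof.
apply: measurable_sum => i; apply: measurable_funM => //.
Qed.

End stepfun_isometry.

Section brownian.
Context (R : realType) (d : measure_display) (T : measurableType d)
  (P : probability T R) (B : R -> {RV P >-> R}).
Hypothesis hB : standard_brownian_motion B.
Notation lam := (@lebesgue_measure R).

Lemma bm_second_moment u v : 0 <= u <= 1 -> 0 <= v <= 1 ->
  (\int[P]_w ((B u w - B v w) ^+ 2)%:E = `|u - v|%:E)%E.
Proof.
wlog uv : u v / v <= u.
  move=> h hu hv; have [uv|/ltW vu] := leP v u; first exact: h.
  rewrite distrC -(h v u) //; apply: eq_integral => s _; congr EFin; ring.
move=> /andP[u0 _] /andP[v0 _]; rewrite ger0_norm ?subr_ge0 //.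
have [vu|uv'] := ltP v u; last first.
  have -> : u = v by lra.
  under eq_integral do rewrite subrr expr0n.
  by rewrite integral0 subrr.
have s0 : 0 < Num.sqrt (u - v) by rewrite sqrtr_gt0 subr_gt0.
rewrite -[X in _ = X%:E]sqr_sqrtr ?subr_ge0 //.
rewrite -(@normal_second_moment R _ s0).
rewrite -(@normal_law_ge0_integral _ _ _ P (Num.sqrt (u - v))
  [the {mfun T >-> R} of B u \- B v] (fun x : R => (x ^+ 2)%:E)) //.
- by move=> A mA; exact: (bm_normal hB v0 vu mA).
- by apply/measurable_EFinP; exact: measurable_funX.
- by move=> x; rewrite lee_fin sqr_ge0.
Qed.

Lemma ito_isometry (g h : stepfun R) :
  (\int[P]_w ((stepfun_integral B g w - stepfun_integral B h w) ^+ 2)%:E =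
   \int[lam]_(s in `[0%R, 1%R]) ((stepfun_eval g s - stepfun_eval h s) ^+ 2)%:E)%E.
Proof.
have ha i : 0 <= sub_left g h i <= 1 by rewrite /sub_left; case: ifP => _; exact: node_itv.
have hb i : 0 <= sub_right g h i <= 1 by rewrite /sub_right; case: ifP => _; exact: node_itv.
transitivity (\int[P]_w ((\sum_(i < nsteps g + nsteps h) sub_height g h i *
    (B (sub_right g h i) w - B (sub_left g h i) w)) ^+ 2)%:E)%E.
  apply: eq_integral => w _; rewrite -(sub_stepfun g h (fun a b => B b w - B a w)).
  by [].
rewrite (integral_increments_sqr (mu := P) (D := setT) measurableT (Z := fun u w => B u w)) //;
  last exact: bm_second_moment.
rewrite -(integral_increments_sqr (mu := lam) (D := `[0, 1]%classic)
  (measurable_itv _) (Z := fun u s => \1_(`]0, u]%classic) s)) //; last 2 first.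
- move=> u _; apply: measurable_funTS; exact: measurable_indic.
- exact: indic_itv_sqr.
apply: eq_integral => s _.
rewrite !stepfun_eval_indic.
by rewrite (sub_stepfun g h (fun a b => \1_(`]0, b]%classic) s - \1_(`]0, a]%classic) s)).
Qed.

Lemma measurable_stepfun_integral (g : stepfun R) :
  measurable_fun setT (stepfun_integral B g).
Proof.
by apply: measurable_sum => i; apply: measurable_funM => //; exact: measurable_funB.
Qed.

Lemma integral_sqr_le2 d' (T' : measurableType d') (mu : {measure set T' -> \bar R})
    (D : set T') (u v : T' -> R) : measurable D ->
  measurable_fun D u -> measurable_fun D v ->
  (\int[mu]_(x in D) ((u x + v x) ^+ 2)%:E <=
   2%:E * \int[mu]_(x in D) (u x ^+ 2)%:E + 2%:E * \int[mu]_(x in D) (v x ^+ 2)%:E)%E.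
Proof.
move=> mD mu_ mv.
have m2 (f : T' -> R) : measurable_fun D f -> measurable_fun D (fun x => (f x ^+ 2)%:E).
  by move=> mf; apply/measurable_EFinP; exact: measurable_funX.
rewrite -!ge0_integralZl //; try exact: m2; try by move=> x _; rewrite lee_fin sqr_ge0.
rewrite -ge0_integralD //; first last.
- by apply: emeasurable_funM => //; exact: m2.
- by move=> x _; rewrite mule_ge0 // lee_fin sqr_ge0.
- by apply: emeasurable_funM => //; exact: m2.
- by move=> x _; rewrite mule_ge0 // lee_fin sqr_ge0.
apply: ge0_le_integral => //.
- by move=> x _; rewrite lee_fin sqr_ge0.
- by apply: m2; exact: measurable_funD.
- by apply: emeasurable_funD; apply: emeasurable_funM => //; exact: m2.
- move=> x _; rewrite -!EFinM -EFinD lee_fin.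
  have := sqr_ge0 (u x - v x); lra.
Qed.

(** The step functions in [is_wiener_integral] are unspecified, so one far in the sequence is
    compared with [h] through the isometry. The factor 4 comes from using (u + v)^2 <= 2 u^2 + 2 v^2
    twice. *)
Lemma wiener_integral_step (f : R -> R) (J : {RV P >-> R}) (h : stepfun R) (e : R) :
  measurable_fun setT f -> is_wiener_integral B f J ->
  (\int[lam]_(s in `[0%R, 1%R]) ((f s - stepfun_eval h s) ^+ 2)%:E <= e%:E)%E ->
  (\int[P]_w ((J w - stepfun_integral B h w) ^+ 2)%:E <= (4 * e)%:E)%E.
Proof.
move=> mf [g [gf gJ]] he; apply/lee_addgt0Pr => eta eta0.
have mh := measurable_stepfun_eval h.
have [m [h1 h2]] : exists m,
    (\int[lam]_(s in `[0%R, 1%R]) ((f s - stepfun_eval (g m) s) ^+ 2)%:E <= (eta / 6)%:E)%E /\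
    (\int[P]_w ((J w - stepfun_integral B (g m) w) ^+ 2)%:E <= (eta / 6)%:E)%E.
  have e0 : (0 < (eta / 6)%:E :> \bar R)%E by rewrite lte_fin divr_gt0.
  have hm : \forall m \near \oo, 
    (\int[lam]_(s in `[0%R, 1%R]) ((f s - stepfun_eval (g m) s) ^+ 2)%:E < (eta / 6)%:E)%E.
    apply: (gf [set x | (x < (eta / 6)%:E)%E]); exact: open_ereal_lt'.
  have hm' : \forall m \near \oo, 
    ('E_P[fun w => ((J w - stepfun_integral B (g m) w) ^+ 2)%R] < (eta / 6)%:E)%E.
    apply: (gJ [set x | (x < (eta / 6)%:E)%E]); exact: open_ereal_lt'.
  near \oo => m; exists m; split; apply: ltW.
    by near: m.
  by have : ('E_P[fun w => ((J w - stepfun_integral B (g m) w) ^+ 2)%R] < (eta / 6)%:E)%E;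
    [near: m|rewrite unlock].
have mg := measurable_stepfun_eval (g m).
have s1 : (\int[lam]_(s in `[0%R, 1%R]) ((stepfun_eval (g m) s - stepfun_eval h s) ^+ 2)%:E <=
    (2 * (eta / 6) + 2 * e)%:E)%E.
  have := @integral_sqr_le2 _ _ lam `[0, 1]%classic
    (fun s => stepfun_eval (g m) s - f s) (fun s => f s - stepfun_eval h s) (measurable_itv _)
    (measurable_funTS (measurable_funB mg mf)) (measurable_funTS (measurable_funB mf mh)).
  under eq_integral do rewrite addrA subrK.
  move=> h3; apply: (le_trans h3).
  have -> : ((2 * (eta / 6) + 2 * e)%:E = 2%:E * (eta / 6)%:E + 2%:E * e%:E :> \bar R)%E.
    by rewrite -!EFinM -EFinD.
  rewrite leeD // lee_pmul2l ?lte_fin //.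
  apply: le_trans h1; rewrite le_eqVlt; apply/orP; left; apply/eqP.
  by apply: eq_integral => s _; congr EFin; ring.
have mgm := measurable_stepfun_integral (g m).
have mhm := measurable_stepfun_integral h.
have mJ : measurable_fun setT J by [].
have := @integral_sqr_le2 _ _ P setT (fun w => J w - stepfun_integral B (g m) w)
  (fun w => stepfun_integral B (g m) w - stepfun_integral B h w) measurableT
  (measurable_funB mJ mgm) (measurable_funB mgm mhm).
under eq_integral do rewrite addrA subrK.
move=> h3; apply: (le_trans h3); rewrite ito_isometry.
apply: (@le_trans _ _ (2%:E * (eta / 6)%:E + 2%:E * (2 * (eta / 6) + 2 * e)%:E)%E).
  by rewrite leeD // lee_pmul2l ?lte_fin.
by rewrite -!EFinM -!EFinD lee_fin; lra.
Unshelve. all: by end_near. Qed.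

End brownian.

Section laplace_approximation.
Context (R : realType) (d : measure_display) (T : measurableType d)
  (P : probability T R) (B X : R -> {RV P >-> R}).
Hypotheses (hB : standard_brownian_motion B) (hX : continuous_laplace_process B X).
Notation lam := (@lebesgue_measure R).

Let node_unit n (i : nat) : 0 <= Num.min (i%:R / n.+1%:R : R) 1 <= 1.
Proof.
by rewrite ge_min lexx orbT andbT le_min ler01 andbT divr_ge0.
Qed.

Let node_mono n : nondecreasing_seq (fun i : nat => Num.min (i%:R / n.+1%:R : R) 1).
Proof.
move=> i j ij /=; rewrite le_min !ge_min lexx orbT andbT; apply/orP; left.
by rewrite ler_pM2r ?invr_gt0 // ler_nat.
Qed.

(** The nodes are capped at 1 because [node_itv] bounds the nodes of all indices, including those
    beyond [nsteps]. *)
Definition laplace_step n (t : R) : stepfun R :=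
  @Stepfun R n.+1 (fun i => Num.min (i%:R / n.+1%:R) 1)
    (fun i => expR (- (i%:R / n.+1%:R * t))) (node_unit n) (node_mono n).

Lemma laplace_step_dist n t (s : R) : 0 <= t -> 0 < s <= 1 ->
  `|expR (- (s * t)) - stepfun_eval (laplace_step n t) s| <= t / n.+1%:R.
Proof.
move=> t0 /andP[s0 s1].
have n0 : 0 < n.+1%:R :> R by rewrite ltr0n.
have minE i : (i <= n.+1)%N -> Num.min (i%:R / n.+1%:R : R) 1 = i%:R / n.+1%:R.
  by move=> ni; apply/min_idPl; rewrite ler_pdivrMr // mul1r ler_nat.
have [k [kn ks sk]] : exists k, [/\ (k < n.+1)%N, k%:R / n.+1%:R < s & s <= k.+1%:R / n.+1%:R].
  have ex : exists k, s <= k.+1%:R / n.+1%:R.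
    by exists n; rewrite divff // gt_eqF.
  case: (ex_minnP ex) => k sk kmin; exists k; split => //.
    by rewrite ltnS; apply: kmin; rewrite divff // gt_eqF.
  case: k kmin {sk} => [|k] kmin; first by rewrite mul0r.
  by rewrite ltNge; apply/negP => /kmin; rewrite ltnn.
have -> : stepfun_eval (laplace_step n t) s = expR (- (k%:R / n.+1%:R * t)).
  rewrite /stepfun_eval /= (bigD1 (Ordinal kn)) //= big1 ?addr0.
    rewrite indicE mem_setE in_itv /= !minE //; last exact: ltnW.
    by rewrite ks sk mulr1.
  move=> i ik; rewrite indicE mem_setE in_itv /= !minE //; last exact: ltnW.
  have [ki|ki|ki] := ltngtP i k.
  - rewrite (_ : (s <= _) = false) ?andbF ?mulr0 //; apply/negbTE; rewrite -ltNge.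
    by apply: le_lt_trans ks; rewrite ler_pM2r ?invr_gt0 // ler_nat.
  - rewrite (_ : (_ < s) = false) ?mulr0 //; apply/negbTE; rewrite -leNgt.
    by apply: (le_trans sk); rewrite ler_pM2r ?invr_gt0 // ler_nat.
  - by case/eqP: ik; apply: val_inj.
set a := k%:R / n.+1%:R in ks *.
have a0 : 0 <= a by rewrite divr_ge0.
have sa : s - a <= n.+1%:R^-1.
  have e : k.+1%:R / n.+1%:R = a + n.+1%:R^-1 :> R.
    by rewrite /a -(natr1 k) mulrDl mul1r.
  by rewrite lerBlDl -e.
have -> : expR (- (s * t)) = expR (- (a * t)) * expR (- ((s - a) * t)).
  by rewrite -expRD; congr expR; ring.
have e1 : expR (- (a * t)) <= 1 by rewrite -expR0 ler_expR oppr_le0 mulr_ge0.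
have e0 := expR_ge0 (- (a * t)).
have st0 : 0 <= (s - a) * t by rewrite mulr_ge0 // subr_ge0 ltW.
have f1 : expR (- ((s - a) * t)) <= 1 by rewrite -expR0 ler_expR oppr_le0.
have f2 : 1 - (s - a) * t <= expR (- ((s - a) * t)) by rewrite expR_ge1Dx.
have f3 : (s - a) * t <= t / n.+1%:R by rewrite mulrC ler_wpM2l.
rewrite ler0_norm; last by rewrite subr_le0 ler_piMr.
set E := expR _ in e1 e0 *; set G := expR _ in f1 f2 *.
have : E * (1 - G) <= 1 - G by rewrite ler_piMl // subr_ge0.
by move: f2 f3; move: (t / n.+1%:R) ((s - a) * t) => p q; lra.
Qed.

Lemma laplace_step_L2 n t : 0 <= t ->
  (\int[lam]_(s in `[0%R, 1%R])
     ((expR (- (s * t)) - stepfun_eval (laplace_step n t) s) ^+ 2)%:E <=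
   ((t / n.+1%:R) ^+ 2)%:E)%E.
Proof.
move=> t0.
have mf : measurable_fun setT
    (fun s : R => ((expR (- (s * t)) - stepfun_eval (laplace_step n t) s) ^+ 2)%:E).
  apply/measurable_EFinP; apply: measurable_funX; apply: measurable_funB.
    apply: measurableT_comp => //; apply: measurable_funN; exact: measurable_funM.
  exact: measurable_stepfun_eval.
rewrite -integral_itv_obnd_cbnd; last exact: measurable_funTS.
apply: (@le_trans _ _ (\int[lam]_(s in `]0%R, 1%R]) ((t / n.+1%:R) ^+ 2)%:E)%E).
  apply: ge0_le_integral => //.
  - by move=> s _; rewrite lee_fin sqr_ge0.
  - exact: measurable_funTS.
  - move=> s; rewrite /= in_itv /= => hs; rewrite lee_fin.
    rewrite -(real_normK (num_real (_ - _))) lerXn2r ?nnegrE ?divr_ge0 //.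
    exact: laplace_step_dist.
rewrite integral_cst //= lebesgue_measure_itv /= lte_fin ltr01.
by rewrite -EFinD subr0 mule1.
Qed.

Definition bm_increment n k : {RV P >-> R} :=
  [the {mfun T >-> R} of B (k.+1%:R / n%:R) \- B (k%:R / n%:R)].

Lemma gauss_seq_bm_increment n : gauss_seq (bm_increment n.+1) (Num.sqrt n.+1%:R^-1).
Proof.
split.
  apply: (bm_indep hB (t := fun i => i%:R / n.+1%:R)); first by rewrite mul0r.
  by move=> i j ij; rewrite ler_pM2r ?invr_gt0 ?ltr0n // ler_nat.
move=> k A mA.
have h1 : 0 <= k%:R / n.+1%:R :> R by rewrite divr_ge0.
have h2 : k%:R / n.+1%:R < k.+1%:R / n.+1%:R :> R.
  by rewrite ltr_pM2r ?invr_gt0 ?ltr0n // ltr_nat.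
have := bm_normal hB h1 h2 mA.
have e : k.+1%:R / n.+1%:R - k%:R / n.+1%:R = n.+1%:R^-1 :> R.
  by rewrite -(natr1 k) mulrDl mul1r addrAC subrr add0r.
by rewrite e.
Qed.

(** The Wiener integral of the step function of mesh 1/n is a polynomial in exp (- t / n) whose
    coefficients are i.i.d. Gaussian; this is the bridge between the Laplace process and random
    polynomials. *)
Definition laplace_sum n (t : R) (w : T) : R :=
  pev (fun k => bm_increment n k w) n (expR (- (t / n%:R))).

Lemma measurable_laplace_sum n t : measurable_fun setT (laplace_sum n t).
Proof.
by apply: measurable_sum => k; apply: measurable_funM => //; exact: measurable_funP.
Qed.

Lemma laplace_stepE n t w :
  stepfun_integral B (laplace_step n t) w = laplace_sum n.+1 t w.
Proof.
apply: eq_bigr => k _ /=.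
have minE i : (i <= n.+1)%N -> Num.min (i%:R / n.+1%:R : R) 1 = i%:R / n.+1%:R.
  by move=> ni; apply/min_idPl; rewrite ler_pdivrMr ?ltr0n // mul1r ler_nat.
rewrite !minE //; last exact: ltnW.
rewrite mulrC; congr (_ * _); rewrite -expRM_natl; congr expR; ring.
Qed.

Lemma laplace_L2 n t : 0 <= t ->
  (\int[P]_w ((X t w - laplace_sum n.+1 t w) ^+ 2)%:E <=
   (4 * (t / n.+1%:R) ^+ 2)%:E)%E.
Proof.
move=> t0; under eq_integral do rewrite -laplace_stepE.
apply: (wiener_integral_step hB _ (hX.1 t t0)); last exact: laplace_step_L2.
apply: measurableT_comp => //; apply: measurable_funN; exact: measurable_funM.
Qed.

Lemma laplace_prob n t (eta : R) : 0 <= t -> 0 < eta ->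
  pr P [set w | eta <= `|X t w - laplace_sum n.+1 t w|] <=
    4 * (t / n.+1%:R) ^+ 2 / eta ^+ 2.
Proof.
move=> t0 eta0; rewrite ler_pdivlMr ?exprn_gt0 // -lee_fin.
apply: le_trans (laplace_L2 n t0).
have mD : measurable_fun setT (fun w => X t w - laplace_sum n.+1 t w).
  by apply: measurable_funB => //; exact: measurable_laplace_sum.
set A := [set w | _].
have mA : measurable A.
  rewrite -[X in measurable X]setTI; apply: measurable_fun_le => //.
  exact: measurableT_comp.
rewrite EFinM -prE // muleC (prob_indic P mA) -ge0_integralZl //; last 2 first.
- by apply/measurable_EFinP; exact: measurable_indic.
- by rewrite lee_fin sqr_ge0.
apply: ge0_le_integral => //.
- by move=> w _; rewrite mule_ge0 // lee_fin // sqr_ge0.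
- by apply: emeasurable_funM => //; apply/measurable_EFinP; exact: measurable_indic.
- by apply/measurable_EFinP; exact: measurable_funX.
- move=> w _; rewrite -EFinM lee_fin indicE; have [wA|wA] := boolP (w \in A).
    rewrite mulr1 -(real_normK (num_real (_ - _))).
    by rewrite lerXn2r ?nnegrE ?(ltW eta0) //; move: wA; rewrite inE.
  by rewrite mulr0 sqr_ge0.
Qed.

End laplace_approximation.

(** * Geometric grids *)

Section rational_points.
Context (R : realType).
Implicit Types (f : R -> R) (a t u : R).

(** An enumeration of the rationals; codes that decode to nothing give 0, itself rational. *)
Definition rat_point (n : nat) : R := ratr (odflt 0 (unpickle n : option rat)).

Lemma rat_point_ratr (q : rat) : rat_point (pickle q) = ratr q.
Proof. by rewrite /rat_point pickleK. Qed.

Lemma right_dense_le f t u a : t < u -> f x @[x --> t^'+] --> f t ->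
  (forall n, t < rat_point n < u -> `|f (rat_point n)| <= a) -> `|f t| <= a.
Proof.
move=> tu ft h; rewrite leNgt; apply/negP => aft.
have [e /= e0 he] := cvgr_norm_gt _ ft _ aft.
have : t < Num.min u (t + e) by rewrite lt_min tu ltrDl.
move=> /rat_in_itvoo[q]; rewrite in_itv /= lt_min => /and3P[tq qu qe].
have := h (pickle q); rewrite rat_point_ratr tq qu => /(_ isT).
apply/negP; rewrite -ltNge; apply: he => //=.
by rewrite ltr0_norm ?subr_lt0 // opprB ltrBlDl.
Qed.

Lemma continuous_bound_itvcy f a : {within `[0, +oo[, continuous f} ->
  (forall n, 0 <= rat_point n -> `|f (rat_point n)| <= a) ->
  forall t, 0 <= t -> `|f t| <= a.
Proof.
move=> /continuous_within_itvcyP[fc f0] h t t0.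
apply: (@right_dense_le f t (t + 1)); first by rewrite ltrDl.
  move: t0; rewrite le_eqVlt => /orP[/eqP <- //|t0].
  by apply: cvg_at_right_filter; apply: fc; rewrite in_itv /= t0.
by move=> n /andP[tn _]; apply: h; exact: le_trans (ltW tn).
Qed.

Lemma continuous_bound_unit f a : continuous f ->
  (forall n, 0 <= rat_point n <= 1 -> `|f (rat_point n)| <= a) ->
  forall t, 0 <= t <= 1 -> `|f t| <= a.
Proof.
move=> fc h t /andP[t0]; rewrite le_eqVlt => /orP[/eqP ->|t1].
  by have := h (pickle (1%Q : rat)); rewrite rat_point_ratr rmorph1 ler01 lexx; apply.
apply: (@right_dense_le f t 1) => //.
  by apply: cvg_at_right_filter; exact: fc.
by move=> n /andP[tn n1]; apply: h; rewrite (le_trans t0 (ltW tn)) ltW.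
Qed.

Lemma continuous_pev (x : nat -> R) n : continuous (pev x n).
Proof.
elim: n => [|n IH] y.
  rewrite (_ : pev x 0 = cst 0); first exact: cvg_cst.
  by apply/funext => z; rewrite /pev big_ord0.
rewrite (_ : pev x n.+1 = pev x n \+ (fun z => x n * z ^+ n)).
  apply: cvgD; first exact: IH.
  apply: cvgM; first exact: cvg_cst.
  exact: exprn_continuous.
by apply/funext => z; rewrite /pev big_ord_recr.
Qed.

End rational_points.

Section grid.
Context (R : realType).
Implicit Types (a h t tau M y : R) (x : nat -> R).

(* Concavity of [1 - exp (- t)]. *)
Lemma expR_ratio a t : 0 <= a -> a <= t -> 0 < t ->
  a / t * (1 - expR (- t)) <= 1 - expR (- a).
Proof.
move=> a0 at' t0; have tN0 : t != 0 by rewrite gt_eqF.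
have e1 : expR (- a) * (1 - (t - a)) <= expR (- t).
  have -> : - t = - a - (t - a) by ring.
  by rewrite expRD ler_wpM2l ?expR_ge0 // expR_ge1Dx.
have e2 : expR (- a) * (1 + a) <= 1.
  by rewrite -[leRHS](expRxMexpNx_1 a) mulrC ler_wpM2r ?expR_ge0 // expR_ge1Dx.
have th0 : 0 <= a / t by rewrite divr_ge0 // ltW.
have th1 : a / t <= 1 by rewrite ler_pdivrMr // mul1r.
have h1 := ler_wpM2l th0 e1.
have h2 : (1 - a / t) * (expR (- a) * (1 + a)) <= (1 - a / t) * 1.
  by rewrite ler_wpM2l // subr_ge0.
have e3 : a / t * (expR (- a) * (1 - (t - a))) +
  (1 - a / t) * (expR (- a) * (1 + a)) = expR (- a) by field.
move: h1 h2 e3; move: (a / t * _) ((1 - a / t) * (expR (- a) * (1 + a))) => p q; lra.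
Qed.

(** Nodes for t = - n ln y. The ratio 1 + h is what [pev_diff] asks for; the node 0, that is y = 1,
    takes care of t < h. *)
Definition grid h J : seq R := 0 :: [seq h * (1 + h) ^+ i | i <- iota 0 J.+1].

Lemma size_grid h J : size (grid h J) = J.+2.
Proof. by rewrite /= size_map size_iota. Qed.

Lemma grid_ge0 h J t : 0 < h -> t \in grid h J -> 0 <= t.
Proof.
move=> h0; rewrite in_cons => /orP[/eqP -> //|/mapP[i _ ->]].
by rewrite mulr_ge0 ?exprn_ge0 ?addr_ge0 ?ltW.
Qed.

Lemma grid_le h J t : 0 < h -> t \in grid h J -> t <= h * (1 + h) ^+ J.
Proof.
move=> h0; have h1 : 1 <= 1 + h by rewrite lerDl ltW.
rewrite in_cons => /orP[/eqP ->|/mapP[i]].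
  by rewrite mulr_ge0 ?exprn_ge0 ?addr_ge0 ?ltW.
by rewrite mem_iota add0n ltnS => /andP[_ iJ] ->; rewrite ler_pM2l // ler_weXn2l.
Qed.

Lemma grid_bracket h J t : 0 < h -> h <= t -> t < h * (1 + h) ^+ J ->
  exists2 i, (i < J)%N & h * (1 + h) ^+ i <= t < h * (1 + h) ^+ i.+1.
Proof.
move=> h0 ht; elim: J => [|J IH]; first by rewrite mulr1 ltNge ht.
move=> tJ; have [tJ'|Jt] := ltP t (h * (1 + h) ^+ J).
  by have [i iJ hi] := IH tJ'; exists i => //; exact: ltnW.
by exists J => //; rewrite Jt.
Qed.

(** Three ranges of t = - n ln y. Beyond the last node, [pev_bound_le] is applied to the partial
    sums there; below h, the comparison is with y = 1; in between, it is with the next node, where 1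
    - y differs by a relative amount of at most h. *)
Lemma grid_cover x n h J M b a : (0 < n)%N -> 0 < h ->
  (forall k, (k <= n)%N -> `|\sum_(i < k) x i| <= M) ->
  (forall k, (k <= n)%N ->
    `|\sum_(i < k) expR (- (h * (1 + h) ^+ J / n%:R)) ^+ i * x i| <= b) ->
  (forall t, t \in grid h J -> `|pev x n (expR (- (t / n%:R)))| <= a) ->
  a + 4 * h * M <= b ->
  forall y, 0 <= y <= 1 -> `|pev x n y| <= b.
Proof.
move=> n0 h0 hM hb ha ab y /andP[y0 y1].
have n0' : 0 < n%:R :> R by rewrite ltr0n.
have M0 : 0 <= M by have := hM 0%N isT; rewrite big_ord0 normr0.
set tau := h * (1 + h) ^+ J in hb *.
have [ysmall|ybig] := leP y (expR (- (tau / n%:R))).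
  apply: (@pev_bound_le R x n b (expR (- (tau / n%:R)))); rewrite ?expR_gt0 //.
    by move=> k kn; rewrite pevE; exact: hb.
  by rewrite y0.
have yp : 0 < y := lt_trans (expR_gt0 _) ybig.
pose t := - (n%:R * ln y).
have yE : y = expR (- (t / n%:R)).
  have -> : - (t / n%:R) = ln y by rewrite /t; field; rewrite gt_eqF.
  by rewrite lnK.
have t0 : 0 <= t by rewrite oppr_ge0 mulr_ge0_le0 ?ler0n // ln_le0.
have ttau : t < tau.
  have : - (tau / n%:R) < - (t / n%:R) by rewrite -ltr_expR -yE.
  by rewrite ltrN2 ltr_pM2r ?invr_gt0.
have near z c : `|pev x n z| <= a -> `|pev x n y - pev x n z| <= c * M ->
    c <= 4 * h -> `|pev x n y| <= b.
  move=> h1 h2 h3.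
  have h4 : c * M <= 4 * h * M by rewrite ler_wpM2r.
  have := ler_normD (pev x n y - pev x n z) (pev x n z); rewrite subrK; lra.
have [th|ht] := ltP t h.
  apply: (@near 1 (2 * h)); last by lra.
    have := ha 0; rewrite mul0r oppr0 expR0; apply; exact: mem_head.
  rewrite distrC; apply: (le_trans (pev1_diff hM _)); first by rewrite y0.
  rewrite ler_wpM2r // ler_wpM2l // yE -expRM_natl.
  have -> : n%:R * - (t / n%:R) = - t by field; rewrite gt_eqF.
  have := expR_ge1Dx (- t); lra.
have [i iJ /andP[ti it]] := grid_bracket h0 ht ttau.
set t' := h * (1 + h) ^+ i.+1 in it.
have t'0 : 0 < t' := le_lt_trans t0 it.
have z1 : expR (- (t' / n%:R)) < 1 by rewrite -[ltRHS]expR0 ltr_expR oppr_lt0; exact: divr_gt0.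
apply: (@near (expR (- (t' / n%:R))) (4 * h)) => //.
  apply: ha; rewrite in_cons; apply/orP; right; apply/mapP; exists i.+1 => //.
  by rewrite mem_iota add0n ltnS.
have zy : expR (- (t' / n%:R)) <= y.
  by rewrite [leRHS]yE ler_expR lerN2 ler_pM2r ?invr_gt0 // ltW.
apply: (le_trans (pev_diff hM _ zy y1 z1)); first exact: expR_ge0.
rewrite ler_wpM2r // ler_wpM2l // ler_pdivrMr ?subr_gt0 //.
have r0 : 0 < t' / n%:R by rewrite divr_gt0.
have r1 : t / n%:R <= t' / n%:R by rewrite ler_pM2r ?invr_gt0 // ltW.
have r2 : 0 <= t / n%:R by rewrite divr_ge0 // ltW.
have := expR_ratio r2 r1 r0; rewrite -yE.
have -> : t / n%:R / (t' / n%:R) = t / t' by field; rewrite !gt_eqF.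
(* From t' <= (1 + h) t and (1 - h) (1 + h) <= 1. *)
have tt' : 1 - h <= t / t'.
  have [h1|h1] := leP 1 h; first by apply: (@le_trans _ _ 0); rewrite ?subr_le0 // divr_ge0 // ltW.
  rewrite ler_pdivlMr //.
  have -> : t' = (1 + h) * (h * (1 + h) ^+ i) by rewrite /t' exprS; ring.
  have : (1 - h) * ((1 + h) * (h * (1 + h) ^+ i)) <= (1 - h) * ((1 + h) * t).
    by rewrite ler_wpM2l ?subr_ge0 ?(ltW h1) // ler_wpM2l // addr_ge0 // ltW.
  have : 0 <= h ^+ 2 * t by rewrite mulr_ge0 ?sqr_ge0.
  by move: (_ * (h * _)) => q; nra.
have z1' : 0 <= 1 - expR (- (t' / n%:R)) by rewrite subr_ge0 ltW.
have := ler_wpM2r z1' tt'.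
move: (t / t' * _) => p; lra.
Qed.

End grid.

Section grid_probability.
Context (R : realType) (d : measure_display) (T : measurableType d)
  (P : probability T R) (X : nat -> {RV P >-> R}).
Notation pr := (pr P).

Definition sup_ball n (a : R) : set T :=
  [set w | forall y : R, 0 <= y <= 1 -> `|pev (X ^~ w) n y| <= a].

Lemma measurable_pev n y : measurable_fun setT (fun w => pev (X ^~ w) n y).
Proof.
by apply: measurable_sum => k; apply: measurable_funM => //; exact: measurable_funP.
Qed.

Lemma measurable_norm_le (f : T -> R) (a : R) : measurable_fun setT f ->
  measurable [set w | `|f w| <= a].
Proof.
move=> mf; rewrite -[X in measurable X]setTI; apply: measurable_fun_le => //.
exact: measurableT_comp.
Qed.

Lemma measurable_norm_ge (f : T -> R) (a : R) : measurable_fun setT f ->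
  measurable [set w | a <= `|f w|].
Proof.
move=> mf; rewrite -[X in measurable X]setTI; apply: measurable_fun_le => //.
exact: measurableT_comp.
Qed.

Lemma measurable_sup_ball n a : measurable (sup_ball n a).
Proof.
rewrite (_ : sup_ball n a = \bigcap_k [set w | 0 <= rat_point R k <= 1 ->
    `|pev (X ^~ w) n (rat_point R k)| <= a]).
  apply: bigcap_measurable => [|k _]; first by exists 0%N.
  have [h|h] := boolP (0 <= rat_point R k <= 1).
    rewrite (_ : [set w | _] = [set w | `|pev (X ^~ w) n (rat_point R k)| <= a]).
      exact: measurable_norm_le (measurable_pev n _).
    by rewrite predeqE => w; split => /= [h1|h1 _]; [exact: h1|exact: h1].
  by rewrite (_ : [set w | _] = setT) // predeqE => w; split.
rewrite predeqE => w; split => [h k _ hk|h]; first exact: h.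
apply: continuous_bound_unit; first exact: continuous_pev.
by move=> k hk; apply: h.
Qed.

Lemma measurable_all_norm_le (s : seq R) (f : R -> T -> R) (a : R) :
  (forall t, measurable_fun setT (f t)) ->
  measurable [set w | forall t, t \in s -> `|f t w| <= a].
Proof.
move=> mf; elim: s => [|t s IH].
  by rewrite (_ : [set w | _] = setT) // predeqE => w; split.
rewrite (_ : [set w | _] = [set w | `|f t w| <= a] `&`
    [set w | forall t, t \in s -> `|f t w| <= a]).
  by apply: measurableI => //; exact: measurable_norm_le.
rewrite predeqE => w; split => [h|[h1 h2] u].
  split; first by apply: h; exact: mem_head.
  by move=> u us; apply: h; rewrite in_cons us orbT.
by rewrite in_cons => /orP[/eqP ->|/h2].
Qed.

Variable v : R.
Hypothesis hX : std_seq X v.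

Let v0 : 0 <= v.
Proof.
have [_ _ vX] := hX.2 0%N; rewrite -lee_fin -vX.
by apply: integral_ge0 => w _; rewrite lee_fin sqr_ge0.
Qed.

Definition partial_exceed n (y lam : R) : set T :=
  [set w | exists2 j, (j <= n)%N & lam <= `|\sum_(i < j) y ^+ i * X i w|].

Lemma measurable_partial_exceed n y lam : measurable (partial_exceed n y lam).
Proof.
rewrite (_ : partial_exceed n y lam = \bigcup_(j in `I_n.+1)
  [set w | lam <= `|\sum_(i < j) y ^+ i * X i w|]).
  apply: bigcup_measurable => j _; apply: measurable_norm_ge.
  by apply: measurable_sum => k; apply: measurable_funM => //; exact: measurable_funP.
by rewrite predeqE => w; split => -[j]; exists j.
Qed.

Lemma pr_partial_exceed1 n (lam : R) : 0 < lam ->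
  pr (partial_exceed n 1 lam) <= n%:R * v / lam ^+ 2.
Proof.
move=> lam0; apply: (le_trans (kolmogorov_partial_sums hX (fun i => 1 ^+ i) n lam0)).
rewrite (eq_bigr (fun=> 1)); first by rewrite sumr_const card_ord.
by move=> i _; rewrite !expr1n.
Qed.

(** With u = 2 tau / n the variances y^(2 i) = exp (- u i) add up to at most 1 / (1 - exp (- u)) <=
    1 + 1 / u. The damping is what makes the partial sums at the last node small compared with those
    at y = 1. *)
Lemma pr_partial_exceed n (tau lam : R) : (0 < n)%N -> 0 < tau -> 0 < lam ->
  pr (partial_exceed n (expR (- (tau / n%:R))) lam) <=
    (1 + n%:R / (2 * tau)) * v / lam ^+ 2.
Proof.
move=> n0 tau0 lam0; have n0' : 0 < n%:R :> R by rewrite ltr0n.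
apply: (le_trans (kolmogorov_partial_sums hX _ n lam0)).
rewrite ler_wpM2r ?invr_ge0 ?sqr_ge0 // ler_wpM2r //.
pose u := 2 * tau / n%:R.
have u0 : 0 < u by rewrite divr_gt0 // mulr_gt0.
pose q := expR (- u).
have qE : expR (- (tau / n%:R)) ^+ 2 = q.
  by rewrite -expRM_natl; congr expR; rewrite /u; ring.
rewrite (eq_bigr (fun i : 'I_n => q ^+ i)); last first.
  by move=> i _; rewrite exprAC qE.
have q1 : q < 1 by rewrite -[ltRHS]expR0 ltr_expR oppr_lt0.
have sg := sum_geom n q.
have qn : 0 <= q ^+ n by rewrite exprn_ge0 // expR_ge0.
have qu : q * (1 + u) <= 1.
  by rewrite -[leRHS](expRxMexpNx_1 u) mulrC ler_wpM2r ?expR_ge0 // expR_ge1Dx.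
have -> : n%:R / (2 * tau) = u^-1 by rewrite /u; field; rewrite !gt_eqF.
have s0 : 0 <= \sum_(i < n) q ^+ i.
  by apply: sumr_ge0 => i _; rewrite exprn_ge0 // expR_ge0.
have u1 : 0 < u^-1 by rewrite invr_gt0.
have -> : 1 + u^-1 = (1 + u) / u by field; rewrite gt_eqF.
rewrite ler_pdivlMr //; move: sg s0; set S := \sum_(i < n) _ => sg s0.
have : (1 + u) * ((1 - q) * S) <= (1 + u) * 1.
  by rewrite ler_wpM2l ?addr_ge0 ?(ltW u0) // sg lerBlDr lerDl.
have : 0 <= S * (1 - q * (1 + u)) by rewrite mulr_ge0 // subr_ge0.
nra.
Qed.

(** The exceptional event is exhibited rather than only its probability, so that two dependent
    polynomials can be controlled on the same sample point, as the sign polynomials require. *)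
Lemma grid_sup_ball_exception n (h lam a b : R) J : (0 < n)%N -> 0 < h -> 0 < lam ->
  0 < b -> a + 4 * h * lam <= b ->
  exists E, [/\ measurable E, pr E <= n%:R * v / lam ^+ 2 +
      (1 + n%:R / (2 * (h * (1 + h) ^+ J))) * v / b ^+ 2 &
    [set w | forall t, t \in grid h J -> `|pev (X ^~ w) n (expR (- (t / n%:R)))| <= a] `<=`
      sup_ball n b `|` E].
Proof.
move=> n0 h0 lam0 b0 ab; set tau := h * _.
have tau0 : 0 < tau by rewrite mulr_gt0 ?exprn_gt0 ?addr_gt0.
have mE1 := measurable_partial_exceed n 1 lam.
have mE2 := measurable_partial_exceed n (expR (- (tau / n%:R))) b.
exists (partial_exceed n 1 lam `|` partial_exceed n (expR (- (tau / n%:R))) b); split.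
- exact: measurableU.
- by apply: le_trans (pr_setU P mE1 mE2) _; rewrite lerD // ?pr_partial_exceed1 // pr_partial_exceed.
move=> w /= hw.
have [?|n1] := pselect (partial_exceed n 1 lam w); first by right; left.
have [?|n2] := pselect (partial_exceed n (expR (- (tau / n%:R))) b w); first by right; right.
left; apply: (grid_cover n0 h0 _ _ hw ab).
  move=> k kn; rewrite leNgt; apply/negP => kl; apply: n1; exists k => //.
  by under eq_bigr do rewrite expr1n mul1r; rewrite ltW.
by move=> k kn; rewrite leNgt; apply/negP => kl; apply: n2; exists k => //; rewrite ltW.
Qed.

Lemma pr_grid_sup_ball n (h lam a b : R) J : (0 < n)%N -> 0 < h -> 0 < lam ->
  0 < b -> a + 4 * h * lam <= b ->
  pr [set w | forall t, t \in grid h J -> `|pev (X ^~ w) n (expR (- (t / n%:R)))| <= a] <=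
    pr (sup_ball n b) + n%:R * v / lam ^+ 2 +
    (1 + n%:R / (2 * (h * (1 + h) ^+ J))) * v / b ^+ 2.
Proof.
move=> n0 h0 lam0 b0 ab.
have [E [mE hE sE]] := grid_sup_ball_exception J n0 h0 lam0 b0 ab.
rewrite -addrA; apply: le_trans (lerD (lexx _) hE); apply: pr_subU => //.
  by apply: (@measurable_all_norm_le _ (fun t w => _)) => t; exact: measurable_pev.
exact: measurable_sup_ball.
Qed.

End grid_probability.

Section finite_lists.
Context (R : realType).

Lemma seq_ub (s : seq R) : exists2 tau : R, 0 < tau & forall t, t \in s -> t <= tau.
Proof.
elim: s => [|t s [tau tau0 IH]]; first by exists 1.
exists (Num.max t tau); first by rewrite lt_max tau0 orbT.
move=> u; rewrite in_cons le_max => /orP[/eqP ->|/IH ->]; rewrite ?lexx ?orbT //.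
Qed.

Lemma small_div (c e : R) : 0 < e ->
  exists N, forall n, (N <= n)%N -> c / n.+1%:R <= e.
Proof.
move=> e0; exists (Num.truncn `|c / e|) => n Nn.
have n0 : 0 < n.+1%:R :> R by rewrite ltr0n.
rewrite ler_pdivrMr // mulrC -ler_pdivrMr //.
apply: (le_trans (ler_norm _)); apply: ltW.
apply: (lt_le_trans (truncnS_gt _)).
by rewrite ler_nat ltnS.
Qed.

End finite_lists.

(** * The small ball function and its finite-dimensional approximations *)

Section small_ball.
Context (R : realType) (d : measure_display) (T : measurableType d)
  (P : probability T R) (B X : R -> {RV P >-> R}).
Hypotheses (hB : standard_brownian_motion B) (hX : continuous_laplace_process B X).
Notation pr := (pr P).
Notation F := (sup_ball_prob X).
Implicit Types (s : seq R) (a b eta tau : R).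

Definition lap_ball a : set T := [set w | forall t : R, 0 <= t -> `|X t w| <= a].
Definition lap_grid s a : set T := [set w | forall t : R, t \in s -> `|X t w| <= a].
Definition sum_grid n s a : set T :=
  [set w | forall t : R, t \in s -> `|laplace_sum B n.+1 t w| <= a].

Lemma measurable_lap_grid s a : measurable (lap_grid s a).
Proof. exact: (@measurable_all_norm_le _ _ _ s (fun t w => X t w)). Qed.

Lemma measurable_sum_grid n s a : measurable (sum_grid n s a).
Proof.
apply: (@measurable_all_norm_le _ _ _ s (fun t w => laplace_sum B n.+1 t w)) => t.
exact: measurable_laplace_sum.
Qed.

Definition rat_times N : seq R := [seq Num.max 0 (rat_point R i) | i <- iota 0 N].

Lemma rat_times_ge0 N t : t \in rat_times N -> 0 <= t.
Proof. by move=> /mapP[i _ ->]; rewrite le_max lexx. Qed.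

Lemma lap_ballE a : lap_ball a = \bigcap_N lap_grid (rat_times N) a.
Proof.
rewrite predeqE => w; split => [h N _ t /rat_times_ge0|h]; first exact: h.
apply: continuous_bound_itvcy => [|i i0]; first exact: hX.2.
apply: (h i.+1) => //; apply/mapP; exists i; last by rewrite max_r.
by rewrite mem_iota add0n ltnS leqnn.
Qed.

Lemma measurable_lap_ball a : measurable (lap_ball a).
Proof.
rewrite lap_ballE; apply: bigcap_measurable => [|N _]; first by exists 0%N.
exact: measurable_lap_grid.
Qed.

Lemma sup_ball_probE a : F a = pr (lap_ball a).
Proof.
rewrite /sup_ball_prob /pr; congr (fine (P _)); rewrite predeqE => w; split => h.
  move=> t t0; rewrite -lee_fin; apply: le_trans h; apply: ereal_sup_ubound.
  by exists t => //=; rewrite in_itv /= t0.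
apply/ereal_supP => y [t /=]; rewrite in_itv /= andbT => t0 <-.
by rewrite lee_fin; exact: h.
Qed.

Lemma sup_ball_prob_le a b : a <= b -> F a <= F b.
Proof.
move=> ab; rewrite !sup_ball_probE; apply: pr_le; try exact: measurable_lap_ball.
by move=> w h t t0; apply: le_trans ab; exact: h.
Qed.

Lemma sup_ball_prob_grid s a : (forall t, t \in s -> 0 <= t) -> F a <= pr (lap_grid s a).
Proof.
move=> s0; rewrite sup_ball_probE; apply: pr_le.
- exact: measurable_lap_ball.
- exact: measurable_lap_grid.
- by move=> w h t /s0; exact: h.
Qed.

(** By path continuity the ball is the decreasing intersection of its traces on finitely many
    rational times; continuity of the measure from above does the rest. *)
Lemma sup_ball_prob_approx a e : 0 < e -> exists2 s, forall t, t \in s -> 0 <= t &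
  pr (lap_grid s a) <= F a + e.
Proof.
move=> e0; have mG N : measurable (lap_grid (rat_times N) a) by exact: measurable_lap_grid.
have h : (P \o (fun N => lap_grid (rat_times N) a)) x @[x --> \oo] -->
    P (\bigcap_N lap_grid (rat_times N) a).
  apply: nonincreasing_cvg_mu => //.
  - by rewrite (le_lt_trans (probability_le1 _ _)) // ltry.
  - by apply: bigcap_measurable => [|N _]; first by exists 0%N.
  - move=> m n mn; rewrite subsetEset => w h t /mapP[i].
    rewrite mem_iota add0n => /andP[_ im] ->; apply: h; apply/mapP; exists i => //.
    by rewrite mem_iota add0n (leq_trans im).
rewrite -lap_ballE prE in h; last exact: measurable_lap_ball.
move/fine_cvgP : h => [_ /cvgrPdist_lt/(_ _ e0)[N _ /(_ N (leqnn _))]].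
rewrite /= -sup_ball_probE -/(pr _) => h.
exists (rat_times N); first exact: rat_times_ge0.
have := ler_norm (pr (lap_grid (rat_times N) a) - F a); rewrite distrC in h; lra.
Qed.

Lemma pr_far n s tau eta : 0 < eta -> (forall t, t \in s -> 0 <= t <= tau) ->
  let E := [set w | exists2 t, t \in s & eta <= `|X t w - laplace_sum B n.+1 t w|] in
  measurable E /\ pr E <= (size s)%:R * (4 * (tau / n.+1%:R) ^+ 2 / eta ^+ 2).
Proof.
move=> eta0; elim: s => [|t s IH] hs E.
  rewrite (_ : E = set0); last by rewrite predeqE => w; split => // -[].
  by rewrite mul0r /pr measure0.
have [mE' hE'] := IH (fun u us => hs u (mem_behead (s := t :: s) us)).
set E' := [set w | _] in mE' hE'.
pose A := [set w | eta <= `|X t w - laplace_sum B n.+1 t w|].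
have mA : measurable A.
  apply: (@measurable_norm_ge _ _ _ (fun w => X t w - laplace_sum B n.+1 t w)).
  by apply: measurable_funB => //; exact: measurable_laplace_sum.
have -> : E = A `|` E'.
  rewrite predeqE => w; split => [[u]|].
    by rewrite in_cons => /orP[/eqP -> ?|us ?]; [left|right; exists u].
  case=> [?|[u us ?]]; first by exists t => //; exact: mem_head.
  by exists u => //; rewrite in_cons us orbT.
split; first exact: measurableU.
apply: (le_trans (pr_setU P mA mE')).
rewrite /= -(natr1 (size s)) mulrDl mul1r addrC lerD //.
have /andP[t0 tt] := hs t (mem_head _ _).
apply: (le_trans (laplace_prob hB hX n t0 eta0)).
rewrite ler_wpM2r ?invr_ge0 ?sqr_ge0 // ler_wpM2l // lerXn2r ?nnegrE ?divr_ge0 //.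
  exact: le_trans tt.
by rewrite ler_wpM2r // invr_ge0.
Qed.

Definition transfer_error n s tau eta :=
  (size s)%:R * (4 * (tau / n.+1%:R) ^+ 2 / eta ^+ 2).

Lemma transfer_sum_lap n s a b tau eta : 0 < eta -> a + eta <= b ->
  (forall t, t \in s -> 0 <= t <= tau) ->
  pr (sum_grid n s a) <= pr (lap_grid s b) + transfer_error n s tau eta.
Proof.
move=> eta0 ab hs; have [mE hE] := pr_far n eta0 hs.
apply: le_trans (lerD (lexx _) hE).
apply: pr_subU => //; [exact: measurable_sum_grid|exact: measurable_lap_grid|].
move=> w h; have [|far] := pselect ([set w | exists2 t, t \in s &
  eta <= `|X t w - laplace_sum B n.+1 t w|] w); [by right|left => t ts].
have h1 : `|X t w - laplace_sum B n.+1 t w| < eta.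
  by rewrite ltNge; apply/negP => ?; apply: far; exists t.
have := ler_normD (X t w - laplace_sum B n.+1 t w) (laplace_sum B n.+1 t w).
have := h t ts; rewrite subrK; lra.
Qed.

Lemma transfer_lap_sum n s a b tau eta : 0 < eta -> a + eta <= b ->
  (forall t, t \in s -> 0 <= t <= tau) ->
  pr (lap_grid s a) <= pr (sum_grid n s b) + transfer_error n s tau eta.
Proof.
move=> eta0 ab hs; have [mE hE] := pr_far n eta0 hs.
apply: le_trans (lerD (lexx _) hE).
apply: pr_subU => //; [exact: measurable_lap_grid|exact: measurable_sum_grid|].
move=> w h; have [|far] := pselect ([set w | exists2 t, t \in s &
  eta <= `|X t w - laplace_sum B n.+1 t w|] w); [by right|left => t ts].
have h1 : `|X t w - laplace_sum B n.+1 t w| < eta.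
  by rewrite ltNge; apply/negP => ?; apply: far; exists t.
have := ler_normB (X t w) (X t w - laplace_sum B n.+1 t w).
have := h t ts; rewrite opprB addrC subrK; lra.
Qed.

Lemma transfer_error_small s tau eta e : 0 < e ->
  exists N, forall n, (N <= n)%N -> transfer_error n s tau eta <= e.
Proof.
move=> e0; have [N hN] := small_div ((size s)%:R * (4 * tau ^+ 2 / eta ^+ 2)) e0.
exists N => n /hN; apply: le_trans; rewrite /transfer_error.
have n1 : 1 <= n.+1%:R :> R by rewrite ler1n.
have -> : (size s)%:R * (4 * (tau / n.+1%:R) ^+ 2 / eta ^+ 2) =
   (size s)%:R * (4 * tau ^+ 2 / eta ^+ 2) / n.+1%:R * n.+1%:R^-1.
  by rewrite exprMn exprVn expr2 (expr2 n.+1%:R) invfM; ring.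
rewrite ler_piMr ?invf_le1 ?ltr0n //.
apply: divr_ge0 => //; apply: mulr_ge0 => //; apply: divr_ge0; rewrite ?sqr_ge0 //.
by apply: mulr_ge0 => //; exact: sqr_ge0.
Qed.

(** The route to lower bounds of F: a bound for discretised polynomials on every finite set of times
    and for arbitrarily large n. The gap between [a] and [b] absorbs the L^2 error of the
    discretisation. *)
Lemma sum_grid_sup_ball_prob a b c : a < b ->
  (forall s, (forall t, t \in s -> 0 <= t) -> forall N : nat,
     exists2 n, (N <= n)%N & c <= pr (sum_grid n s a)) -> c <= F b.
Proof.
move=> ab h; apply/ler_addgt0Pr => e e0.
have e20 : 0 < e / 2 by rewrite divr_gt0.
have [s s0 hs] := sup_ball_prob_approx b e20.
have [tau tau0 stau] := seq_ub s.
have [N hN] := transfer_error_small s tau (b - a) e20.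
have [n Nn hn] := h s s0 N.
apply: (le_trans hn).
have st t : t \in s -> 0 <= t <= tau by move=> ts; rewrite s0 // stau.
have ba : 0 < b - a by rewrite subr_gt0.
have hab : a + (b - a) <= b by rewrite addrC subrK.
have := transfer_sum_lap n ba hab st.
have := hN _ Nn; lra.
Qed.

Lemma sup_ball_prob_sum_grid s a b e : a < b -> (forall t, t \in s -> 0 <= t) -> 0 < e ->
  exists N, forall n, (N <= n)%N -> F a <= pr (sum_grid n s b) + e.
Proof.
move=> ab s0 e0; have [tau tau0 stau] := seq_ub s.
have [N hN] := transfer_error_small s tau (b - a) e0.
exists N => n Nn; apply: (le_trans (sup_ball_prob_grid a s0)).
have st t : t \in s -> 0 <= t <= tau by move=> ts; rewrite s0 // stau.
have ba : 0 < b - a by rewrite subr_gt0.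
have hab : a + (b - a) <= b by rewrite addrC subrK.
have := transfer_lap_sum n ba hab st.
have := hN _ Nn; lra.
Qed.

Lemma std_seq_bm_increment n : std_seq (bm_increment B n.+1) n.+1%:R^-1.
Proof.
rewrite -[X in std_seq _ X]sqr_sqrtr ?invr_ge0 //.
apply: gauss_std_seq; last exact: gauss_seq_bm_increment hB n.
by rewrite sqrtr_gt0 invr_gt0 ltr0n.
Qed.

Lemma sup_ball_sum_grid n s a : (forall t, t \in s -> 0 <= t) ->
  sup_ball (bm_increment B n.+1) n.+1 a `<=` sum_grid n s a.
Proof.
move=> s0 w h t ts; apply: h; rewrite expR_ge0 /= -[leRHS]expR0 ler_expR oppr_le0.
by rewrite divr_ge0 // s0.
Qed.

(** As n grows the discretisation terms disappear, and what remains is the price of the partial sums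
    at y = 1 and of the times beyond the last node. *)
Lemma pr_grid_sup_ball_prob (h lam a b b' : R) J : 0 < h -> 0 < lam -> 0 < b' ->
  a + 4 * h * lam < b' -> b' < b ->
  pr (lap_grid (grid h J) a) <=
    F b + 1 / lam ^+ 2 + 1 / (2 * (h * (1 + h) ^+ J)) / b' ^+ 2.
Proof.
move=> h0 lam0 b'0 ab' b'b; set tau := h * _.
have tau0 : 0 < tau by rewrite mulr_gt0 ?exprn_gt0 ?addr_gt0.
apply/ler_addgt0Pr => e e0; rewrite -!lerBlDr.
apply: (sum_grid_sup_ball_prob b'b) => s s0 N.
have e20 : 0 < e / 2 by rewrite divr_gt0.
pose eta := b' - (a + 4 * h * lam).
have eta0 : 0 < eta by rewrite subr_gt0.
have gt t : t \in grid h J -> 0 <= t <= tau.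
  by move=> tg; rewrite (grid_ge0 h0 tg) (grid_le h0 tg).
have [N1 hN1] := transfer_error_small (grid h J) tau eta e20.
have [N2 hN2] := small_div (b' ^- 2) e20.
pose n := maxn N (maxn N1 N2).
exists n; first exact: leq_maxl.
have h1 := hN1 n (leq_trans (leq_maxl _ _) (leq_maxr _ _)).
have h2 := hN2 n (leq_trans (leq_maxr _ _) (leq_maxr _ _)).
have h3 := transfer_lap_sum n eta0 (lexx (a + eta)) gt.
have ab : a + eta + 4 * h * lam <= b' by rewrite /eta; lra.
have h4 := @pr_grid_sup_ball _ _ _ P _ _ (std_seq_bm_increment n) n.+1 h lam (a + eta) b' J
  isT h0 lam0 b'0 ab.
have h5 : pr (sup_ball (bm_increment B n.+1) n.+1 b') <= pr (sum_grid n s b').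
  apply: pr_le; [exact: measurable_sup_ball|exact: measurable_sum_grid|].
  exact: sup_ball_sum_grid.
have n0 : n.+1%:R != 0 :> R by rewrite pnatr_eq0.
have e1 : n.+1%:R * n.+1%:R^-1 / lam ^+ 2 = 1 / lam ^+ 2 :> R by rewrite divff.
have e2 : (1 + n.+1%:R / (2 * (h * (1 + h) ^+ J))) * n.+1%:R^-1 / b' ^+ 2 =
    b' ^- 2 / n.+1%:R + 1 / (2 * tau) / b' ^+ 2.
  rewrite -/tau; move: n0; move: (n.+1%:R : R) => z z0.
  by field; rewrite z0 !gt_eqF.
move: h4; rewrite e1 e2; change [set w : T | _] with (sum_grid n (grid h J) (a + eta)).
move: h1 h2 h3 h5; move: (transfer_error _ _ _ _) (b' ^- 2 / _) (pr _) (pr _) (pr _) (pr _).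
by move=> u1 u2 u3 u4 u5 u6; move: (1 / _ / _) (1 / _) => u7 u8; lra.
Qed.

(** Only t = 0 is used: with a single increment the sum at t = 0 is B_1 - B_0, a standard normal
    variable, and the transfer error vanishes because tau = 0. For the quantiles this yields delta^2
    >= 1 / ln n, on which all error terms rely. *)
Lemma sup_ball_prob_le_id (a : R) : 0 <= a -> F a <= a.
Proof.
move=> a0; apply/ler_addgt0Pr => e e0.
have h0 (t : R) : t \in [:: 0] -> 0 <= t <= 0 by rewrite inE => /eqP ->; rewrite lexx.
have h0' (t : R) : t \in [:: 0] -> 0 <= t by move=> /h0 /andP[].
apply: (le_trans (sup_ball_prob_grid a h0')).
apply: (le_trans (transfer_lap_sum 0 e0 (lexx (a + e)) h0)).
rewrite /transfer_error mul0r expr0n mulr0 mul0r mulr0 addr0.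
rewrite -lee_fin -prE; last exact: measurable_sum_grid.
have ae0 : 0 <= a + e by rewrite addr_ge0 // ltW.
apply: le_trans (normal_small_ball ae0).
have mA : measurable [set x : R | `|x| <= a + e] by exact: measurable_norm_le.
have := (gauss_seq_bm_increment hB 0).2 0%N _ mA.
rewrite invr1 sqrtr1 => <-; rewrite le_eqVlt; apply/orP; left; apply/eqP; congr (P _).
rewrite predeqE => w; rewrite /sum_grid /= /laplace_sum /pev; split => [/(_ 0 (mem_head _ _))|h t].
  by rewrite big_ord_recl big_ord0 expr0 mulr1 addr0.
by rewrite inE => /eqP ->; rewrite big_ord_recl big_ord0 expr0 mulr1 addr0.
Qed.

Lemma pr_sup_ball_ge n (a : R) : 0 < a ->
  1 - a ^- 2 <= pr (sup_ball (bm_increment B n.+1) n.+1 a).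
Proof.
move=> a0; have h := pr_partial_exceed1 (std_seq_bm_increment n) n.+1 a0.
rewrite divff ?pnatr_eq0 // mul1r in h.
have mE := measurable_partial_exceed (bm_increment B n.+1) n.+1 1 a.
have mS := measurable_sup_ball (bm_increment B n.+1) n.+1 a.
have := pr_subU P measurableT mS mE _; rewrite prT => h1.
have {}h1 : 1 <= pr (sup_ball (bm_increment B n.+1) n.+1 a) +
    pr (partial_exceed (bm_increment B n.+1) n.+1 1 a); last lra.
apply: h1 => w _; have [|nE] := pselect (partial_exceed (bm_increment B n.+1) n.+1 1 a w).
  by right.
left => y y01; apply: pev_bound y01 => k kn; rewrite leNgt; apply/negP => ak; apply: nE.
by exists k => //; under eq_bigr do rewrite expr1n mul1r; rewrite ltW.
Qed.

Lemma sup_ball_prob_ge (a b : R) : 0 < a -> a < b -> 1 - a ^- 2 <= F b.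
Proof.
move=> a0 ab; apply: (sum_grid_sup_ball_prob ab) => s s0 N; exists N => //.
apply: (le_trans (pr_sup_ball_ge N a0)).
apply: pr_le; [exact: measurable_sup_ball|exact: measurable_sum_grid|].
exact: sup_ball_sum_grid.
Qed.

End small_ball.

Section grid_reach.
Context (R : realType).

Lemma ln_ge_half (h : R) : 0 <= h <= 1 -> h / 2 <= ln (1 + h).
Proof.
move=> /andP[h0 h1]; have h2 : 0 < 1 + h by rewrite ltr_pwDl.
rewrite -ler_expR lnK //.
have e1 := expR_ge1Dx (- (h / 2)).
have e2 := expRxMexpNx_1 (h / 2).
have e0 := expR_gt0 (h / 2).
move: e1 e2 e0; move: (expR (h / 2)) (expR (- (h / 2))) => p q; nra.
Qed.

(** The least J that reaches tau overshoots by a factor at most 1 + h <= 2, and its predecessor does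
    not reach tau; the logarithm of the latter fact, with ln (1 + h) >= h / 2, bounds J. *)
Lemma grid_reach (h tau : R) : 0 < h <= 1 -> h <= tau -> exists J : nat,
  [/\ tau <= h * (1 + h) ^+ J, h * (1 + h) ^+ J <= 2 * tau &
      J%:R <= 2 / h * ln (tau / h) + 1].
Proof.
move=> /andP[h0 h1] ht; have tau0 := lt_le_trans h0 ht.
have hh1 : 1 <= 1 + h by rewrite lerDl ltW.
have ex : exists J, tau <= h * (1 + h) ^+ J.
  exists (Num.truncn (tau / h ^+ 2)).+1.
  have h2 : 0 < h ^+ 2 by rewrite exprn_gt0.
  have : tau / h ^+ 2 <= (Num.truncn (tau / h ^+ 2)).+1%:R by rewrite ltW // truncnS_gt.
  move: (Num.truncn _).+1 => J hJ.
  have bern : 1 + J%:R * h <= (1 + h) ^+ J.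
    elim: J {hJ} => [|J IH]; first by rewrite mul0r addr0.
    have := ler_wpM2l (le_trans ler01 hh1) IH; rewrite -exprS; apply: le_trans.
    rewrite -natr1; have : 0 <= J%:R * h ^+ 2 by rewrite mulr_ge0 ?sqr_ge0.
    move: (J%:R : R) => j; nra.
  have := ler_wpM2l (ltW h0) bern; apply: le_trans.
  move: hJ; rewrite ler_pdivrMr // expr2; nra.
case: (ex_minnP ex) => J hJ Jmin; exists J; split => //.
  case: J hJ Jmin => [|J] hJ Jmin; first by rewrite mulr1; lra.
  have : h * (1 + h) ^+ J <= tau.
    by rewrite leNgt; apply/negP => /ltW/Jmin; rewrite ltnn.
  by rewrite exprS; move: (_ ^+ J) => p; nra.
case: J hJ Jmin => [|J] hJ Jmin.
  by rewrite addr_ge0 // mulr_ge0 ?divr_ge0 ?(ltW h0) // ln_ge0 // ler_pdivlMr // mul1r.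
have : h * (1 + h) ^+ J <= tau.
  by rewrite leNgt; apply/negP => /ltW/Jmin; rewrite ltnn.
rewrite mulrC -ler_pdivlMr // -ler_ln ?posrE ?divr_gt0 ?exprn_gt0 ?(lt_le_trans ltr01 hh1) //.
rewrite lnXn ?(lt_le_trans ltr01 hh1) // -(mulr_natl _ J) => hln.
rewrite -(natr1 J) lerD2r.
have hh : h / 2 <= ln (1 + h) by rewrite ln_ge_half // ltW.
have J0 : 0 <= J%:R :> R by rewrite ler0n.
have h3 := ler_wpM2l J0 hh.
rewrite mulrAC ler_pdivlMr //; lra.
Qed.

End grid_reach.

Section tuple_polynomial.
Context (R : realType).

Definition tpev n (x : n.-tuple R) (y : R) := \sum_(k < n) tnth x k * y ^+ k.

Lemma tpev_sample d (T : measurableType d) (P : probability T R)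
    (X : nat -> {RV P >-> R}) n w y : tpev (sample X n w) y = pev (X ^~ w) n y.
Proof. by apply: eq_bigr => k _; rewrite tnth_mktuple. Qed.

Lemma tpev_tshift n (c : nat -> R) (x : n.-tuple R) y :
  tpev (tshift c x) y = tpev x y + pev c n y.
Proof.
by rewrite /tpev /pev -big_split; apply: eq_bigr => k _; rewrite tnth_mktuple mulrDl.
Qed.

Lemma measurable_tpev n y : measurable_fun setT (fun x : n.-tuple R => tpev x y).
Proof.
apply: measurable_sum => k; apply: measurable_funM => //; exact: measurable_tnth.
Qed.

Lemma measurable_all_le d (T : measurableType d) (s : seq R) (f : R -> T -> R) (a : R) :
  (forall t, measurable_fun setT (f t)) ->
  measurable [set w | forall t, t \in s -> f t w <= a].
Proof.
move=> mf; elim: s => [|t s IH].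
  by rewrite (_ : [set w | _] = setT) // predeqE => w; split.
rewrite (_ : [set w | _] = [set w | f t w <= a] `&`
    [set w | forall t, t \in s -> f t w <= a]).
  apply: measurableI => //.
  by rewrite -[X in measurable X]setTI; apply: measurable_fun_le.
rewrite predeqE => w; split => [h|[h1 h2] u].
  split; first by apply: h; exact: mem_head.
  by move=> u us; apply: h; rewrite in_cons us orbT.
by rewrite in_cons => /orP[/eqP ->|/h2].
Qed.

End tuple_polynomial.

(** * Continuity of the small ball function *)

Section small_ball_continuity.
Context (R : realType) (d : measure_display) (T : measurableType d)
  (P : probability T R) (B X : R -> {RV P >-> R}).
Hypotheses (hB : standard_brownian_motion B) (hX : continuous_laplace_process B X).
Notation pr := (pr P).
Notation F := (sup_ball_prob X).
Implicit Types (s : seq R) (a b eta tau : R).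

Lemma bm_increment_sd_gt0 n : 0 < Num.sqrt n.+1%:R^-1 :> R.
Proof. by rewrite sqrtr_gt0 invr_gt0 ltr0n. Qed.

Lemma bm_shift_cost n (c : nat -> R) :
  shift_cost (Num.sqrt n.+1%:R^-1) c n.+1 = n.+1%:R * \sum_(k < n.+1) c k ^+ 2.
Proof. by rewrite /shift_cost sqr_sqrtr ?invr_ge0 // invrK mulrC. Qed.

Lemma expR_inv_le (x : R) : 0 < x -> expR (- x^-1) <= x.
Proof.
move=> x0; rewrite expRN -[leRHS]invrK lef_pV2 ?posrE ?expR_gt0 ?invr_gt0 //.
by apply: le_trans (expR_ge1Dx _); rewrite lerDr.
Qed.

(** A thin shell has small mass. Constant coefficients of size kap / (n + 1) move a polynomial by at
    least the width of the shell at every time up to tau, so the translates of the shell are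
    disjoint, and by [disjoint_shift_bound] m + 1 of them have comparable probability. The width
    does not depend on n, on the grid or on [a]. *)
Lemma shift_window tau e : 0 < e -> exists2 w, 0 < w &
  forall n s a, (forall t, t \in s -> 0 <= t <= tau) ->
    pr (sum_grid B n s a) <= pr (sum_grid B n s (a - w)) + e.
Proof.
move=> e0.
have [m em] : exists m, expR 1 / m.+1%:R <= e / 4.
  by have [N hN] := small_div (expR 1 : R) (divr_gt0 e0 (ltr0Sn R 3)); exists N; exact: hN.
pose theta : R := Num.min 1 (e / 32).
have th0 : 0 < theta by rewrite lt_min ltr01 divr_gt0.
have th1 : theta <= 1 by rewrite ge_min lexx.
have the : theta <= e / 32 by rewrite ge_min lexx orbT.
pose kap : R := theta / m.+1%:R.
have kap0 : 0 < kap by rewrite divr_gt0.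
exists (kap * expR (- tau)); first by rewrite mulr_gt0 ?expR_gt0.
set W := kap * expR (- tau) => n s a hs.
pose y t : R := expR (- (t / n.+1%:R)).
(* The sign g = 1 or -1 selects the upper or the lower side: a shift displaces a one-sided supremum
   monotonically, but not the supremum of the absolute value. *)
pose A (g : R) : set (n.+1.-tuple R) :=
  [set x | forall t, t \in s -> g * tpev x (y t) <= a] `&`
  ~` [set x | forall t, t \in s -> g * tpev x (y t) <= a - W].
have mA g : measurable (A g).
  apply: measurableI; [|apply: measurableC]; apply: measurable_all_le => t;
    by apply: measurable_funM => //; exact: measurable_tpev.
have pA (g : R) : g ^+ 2 = 1 -> pr (sample (bm_increment B n.+1) n.+1 @^-1` A g) <= e / 2.
  move=> g2; pose c (k : nat) : R := g * (kap / n.+1%:R).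
  have cost : shift_cost (Num.sqrt n.+1%:R^-1) c n.+1 = kap ^+ 2.
    rewrite bm_shift_cost /c sumr_const card_ord exprMn g2 mul1r -(mulr_natl (_ ^+ 2)).
    by move: (pnatr_eq0 R n.+1); move: (n.+1%:R : R) => z /= hz; field; rewrite hz.
  have mk : m.+1%:R ^+ 2 * kap ^+ 2 = theta ^+ 2.
    by rewrite -exprMn /kap mulrC divfK // pnatr_eq0.
  (* The shift evaluates to kap times an average of powers of y, each at least exp (- tau). *)
  have pc t : t \in s -> W <= g * pev c n.+1 (y t).
    move=> ts; have /andP[t0 tt] := hs t ts.
    have -> : g * pev c n.+1 (y t) = \sum_(k < n.+1) kap / n.+1%:R * y t ^+ k.
      rewrite /pev mulr_sumr; apply: eq_bigr => k _.
      by rewrite /c !mulrA -expr2 g2 mul1r.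
    rewrite -mulr_sumr -mulrA ler_pM2l // mulrC ler_pdivlMr ?ltr0n //.
    rewrite mulr_natr -[X in _ *+ X]card_ord -sumr_const; apply: ler_sum => k _.
    rewrite /y -expRM_natl ler_expR mulrN lerN2; apply: le_trans tt.
    rewrite mulrCA ler_piMr // ler_pdivrMr ?ltr0n // mul1r ler_nat ltnW //.
  have := @disjoint_shift_bound R d T P (bm_increment B n.+1) (Num.sqrt n.+1%:R^-1)
    (bm_increment_sd_gt0 n) (gauss_seq_bm_increment hB n) c n.+1 (A g) m.+1 1 (mA g) isT.
  rewrite cost mk => h.
  have : pr (sample (bm_increment B n.+1) n.+1 @^-1` A g) <= expR 1 / m.+1%:R +
      expR (- (1 ^+ 2 / (8 * theta ^+ 2))).
    apply: h; first by rewrite exprn_gt0.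
      by rewrite exprn_ile1 // ltW.
    move=> x i j ij [h1 h2] [h3 h4]; apply: h4 => t ts.
    have := h1 t ts; rewrite !tpev_tshift.
    have pevc (k : nat) : pev (fun l => - (k%:R * c l)) n.+1 (y t) = - (k%:R * pev c n.+1 (y t)).
      by rewrite /pev mulr_sumr -sumrN; apply: eq_bigr => l _; rewrite mulNr mulrA.
    rewrite !pevc => h5; have h6 := pc t ts.
    have ij1 : i%:R + 1 <= j%:R :> R by rewrite natr1 ler_nat.
    have W0 : 0 <= W by rewrite mulr_ge0 ?expR_ge0 // ltW.
    move: h5 h6; rewrite mulrDr mulrDr !mulrN !(mulrCA g); set u := g * pev _ _ _ => h5 h6.
    move: ij1 h5 h6 W0; move: (i%:R : R) (j%:R : R) (g * _) => p q v; nra.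
  move=> hh; apply: (le_trans hh).
  have : expR (- (1 ^+ 2 / (8 * theta ^+ 2))) <= e / 4.
    rewrite expr1n mul1r; apply: (@le_trans _ _ (8 * theta ^+ 2)).
      by apply: expR_inv_le; rewrite mulr_gt0 // exprn_gt0.
    have : theta ^+ 2 <= theta by rewrite expr2 ler_piMl // ltW.
    lra.
  move=> hq; rewrite (_ : e / 2 = e / 4 + e / 4); first exact: lerD.
  by field.
have e1 := pA 1 (expr1n _ 2).
have e2 : pr (sample (bm_increment B n.+1) n.+1 @^-1` A (-1)) <= e / 2.
  by apply: pA; rewrite sqrrN expr1n.
have mp g : measurable (sample (bm_increment B n.+1) n.+1 @^-1` A g).
  exact: measurable_sample_preim.
apply: (@le_trans _ _ (pr (sum_grid B n s (a - W) `|`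
    sample (bm_increment B n.+1) n.+1 @^-1` A 1) +
    pr (sample (bm_increment B n.+1) n.+1 @^-1` A (-1)))).
  apply: pr_subU => //.
  - exact: measurable_sum_grid.
  - by apply: measurableU => //; exact: measurable_sum_grid.
  move=> w h.
  have tE t : tpev (sample (bm_increment B n.+1) n.+1 w) (y t) = laplace_sum B n.+1 t w.
    by rewrite tpev_sample.
  have [?|h1] := pselect ((sample (bm_increment B n.+1) n.+1 @^-1` A 1) w); first by left; right.
  have [?|h2] := pselect ((sample (bm_increment B n.+1) n.+1 @^-1` A (-1)) w); first by right.
  left; left => t ts; rewrite ler_norml; apply/andP; split.
    rewrite leNgt; apply/negP => h3; apply: h2; split => [u us|].
      by rewrite tE mulN1r; have := h u us; rewrite ler_norml => /andP[]; lra.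
    by move=> h4; have := h4 t ts; rewrite tE mulN1r; lra.
  rewrite leNgt; apply/negP => h3; apply: h1; split => [u us|].
    by rewrite tE mul1r; have := h u us; rewrite ler_norml => /andP[].
  by move=> h4; have := h4 t ts; rewrite tE mul1r; lra.
have := pr_setU P (measurable_sum_grid B n s (a - W)) (mp 1); lra.
Qed.

(** The radius goes from a + w to a + 2 w when F is replaced by a discretised grid, drops to a - 5 w
    after crossing the shell by [shift_window] and returning to the process, and ends at a - w after
    passing from the grid to all times. As [shift_window] needs bounded times, the grid stops near
    tau0, of order 1 / (e a^2), beyond which Kolmogorov's bound is small. *)
Lemma sup_ball_prob_window a e : 0 < a -> 0 < e ->
  exists w, [/\ 0 < w, w < a & F (a + w) <= F (a - w) + e].
Proof.
move=> a0 e0.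
have e80 : 0 < e / 8 by rewrite divr_gt0.
pose tau0 := 8 / (e * a ^+ 2) + 1.
have tp : 0 < 8 / (e * a ^+ 2) by rewrite divr_gt0 // mulr_gt0 // exprn_gt0.
have tau1 : 1 <= tau0 by rewrite lerDr ltW.
have [w0 w00 hw0] := shift_window (2 * tau0) (divr_gt0 e0 (ltr0Sn R 3)).
pose w := Num.min (w0 / 8) (a / 8).
have wp : 0 < w by rewrite lt_min !divr_gt0.
have ww0 : w <= w0 / 8 by rewrite ge_min lexx.
have wa : w <= a / 8 by rewrite ge_min lexx orbT.
have aw2 : a / 2 <= a - 2 * w by lra.
have c1 : a + w + w <= a + 2 * w by lra.
have c2 : a + 2 * w - w0 + w <= a - 5 * w by lra.
have b0 : 0 < a - 2 * w by lra.
have c4 : a - 2 * w < a - w by lra.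
exists w; split => //; first by lra.
pose lam : R := 1 + 4 / e.
have lam0 : 0 < lam by rewrite addr_gt0 // divr_gt0.
pose h := Num.min 1 (w / (8 * lam)).
have h0 : 0 < h by rewrite lt_min ltr01 divr_gt0 // mulr_gt0.
have h1 : h <= 1 by rewrite ge_min lexx.
have hlam : 8 * (h * lam) <= w.
  have : h <= w / (8 * lam) by rewrite ge_min lexx orbT.
  by rewrite ler_pdivlMr ?mulr_gt0 // mulrCA.
have [|J [J1 J2 _]] := @grid_reach R h tau0 _ (le_trans h1 tau1); first by rewrite h0.
set s := grid h J.
have s0 t : t \in s -> 0 <= t by exact: grid_ge0.
have st t : t \in s -> 0 <= t <= 2 * tau0.
  by move=> ts; rewrite s0 //= (le_trans (grid_le h0 ts)).
have [N1 hN1] := transfer_error_small s (2 * tau0) w e80.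
have t1 := hN1 _ (leqnn N1).
have i1 := sup_ball_prob_grid hX (a + w) s0.
have i2 := transfer_lap_sum hB hX N1 wp c1 st.
have i3 := hw0 N1 s (a + 2 * w) st.
have i4 := transfer_sum_lap hB hX N1 wp c2 st.
have c3 : a - 5 * w + 4 * h * lam < a - 2 * w by lra.
have i5 := @pr_grid_sup_ball_prob R d T P B X hB hX h lam (a - 5 * w) (a - w)
  (a - 2 * w) J h0 lam0 b0 c3 c4.
have j1 : 1 / lam ^+ 2 <= e / 4.
  rewrite ler_pdivrMr ?exprn_gt0 //.
  have : e * lam = e + 4 by rewrite /lam; field; rewrite gt_eqF.
  have : 0 < e / e by rewrite divr_gt0.
  have := lam0; move=> l0 _ el.
  have l1 : 1 <= lam by rewrite lerDl divr_ge0 // ltW.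
  have : e * lam * lam <= e * lam ^+ 2 by rewrite expr2 mulrA.
  rewrite el; nra.
have j2 : 1 / (2 * (h * (1 + h) ^+ J)) / (a - 2 * w) ^+ 2 <= e / 4.
  have q0 : 0 < h * (1 + h) ^+ J by apply: lt_le_trans J1; apply: lt_le_trans tau1.
  have q02 := mulr_gt0 (ltr0Sn R 1) q0.
  rewrite ler_pdivrMr ?exprn_gt0 // ler_pdivrMr //.
  have : (a / 2) ^+ 2 <= (a - 2 * w) ^+ 2.
    by rewrite lerXn2r ?nnegrE ?divr_ge0 ?(ltW a0) ?(ltW b0).
  have : 8 <= h * (1 + h) ^+ J * (e * a ^+ 2).
    by rewrite -ler_pdivrMr ?mulr_gt0 ?exprn_gt0 //; apply: le_trans J1; rewrite lerDl.
  move: q0; move: (h * _) ((a - 2 * w) ^+ 2) => q z q0 h2 h3.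
  have : q * e * (a / 2) ^+ 2 <= q * e * z by rewrite ler_wpM2l // mulr_ge0 // ltW.
  rewrite expr_div_n; move: h2; move: (a ^+ 2) => a2; lra.
move: i1 i2 i3 i4 i5 t1 j1 j2; rewrite -/s.
move: (1 / _ / _) (1 / _) (transfer_error _ _ _ _) => u1 u2 u3.
move: (pr _) (pr _) (pr _) (pr _) => u4 u5 u6 u7; lra.
Qed.

End small_ball_continuity.

(** * Small ball probabilities *)

Section independence_transformations.
Context (R : realType) (d : measure_display) (T : measurableType d)
  (P : probability T R).
Implicit Types X Y : nat -> {RV P >-> R}.

Lemma indep_map X Y (f : nat -> R -> R) :
  mutually_independent P (fun i => X i : T -> R) ->
  (forall i, measurable_fun setT (f i)) -> (forall i w, Y i w = f i (X i w)) ->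
  mutually_independent P (fun i => Y i : T -> R).
Proof.
move=> hX mf YX s A us mA.
have mA' i : measurable (f i @^-1` A i) by rewrite -[X in measurable X]setTI; exact: mf.
have e i : Y i @^-1` A i = X i @^-1` (f i @^-1` A i).
  by apply/funext => w; rewrite /preimage /= YX.
under eq_bigr do rewrite e.
rewrite -(hX s _ us mA'); congr (P _).
by rewrite predeqE => w; split => h i /h; rewrite e.
Qed.

Lemma indep_reindex X (sg ta : nat -> nat) : cancel sg ta ->
  mutually_independent P (fun i => X i : T -> R) ->
  mutually_independent P (fun i => X (sg i) : T -> R).
Proof.
move=> sK hX s A us mA.
have := hX (map sg s) (fun i => A (ta i)) _ (fun i => mA (ta i)).
rewrite (map_inj_uniq (can_inj sK)) big_map => /(_ us).
under [in RHS]eq_bigr do rewrite sK.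
move=> <-; congr (P _); rewrite predeqE => w; split => h i /=.
  by move=> /mapP[j js ->]; rewrite sK; exact: h.
by move=> js; have := h (sg i); rewrite /= sK; apply; apply/mapP; exists i.
Qed.

Lemma same_law d' (T' : measurableType d') (P' : probability T' R)
    (X : nat -> {RV P >-> R}) (X' : nat -> {RV P' >-> R}) n (A : set (n.-tuple R)) :
  mutually_independent P (fun i => X i : T -> R) ->
  mutually_independent P' (fun i => X' i : T' -> R) ->
  (forall k (C : set R), measurable C -> P (X k @^-1` C) = P' (X' k @^-1` C)) ->
  measurable A -> pr P (sample X n @^-1` A) = pr P' (sample X' n @^-1` A).
Proof.
move=> hX hX' h mA; rewrite /pr; congr fine; symmetry.
have := @change_of_law R d d' T T' P P' X X' (fun _ _ => 1) hX hX'
  (fun _ => measurable_cst _) (fun _ _ => ler01) _ n A mA.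
move=> -> //; first by under eq_integral do rewrite big1 //;
  rewrite integral_cst ?mul1e //; exact: measurable_sample_preim.
move=> k C mC; rewrite -h // integral_cst ?mul1e //.
by rewrite -[X in measurable X]setTI; exact: measurable_funP.
Qed.

End independence_transformations.

Section pigeonhole.
Context (R : realType) (d d0 : measure_display) (T : measurableType d)
  (T0 : measurableType d0) (P : probability T R) (S : T -> T0) (f : R -> T0 -> R).
Hypotheses (mS : measurable_fun setT S) (mf : forall t, measurable_fun setT (f t)).

Let mpre (A : set T0) : measurable A -> measurable (S @^-1` A).
Proof. by move=> mA; rewrite -[X in measurable X]setTI; exact: mS. Qed.

(** The interval [- lam, lam] is covered by [K.+1] cells of width [del]. For each time in turn the
    most probable cell is kept, which costs a factor of at most [K.+1]. *)
Lemma pigeonhole (lam del : R) K (s : seq R) (G : set T0) : 0 < del ->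
  2 * lam <= K.+1%:R * del -> measurable G ->
  (forall x t, G x -> t \in s -> `|f t x| <= lam) ->
  exists G', [/\ measurable G', G' `<=` G,
    pr P (S @^-1` G) <= K.+1%:R ^+ size s * pr P (S @^-1` G') &
    forall x y t, G' x -> G' y -> t \in s -> `|f t x - f t y| <= del].
Proof.
move=> del0 hK mG; elim: s => [|t s IH] hG.
  by exists G; split => //; rewrite expr0 mul1r.
have [G1 [mG1 G1G pG1 hG1]] := IH (fun x u Gx us => hG x u Gx (mem_behead (s := t :: s) us)).
pose C (j : nat) : set T0 := G1 `&`
  [set x | `|f t x - (- lam + (j%:R + 2^-1) * del)| <= del / 2].
have mC j : measurable (C j).
  apply: measurableI => //.
  apply: (@measurable_norm_le _ _ _ (fun x => f t x - (- lam + (j%:R + 2^-1) * del))).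
  exact: measurable_funB.
have cov : S @^-1` G1 `<=` \bigcup_(j in `I_K.+1) (S @^-1` C j).
  move=> w Gw; pose v := (f t (S w) + lam) / del.
  have := hG _ t (G1G _ Gw) (mem_head _ _); rewrite ler_norml => /andP[l1 l2].
  have v0 : 0 <= v by rewrite divr_ge0 ?(ltW del0) // -lerBlDr sub0r.
  have vK : v <= K.+1%:R by rewrite ler_pdivrMr //; lra.
  have fE : f t (S w) = - lam + v * del by rewrite /v divfK ?gt_eqF //; ring.
  have [j jK /andP[jv vj]] : exists2 j, (j < K.+1)%N & j%:R <= v <= j.+1%:R.
    have [vK'|vK'] := ltP v K.+1%:R.
      exists (Num.truncn v); last first.
        by apply/andP; split; [rewrite truncn_le|exact/ltW/truncnS_gt].
      by rewrite -(ltr_nat R); apply: le_lt_trans vK'; rewrite truncn_le.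
    by exists K => //; rewrite vK (le_trans _ vK') // ler_nat.
  exists j => //; split => //=; rewrite fE.
  have -> : - lam + v * del - (- lam + (j%:R + 2^-1) * del) = (v - j%:R - 2^-1) * del by ring.
  rewrite normrM (gtr0_norm del0) mulrC ler_wpM2l ?(ltW del0) //.
  by rewrite -natr1 in vj; rewrite ler_norml; lra.
have h1 : pr P (S @^-1` G1) <= \sum_(j < K.+1) pr P (S @^-1` C j).
  apply: le_trans (@pr_bigcup _ _ _ P K.+1 (fun j => S @^-1` C j) (fun j => mpre (mC j))).
  apply: pr_le => //; first exact: mpre.
  by apply: bigcup_measurable => j _; exact: mpre.
have [j hj] : exists j, pr P (S @^-1` G1) <= K.+1%:R * pr P (S @^-1` C j).
  have [j _ jmax] := @Order.TotalTheory.arg_maxP _ R 'I_K.+1 ord0 xpredT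
    (fun j : 'I_K.+1 => pr P (S @^-1` C j)) isT.
  exists j; apply: (le_trans h1); rewrite mulr_natl -[X in _ *+ X]card_ord -sumr_const.
  by apply: ler_sum => i _; exact: jmax.
exists (C j); split => //.
- by move=> x [/G1G].
- apply: (le_trans pG1); rewrite /= exprSr -mulrA ler_wpM2l // exprn_ge0 //.
- move=> x y u [Gx Cx] [Gy Cy]; rewrite in_cons => /orP[/eqP ->|us]; last exact: hG1.
  move: Cx Cy => /=; rewrite !ler_norml; move: (_ * del) => z.
  by move=> /andP[? ?] /andP[? ?]; apply/andP; split; lra.
Qed.

End pigeonhole.

Lemma measurable_tuple_nth (R : realType) n i :
  measurable_fun setT (fun x : n.-tuple R => x`_i).
Proof.
have [ni|ni] := ltnP i n.
  rewrite (_ : (fun x => _) = fun x : n.-tuple R => tnth x (Ordinal ni)).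
    exact: measurable_tnth.
  by apply/funext => x; rewrite (tnth_nth 0).
rewrite (_ : (fun x => _) = cst 0) //.
by apply/funext => x; rewrite nth_default // size_tuple.
Qed.

Section tuple_grid.
Context (R : realType).

Definition tgrid n (s : seq R) (a : R) : set (n.+1.-tuple R) :=
  [set x | forall t, t \in s -> `|tpev x (expR (- (t / n.+1%:R)))| <= a].

Lemma measurable_tgrid n s a : measurable (@tgrid n s a).
Proof.
apply: (@measurable_all_norm_le _ _ _ s
  (fun t (x : n.+1.-tuple R) => tpev x (expR (- (t / n.+1%:R))))) => t.
exact: measurable_tpev.
Qed.

Lemma sum_gridE d (T : measurableType d) (P : probability T R) (B : R -> {RV P >-> R})
    n s a : sum_grid B n s a = sample (bm_increment B n.+1) n.+1 @^-1` (@tgrid n s a).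
Proof.
by rewrite predeqE => w; split => h t /h; rewrite tpev_sample.
Qed.

End tuple_grid.

Arguments tgrid {R} n s a.
Arguments measurable_tgrid {R} n s a.

(** * Lower bound and strict monotonicity of the small ball function *)

Section small_ball_lower.
Context (R : realType) (d : measure_display) (T : measurableType d)
  (P : probability T R) (B X : R -> {RV P >-> R}).
Hypotheses (hB : standard_brownian_motion B) (hX : continuous_laplace_process B X).
Notation pr := (pr P).
Notation F := (sup_ball_prob X).

Section halves.
Variable n : nat.
Let Z := bm_increment B (n.*2.+1).+1.
Let p k : {RV P >-> R} := Z k.*2.
Let q k : {RV P >-> R} := [the {mfun T >-> R} of (-1) \o* Z k.*2.+1].

Let hZ := gauss_seq_bm_increment hB n.*2.+1.
Let sd : R := Num.sqrt (n.*2.+2)%:R^-1.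
Let sd0 : 0 < sd.
Proof. by rewrite sqrtr_gt0 invr_gt0 ltr0n. Qed.

(** Each increment is a difference of two independent half increments with the same symmetric law.
    Whenever the vectors [p] and [q] fall in the same small cell, the polynomial of the increments
    is small. *)
Lemma bm_increment_halves k w : bm_increment B n.+1 k w = p k w - q k w.
Proof.
rewrite /p /q /Z /= mulrN1 opprK.
have e j : j.*2%:R / (n.*2.+2)%:R = j%:R / n.+1%:R :> R.
  rewrite -doubleS -!mul2n !natrM -mulf_div divff ?mul1r //.
by rewrite -(doubleS k) !e; ring.
Qed.

Lemma gauss_seq_even : gauss_seq p sd.
Proof.
split; last by move=> k; exact: hZ.2.
by apply: (@indep_reindex _ _ _ _ Z double half doubleK hZ.1).
Qed.

Lemma gauss_seq_odd : gauss_seq q sd.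
Proof.
have i1 : mutually_independent P (fun k => Z k.*2.+1 : T -> R).
  apply: (@indep_reindex _ _ _ _ Z (fun k => k.*2.+1) half _ hZ.1).
  by move=> k; rewrite /= uphalf_double.
split.
  apply: (@indep_map _ _ _ P (fun k => Z k.*2.+1) q (fun _ x => - x) i1).
    by move=> _; exact: oppr_measurable.
  by move=> i w; rewrite /q /= mulrN1.
move=> k A mA.
have mA' : measurable [set x | A (- x)].
  rewrite -[X in measurable X]setTI; have : measurable_fun setT (fun x : R => - x) by exact: oppr_measurable.
  by apply.
rewrite (_ : q k @^-1` A = Z k.*2.+1 @^-1` [set x | A (- x)]).
  by rewrite hZ.2 //; exact: normal_probN.
by apply/funext => w; rewrite /preimage /q /= mulrN1.
Qed.

Lemma pr_halves (A : set (n.+1.-tuple R)) : measurable A ->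
  pr (sample p n.+1 @^-1` A `&` sample q n.+1 @^-1` A) =
  pr (sample p n.+1 @^-1` A) ^+ 2.
Proof.
move=> mA.
have e : pr (sample q n.+1 @^-1` A) = pr (sample p n.+1 @^-1` A).
  apply: same_law => //; [exact: gauss_seq_odd.1|exact: gauss_seq_even.1|].
  by move=> k C mC; rewrite gauss_seq_odd.2 // gauss_seq_even.2.
rewrite expr2 -{2}e /pr -fineM ?fin_num_measure //; try exact: measurable_sample_preim.
congr fine.
have mp : measurable (sample p n.+1 @^-1` A : set (sub_space Z (fun i => ~~ odd i))).
  rewrite -[X in measurable X]setTI.
  have : measurable_fun setT (sample p n.+1 : sub_space Z (fun i => ~~ odd i) -> _).
    apply/measurable_fun_tnthP => i.
    rewrite (_ : _ \o _ = p i); last by apply/funext => w /=; rewrite tnth_mktuple.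
    by apply: sub_space_RV; rewrite /= odd_double.
  by apply.
have mq : measurable (sample q n.+1 @^-1` A : set (sub_space Z odd)).
  rewrite -[X in measurable X]setTI.
  have : measurable_fun setT (sample q n.+1 : sub_space Z odd -> _).
    apply/measurable_fun_tnthP => i.
    rewrite (_ : _ \o _ = fun w => Z i.*2.+1 w * -1).
      apply: measurable_funM => //.
      by apply: sub_space_RV; rewrite /= odd_double.
    by apply/funext => w /=; rewrite tnth_mktuple.
  by apply.
by apply: (indep_sub_space hZ.1 _ mp mq).
Qed.

(** An entropy bound. With probability at least 1/2 the vector [p] is in [G], where grid values are
    at most 2; [pigeonhole] extracts a part of [G] on which the values at the J + 2 nodes vary by at
    most del / 4. That both [p] and its independent copy [q] lie there suffices, whence the
    square. *)
Lemma pr_sup_ball_lower (h del : R) J K : 0 < del <= 1 -> h = del / 64 ->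
  8 / del ^+ 2 <= h * (1 + h) ^+ J -> 16 / del ^+ 2 <= n.+1%:R -> 16 / del <= K.+1%:R ->
  ((2 * K.+1%:R ^+ J.+2)^-1) ^+ 2 <= pr (sup_ball (bm_increment B n.+1) n.+1 del).
Proof.
move=> /andP[d0 d1] hE hJ hn hK.
have h0 : 0 < h by rewrite hE divr_gt0.
set tau := h * _ in hJ.
have d2 : 0 < del ^+ 2 by rewrite exprn_gt0.
have tau0 : 0 < tau by rewrite mulr_gt0 // exprn_gt0 // addr_gt0.
pose y : R := expR (- (tau / n.+1%:R)).
pose s := grid h J.
have y01 : 0 <= y <= 1.
  by rewrite expR_ge0 /= -[leRHS]expR0 ler_expR oppr_le0 divr_ge0 // ltW.
pose G : set (n.+1.-tuple R) := [set x : n.+1.-tuple R |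
  forall k, (k <= n.+1)%N -> `|\sum_(i < k) 1 ^+ i * x`_i| <= 2 /\
    `|\sum_(i < k) y ^+ i * x`_i| <= del / 2].
have mG : measurable G.
  have msum (z : R) k (a : R) : measurable
      [set x : n.+1.-tuple R | `|\sum_(i < k) z ^+ i * x`_i| <= a].
    apply: measurable_norm_le; apply: measurable_sum => i; apply: measurable_funM => //.
    exact: measurable_tuple_nth.
  rewrite (_ : G = \bigcap_(k in `I_n.+2) ([set x : n.+1.-tuple R |
      `|\sum_(i < k) 1 ^+ i * x`_i| <= 2] `&` [set x : n.+1.-tuple R |
      `|\sum_(i < k) y ^+ i * x`_i| <= del / 2])); last first.
    by rewrite predeqE => x; split => hx k hk; exact: hx.
  by apply: bigcap_measurable => [|k _]; [exists 0%N|exact: measurableI].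
have sampleE (r : nat -> {RV P >-> R}) (z : R) k w : (k <= n.+1)%N ->
    \sum_(i < k) z ^+ i * (sample r n.+1 w)`_i = \sum_(i < k) z ^+ i * r i w.
  move=> kn; apply: eq_bigr => i _; congr (_ * _).
  by rewrite (nth_mktuple _ _ (widen_ord kn i)).
have sdE : sd ^+ 2 = (2 * n.+1%:R)^-1.
  by rewrite /sd sqr_sqrtr ?invr_ge0 // -doubleS -mul2n natrM.
have n0 : 0 < n.+1%:R :> R by rewrite ltr0n.
have stdp := gauss_std_seq sd0 gauss_seq_even; rewrite sdE in stdp.
have pG : 2^-1 <= pr (sample p n.+1 @^-1` G).
  have e1 : pr (partial_exceed p n.+1 1 2) <= 1 / 8.
    apply: (le_trans (pr_partial_exceed1 stdp n.+1 (ltr0Sn R 1))).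
    move: n0; move: (n.+1%:R : R) => z z0.
    by rewrite (_ : _ / _ = 1 / 8) //; field; rewrite gt_eqF.
  have e2 : pr (partial_exceed p n.+1 y (del / 2)) <= 1 / 4.
    apply: (le_trans (pr_partial_exceed stdp _ tau0 _)) => //; first by rewrite divr_gt0.
    rewrite ler_pdivrMr ?exprn_gt0 ?divr_gt0 //.
    move: n0 hn hJ; move: (n.+1%:R : R) => z z0.
    rewrite ler_pdivrMr // => hz; rewrite ler_pdivrMr // => ht.
    have -> : (1 + z / (2 * tau)) * (2 * z)^-1 = 1 / 2 / z + 1 / 4 / tau.
      by field; rewrite !gt_eqF.
    rewrite expr_div_n.
    have : 1 / 2 / z <= del ^+ 2 / 32 by rewrite ler_pdivrMr //; lra.
    have : 1 / 4 / tau <= del ^+ 2 / 32 by rewrite ler_pdivrMr //; lra.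
    lra.
  have mE1 := measurable_partial_exceed p n.+1 1 2.
  have mE2 := measurable_partial_exceed p n.+1 y (del / 2).
  have mGp : measurable (sample p n.+1 @^-1` G) by exact: measurable_sample_preim.
  have : pr setT <= pr (sample p n.+1 @^-1` G `|` partial_exceed p n.+1 1 2) +
      pr (partial_exceed p n.+1 y (del / 2)).
    apply: pr_subU => //; first exact: measurableU.
    move=> w _; have [?|nE1] := pselect (partial_exceed p n.+1 1 2 w); first by left; right.
    have [?|nE2] := pselect (partial_exceed p n.+1 y (del / 2) w); first by right.
    left; left => k kn; rewrite !sampleE //; split; rewrite leNgt; apply/negP => hh.
      by apply: nE1; exists k => //; exact: ltW.
    by apply: nE2; exists k => //; exact: ltW.
  have := pr_setU P mGp mE1; rewrite prT; lra.
have tpevE (x : n.+1.-tuple R) z : tpev x z = pev (fun i => x`_i) n.+1 z.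
  by apply: eq_bigr => i _; rewrite (tnth_nth 0).
have gridG (x : n.+1.-tuple R) t : G x -> t \in s ->
    `|tpev x (expR (- (t / n.+1%:R)))| <= 2.
  move=> Gx ts; rewrite tpevE; apply: pev_bound.
    move=> k /Gx[+ _]; by under eq_bigr do rewrite expr1n mul1r.
  rewrite expR_ge0 /= -[leRHS]expR0 ler_expR oppr_le0 divr_ge0 //.
  exact: grid_ge0 ts.
have d40 : 0 < del / 4 by rewrite divr_gt0.
have hK' : 2 * 2 <= K.+1%:R * (del / 4).
  by move: hK; rewrite ler_pdivrMr //; lra.
have [G' [mG' G'G pG' hG']] := @pigeonhole R d _ T _ P (sample p n.+1)
  (fun t (x : n.+1.-tuple R) => tpev x (expR (- (t / n.+1%:R))))
  (@measurable_sample _ _ _ _ p n.+1) (fun t => @measurable_tpev R n.+1 _)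
  2 (del / 4) K s G d40 hK' mG gridG.
have K0 : 0 < K.+1%:R ^+ J.+2 :> R by rewrite exprn_gt0 // ltr0n.
have pG'' : (2 * K.+1%:R ^+ J.+2)^-1 <= pr (sample p n.+1 @^-1` G').
  rewrite invfM ler_pdivrMr //; apply: (le_trans pG); apply: (le_trans pG').
  by rewrite size_grid mulrC.
apply: (@le_trans _ _ (pr (sample p n.+1 @^-1` G') ^+ 2)).
  have K1 : 0 < 2 * K.+1%:R ^+ J.+2 :> R by exact: mulr_gt0.
  by apply: lerXn2r => //; rewrite nnegrE; [rewrite invr_ge0 ltW|exact: pr_ge0].
rewrite -pr_halves //; apply: pr_le.
- by apply: measurableI; exact: measurable_sample_preim.
- exact: measurable_sup_ball.
move=> w [/= Gp Gq].
have bd (z : R) k c : (k <= n.+1)%N ->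
    `|\sum_(i < k) z ^+ i * (sample p n.+1 w)`_i| <= c ->
    `|\sum_(i < k) z ^+ i * (sample q n.+1 w)`_i| <= c ->
    `|\sum_(i < k) z ^+ i * bm_increment B n.+1 i w| <= 2 * c.
  move=> kn; rewrite !sampleE // => h1 h2.
  under eq_bigr do rewrite bm_increment_halves mulrBr.
  rewrite sumrB; apply: (le_trans (ler_normB _ _)); lra.
(* The partial sums of the difference are at most 2 + 2 = 4, and h = del / 64 gives del / 4 + 4 * h
   * 4 = del / 2. *)
apply: (@grid_cover R _ n.+1 h J 4 del (del / 4)) => //.
- move=> k kn; have := bd 1 k 2 kn (G'G _ Gp k kn).1 (G'G _ Gq k kn).1.
  by under eq_bigr do rewrite expr1n mul1r; move=> /le_trans; apply; lra.
- move=> k kn; have := bd y k (del / 2) kn (G'G _ Gp k kn).2 (G'G _ Gq k kn).2.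
  by move=> /le_trans; apply; lra.
- move=> t ts; have := hG' _ _ t Gp Gq ts; rewrite !tpev_sample.
  rewrite (_ : pev _ _ _ - _ = pev (fun i => bm_increment B n.+1 i w) n.+1
    (expR (- (t / n.+1%:R)))) //.
  by rewrite /pev -sumrB; apply: eq_bigr => i _; rewrite -mulrBl -bm_increment_halves.
- by rewrite hE; lra.
Qed.

End halves.

(** With [del] of order u^-8 the number of nodes is O(u^8 ln u), hence O(u^9), and the logarithm of
    the number of cells is O(u). The exponent is thus O(u^10), and the remaining factor u^2 absorbs
    the constant [C]. *)
Lemma sup_ball_prob_lower : exists u0 : R, 1 <= u0 /\
  forall u, u0 <= u -> expR (- u ^+ 12) <= F (u ^- 8).
Proof.
pose L1 : R := ln 34 + 8; pose L2 : R := ln (8 ^+ 4) + 24.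
pose C := 2 * (1 + (256 * L2 + 3) * L1).
exists (Num.max 1 C); split; first by rewrite le_max lexx.
move=> u; rewrite ge_max => /andP[u1 Cu].
have u0 : 0 < u := lt_le_trans ltr01 u1.
have un k : 1 <= u ^+ k by exact: exprn_ege1.
have u80 : 0 < u ^+ 8 by rewrite exprn_gt0.
pose del : R := u ^- 8 / 2.
have d0 : 0 < del by rewrite divr_gt0 // invr_gt0.
have dE : del = (2 * u ^+ 8)^-1 by rewrite /del; field; rewrite gt_eqF.
have d1 : del <= 1.
  by rewrite dE invf_le1 ?mulr_gt0 //; have := un 8; lra.
have dinv : del^-1 = 2 * u ^+ 8 by rewrite dE invrK.
pose h := del / 64; pose tau := 8 / del ^+ 2.
have h0 : 0 < h by rewrite divr_gt0.
have h1 : h <= 1 by rewrite ler_pdivrMr //; lra.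
have d20 : 0 < del ^+ 2 by rewrite exprn_gt0.
have ht : h <= tau.
  apply: (le_trans h1); rewrite ler_pdivlMr // mul1r.
  have : del ^+ 2 <= 1 by rewrite exprn_ile1 // ltW.
  lra.
have [|J [hJ _ Jub]] := @grid_reach R h tau _ ht; first by rewrite h0.
pose K := Num.truncn (16 / del).
have hK : 16 / del <= K.+1%:R by rewrite ltW // truncnS_gt.
have K17 : K.+1%:R <= 34 * u ^+ 8.
  rewrite -natr1; have : K%:R <= 16 / del by rewrite truncn_le // divr_ge0 // ltW.
  by rewrite dinv; have := un 8; lra.
apply: (@le_trans _ _ (((2 * K.+1%:R ^+ J.+2)^-1) ^+ 2)).
  have lnu : ln u <= u by exact: ltW (ln_sublinear u0).
  have K0 : 0 < K.+1%:R :> R by rewrite ltr0n.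
  have lnK1 : ln (K.+1%:R : R) <= L1 * u.
    apply: (@le_trans _ _ (ln (34 * u ^+ 8))); first by rewrite ler_ln ?posrE ?mulr_gt0.
    rewrite lnM ?posrE // lnXn // -(mulr_natl (ln u)) /L1.
    have : 0 <= ln (34 : R) by apply: ln_ge0; rewrite ler1n.
    nra.
  have lnt : ln (tau / h) <= L2 * u.
    have -> : tau / h = 8 ^+ 4 * u ^+ 24.
      have -> : tau / h = 512 * del^-1 ^+ 3 by rewrite /tau /h; field; rewrite gt_eqF.
      by rewrite dinv; ring.
    rewrite lnM ?posrE ?exprn_gt0 // (lnXn _ u0) -(mulr_natl (ln u)) /L2.
    have : 0 <= ln (8 ^+ 4 : R) by apply: ln_ge0; rewrite exprn_ege1 // ler1n.
    nra.
  have J2 : J.+2%:R <= (256 * L2 + 3) * u ^+ 9.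
    have hi : 2 / h = 256 * u ^+ 8.
      have -> : 2 / h = 128 * del^-1 by rewrite /h; field; rewrite gt_eqF.
      by rewrite dinv; ring.
    rewrite -(natr1 J.+1) -(natr1 J).
    rewrite hi in Jub.
    have : 256 * u ^+ 8 * ln (tau / h) <= 256 * u ^+ 8 * (L2 * u).
      by exact: (ler_wpM2l (mulr_ge0 (ler0n _ _) (ltW u80)) lnt).
    have -> : 256 * u ^+ 8 * (L2 * u) = 256 * L2 * u ^+ 9 by ring.
    have := un 9; move: Jub; move: (ln _) (u ^+ 9) (u ^+ 8) => l u9 u8; lra.
  have L20 : 0 <= 256 * L2 + 3.
    have : 0 <= ln (8 ^+ 4 : R) by apply: ln_ge0; rewrite exprn_ege1 // ler1n.
    rewrite /L2; lra.
  have L10 : 0 <= L1.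
    have : 0 <= ln (34 : R) by apply: ln_ge0; rewrite ler1n.
    rewrite /L1; lra.
  have q0 : 0 < 2 * K.+1%:R ^+ J.+2 :> R by rewrite mulr_gt0 // exprn_gt0.
  rewrite -[leRHS]lnK ?posrE ?exprn_gt0 ?invr_gt0 // ler_expR.
  rewrite lnXn ?invr_gt0 // lnV ?posrE // lnM ?posrE ?exprn_gt0 // lnXn // .
  rewrite -(mulr_natl (- _)) -(mulr_natl (ln _)) mulrN lerN2.
  have ln2 : ln (2 : R) <= 1.
    by rewrite -ler_expR lnK ?posrE //; have := expR_ge1Dx (1 : R); lra.
  have JK : J.+2%:R * ln (K.+1%:R : R) <= (256 * L2 + 3) * L1 * u ^+ 10.
    have -> : (256 * L2 + 3) * L1 * u ^+ 10 = (256 * L2 + 3) * u ^+ 9 * (L1 * u) by ring.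
    apply: ler_pM => //; apply: ln_ge0; by rewrite ler1n.
  have u12 : u ^+ 12 = u ^+ 10 * u ^+ 2 by rewrite -exprD.
  have u10 := un 10.
  have u2 : C <= u ^+ 2.
    by apply: (le_trans Cu); rewrite expr2 ler_peMl // ltW.
  have : u ^+ 10 * C <= u ^+ 10 * u ^+ 2 by rewrite ler_wpM2l // (le_trans ler01).
  rewrite u12 /C; move: JK; move: (J.+2%:R * _) ((256 * L2 + 3) * L1) (u ^+ 10 * u ^+ 2) => a1 a2 a3.
  by move: u10; move: (u ^+ 10) => a4; lra.
have db : del < u ^- 8 by rewrite /del ltr_pdivrMr // mulr_natr mulr2n ltrDl invr_gt0.
apply: (sum_grid_sup_ball_prob hB hX db) => s s0 N.
pose n := maxn N (Num.truncn (16 / del ^+ 2)).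
exists n; first exact: leq_maxl.
have hn : 16 / del ^+ 2 <= n.+1%:R.
  apply: ltW; apply: (lt_le_trans (truncnS_gt _)).
  by rewrite ler_nat ltnS leq_maxr.
apply: (le_trans (@pr_sup_ball_lower n h del J K _ erefl hJ hn hK)); first by rewrite d0.
apply: pr_le; [exact: measurable_sup_ball|exact: measurable_sum_grid|].
exact: sup_ball_sum_grid.
Qed.

Lemma sup_ball_prob_gt0 a : 0 < a -> 0 < F a.
Proof.
move=> a0; have [u0 [u01 hu]] := sup_ball_prob_lower.
pose u := Num.max u0 a^-1.
have uu : u0 <= u by rewrite le_max lexx.
have u1 : 1 <= u := le_trans u01 uu.
apply: (lt_le_trans (expR_gt0 (- u ^+ 12))); apply: (le_trans (hu u uu)).
apply: (sup_ball_prob_le hX); rewrite -[leRHS]invrK lef_pV2 ?posrE ?invr_gt0 ?exprn_gt0 //.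
- apply: (@le_trans _ _ u); first by rewrite le_max lexx orbT.
  by rewrite -{1}(expr1 u); apply: ler_weXn2l.
- exact: lt_le_trans u1.
Qed.

(* Shifting by [kap] times the average of the Laplace kernel moves the process by at
   most [kap], and moves it out of any ball after finitely many steps. *)
Lemma sup_ball_prob_lt a b : 0 < a -> a < b -> F a < F b.
Proof.
move=> a0 ab; have Fa := sup_ball_prob_gt0 a0.
(* Two thirds of the gap serve the passage to increments and the shift; the last third serves the
   return to the process. *)
pose kap := (b - a) / 3.
have kap0 : 0 < kap by rewrite divr_gt0 // subr_gt0.
pose m := Num.truncn (2 * (a + kap) / kap).
have m0 : 0 < m.+1%:R :> R by rewrite ltr0n.
have mk : 2 * (a + kap) < m.+1%:R * kap by rewrite -ltr_pdivrMr // truncnS_gt.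
pose Q := m.+1%:R ^+ 2 * kap ^+ 2.
have Q0 : 0 < Q by rewrite mulr_gt0 // exprn_gt0.
(* The tail must be at most F(a) / (4 (m + 1)) = 1 / z. As r >= 1 and r >= 8 Q z, the exponent r^2 /
   (8 Q) is at least z, and exp (- z) <= 1 / z. *)
pose z := 4 * m.+1%:R / F a.
have z0 : 0 < z by rewrite divr_gt0 // mulr_gt0.
pose r := 1 + Q + 8 * Q * z.
have Qz0 : 0 < 8 * Q * z by apply: mulr_gt0 => //; exact: mulr_gt0.
have Qr : Q <= r by rewrite /r; lra.
have r1 : 1 <= r by rewrite /r; lra.
have tail : expR (- (r ^+ 2 / (8 * Q))) <= F a / m.+1%:R / 4.
  have -> : F a / m.+1%:R / 4 = z^-1.
    by rewrite /z; move: m0; move: (m.+1%:R : R) => y yy; field; rewrite !gt_eqF.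
  apply: le_trans (expR_inv_le _); last by rewrite invr_gt0.
  have Q80 : 0 < 8 * Q by exact: mulr_gt0.
  rewrite invrK ler_expR lerN2 ler_pdivlMr //.
  apply: (@le_trans _ _ r); first by rewrite /r mulrC; lra.
  by rewrite expr2 ler_peMl // (le_trans ler01).
(* One shift yields about four times this amount: one part is lost to the tail, one to the
   discretisation, and at most one to its effect inside the gain. *)
pose gain := expR (- r) * (F a / m.+1%:R / 4).
have gain0 : 0 < gain by rewrite mulr_gt0 ?expR_gt0 // !divr_gt0.
suff : F a + gain <= F b by lra.
have ab2 : a + 2 * kap < b by rewrite /kap; lra.
apply: (sum_grid_sup_ball_prob hB hX ab2) => s s0 N.
(* The time 0 is adjoined because there the shift has its full size [kap], which guarantees the exit
   from the ball. *)
have s0' t : t \in 0 :: s -> 0 <= t.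
  by rewrite in_cons => /orP[/eqP ->|/s0].
have ak : a < a + kap by rewrite ltrDl.
have [N' hN'] := sup_ball_prob_sum_grid hB hX ak s0' gain0.
pose n := maxn N N'; exists n; first exact: leq_maxl.
have h1 := hN' n (leq_maxr _ _).
have n0 : 0 < n.+1%:R :> R by rewrite ltr0n.
pose c (k : nat) := kap / n.+1%:R.
have cost : shift_cost (Num.sqrt n.+1%:R^-1) c n.+1 = kap ^+ 2.
  rewrite bm_shift_cost /c sumr_const card_ord -(mulr_natl (_ ^+ 2)).
  by move: n0; move: (n.+1%:R : R) => y y0; field; rewrite gt_eqF.
have pc t : 0 <= t -> 0 <= pev c n.+1 (expR (- (t / n.+1%:R))) <= kap.
  move=> t0; set y := expR _.
  have y0 : 0 <= y by exact: expR_ge0.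
  have y1 : y <= 1 by rewrite -[leRHS]expR0 ler_expR oppr_le0 divr_ge0.
  apply/andP; split.
    by apply: sumr_ge0 => k _; rewrite mulr_ge0 ?exprn_ge0 // divr_ge0 // ltW.
  have -> : kap = \sum_(k < n.+1) c k.
    by rewrite sumr_const card_ord -(mulr_natr (kap / _)) divfK // gt_eqF.
  apply: ler_sum => k _; apply: ler_piMr; first by rewrite divr_ge0 // ltW.
  exact: exprn_ile1.
have pc0 : pev c n.+1 (expR (- (0 / n.+1%:R))) = kap.
  rewrite mul0r oppr0 expR0 /pev; under eq_bigr do rewrite expr1n mulr1.
  by rewrite sumr_const card_ord -(mulr_natr (kap / _)) divfK // gt_eqF.
have pevZ (a' : R) y : pev (fun k => a' * c k) n.+1 y = a' * pev c n.+1 y.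
  by rewrite /pev mulr_sumr; apply: eq_bigr => k _; rewrite mulrA.
have pevN y : pev (fun k => - c k) n.+1 y = - pev c n.+1 y.
  by rewrite /pev -sumrN; apply: eq_bigr => k _; rewrite mulNr.
have := @shift_gain R d T P (bm_increment B n.+1) (Num.sqrt n.+1%:R^-1)
  (bm_increment_sd_gt0 R n) (gauss_seq_bm_increment hB n) c n.+1 (tgrid n (0 :: s) (a + kap))
  m.+1 r (measurable_tgrid n _ _) isT.
rewrite cost -!sum_gridE => /(_ (exprn_gt0 2 kap0) Qr) h2.
have {}h2 := h2 _.
have h3 : pr (sample (bm_increment B n.+1) n.+1 @^-1` (tgrid n (0 :: s) (a + kap) `|`
    [set x | tgrid n (0 :: s) (a + kap) (tshift (fun k => - c k) x)])) <=
    pr (sum_grid B n s (a + 2 * kap)).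
  apply: pr_le.
  - apply: measurable_sample_preim; apply: measurableU; first exact: measurable_tgrid.
    by apply: measurable_tshift_preim; exact: measurable_tgrid.
  - exact: measurable_sum_grid.
  rewrite sum_gridE => w [hx|hx] t ts /=.
    by apply: (le_trans (hx t _)); rewrite ?in_cons ?ts ?orbT // lerD2l; lra.
  have := hx t; rewrite in_cons ts orbT => /(_ isT).
  rewrite tpev_tshift pevN; have /andP[p0 p1] := pc t (s0 t ts).
  by rewrite !ler_norml => /andP[? ?]; apply/andP; split; lra.
apply: le_trans h3; apply: le_trans (h2 _); last first.
  move=> x hx; exists m => //; rewrite /tgrid /= => hx'.
  have := hx' 0 (mem_head _ _); rewrite tpev_tshift pevZ pc0.
  have := hx 0 (mem_head _ _); rewrite !ler_norml => /andP[? ?] /andP[? ?].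
  by move: mk; lra.
move: h1; set p := pr _ => h1.
have er1 : expR (- r) <= 1 by rewrite -[leRHS]expR0 ler_expR oppr_le0 (le_trans ler01).
have er0 := expR_gt0 (- r).
have m1 : m.+1%:R^-1 <= 1 :> R by rewrite invf_le1 // ler1n.
have mi : 0 < m.+1%:R^-1 :> R by rewrite invr_gt0.
have q1 : expR (- r) * ((F a - gain) / m.+1%:R - F a / m.+1%:R / 4) <=
    expR (- r) * (p / m.+1%:R - expR (- (r ^+ 2 / (8 * Q)))).
  rewrite ler_wpM2l ?(ltW er0) //; apply: lerB; last exact: tail.
  by rewrite ler_wpM2r ?(ltW mi) // lerBlDr.
have q2 : expR (- r) * (gain / m.+1%:R) <= gain.
  by rewrite mulrCA ler_piMr ?(ltW gain0) // mulr_ile1 // ltW.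
have q3 : expR (- r) * ((F a - gain) / m.+1%:R - F a / m.+1%:R / 4) =
    3 * gain - expR (- r) * (gain / m.+1%:R).
  suff h g : g = expR (- r) * (F a / m.+1%:R / 4) ->
      expR (- r) * ((F a - g) / m.+1%:R - F a / m.+1%:R / 4) =
      3 * g - expR (- r) * (g / m.+1%:R) by exact: h.
  by move=> ->; move: (m.+1%:R^-1) => u; field.
rewrite q3 in q1; apply: le_trans (lerD (lexx p) q1).
by set u := expR (- r) * (gain / _) in q2 *; lra.
Qed.

End small_ball_lower.

(** * Polynomials with prescribed bumps and small coefficients *)

Section bump_polynomials.
Context (R : realType).
Implicit Types (p : {poly R}) (lo hi n M : nat) (x : R).

Definition sqnorm n p : R := \sum_(k < n) p`_k ^+ 2.

Definition window lo hi : {poly R} := (hi - lo)%:R^-1 *: \sum_(lo <= j < hi) 'X^j.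

(* [1 - (1 - e)^M] for the window polynomial [e]: in the variable [x = exp (- t)] this is
   close to 1 when [M * x^j] is large on the window and close to 0 when it is small. *)
Definition bump M lo hi : {poly R} := 1 - (1 - window lo hi) ^+ M.

Lemma sqnormD n p r : sqnorm n (p + r) <= 2 * (sqnorm n p + sqnorm n r).
Proof.
rewrite /sqnorm -big_split /= mulr_sumr; apply: ler_sum => k _.
rewrite coefD; have := sqr_ge0 (p`_k - r`_k); lra.
Qed.

Lemma sqnormN n p : sqnorm n (- p) = sqnorm n p.
Proof. by apply: eq_bigr => k _; rewrite coefN sqrrN. Qed.

Lemma sqr_sum_le I (s : seq I) (f : I -> R) :
  (\sum_(i <- s) f i) ^+ 2 <= (size s)%:R * \sum_(i <- s) f i ^+ 2.
Proof.
elim: s => [|i s IH]; first by rewrite !big_nil expr0n mul0r.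
case: s IH => [|j s] IH; first by rewrite !big_seq1 mul1r.
move: (j :: s) (isT : (0 < size (j :: s))%N) IH => {}s s0.
rewrite !big_cons /= -(natr1 (size s)); set S := \sum_(j <- s) f j.
set S2 := \sum_(j <- s) f j ^+ 2 => IH.
have z0 : 0 < (size s)%:R :> R by rewrite ltr0n.
move: z0 IH; move: ((size s)%:R : R) => z z0 IH.
have h : 2 * f i * S <= z * f i ^+ 2 + S ^+ 2 / z.
  rewrite -(ler_pM2r z0) [leRHS]mulrDl divfK ?gt_eqF //.
  have := sqr_ge0 (z * f i - S); nra.
have h2 : S ^+ 2 / z <= S2 by rewrite ler_pdivrMr // mulrC.
move: h h2; move: (S ^+ 2 / z) => y; nra.
Qed.

Lemma sqnormXn n j p : sqnorm n ('X^j * p) <= sqnorm n p.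
Proof.
rewrite /sqnorm; have [nj|jn] := leqP n j.
  rewrite big1; first by apply: sumr_ge0 => k _; exact: sqr_ge0.
  by move=> k _; rewrite coefXnM (leq_trans (ltn_ord k) nj) expr0n.
rewrite -!(big_mkord xpredT (fun k => (_ : {poly R})`_k ^+ 2)).
rewrite (big_cat_nat (leq0n j) (ltnW jn)) /= big_nat_cond big1 ?add0r; last first.
  by move=> k /andP[/andP[_ kj] _]; rewrite coefXnM kj expr0n.
rewrite -{1}[j]add0n big_addn.
rewrite (@big_cat_nat _ _ _ (n - j) 0 n) ?leq_subr //= -[leLHS]addr0 lerD //.
  by apply: ler_sum => k _; rewrite coefXnM ltnNge leq_addl addnK.
by apply: sumr_ge0 => k _; exact: sqr_ge0.
Qed.

(** A window is an average of monomials, and multiplication by a monomial does not increase the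
    truncated norm; convexity of the square concludes. The norm matters because it is the cost of a
    shift. *)
Lemma sqnorm_window n lo hi p : (lo < hi)%N ->
  sqnorm n (window lo hi * p) <= sqnorm n p.
Proof.
move=> lh; have w0 : 0 < (hi - lo)%:R :> R by rewrite ltr0n subn_gt0.
apply: (@le_trans _ _ ((hi - lo)%:R^-1 * \sum_(lo <= j < hi) sqnorm n ('X^j * p))).
  rewrite /sqnorm exchange_big /= mulr_sumr; apply: ler_sum => k _.
  rewrite /window -scalerAl coefZ exprMn mulr_suml coef_sum expr2 -mulrA.
  rewrite ler_wpM2l ?invr_ge0 ?(ltW w0) // mulrC ler_pdivrMr //.
  have := @sqr_sum_le _ (index_iota lo hi) (fun j => ('X^j * p)`_k).
  by rewrite size_iota mulrC.
rewrite mulrC ler_pdivrMr // mulrC.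
apply: (@le_trans _ _ (\sum_(lo <= j < hi) sqnorm n p)).
  by apply: ler_sum => j _; exact: sqnormXn.
by rewrite sumr_const_nat mulr_natl.
Qed.

Lemma sqnorm_window1 n lo hi : (lo < hi)%N ->
  sqnorm n (window lo hi) <= (hi - lo)%:R^-1.
Proof.
move=> lh; have w0 : 0 < (hi - lo)%:R :> R by rewrite ltr0n subn_gt0.
have c k : (window lo hi)`_k = (hi - lo)%:R^-1 * (lo <= k < hi)%:R.
  rewrite /window coefZ coef_sum; congr (_ * _).
  under eq_bigr do rewrite coefXn.
  have [kin|kout] := boolP (lo <= k < hi)%N.
    rewrite (bigD1_seq k) ?iota_uniq ?mem_index_iota //= eqxx big1 ?addr0 //.
    by move=> j jk; rewrite eq_sym (negbTE jk).
  rewrite big_nat_cond big1 // => j /andP[jin _].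
  by case: eqP => // kj; move: kout; rewrite kj jin.
rewrite /sqnorm; under eq_bigr do rewrite c exprMn.
rewrite -mulr_sumr expr2 -mulrA ler_piMr ?invr_ge0 ?(ltW w0) // mulrC ler_pdivrMr // mul1r.
under eq_bigr do rewrite -natrX expnS expn1 mulnb andbb.
rewrite -natr_sum ler_nat.
suff -> : (\sum_(k < n) (lo <= k < hi) = minn n hi - lo)%N.
  by rewrite leq_sub2r // geq_minr.
elim: n => [|n IH]; first by rewrite big_ord0 min0n sub0n.
rewrite big_ord_recr /= IH.
by have [h1|h1] := leqP lo n; have [h2|h2] := ltnP n hi; rewrite /=; lia.
Qed.

Lemma window_bounds lo hi x : (lo < hi)%N -> 0 <= x <= 1 ->
  x ^+ hi <= (window lo hi).[x] <= x ^+ lo.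
Proof.
move=> lh /andP[x0 x1]; have w0 : 0 < (hi - lo)%:R :> R by rewrite ltr0n subn_gt0.
rewrite /window hornerZ horner_sum; under eq_bigr do rewrite hornerXn.
have cst (c : R) : \sum_(lo <= j < hi) c = c * (hi - lo)%:R.
  by rewrite sumr_const_nat mulr_natr.
apply/andP; split; rewrite mulrC; [rewrite ler_pdivlMr //|rewrite ler_pdivrMr //];
  rewrite -cst [leLHS]big_nat_cond [leRHS]big_nat_cond; apply: ler_sum => j /andP[/andP[lj jh] _].
  by apply: ler_wiXn2l => //; exact: ltnW.
exact: ler_wiXn2l.
Qed.

Lemma bump_horner M lo hi x : (bump M lo hi).[x] = 1 - (1 - (window lo hi).[x]) ^+ M.
Proof. by rewrite /bump !hornerE. Qed.

Lemma bump_itv M lo hi x : (lo < hi)%N -> 0 <= x <= 1 -> 0 <= (bump M lo hi).[x] <= 1.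
Proof.
move=> lh x01; have /andP[x0 x1] := x01.
have /andP[h1 h2] := window_bounds lh x01.
have e0 : 0 <= (window lo hi).[x] by apply: le_trans h1; exact: exprn_ge0.
have e1 : (window lo hi).[x] <= 1 by apply: (le_trans h2); exact: exprn_ile1.
rewrite bump_horner subr_ge0 exprn_ile1 ?subr_ge0 ?gerBl //=.
by apply: exprn_ge0; rewrite subr_ge0.
Qed.

Lemma bump_le M lo hi lo' hi' x : (lo < hi)%N -> (hi <= lo')%N -> (lo' < hi')%N ->
  0 <= x <= 1 -> (bump M lo' hi').[x] <= (bump M lo hi).[x].
Proof.
move=> lh hl lh' x01; have /andP[x0 x1] := x01.
have /andP[h1 _] := window_bounds lh x01.
have /andP[_ h2] := window_bounds lh' x01.
have h3 : x ^+ lo' <= x ^+ hi by exact: ler_wiXn2l.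
have h4 : (window lo hi).[x] <= 1.
  by have /andP[_ h] := window_bounds lh x01; apply: (le_trans h); exact: exprn_ile1.
rewrite !bump_horner lerD2l lerN2 lerXn2r ?nnegrE ?subr_ge0 //; last by lra.
by apply: (le_trans h2); exact: exprn_ile1.
Qed.

Lemma bump_size M lo hi : (lo < hi)%N -> (0 < M)%N -> (size (bump M lo hi) <= M * hi)%N.
Proof.
move=> lh M0.
have sw : (size (window lo hi) <= hi)%N.
  apply: (leq_trans (size_scale_leq _ _)); apply: (leq_trans (size_sum _ _ _)).
  rewrite big_seq; apply/bigmax_leqP_seq => j; rewrite mem_index_iota => /andP[_ jh] _.
  by rewrite size_polyXn.
have hi0 : (0 < hi)%N by exact: leq_ltn_trans lh.
have s1 : (size (1 - window lo hi)%R <= hi)%N.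
  apply: (leq_trans (size_polyD _ _)); rewrite geq_max size_polyN sw andbT.
  by rewrite size_poly1.
apply: (leq_trans (size_polyD _ _)); rewrite geq_max size_polyN size_poly1 muln_gt0 M0 hi0 /=.
apply: (leq_trans (size_poly_exp_leq _ _)).
have h1 : ((size (1 - window lo hi)%R).-1 <= hi.-1)%N by lia.
apply: (@leq_ltn_trans (hi.-1 * M)); first by rewrite leq_mul2r h1 orbT.
by rewrite mulnC ltn_pmul2l // prednK.
Qed.

(** With w the window, the next bump is w + (b - w b). Two uses of [sqnormD] and the contraction by
    w cost 2 + 8 * 10^M <= 10^(M + 1) in units of 1 / (hi - lo). *)
Lemma bump_sqnorm n M lo hi : (lo < hi)%N ->
  sqnorm n (bump M lo hi) <= 10 ^+ M / (hi - lo)%:R.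
Proof.
move=> lh; have w0 : 0 < (hi - lo)%:R :> R by rewrite ltr0n subn_gt0.
elim: M => [|M IH].
  rewrite /bump expr0 subrr /sqnorm big1 ?mul1r ?invr_ge0 ?(ltW w0) // => k _.
  by rewrite coef0 expr0n.
have -> : bump M.+1 lo hi = window lo hi + (bump M lo hi - window lo hi * bump M lo hi).
  by rewrite /bump exprS; ring.
apply: (le_trans (sqnormD _ _ _)).
have h1 := sqnorm_window1 n lh.
have h2 := sqnormD n (bump M lo hi) (- (window lo hi * bump M lo hi)).
rewrite sqnormN in h2.
have h3 := sqnorm_window n (bump M lo hi) lh.
have c1 : 1 <= 10 ^+ M :> R by rewrite exprn_ege1 // ler1n.
have w1 : 0 < (hi - lo)%:R^-1 :> R by rewrite invr_gt0.
rewrite exprS; move: IH c1 h1 h2 h3 w1; move: (10 ^+ M) ((hi - lo)%:R^-1) => z w.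
move: (sqnorm _ _) (sqnorm _ _) (sqnorm _ _) (sqnorm _ _) => s1 s2 s3 s4.
move=> ? ? ? ? ? w1; have : w <= z * w by rewrite ler_peMl // ltW.
nra.
Qed.

Lemma bump_high M lo hi x : (lo < hi)%N -> (2 <= M)%N -> 0 <= x <= 1 ->
  2 / M%:R <= x ^+ hi -> 3 / 4 <= (bump M lo hi).[x].
Proof.
move=> lh M2 x01 hx; have /andP[x0 x1] := x01; have /andP[h1 h2] := window_bounds lh x01.
have h3 : (window lo hi).[x] <= 1 by apply: (le_trans h2); exact: exprn_ile1.
have M0 : 0 < M%:R :> R by rewrite ltr0n; lia.
rewrite bump_horner; set w := _.[x] in h1 h2 h3 *.
have : (1 - w) ^+ M <= expR (- 2).
  have -> : - 2 = - (2 / M%:R) * M%:R :> R by rewrite mulNr divfK // gt_eqF.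
  rewrite mulrC expRM_natl lerXn2r ?nnegrE ?subr_ge0 ?expR_ge0 //.
  have := expR_ge1Dx (- (2 / M%:R) : R).
  by move: hx; move: (2 / M%:R) => z; lra.
have : expR (- 2) <= 1 / 4 :> R.
  have e1 := expR_ge1Dx (1 : R).
  have e2 := expRxMexpNx_1 (2 : R).
  have e3 : expR 2 = expR 1 * expR 1 :> R by rewrite -expRD.
  rewrite e3 in e2; have := expR_gt0 (- 2 : R).
  move: e1 e2; move: (expR 1) (expR (-2)) => u v e1 e2 v0.
  have u4 : 4 <= u * u by nra.
  have := ler_wpM2r (ltW v0) u4; rewrite e2; lra.
lra.
Qed.

Lemma bump_low M lo hi x : (lo < hi)%N -> 0 <= x <= 1 ->
  M%:R * x ^+ lo <= 1 / 4 -> (bump M lo hi).[x] <= 1 / 4.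
Proof.
move=> lh x01 hx; have /andP[x0 x1] := x01; have /andP[h1 h2] := window_bounds lh x01.
have h3 : (window lo hi).[x] <= 1 by apply: (le_trans h2); exact: exprn_ile1.
have h4 : 0 <= (window lo hi).[x] by apply: le_trans h1; exact: exprn_ge0.
rewrite bump_horner; set w := _.[x] in h1 h2 h3 h4 *.
have : 1 - M%:R * w <= (1 - w) ^+ M.
  elim: M {hx} => [|M IH]; first by rewrite mul0r subr0 expr0.
  have w1 : 0 <= 1 - w by rewrite subr_ge0.
  have := ler_wpM2l w1 IH; rewrite -exprS; apply: le_trans.
  have : 0 <= M%:R * w ^+ 2 by rewrite mulr_ge0 ?sqr_ge0.
  by rewrite -natr1; move: (M%:R : R) => z; nra.
have : M%:R * w <= M%:R * x ^+ lo by rewrite ler_wpM2l.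
lra.
Qed.

Lemma pev_horner p n (y : R) : (size p <= n)%N -> pev (fun k => p`_k) n y = p.[y].
Proof. by move=> sp; rewrite (horner_coef_wide y sp). Qed.

(* The scales [sg i = l * q^i * (q+1)^(I-i)] are integers in geometric progression; the
   bumps on the windows [sg (2i+1), sg (2i)) increase with [i], and their increments
   [phi_i] are separated by the gaps between the windows. *)
Lemma bump_family q N M : (0 < q)%N -> (2 <= M)%N -> M%:R = 2 * 8 ^+ q :> R ->
  exists tt : nat -> R, (forall i, 0 <= tt i) /\
  forall L, exists n (cc : nat -> nat -> R),
  let phi i t := pev (cc i) n.+1 (expR (- (t / n.+1%:R))) in
  [/\ (L <= n)%N,
     forall i t, (i < N)%N -> 0 <= t -> 0 <= phi i t,
     forall j t, (j <= N)%N -> 0 <= t -> \sum_(i < j) phi i t <= 1,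
     forall i, (i < N)%N -> 2^-1 <= phi i (tt i) &
     forall i, (i < N)%N -> n.+1%:R * \sum_(k < n.+1) cc i k ^+ 2 <=
       4 * 10 ^+ M * M%:R * q.+1%:R * (q.+1%:R / q%:R) ^+ (2 * N)].
Proof.
move=> qn0 M2 ME.
(* The time at which y^b = 1/8, where b = [b (2 * i).+1] is the common unit of the two scales (q +
   1) b and q b that bound the i-th gap. As M = 2 * 8^q, M y^(q b) = 2 and M y^((q + 1) b) = 1/4:
   the bump [H i.+1] is already high and [H i] still low. The factor l cancels, so the time does not
   depend on [L]. *)
pose tt (i : nat) : R := ln 8 * M%:R * q.+1%:R ^+ (2 * i + 2) / q%:R ^+ (2 * i + 1).
have ln8 : 0 <= ln (8 : R) by apply: ln_ge0; rewrite ler1n.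
exists tt; split=> [i|L].
  by apply: divr_ge0; rewrite ?exprn_ge0 // mulr_ge0 ?exprn_ge0 // mulr_ge0.
have q0 : 0 < q%:R :> R by rewrite ltr0n.
have q10 : 0 < q.+1%:R :> R by rewrite ltr0n.
have Mn0 : (0 < M)%N by exact: ltnW.
have M0 : 0 < M%:R :> R by rewrite ltr0n.
pose rho : R := q.+1%:R / q%:R.
have rho1 : 1 <= rho by rewrite ler_pdivlMr // mul1r ler_nat.
have [l hl] : exists l, (L < l)%N by exists L.+1.
have ln0 : (0 < l)%N by exact: leq_trans hl.
have [I IE] : exists I, I = (2 * N).+1 by exists (2 * N).+1.
have dI i : (i <= N)%N -> (2 * i < I)%N by rewrite IE ltnS leq_mul2l.
have d2 i : (2 * i.+1 = (2 * i).+2)%N by rewrite mulnS.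
have dI1 i : (i < N)%N -> ((2 * i).+1 < I)%N by move=> /dI; rewrite d2 => /ltnW.
pose sg i := (l * q ^ i * q.+1 ^ (I - i))%N.
pose b i := (l * q ^ i * q.+1 ^ (I - i.+1))%N.
have sgE i : (i < I)%N -> sg i = (q.+1 * b i)%N.
  move=> iI; have e : (I - i = (I - i.+1).+1)%N by rewrite subnSK.
  by rewrite /sg /b e expnS mulnCA.
have sgS i : (i < I)%N -> sg i.+1 = (q * b i)%N.
  by move=> iI; rewrite /sg /b expnS (mulnCA l) -mulnA.
have b0 i : (0 < b i)%N by rewrite !muln_gt0 !expn_gt0 qn0 ln0.
have sglt i : (i < I)%N -> (sg i.+1 < sg i)%N.
  by move=> iI; rewrite (sgS _ iI) (sgE _ iI) ltn_pmul2r.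
have sg0 i : (i <= I)%N -> (sg i <= sg 0)%N.
  elim: i => // i IH iI; apply: leq_trans (IH (ltnW iI)); exact/ltnW/sglt.
(* Every bump has size at most M * sg 0, so its coefficients fit into n + 1 places. *)
pose n := (M * sg 0).-1.
have sg00 : (0 < sg 0)%N by rewrite !muln_gt0 !expn_gt0 qn0 ln0.
have nE : n.+1 = (M * sg 0)%N by rewrite prednK // muln_gt0 sg00 Mn0.
have ln' : (L <= n)%N.
  rewrite -ltnS nE; apply: (leq_trans hl); apply: (@leq_trans (sg 0)).
    by rewrite /sg expn0 muln1 leq_pmulr // expn_gt0.
  by rewrite leq_pmull.
exists n.
pose H i := bump M (sg (2 * i).+1) (sg (2 * i)%N) : {poly R}.
pose cc i k := (H i.+1)`_k - (H i)`_k.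
exists cc => phi.
have Hsize i : (i <= N)%N -> (size (H i) <= n.+1)%N.
  move=> iN; rewrite nE; apply: (leq_trans (bump_size _ _)) => //; first exact: sglt (dI _ iN).
  by rewrite leq_mul2l sg0 ?orbT //; exact/ltnW/dI.
have phiE i y : (i < N)%N -> pev (cc i) n.+1 y = (H i.+1).[y] - (H i).[y].
  move=> iN; rewrite -(pev_horner y (Hsize _ iN)) -(pev_horner y (Hsize _ (ltnW iN))).
  by rewrite /pev -sumrB; apply: eq_bigr => k _; rewrite -mulrBl.
have y01 (t : R) : 0 <= t -> 0 <= expR (- (t / n.+1%:R)) <= 1.
  by move=> t0; rewrite expR_ge0 /= -[leRHS]expR0 ler_expR oppr_le0 divr_ge0.
have n0 : 0 < n.+1%:R :> R by rewrite ltr0n.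
have nR : n.+1%:R = M%:R * (l%:R * q.+1%:R ^+ I) :> R.
  by rewrite nE /sg expn0 muln1 subn0 !natrM natrX.
have l0 : 0 < l%:R :> R by rewrite ltr0n.
have cond1 i t : (i < N)%N -> 0 <= t -> 0 <= pev (cc i) n.+1 (expR (- (t / n.+1%:R))).
  move=> iN tQ; rewrite phiE // subr_ge0; apply: bump_le (y01 t tQ).
  - exact: sglt (dI _ iN).
  - by rewrite d2; apply/ltnW/sglt/dI1.
  - exact: sglt (dI _ (ltnW iN)).
have cond2 j t : (j <= N)%N -> 0 <= t ->
    \sum_(i < j) pev (cc i) n.+1 (expR (- (t / n.+1%:R))) <= 1.
  move=> jN tQ; have yt := y01 t tQ.
  have -> : \sum_(i < j) pev (cc i) n.+1 (expR (- (t / n.+1%:R))) =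
      (H j).[expR (- (t / n.+1%:R))] - (H 0%N).[expR (- (t / n.+1%:R))].
    elim: j jN => [|j IH] jN; first by rewrite big_ord0 subrr.
    by rewrite big_ord_recr /= IH ?(ltnW jN) // phiE //; ring.
  have /andP[_ h1] : 0 <= (H j).[expR (- (t / n.+1%:R))] <= 1.
    by apply: bump_itv yt; exact: sglt (dI _ jN).
  have /andP[h2 _] : 0 <= (H 0%N).[expR (- (t / n.+1%:R))] <= 1.
    by apply: bump_itv yt; exact: sglt (dI _ (leq0n N)).
  lra.
have cond3 i : (i < N)%N -> 2^-1 <= pev (cc i) n.+1 (expR (- (tt i / n.+1%:R))).
  move=> iN; have tt0 : 0 <= tt i.
    by apply: divr_ge0; rewrite ?exprn_ge0 // mulr_ge0 ?exprn_ge0 // mulr_ge0.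
  rewrite phiE //; have yt := y01 _ tt0.
  set y := expR _ in yt *.
  have yg : y ^+ b (2 * i).+1 = 8^-1.
    rewrite /y -expRM_natl mulrN expRN; congr (_^-1).
    rewrite -[RHS]lnK ?posrE //; congr expR.
    rewrite /b !natrM !natrX /tt nR.
    have -> : q.+1%:R ^+ I = q.+1%:R ^+ (2 * i + 2) * q.+1%:R ^+ (I - (2 * i).+2) :> R.
      by rewrite -exprD addn2 subnKC //; exact: dI1.
    have e1 : q%:R ^+ (2 * i).+1 = q%:R ^+ (2 * i + 1) :> R by rewrite addn1.
    rewrite e1; field.
    by rewrite !expf_neq0 ?gt_eqF.
  have iI := dI1 _ iN.
  have h1 : 3 / 4 <= (H i.+1).[y].
    apply: bump_high => //; first exact: sglt (dI _ iN).
    rewrite d2 sgS // mulnC exprM yg ME exprVn invfM mulrA divff ?mul1r //.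
  have h2 : (H i).[y] <= 1 / 4.
    apply: bump_low => //; first exact: sglt (dI _ (ltnW iN)).
    rewrite (sgE _ iI) mulnC exprM yg ME exprVn exprS.
    have : 0 < 8 ^+ q :> R by rewrite exprn_gt0.
    move: (8 ^+ q : R) => z z0; rewrite (_ : 2 * z / (8 * z) = 1 / 4) //.
    by field; rewrite gt_eqF.
  lra.
have cond4 i : (i < N)%N -> n.+1%:R * \sum_(k < n.+1) cc i k ^+ 2 <=
    4 * 10 ^+ M * M%:R * q.+1%:R * rho ^+ (2 * N).
  have wb j : (j <= N)%N -> n.+1%:R * sqnorm n.+1 (H j) <= 10 ^+ M * M%:R * q.+1%:R * rho ^+ (2 * N).
    move=> jN; have jI := dI _ jN.
    apply: (@le_trans _ _ (n.+1%:R * (10 ^+ M / (b (2 * j)%N)%:R))).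
      rewrite ler_wpM2l ?(ltW n0) //; apply: (le_trans (bump_sqnorm _ _ (sglt _ jI))).
      by rewrite (sgE _ jI) (sgS _ jI) -mulnBl subSnn mul1n.
    have -> : n.+1%:R * (10 ^+ M / (b (2 * j)%N)%:R) =
        10 ^+ M * M%:R * q.+1%:R * rho ^+ (2 * j) :> R.
      rewrite nR /b !natrM !natrX /rho.
      have -> : q.+1%:R ^+ I = q.+1%:R * q.+1%:R ^+ (2 * j) * q.+1%:R ^+ (I - (2 * j).+1) :> R.
        by rewrite -exprS -exprD subnKC.
      by rewrite expr_div_n; field; rewrite !expf_neq0 ?gt_eqF.
    apply: ler_wpM2l; first by rewrite !mulr_ge0 ?exprn_ge0.
    by apply: ler_weXn2l => //; rewrite leq_mul2l.
  move=> iN.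
  have h1 := wb i (ltnW iN); have h2 := wb i.+1 iN.
  have h3 : \sum_(k < n.+1) cc i k ^+ 2 <= 2 * (sqnorm n.+1 (H i.+1) + sqnorm n.+1 (H i)).
    have := sqnormD n.+1 (H i.+1) (- H i); rewrite sqnormN; apply: le_trans.
    by rewrite /sqnorm; apply: ler_sum => k _; rewrite coefD coefN.
  apply: (le_trans (ler_wpM2l (ltW n0) h3)).
  have -> : 4 * 10 ^+ M * M%:R * q.+1%:R * rho ^+ (2 * N) = 2 * (10 ^+ M * M%:R * q.+1%:R * rho ^+ (2 * N) + 10 ^+ M * M%:R * q.+1%:R * rho ^+ (2 * N)).
    by move: (q.+1%:R : R) (rho ^+ _) => q' r'; ring.
  by rewrite mulrCA ler_pM2l // mulrDr lerD.
split=> //.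
Qed.

End bump_polynomials.

Lemma le_of_sum4 (R : realType) (a b c d u : R) : 0 <= a -> 0 <= b -> 0 <= c -> 0 <= d ->
  a + b + c + d <= u -> [/\ a <= u, b <= u, c <= u & d <= u].
Proof. by move=> a0 b0 c0 d0 h; split; lra. Qed.

Section small_ball_ratio.
Context (R : realType) (d : measure_display) (T : measurableType d)
  (P : probability T R) (B X : R -> {RV P >-> R}).
Hypotheses (hB : standard_brownian_motion B) (hX : continuous_laplace_process B X).
Notation pr := (pr P).
Notation F := (sup_ball_prob X).

Lemma pevZ (a : R) (c : nat -> R) n y : pev (fun k => a * c k) n y = a * pev c n y.
Proof. by rewrite /pev mulr_sumr; apply: eq_bigr => k _; rewrite mulrA. Qed.

Lemma pevN (c : nat -> R) n (y : R) : pev (fun k => - c k) n y = - pev c n y.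
Proof. by rewrite /pev -sumrN; apply: eq_bigr => k _; rewrite mulNr. Qed.

(** One round of [shift_gain] with r = 1 for each bump. After m steps of size kap phi_i the value at
    some time has moved by m kap / 2 > 2 (a + kap), so the set is left. Half of the gain exp (-1) /
    m is given up to the tail term. *)
Lemma iterated_gain n (Q : seq R) (c : nat -> nat -> R) N m (D a kap : R) :
  let phi i t := pev (c i) n.+1 (expR (- (t / n.+1%:R))) in
  0 < kap -> (0 < m)%N ->
  (forall i t, (i < N)%N -> t \in Q -> 0 <= phi i t) ->
  (forall j t, (j <= N)%N -> t \in Q -> \sum_(i < j) phi i t <= 1) ->
  (forall i, (i < N)%N -> exists2 t, t \in Q & 2^-1 <= phi i t) ->
  (forall i, (i < N)%N -> n.+1%:R * \sum_(k < n.+1) c i k ^+ 2 <= D) ->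
  4 * (a + kap) < m%:R * kap -> m%:R ^+ 2 * (kap ^+ 2 * D) <= 1 ->
  expR (- (1 / (8 * (m%:R ^+ 2 * (kap ^+ 2 * D))))) <= pr (sum_grid B n Q a) / (2 * m%:R) ->
  (1 + expR (-1) / (2 * m%:R)) ^+ N * pr (sum_grid B n Q a) <=
    pr (sum_grid B n Q (a + kap)).
Proof.
move=> phi kap0 m0 phi0 phi1 phih cD ak QD tail.
have m0' : 0 < m%:R :> R by rewrite ltr0n.
have mi0 : 0 < m%:R^-1 :> R by rewrite invr_gt0.
pose y t := expR (- (t / n.+1%:R)) : R.
(* The ball is widened exactly where the first i bumps act: [A 0] is the ball of radius a, and
   [phi1] puts [A N] inside the ball of radius a + kap. *)
pose A i : set (n.+1.-tuple R) := [set x : n.+1.-tuple R | forall t, t \in Q ->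
  `|tpev x (y t)| - kap * \sum_(l < i) phi l t <= a].
have mA i : measurable (A i).
  apply: (@measurable_all_le R _ _ Q
    (fun t (x : n.+1.-tuple R) => `|tpev x (y t)| - kap * \sum_(l < i) phi l t)) => t.
  apply: measurable_funB => //; apply: measurableT_comp => //; exact: measurable_tpev.
pose p i := pr (sample (bm_increment B n.+1) n.+1 @^-1` A i).
have p0E : p 0%N = pr (sum_grid B n Q a).
  rewrite sum_gridE /p; congr (pr _); rewrite predeqE => w; split => h t tQ;
    by have := h t tQ; rewrite big_ord0 mulr0 subr0.
have pN : p N <= pr (sum_grid B n Q (a + kap)).
  rewrite sum_gridE; apply: pr_le.
  - exact: measurable_sample_preim.
  - by apply: measurable_sample_preim; exact: measurable_tgrid.
  move=> w h t tQ; have := h t tQ; rewrite lerBlDr => /le_trans; apply.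
  by rewrite lerD2l ler_piMr ?(ltW kap0) // phi1.
set g := expR (-1) / (2 * m%:R) in tail *.
have g0 : 0 <= g by rewrite divr_ge0 ?expR_ge0 // mulr_ge0.
suff : forall i, (i <= N)%N -> (1 + g) ^+ i * p 0%N <= p i.
  by rewrite -p0E => /(_ N (leqnn N)) h; apply: (le_trans h).
have pge0 i : 0 <= p i by exact: pr_ge0.
elim=> [|i IH] iN; first by rewrite expr0 mul1r.
have {}IH := IH (ltnW iN).
apply: (@le_trans _ _ ((1 + g) * p i)).
  by rewrite exprS -mulrA ler_wpM2l // addr_ge0.
have p0i : p 0%N <= p i.
  apply: le_trans IH; rewrite ler_peMl // exprn_ege1 // lerDl //.
pose ci k := kap * c i k.
have cost : shift_cost (Num.sqrt n.+1%:R^-1) ci n.+1 =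
    kap ^+ 2 * (n.+1%:R * \sum_(k < n.+1) c i k ^+ 2).
  rewrite bm_shift_cost [RHS]mulrCA; congr (_ * _); rewrite mulr_sumr.
  by apply: eq_bigr => k _; rewrite exprMn.
have [t0 t0Q ht0] := phih i iN.
have cpos : 0 < \sum_(k < n.+1) c i k ^+ 2.
  rewrite lt_neqAle sumr_ge0 ?andbT; last by move=> k _; exact: sqr_ge0.
  apply/negP => /eqP/esym/psumr_eq0P h; move: ht0.
  rewrite /phi /pev big1 ?leNgt ?invr_gt0 ?ltr0n // => k _.
  have /eqP : c i k ^+ 2 = 0 by apply: h => // j _; exact: sqr_ge0.
  by rewrite sqrf_eq0 => /eqP ->; rewrite mul0r.
have cost0 : 0 < shift_cost (Num.sqrt n.+1%:R^-1) ci n.+1.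
  by rewrite cost mulr_gt0 ?exprn_gt0 // mulr_gt0.
have costD : m%:R ^+ 2 * shift_cost (Num.sqrt n.+1%:R^-1) ci n.+1 <=
    m%:R ^+ 2 * (kap ^+ 2 * D).
  by rewrite cost ler_wpM2l ?sqr_ge0 // ler_wpM2l ?sqr_ge0 // cD.
have pci t : pev ci n.+1 (y t) = kap * phi i t by exact: pevZ.
have := @shift_gain R d T P (bm_increment B n.+1) (Num.sqrt n.+1%:R^-1)
  (bm_increment_sd_gt0 R n) (gauss_seq_bm_increment hB n) ci n.+1 (A i) m 1 (mA i) m0 cost0
  (le_trans costD QD) _.
rewrite -/(p i) => gain; have {}gain := gain _.
have pS : pr (sample (bm_increment B n.+1) n.+1 @^-1` (A i `|`
    [set x | A i (tshift (fun k => - ci k) x)])) <= p i.+1.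
  apply: pr_le.
  - apply: measurable_sample_preim; apply: measurableU => //.
    exact: measurable_tshift_preim.
  - exact: measurable_sample_preim.
  move=> w [h|h] t tQ /=; have := h t tQ; rewrite big_ord_recr /= mulrDr.
    have : 0 <= kap * phi i t by rewrite mulr_ge0 ?phi0 // ltW.
    by move: (kap * _) (kap * _) => u v; lra.
  rewrite tpev_tshift pevN pci.
  have : 0 <= kap * phi i t by rewrite mulr_ge0 ?phi0 // ltW.
  have := ler_normD (tpev (sample (bm_increment B n.+1) n.+1 w) (y t) - kap * phi i t)
    (kap * phi i t).
  rewrite subrK => h1 h2; rewrite (ger0_norm h2) in h1.
  by move: h1; move: (kap * \sum_(l < i) _) (kap * _) => u v; lra.
apply: le_trans pS; apply: le_trans (gain _); last first.
  move=> x hx; exists m.-1; rewrite ?prednK // => /(_ t0 t0Q).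
  rewrite tpev_tshift pevZ pci.
  have := hx t0 t0Q.
  have s1 : kap * \sum_(l < i) phi l t0 <= kap.
    by rewrite ler_piMr ?(ltW kap0) // phi1 // ltnW.
  have s2 : m%:R * kap * 2^-1 <= m%:R * (kap * phi i t0).
    by rewrite -mulrA ler_wpM2l // ler_wpM2l // ltW.
  have := ler_norm (tpev x (y t0) + m%:R * (kap * phi i t0)).
  have := ler_norm (- tpev x (y t0)); rewrite normrN.
  move: s1 s2 ak; move: (kap * \sum_(l < i) _) (m%:R * (kap * _)) (m%:R * kap) => w z v.
  move: (tpev x (y t0)) => u3; move: `|u3 + z| `|u3| => u1 u2; lra.
have tail' : expR (- (1 ^+ 2 / (8 * (m%:R ^+ 2 * shift_cost (Num.sqrt n.+1%:R^-1) ci n.+1)))) <=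
    p i / (2 * m%:R).
  apply: (@le_trans _ _ (p 0%N / (2 * m%:R))); last first.
    by rewrite ler_wpM2r // invr_ge0 mulr_ge0.
  rewrite p0E; apply: le_trans tail; rewrite expr1n ler_expR lerN2 !div1r.
  have c0 : 0 < m%:R ^+ 2 * shift_cost (Num.sqrt n.+1%:R^-1) ci n.+1.
    by apply: mulr_gt0 => //; exact: exprn_gt0.
  have c1 : 0 < m%:R ^+ 2 * (kap ^+ 2 * D) := lt_le_trans c0 costD.
  have d0 : 0 < 8 * (m%:R ^+ 2 * shift_cost (Num.sqrt n.+1%:R^-1) ci n.+1) by exact: mulr_gt0.
  have d1 : 0 < 8 * (m%:R ^+ 2 * (kap ^+ 2 * D)) by exact: mulr_gt0.
  by rewrite lef_pV2 ?posrE //; exact: ler_wpM2l.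
rewrite mulrDl mul1r lerD2l /g -mulrA ler_wpM2l ?expR_ge0 //.
apply: (@le_trans _ _ (p i / m%:R - p i / (2 * m%:R))); last by rewrite lerD2l lerN2.
rewrite (_ : p i / m%:R - _ = (2 * m%:R)^-1 * p i) //.
by field; rewrite gt_eqF.
Qed.

(* The number [N] of disjoint bumps is a large multiple of [ln u], which turns the
   constant gain of each shift into an arbitrary power of [u]. *)
Lemma sup_ball_prob_ratio (eps : R) : 0 < eps < 1 ->
  exists u0 : R, 1 <= u0 /\
    forall u, u0 <= u -> F ((1 - eps) * u ^- 8) <= u ^- 16 * F (u ^- 8).
Proof.
move=> /andP[eps0 eps1].
(* m shifts of size kap = (eps / 2) del, felt at half strength, must exceed the diameter 2 del; this
   is m eps > 8. *)
have [m hm] : exists m : nat, 8 / eps < m%:R.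
  by exists (Num.truncn (8 / eps)).+1; exact: truncnS_gt.
have m0 : 0 < m%:R :> R by apply: le_lt_trans hm; rewrite divr_ge0 // ltW.
have hm' : 8 < m%:R * eps by rewrite -ltr_pdivrMr.
pose g : R := expR (-1) / (2 * m%:R).
have g0 : 0 < g by apply: divr_gt0; [exact: expR_gt0|exact: mulr_gt0].
pose lam := ln (1 + g).
have lam0 : 0 < lam by rewrite ln_gt0 // ltrDl.
have lamE : expR lam = 1 + g by rewrite lnK // posrE addr_gt0.
(* With N about q ln u the product (1 + g)^N is about u^(q lam) > u^17. Sixteen powers are the
   claim; the last one pays for the rounding of N and for a factor 2. *)
have [q hq] : exists q : nat, 17 < q%:R * lam.
  by exists (Num.truncn (17 / lam)).+1; rewrite -ltr_pdivrMr // truncnS_gt.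
have q0 : 0 < q%:R :> R by rewrite -(pmulr_lgt0 _ lam0) (lt_trans _ hq).
have qn0 : (0 < q)%N by rewrite -(ltr0n R).
have q10 : 0 < q.+1%:R :> R by rewrite ltr0n.
have [M [M2 ME]] : exists M : nat, (2 <= M)%N /\ M%:R = 2 * 8 ^+ q :> R.
  by exists (2 * 8 ^ q)%N; rewrite leq_pmulr ?expn_gt0 // natrM natrX.
have M0 : 0 < M%:R :> R by rewrite ltr0n; exact: ltnW M2.
pose C1 : R := 4 * 10 ^+ M * M%:R * q.+1%:R.
have C10 : 0 < C1 by rewrite /C1 !mulr_gt0 ?exprn_gt0.
pose C2 := m%:R ^+ 2 * C1.
have C20 : 0 < C2 by rewrite mulr_gt0 // exprn_gt0.
pose c := (1 - eps)^-1.
have e10 : 0 < 1 - eps by rewrite subr_gt0.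
have c0 : 0 < c by rewrite invr_gt0.
have c1 : 1 <= c by rewrite invf_ge1 // gerBl ltW.
have lnm : 0 <= ln (4 * m%:R : R).
  by apply: ln_ge0; have := ler1n R m; rewrite -(ltr0n R) m0; lra.
have [v0 [v01 hv]] := sup_ball_prob_lower hB hX.
pose C3 := 8 * C2 * (c ^+ 12 + ln (4 * m%:R)).
have C30 : 0 <= C3.
  by apply: mulr_ge0; [apply: mulr_ge0 => //; exact: ltW|rewrite addr_ge0 // exprn_ge0 // ltW].
have v00 : 0 <= v0 by exact: le_trans v01.
have g10 : 0 <= 2 * (1 + g) by rewrite mulr_ge0 // addr_ge0 // ltW.
exists (v0 + 2 * (1 + g) + C2 + C3); split.
  by rewrite -!addrA (le_trans v01) // lerDl !addr_ge0 // ltW.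
move=> u hu; have [uv0 ug uC2 uC3] := le_of_sum4 v00 g10 (ltW C20) C30 hu.
have u1 : 1 <= u := le_trans v01 uv0.
have u0 : 0 < u := lt_le_trans ltr01 u1.
have un k : 1 <= u ^+ k by exact: exprn_ege1.
pose del := u ^- 8.
have del0 : 0 < del by rewrite invr_gt0 exprn_gt0.
rewrite -/del; pose a := (1 - eps) * del; rewrite -/a.
have a0 : 0 < a by rewrite mulr_gt0.
pose kap := eps / 2 * del.
have kap0 : 0 < kap by rewrite mulr_gt0 // divr_gt0.
pose a1 := a + eps / 4 * del.
have ed0 : 0 < eps * del by rewrite mulr_gt0.
have aa1 : a < a1 by rewrite /a1; lra.
have a1k : a1 + kap < del.
  rewrite /a1 /a /kap; lra.
have Fa0 := sup_ball_prob_gt0 hB hX a0.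
have lnu0 : 0 <= ln u by exact: ln_ge0.
have qu0 : 0 <= q%:R * ln u by rewrite mulr_ge0.
have [N [Nle ltN]] : exists N : nat, N%:R <= q%:R * ln u /\ q%:R * ln u < N.+1%:R.
  by exists (Num.truncn (q%:R * ln u)); split; [rewrite truncn_le|exact: truncnS_gt].
pose rho : R := q.+1%:R / q%:R.
have rho1 : 1 <= rho by rewrite ler_pdivlMr // mul1r ler_nat.
(* As rho <= exp (1 / q) and N <= q ln u, the geometric spread of the N scales multiplies the cost
   of a shift by u^2 only. *)
have rhoN : rho ^+ (2 * N) <= u ^+ 2.
  have r1 : rho <= expR (q%:R^-1).
    by apply: le_trans (expR_ge1Dx _); rewrite /rho -natr1 mulrDl divff ?gt_eqF // mul1r.
  apply: (@le_trans _ _ (expR (q%:R^-1) ^+ (2 * N))).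
    by rewrite lerXn2r ?nnegrE ?expR_ge0 // (le_trans ler01).
  rewrite -expRM_natl -[leRHS]lnK ?posrE ?exprn_gt0 // ler_expR lnXn // natrM.
  by rewrite -(mulr_natl (ln u)) -mulrA ler_wpM2l // ler_pdivrMr // mulrC.
pose D := C1 * u ^+ 2.
have main : (1 + g) ^+ N * (F a / 2) <= F del.
  apply: (sum_grid_sup_ball_prob hB hX a1k) => s s0 N0.
  have [tt [tt0 tth]] := bump_family N qn0 M2 ME.
  pose Q := s ++ [seq tt i | i <- iota 0 N].
  have Q0 t : t \in Q -> 0 <= t.
    by rewrite mem_cat => /orP[/s0//|/mapP[i _ ->]].
  have Fa20 : 0 < F a / 2 by rewrite divr_gt0.
  have [N1 hN1] := sup_ball_prob_sum_grid hB hX aa1 Q0 Fa20.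
  have [n [cc [ln' cond1 cond2 cond3 cond4]]] := tth (maxn N0 N1).
  exists n; first by apply: leq_trans ln'; exact: leq_maxl.
  have hF := hN1 n (leq_trans (leq_maxr _ _) ln').
  have {}cond1 i t : (i < N)%N -> t \in Q -> 0 <= pev (cc i) n.+1 (expR (- (t / n.+1%:R))).
    by move=> iN /Q0; exact: cond1.
  have {}cond2 j t : (j <= N)%N -> t \in Q ->
      \sum_(i < j) pev (cc i) n.+1 (expR (- (t / n.+1%:R))) <= 1.
    by move=> jN /Q0; exact: cond2.
  have {}cond3 i : (i < N)%N ->
      exists2 t, t \in Q & 2^-1 <= pev (cc i) n.+1 (expR (- (t / n.+1%:R))).
    move=> iN; exists (tt i); last exact: cond3.
    rewrite mem_cat; apply/orP; right; apply/mapP; exists i => //.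
    by rewrite mem_iota.
  have {}cond4 i : (i < N)%N -> n.+1%:R * \sum_(k < n.+1) cc i k ^+ 2 <= D.
    by move=> iN; apply: (le_trans (cond4 i iN)); rewrite /D ler_wpM2l // ltW.
  have hp : F a / 2 <= pr (sum_grid B n Q a1).
    by move: hF; rewrite {1}(splitr (F a)) lerD2r.
  pose z := m%:R ^+ 2 * (kap ^+ 2 * D).
  have z0 : 0 < z.
    rewrite /z /D; apply: mulr_gt0; first exact: exprn_gt0.
    by apply: mulr_gt0; [exact: exprn_gt0|apply: mulr_gt0 => //; exact: exprn_gt0].
  have u14 : 0 < u ^+ 14 by exact: exprn_gt0.
  have zle : z <= C2 / u ^+ 14.
    have -> : z = (eps / 2) ^+ 2 * (C2 / u ^+ 14).
      by rewrite /z /D /kap /C2 /del; field; rewrite gt_eqF.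
    rewrite ler_piMl ?divr_ge0 ?(ltW C20) ?(ltW u14) // exprn_ile1 ?divr_ge0 ?(ltW eps0) //.
    by rewrite ler_pdivrMr // mul1r (le_trans (ltW eps1)) // ler1n.
  have z1 : z <= 1.
    apply: (le_trans zle); rewrite ler_pdivrMr // mul1r.
    apply: (@le_trans _ _ u); first exact: uC2.
    by rewrite -{1}(expr1 u); apply: ler_weXn2l.
  (* The cost satisfies z <= C2 u^-14, so the tail is at most exp (- u^14 / (8 C2)); it is
     negligible because F(a) >= exp (- (c u)^12). This is where the lower bound on F enters the
     ratio estimate. *)
  have tail : expR (- (1 / (8 * z))) <= pr (sum_grid B n Q a1) / (2 * m%:R).
    apply: (@le_trans _ _ (F a / 2 / (2 * m%:R))); last first.
      by apply: ler_wpM2r => //; rewrite invr_ge0 mulr_ge0.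
    apply: (@le_trans _ _ (expR (- (c * u) ^+ 12) / (4 * m%:R))); last first.
      rewrite (_ : F a / 2 / (2 * m%:R) = F a / (4 * m%:R)); last first.
        by field; rewrite gt_eqF.
      apply: ler_wpM2r; first by rewrite invr_ge0 mulr_ge0.
      have cu : v0 <= c * u.
        apply: (@le_trans _ _ u); first exact: uv0.
        by rewrite ler_peMl // ltW.
      apply: (le_trans (hv _ cu)); apply: (sup_ball_prob_le hX).
      rewrite /a /del exprMn invfM ler_wpM2r ?invr_ge0 ?exprn_ge0 ?(ltW u0) //.
      rewrite /c exprVn invrK exprS ler_piMr ?(ltW e10) // exprn_ile1 ?(ltW e10) //.
      by rewrite gerBl ltW.
    have m40 : 0 < 4 * m%:R :> R by exact: mulr_gt0.
    rewrite -[X in _ <= _ / X]lnK ?posrE // -expRN -expRD ler_expR -opprD lerN2.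
    have z80 : 0 < 8 * z by exact: mulr_gt0.
    rewrite div1r -[leLHS]invrK lef_pV2 ?posrE ?invr_gt0 //; last first.
      apply: ltr_pwDl => //; apply: exprn_gt0; exact: mulr_gt0.
    apply: (@le_trans _ _ (8 * (C2 / u ^+ 14))); first by rewrite ler_pM2l.
    have s0' : 0 < (c * u) ^+ 12 + ln (4 * m%:R).
      by apply: ltr_pwDl => //; apply: exprn_gt0; exact: mulr_gt0.
    rewrite -[leRHS]mul1r ler_pdivlMr // mulrA mulrAC ler_pdivrMr // mul1r.
    have u12 := un 12%N.
    have l12 : (c * u) ^+ 12 + ln (4 * m%:R) <= (c ^+ 12 + ln (4 * m%:R)) * u ^+ 12.
      by rewrite exprMn (mulrDl (c ^+ 12)) lerD2l; exact: ler_peMr.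
    apply: (@le_trans _ _ (C3 * u ^+ 12)).
      rewrite /C3 -mulrA; apply: ler_wpM2l => //; apply: mulr_ge0 => //; exact: ltW.
    rewrite (_ : u ^+ 14 = u ^+ 2 * u ^+ 12); last by rewrite -exprD.
    apply: ler_wpM2r; first by rewrite (le_trans ler01).
    apply: (@le_trans _ _ u); first exact: uC3.
    by rewrite expr2 ler_peMl // ltW.
  have mk : 4 * (a1 + kap) < m%:R * kap.
    have : 4 * del < m%:R * kap.
      rewrite /kap (_ : m%:R * (eps / 2 * del) = m%:R * eps / 2 * del); last by ring.
      by rewrite ltr_pM2r // ltr_pdivlMr // -natrM.
    by apply: le_lt_trans; rewrite ler_wpM2l // ltW.
  have mn : (0 < m)%N by rewrite -(ltr0n R).
  have := @iterated_gain n Q cc N m D a1 kap kap0 mn cond1 cond2 cond3 cond4 mk z1 tail.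
  rewrite -/g => hg.
  apply: (@le_trans _ _ ((1 + g) ^+ N * pr (sum_grid B n Q a1))).
    by apply: ler_wpM2l => //; apply: exprn_ge0; rewrite addr_ge0 // ltW.
  apply: (le_trans hg); apply: pr_le; try exact: measurable_sum_grid.
  by move=> w h t ts; apply: h; rewrite mem_cat ts.
have gN : 2 * u ^+ 16 <= (1 + g) ^+ N.
  have u160 : 0 < 2 * u ^+ 16 by apply: mulr_gt0 => //; exact: exprn_gt0.
  rewrite -[leLHS]lnK ?posrE // -lamE -expRM_natl ler_expR.
  rewrite lnM ?posrE ?exprn_gt0 // (lnXn _ u0) -(mulr_natl (ln u)).
  have h1 : ln 2 + lam <= ln u.
    rewrite -(lnK (x := 1 + g)) ?posrE ?addr_gt0 // in lamE *.
    by rewrite -ler_expR expRD !lnK ?posrE // ?addr_gt0.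
  have h2 : (q%:R * ln u - 1) * lam <= N%:R * lam.
    rewrite ler_wpM2r ?(ltW lam0) // lerBlDr natr1 ltW //.
  have h3 : 17 * ln u <= q%:R * lam * ln u by rewrite ler_wpM2r // ltW.
  move: h1 h2 h3; move: (ln 2) (ln u) (N%:R * lam) => l2 l NN.
  rewrite mulrBl mul1r (mulrAC _ l); move: (_ * lam * l) => w; lra.
have g1N : 0 < (1 + g) ^+ N by apply: exprn_gt0; rewrite addr_gt0.
have u16 : 0 < u ^+ 16 by exact: exprn_gt0.
rewrite -(ler_pM2l u16) mulrA divff ?gt_eqF // mul1r.
apply: le_trans main; rewrite (_ : u ^+ 16 * F a = 2 * u ^+ 16 * (F a / 2)); last by field.
by apply: ler_wpM2r => //; rewrite divr_ge0 // ltW.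
Qed.

End small_ball_ratio.

(** * Lindeberg replacement *)

Section calculus.
Context (R : realType).
Implicit Types (f g : R -> R) (x a b C K : R).

(** A quadratic remainder gives the derivative without separate one-sided limits; it is used for the
    truncated square at its junction 0. *)
Lemma derive_of_quadratic f x a C :
  (forall h, `|f (x + h) - f x - h * a| <= C * h ^+ 2) -> is_derive x 1 f a.
Proof.
move=> hC.
have lim : h^-1 *: (f (h *: 1 + x) - f x) @[h --> 0^'] --> a.
  apply/cvgrPdist_le => e e0; near=> h.
  have h0 : h != 0 by near: h; exact: nbhs_dnbhs_neq.
  have hh : `|h| <= e / (`|C| + 1).
    near: h; apply: dnbhs0_le; rewrite divr_gt0 // ltr_wpDl //.
  rewrite /GRing.scale /= mulr1 (addrC h) distrC.
  have -> : h^-1 * (f (x + h) - f x) - a = h^-1 * (f (x + h) - f x - h * a) by field.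
  rewrite normrM normfV ler_pdivrMl ?normr_gt0 //; apply: (le_trans (hC h)).
  rewrite -(real_normK (num_real h)) expr2 mulrA mulrC; apply: ler_wpM2l => //.
  apply: (@le_trans _ _ ((`|C| + 1) * `|h|)).
    by apply: ler_wpM2r => //; have := ler_norm C; lra.
  by rewrite mulrC -ler_pdivlMr // ltr_wpDl.
by apply: DeriveDef; [apply/cvg_ex; exists a|exact: cvg_lim].
Unshelve. all: by end_near. Qed.

Lemma deriveD f g x a b : is_derive x 1 f a -> is_derive x 1 g b ->
  is_derive x 1 (fun y => f y + g y) (a + b).
Proof. by move=> h1 h2; exact: is_deriveD. Qed.

Lemma deriveM f g x a b : is_derive x 1 f a -> is_derive x 1 g b ->
  is_derive x 1 (fun y => f y * g y) (f x * b + g x * a).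
Proof. by move=> h1 h2; exact: is_deriveM. Qed.

Lemma derive_cst (k : R) x : is_derive x 1 (fun=> k) 0.
Proof. exact: is_derive_cst. Qed.

Lemma derive_scale (k : R) f x a : is_derive x 1 f a ->
  is_derive x 1 (fun y => k * f y) (k * a).
Proof.
by move=> h; have := deriveM (derive_cst k x) h; rewrite mulr0 addr0.
Qed.

Lemma derive_affine (k l : R) x : is_derive x 1 (fun y => k + y * l) l.
Proof.
apply: (@derive_of_quadratic _ _ _ 0) => h; rewrite mul0r.
by rewrite (_ : _ - _ = 0) ?normr0 //; ring.
Qed.

Lemma derive_sum n (f : nat -> R -> R) (df : nat -> R) x :
  (forall i, is_derive x 1 (f i) (df i)) ->
  is_derive x 1 (fun y => \sum_(i < n) f i y) (\sum_(i < n) df i).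
Proof.
move=> hf; elim: n => [|n IH].
  rewrite big_ord0 (_ : (fun y => _) = fun=> 0); first exact: derive_cst.
  by apply/funext => y; rewrite big_ord0.
rewrite big_ord_recr /= (_ : (fun y => _) = fun y => \sum_(i < n) f i y + f n y).
  exact: deriveD.
by apply/funext => y; rewrite big_ord_recr.
Qed.

Lemma derive_lipschitz f f' K : (forall x, is_derive x 1 f (f' x)) ->
  (forall x, 0 <= x <= 1 -> `|f' x| <= K) ->
  forall x, 0 <= x <= 1 -> `|f x - f 0| <= K * x.
Proof.
move=> df hK x /andP[x0 x1].
have [] := @MVT_segment R f f' 0 x x0 (fun y _ => df y).
  apply: derivable_within_continuous => y _; exact: (@ex_derive _ _ _ _ _ _ _ (df y)).
move=> c; rewrite in_itv /= subr0 => /andP[c0 cx] ->.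
by rewrite normrM (ger0_norm x0) ler_wpM2r // hK // c0 (le_trans cx).
Qed.

(** The mean value theorem is applied three times, each time to the remainder of a derivative at 0;
    the factor 1/6 is given up. *)
Lemma taylor3 f f1 f2 f3 K :
  (forall x, is_derive x 1 f (f1 x)) -> (forall x, is_derive x 1 f1 (f2 x)) ->
  (forall x, is_derive x 1 f2 (f3 x)) ->
  (forall x, 0 <= x <= 1 -> `|f3 x| <= K) ->
  `|f 1 - (f 0 + f1 0 + f2 0 / 2)| <= K.
Proof.
move=> d0 d1 d2 hK.
have K0 : 0 <= K by apply: (le_trans (normr_ge0 (f3 0))); apply: hK; rewrite lexx ler01.
have b2 x : 0 <= x <= 1 -> `|f2 x - f2 0| <= K.
  move=> x01; apply: (le_trans (derive_lipschitz d2 hK x01)).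
  by case/andP: x01 => ? ?; rewrite ler_piMr.
have b1 x : 0 <= x <= 1 -> `|f1 x + (- f1 0 + x * - f2 0)| <= K.
  move=> x01.
  have dh (y : R) : is_derive y 1 (fun x => f1 x + (- f1 0 + x * - f2 0)) (f2 y - f2 0).
    exact: deriveD (d1 y) (derive_affine _ _ _).
  have := derive_lipschitz dh b2 x01.
  rewrite mul0r addr0 subrr subr0 => /le_trans; apply.
  by case/andP: x01 => ? ?; rewrite ler_piMr.
have dq (y : R) : is_derive y 1 (fun x => (- f2 0 / 2) * (x * x)) ((- f2 0 / 2) * (y * 1 + y * 1)).
  by apply: derive_scale; apply: deriveM; exact: is_derive_id.
have dk (y : R) : is_derive y 1 (fun x => f x + (- f 0 + x * - f1 0) + (- f2 0 / 2) * (x * x))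
    (f1 y - f1 0 + (- f2 0 / 2) * (y * 1 + y * 1)).
  exact: deriveD (deriveD (d0 y) (derive_affine _ _ _)) (dq y).
have bk (y : R) : 0 <= y <= 1 -> `|f1 y - f1 0 + (- f2 0 / 2) * (y * 1 + y * 1)| <= K.
  move=> /b1; rewrite (_ : f1 y + _ = f1 y - f1 0 + - f2 0 / 2 * (y * 1 + y * 1)) //.
  by field.
have i01 (y : R) : y = 1 -> 0 <= y <= 1 by move=> ->; rewrite ler01 lexx.
have := derive_lipschitz dk bk (i01 1 erefl).
move=> h; rewrite -[leRHS]mulr1 (_ : f 1 - _ = f 1 + (- f 0 + 1 * - f1 0) +
  - f2 0 / 2 * (1 * 1) - (f 0 + (- f 0 + 0 * - f1 0) + - f2 0 / 2 * (0 * 0))) //.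
by field.
Qed.

(** The fourth truncated power is of class C^3, which is the regularity that a third order expansion
    needs. *)
Definition pp (k : nat) x := Num.max x 0 ^+ k.

Lemma pp_ge0 k x : 0 <= pp k x.
Proof. by rewrite exprn_ge0 // le_max lexx orbT. Qed.

Lemma pp0 k x : x <= 0 -> pp k.+1 x = 0.
Proof. by move=> x0; rewrite /pp max_r // expr0n. Qed.

Lemma pp_pos k x : 0 <= x -> pp k x = x ^+ k.
Proof. by move=> x0; rewrite /pp max_l. Qed.

Lemma pp_le1 k x : x <= 1 -> pp k x <= 1.
Proof. by move=> x1; rewrite exprn_ile1 // ?le_max ?lexx ?orbT // ge_max x1 ler01. Qed.

Lemma ppS k x : pp k.+2 x = x * pp k.+1 x.
Proof.
have [x0|x0] := leP x 0; first by rewrite !pp0 // mulr0.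
by rewrite !pp_pos ?(ltW x0) // -exprS.
Qed.

Lemma derive_pp2 x : is_derive x 1 (pp 2) (2 * pp 1 x).
Proof.
apply: (@derive_of_quadratic _ _ _ 1) => h; rewrite mul1r.
have [x0|x0] := leP x 0; have [y0|y0] := leP (x + h) 0;
  rewrite ?(pp0 _ x0) ?(pp0 _ y0) ?(pp_pos _ (ltW x0)) ?(pp_pos _ (ltW y0)) ?expr1.
- by rewrite !mulr0 !subr0 normr0 sqr_ge0.
- by rewrite !mulr0 !subr0 ger0_norm ?sqr_ge0 // lerXn2r ?nnegrE; lra.
- rewrite ler_norml; apply/andP; split; nra.
- rewrite (_ : _ - _ = h ^+ 2); last by ring.
  by rewrite ger0_norm ?sqr_ge0.
Qed.

Lemma derive_pp3 x : is_derive x 1 (pp 3) (3 * pp 2 x).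
Proof.
have := deriveM (is_derive_id x 1) (derive_pp2 x).
rewrite (_ : (fun y => _) = pp 3); last by apply/funext => y; rewrite (ppS 1).
by rewrite (_ : _ + _ = 3 * pp 2 x) // (ppS 0); ring.
Qed.

Lemma derive_pp4 x : is_derive x 1 (pp 4) (4 * pp 3 x).
Proof.
have := deriveM (is_derive_id x 1) (derive_pp3 x).
rewrite (_ : (fun y => _) = pp 4); last by apply/funext => y; rewrite (ppS 2).
by rewrite (_ : _ + _ = 4 * pp 3 x) // (ppS 1); ring.
Qed.

Lemma derive_comp_affine f f' (k l : R) x : (forall y : R, is_derive y 1 f (f' y)) ->
  is_derive x 1 (fun y => f (k + y * l)) (l * f' (k + x * l)).
Proof.
move=> df; have := @is_derive1_comp R f (fun y => k + y * l) x _ _ (df _) (derive_affine k l x).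
by rewrite mulrC.
Qed.

Lemma derive_comp f f' g b x : (forall y : R, is_derive y 1 f (f' y)) -> is_derive x 1 g b ->
  is_derive x 1 (fun y => f (g y)) (f' (g x) * b).
Proof. by move=> df dg; exact: (@is_derive1_comp R f g x _ _ (df _) dg). Qed.

End calculus.

Section smooth_box.
Context (R : realType) (n : nat).
Implicit Types (x al be : nat -> R).

(* A smooth function between the indicators of the boxes [x <= 0] and [x < 1]. *)
Definition smooth_box x : R := pp 4 (1 - \sum_(i < n) pp 4 (x i)).

Lemma smooth_box_ge0 x : 0 <= smooth_box x.
Proof. exact: pp_ge0. Qed.

Lemma smooth_box_le1 x : smooth_box x <= 1.
Proof. by apply: pp_le1; rewrite gerBl sumr_ge0 // => i _; exact: pp_ge0. Qed.

Lemma smooth_box_eq1 x : (forall i, (i < n)%N -> x i <= 0) -> smooth_box x = 1.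
Proof.
move=> h; rewrite /smooth_box big1 ?subr0 ?pp_pos ?expr1n // => i _.
by rewrite pp0 // h.
Qed.

Lemma smooth_box_eq0 x i : (i < n)%N -> 1 <= x i -> smooth_box x = 0.
Proof.
move=> ni xi; rewrite /smooth_box pp0 // subr_le0 (bigD1 (Ordinal ni)) //=.
rewrite -[leLHS]addr0 lerD ?sumr_ge0 // => [|j _]; last exact: pp_ge0.
by rewrite pp_pos ?(le_trans ler01) // exprn_ege1.
Qed.

(** The first directional derivative of [smooth_box] at [al] along [be]; [box_quad] is the second
    one. *)
Definition box_lin al be : R :=
  - (4 * pp 3 (1 - \sum_(i < n) pp 4 (al i))) * \sum_(i < n) 4 * be i * pp 3 (al i).

Definition box_quad al be : R :=
  12 * pp 2 (1 - \sum_(i < n) pp 4 (al i)) * (\sum_(i < n) 4 * be i * pp 3 (al i)) ^+ 2 -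
  4 * pp 3 (1 - \sum_(i < n) pp 4 (al i)) * \sum_(i < n) 12 * be i ^+ 2 * pp 2 (al i).

Lemma smooth_box_taylor al be (b : R) : (forall i, `|be i| <= b) ->
  `|smooth_box (fun i => al i + be i) -
    (smooth_box al + box_lin al be + box_quad al be / 2)| <= (16 * (n%:R * b)) ^+ 3.
Proof.
move=> hb; have b0 : 0 <= b := le_trans (normr_ge0 _) (hb 0%N).
pose x t i := al i + t * be i.
pose q t := 1 - \sum_(i < n) pp 4 (x t i).
pose q1 t := - \sum_(i < n) be i * (4 * pp 3 (x t i)).
pose q2 t := - \sum_(i < n) 4 * be i * (be i * (3 * pp 2 (x t i))).
pose q3 t := - \sum_(i < n) 12 * be i ^+ 2 * (be i * (2 * pp 1 (x t i))).
have dq (t : R) : is_derive t 1 q (q1 t).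
  rewrite /q1 -[X in is_derive _ _ _ X]add0r -mulN1r.
  rewrite (_ : q = fun y => 1 + -1 * \sum_(i < n) pp 4 (x y i)); last first.
    by apply/funext => y; rewrite mulN1r.
  apply: (deriveD (derive_cst 1 t)); apply: derive_scale; apply: (@derive_sum R n (fun i y => pp 4 (x y i))
    (fun i => be i * (4 * pp 3 (x t i)))) => i.
  exact: derive_comp_affine (@derive_pp4 R).
have dq1 (t : R) : is_derive t 1 q1 (q2 t).
  rewrite /q2 -mulN1r (_ : q1 = fun y => -1 * \sum_(i < n) 4 * be i * pp 3 (x y i)); last first.
    apply/funext => y; rewrite mulN1r /q1; congr (- _); apply: eq_bigr => i _; ring.
  apply: derive_scale; apply: (@derive_sum R n (fun i y => 4 * be i * pp 3 (x y i))
    (fun i => 4 * be i * (be i * (3 * pp 2 (x t i))))) => i; apply: derive_scale.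
  exact: derive_comp_affine (@derive_pp3 R).
have dq2 (t : R) : is_derive t 1 q2 (q3 t).
  rewrite /q3 -mulN1r (_ : q2 = fun y => -1 * \sum_(i < n) 12 * be i ^+ 2 * pp 2 (x y i));
    last first.
    apply/funext => y; rewrite mulN1r /q2; congr (- _); apply: eq_bigr => i _; ring.
  apply: derive_scale; apply: (@derive_sum R n (fun i y => 12 * be i ^+ 2 * pp 2 (x y i))
    (fun i => 12 * be i ^+ 2 * (be i * (2 * pp 1 (x t i))))) => i; apply: derive_scale.
  exact: derive_comp_affine (@derive_pp2 R).
pose g t := pp 4 (q t).
pose g1 t := 4 * pp 3 (q t) * q1 t.
pose g2 t := 12 * pp 2 (q t) * (q1 t * q1 t) + 4 * pp 3 (q t) * q2 t.
pose g3 t := 24 * pp 1 (q t) * q1 t * (q1 t * q1 t) + 36 * pp 2 (q t) * q1 t * q2 t +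
  4 * pp 3 (q t) * q3 t.
have dg (t : R) : is_derive t 1 g (g1 t) by exact: derive_comp (@derive_pp4 R) (dq t).
have d3 (t : R) : is_derive t 1 (fun y => 4 * pp 3 (q y)) (4 * (3 * pp 2 (q t) * q1 t)).
  by apply: derive_scale; exact: derive_comp (@derive_pp3 R) (dq t).
have d2 (t : R) : is_derive t 1 (fun y => 12 * pp 2 (q y)) (12 * (2 * pp 1 (q t) * q1 t)).
  by apply: derive_scale; exact: derive_comp (@derive_pp2 R) (dq t).
have dg1 (t : R) : is_derive t 1 g1 (g2 t).
  have := deriveM (d3 t) (dq1 t); rewrite (_ : _ + _ = g2 t) // /g2; ring.
have dg2 (t : R) : is_derive t 1 g2 (g3 t).
  have := deriveD (deriveM (d2 t) (deriveM (dq1 t) (dq1 t))) (deriveM (d3 t) (dq2 t)).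
  rewrite (_ : _ + _ = g3 t) // /g3; ring.
have K0 : 0 <= (16 * (n%:R * b)) ^+ 3 :> R.
  by apply: exprn_ge0; rewrite mulr_ge0 // mulr_ge0.
have hg3 (t : R) : 0 <= t <= 1 -> `|g3 t| <= (16 * (n%:R * b)) ^+ 3.
  (* Where q <= 0 the third derivative vanishes; where q > 0 every coordinate is below 1, so all
     truncated powers are at most 1 although the coordinates themselves are unbounded. *)
  move=> _; have [qt|qt] := leP (q t) 0.
    by rewrite /g3 !pp0 // !(mulr0, mul0r, addr0) normr0.
  have q1' : q t <= 1 by rewrite gerBl sumr_ge0 // => i _; exact: pp_ge0.
  have x1 i : (i < n)%N -> x t i <= 1.
    move=> ni; rewrite leNgt; apply/negP => xi; move: qt; rewrite ltNge; apply/negP/negPn.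
    rewrite subr_le0 (bigD1 (Ordinal ni)) //=.
    rewrite -[leLHS]addr0 lerD ?sumr_ge0 // => [|j _]; last exact: pp_ge0.
    by rewrite pp_pos ?(le_trans ler01 (ltW xi)) // exprn_ege1 // ltW.
  have bsum (f : nat -> R) (B : R) : (forall i, (i < n)%N -> `|f i| <= B) ->
      `|- \sum_(i < n) f i| <= n%:R * B.
    move=> hf; rewrite normrN; apply: (le_trans (ler_norm_sum _ _ _)).
    rewrite mulr_natl -[X in _ *+ X]card_ord -sumr_const.
    by apply: ler_sum => i _; exact: hf.
  have pb k i : (i < n)%N -> 0 <= pp k (x t i) <= 1.
    by move=> ni; rewrite pp_ge0 pp_le1 // x1.
  have nrm (k p y B : R) : 0 <= k -> 0 <= p <= 1 -> `|y| <= B -> `|k * (p * y)| <= k * B.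
    move=> k0 /andP[p0 p1] yB; rewrite (normrM k) (normrM p) (ger0_norm k0) (ger0_norm p0).
    by rewrite ler_wpM2l // (le_trans _ yB) // ler_piMl.
  have h1 : `|q1 t| <= n%:R * (4 * b).
    apply: (bsum (fun i => be i * (4 * pp 3 (x t i)))) => i ni.
    rewrite (_ : be i * _ = 4 * (pp 3 (x t i) * be i)); last by ring.
    by apply: nrm => //; exact: pb.
  have h2 : `|q2 t| <= n%:R * (12 * b ^+ 2).
    apply: (bsum (fun i => 4 * be i * (be i * (3 * pp 2 (x t i))))) => i ni.
    rewrite (_ : 4 * be i * _ = 12 * (pp 2 (x t i) * be i ^+ 2)); last by ring.
    by apply: nrm; rewrite ?pb // normrX lerXn2r ?nnegrE.
  have h3 : `|q3 t| <= n%:R * (24 * b ^+ 3).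
    apply: (bsum (fun i => 12 * be i ^+ 2 * (be i * (2 * pp 1 (x t i))))) => i ni.
    rewrite (_ : 12 * _ * _ = 24 * (pp 1 (x t i) * be i ^+ 3)); last by ring.
    by apply: nrm; rewrite ?pb // normrX lerXn2r ?nnegrE.
  have pq k : 0 <= pp k (q t) <= 1 by rewrite pp_ge0 pp_le1.
  have [n0|n0] := leqP n 0.
    have n00 : n%:R = 0 :> R by move: n0; rewrite leqn0 => /eqP ->.
    move: h1 h2 h3; rewrite n00 !mul0r !normr_le0 => /eqP z1 /eqP z2 /eqP z3.
    by rewrite /g3 z1 z2 z3 !(mulr0, addr0) normr0 expr0n.
  have nb0 : 0 <= n%:R * b by rewrite mulr_ge0.
  have n1 : 1 <= n%:R :> R by rewrite ler1n.
  have t1 : `|24 * pp 1 (q t) * q1 t * (q1 t * q1 t)| <= 24 * (64 * (n%:R * b) ^+ 3).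
    rewrite (_ : 24 * _ * _ * _ = 24 * (pp 1 (q t) * q1 t ^+ 3)); last by ring.
    apply: nrm => //; rewrite normrX.
    rewrite (_ : 64 * _ = (n%:R * (4 * b)) ^+ 3); last by ring.
    by rewrite lerXn2r ?nnegrE ?mulr_ge0.
  have t2 : `|36 * pp 2 (q t) * q1 t * q2 t| <= 36 * (48 * (n%:R * b) ^+ 3).
    rewrite (_ : 36 * _ * _ * _ = 36 * (pp 2 (q t) * (q1 t * q2 t))); last by ring.
    apply: nrm => //; rewrite normrM.
    have e1 : `|q1 t| * `|q2 t| <= n%:R * (4 * b) * (n%:R * (12 * b ^+ 2)) by rewrite ler_pM.
    apply: (le_trans e1); rewrite (_ : _ * _ = 48 * (n%:R ^+ 2 * b ^+ 3)); last by ring.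
    rewrite ler_wpM2l // exprMn ler_wpM2r ?exprn_ge0 //; exact: ler_weXn2l.
  have t3 : `|4 * pp 3 (q t) * q3 t| <= 4 * (24 * (n%:R * b) ^+ 3).
    rewrite -(mulrA 4); apply: nrm => //; apply: (le_trans h3).
    rewrite mulrCA ler_wpM2l // exprMn ler_wpM2r ?exprn_ge0 //.
    by rewrite -{1}(expr1 n%:R); exact: ler_weXn2l.
  rewrite /g3; apply: (le_trans (ler_normD _ _)).
  have := ler_normD (24 * pp 1 (q t) * q1 t * (q1 t * q1 t)) (36 * pp 2 (q t) * q1 t * q2 t).
  have z0 : 0 <= (n%:R * b) ^+ 3 by exact: exprn_ge0.
  (* The three terms add up to 24 * 64 + 36 * 48 + 4 * 24 = 3360 <= 16^3. *)
  rewrite (exprMn _ 16); move: t1 t2 t3 z0; move: ((n%:R * b) ^+ 3) => z; lra.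
have := taylor3 dg dg1 dg2 hg3.
have q0E : q 0 = 1 - \sum_(i < n) pp 4 (al i).
  by rewrite /q; congr (_ - _); apply: eq_bigr => i _; rewrite /x mul0r addr0.
have -> : g 1 = smooth_box (fun i => al i + be i).
  by rewrite /g /q /x; under eq_bigr do rewrite mul1r.
have -> : g 0 = smooth_box al by rewrite /g q0E.
have q10 : q1 0 = - \sum_(i < n) 4 * be i * pp 3 (al i).
  by rewrite /q1; congr (- _); apply: eq_bigr => i _; rewrite /x mul0r addr0; ring.
have q20 : q2 0 = - \sum_(i < n) 12 * be i ^+ 2 * pp 2 (al i).
  by rewrite /q2; congr (- _); apply: eq_bigr => i _; rewrite /x mul0r addr0; ring.
have -> : g1 0 = box_lin al be by rewrite /g1 q0E q10 /box_lin; ring.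
have -> : g2 0 = box_quad al be by rewrite /g2 q0E q10 q20 /box_quad; ring.
by [].
Qed.

End smooth_box.

Section unit_expectation.
Context (R : realType) (d : measure_display) (T : measurableType d)
  (P : probability T R).
Implicit Types f g : T -> R.

Definition unit_fun f := measurable_fun setT f /\ forall w, 0 <= f w <= 1.

Definition expect f : R := fine (\int[P]_w (f w)%:E).

Lemma unit_fun_integrable f : unit_fun f -> P.-integrable setT (fun w => (f w)%:E).
Proof.
move=> [mf f01]; apply: (@le_integrable _ _ _ _ _ _ _ (fun=> 1%E)) => //.
- exact/measurable_EFinP.
- by move=> w _; have /andP[f0 f1] := f01 w; rewrite !gee0_abs ?lee_fin.
- exact: finite_measure_integrable_cst.
Qed.

Lemma expectE f : unit_fun f -> (\int[P]_w (f w)%:E = (expect f)%:E)%E.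
Proof. by move=> /unit_fun_integrable h; rewrite fineK //; exact: integrable_fin_num. Qed.

Lemma expect_le f g (c : R) : unit_fun f -> unit_fun g ->
  (forall w, f w <= g w + c) -> expect f <= expect g + c.
Proof.
move=> uf ug fg; rewrite -lee_fin EFinD -!expectE //.
have -> : (\int[P]_w (g w)%:E + c%:E = \int[P]_w ((g w)%:E + c%:E))%E.
  rewrite integralD //; [|exact: unit_fun_integrable|exact: finite_measure_integrable_cst].
  by rewrite integral_cst //= probability_setT mule1.
apply: le_integral => //; first exact: unit_fun_integrable.
  apply: integrableD => //; first exact: unit_fun_integrable.
  exact: finite_measure_integrable_cst.
by move=> w _; rewrite -EFinD lee_fin.
Qed.

Lemma expect_dist f g (c : R) : unit_fun f -> unit_fun g ->
  (forall w, `|f w - g w| <= c) -> `|expect f - expect g| <= c.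
Proof.
move=> uf ug fg.
have h1 : expect f <= expect g + c.
  by apply: expect_le => // w; have := fg w; rewrite ler_norml => /andP[_]; lra.
have h2 : expect g <= expect f + c.
  by apply: expect_le => // w; have := fg w; rewrite ler_norml => /andP[]; lra.
by rewrite ler_norml; apply/andP; split; lra.
Qed.

Lemma expect_mean4 f1 f2 f3 f4 :
  unit_fun f1 -> unit_fun f2 -> unit_fun f3 -> unit_fun f4 ->
  unit_fun (fun w => (f1 w + f2 w + f3 w + f4 w) / 4) /\
  expect (fun w => (f1 w + f2 w + f3 w + f4 w) / 4) =
    (expect f1 + expect f2 + expect f3 + expect f4) / 4.
Proof.
move=> u1 u2 u3 u4.
have u : unit_fun (fun w => (f1 w + f2 w + f3 w + f4 w) / 4).
  split.
    apply: measurable_funM => //; do 3 (apply: measurable_funD; last by case: u2 u3 u4 => ? _ [? _] [? _]).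
    by case: u1.
  move=> w; have /andP[? ?] := u1.2 w; have /andP[? ?] := u2.2 w.
  by have /andP[? ?] := u3.2 w; have /andP[? ?] := u4.2 w; apply/andP; split; lra.
split => //; apply: EFin_inj; rewrite -expectE //.
under eq_integral do rewrite mulrC EFinM !EFinD.
have i1 := unit_fun_integrable u1; have i2 := unit_fun_integrable u2.
have i3 := unit_fun_integrable u3; have i4 := unit_fun_integrable u4.
have i12 := integrableD measurableT i1 i2.
have i123 := integrableD measurableT i12 i3.
rewrite integralZl //; last exact: integrableD.
rewrite integralD // integralD // integralD // !expectE //.
by rewrite -!EFinD -EFinM mulrC.
Qed.

End unit_expectation.

Section measurable_box.
Context (R : realType) (d : measure_display) (T : measurableType d).

Lemma measurable_pp k (f : T -> R) : measurable_fun setT f ->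
  measurable_fun setT (fun w => pp k (f w)).
Proof. by move=> mf; apply: measurable_funX; exact: measurable_maxr. Qed.

Lemma measurable_smooth_box n (f : nat -> T -> R) :
  (forall i, measurable_fun setT (f i)) ->
  measurable_fun setT (fun w => smooth_box n (fun i => f i w)).
Proof.
move=> mf; apply: measurable_pp; apply: measurable_funB => //.
by apply: measurable_sum => i; exact: measurable_pp.
Qed.

Lemma unit_smooth_box n (f : nat -> T -> R) : (forall i, measurable_fun setT (f i)) ->
  unit_fun (fun w => smooth_box n (fun i => f i w)).
Proof.
move=> mf; split; first exact: measurable_smooth_box.
by move=> w; rewrite smooth_box_ge0 smooth_box_le1.
Qed.

End measurable_box.

Section box_forms.
Context (R : realType) (n : nat).
Implicit Types (al A B : nat -> R) (u w : R).

Lemma box_lin_comb al A B u w : box_lin n al (fun i => A i * u + B i * w) =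
  u * box_lin n al A + w * box_lin n al B.
Proof.
rewrite /box_lin; set k := - _; rewrite !mulrA !(mulrC _ k) -!mulrA -mulrDr; congr (_ * _).
rewrite !mulr_sumr -big_split; apply: eq_bigr => i _ /=; ring.
Qed.

Definition box_cross al A B : R :=
  box_quad n al (fun i => A i + B i) - box_quad n al A - box_quad n al B.

Lemma box_quad_comb al A B u w : box_quad n al (fun i => A i * u + B i * w) =
  u ^+ 2 * box_quad n al A + w ^+ 2 * box_quad n al B + u * w * box_cross al A B.
Proof.
rewrite /box_cross /box_quad; set k := 12 * _; set l := 4 * _.
pose a := \sum_(i < n) 4 * A i * pp 3 (al i); pose b := \sum_(i < n) 4 * B i * pp 3 (al i).
pose aa := \sum_(i < n) 12 * A i ^+ 2 * pp 2 (al i).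
pose bb := \sum_(i < n) 12 * B i ^+ 2 * pp 2 (al i).
pose ab := \sum_(i < n) 12 * (A i * B i) * pp 2 (al i).
have s1 : \sum_(i < n) 4 * (A i * u + B i * w) * pp 3 (al i) = u * a + w * b.
  by rewrite /a /b !mulr_sumr -big_split; apply: eq_bigr => i _ /=; ring.
have s2 : \sum_(i < n) 4 * (A i + B i) * pp 3 (al i) = a + b.
  by rewrite /a /b -big_split; apply: eq_bigr => i _ /=; ring.
have s3 : \sum_(i < n) 12 * (A i * u + B i * w) ^+ 2 * pp 2 (al i) =
    u ^+ 2 * aa + w ^+ 2 * bb + 2 * (u * w) * ab.
  by rewrite /aa /bb /ab !mulr_sumr -!big_split; apply: eq_bigr => i _ /=; ring.
have s4 : \sum_(i < n) 12 * (A i + B i) ^+ 2 * pp 2 (al i) = aa + bb + 2 * ab.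
  by rewrite /aa /bb /ab mulr_sumr -!big_split; apply: eq_bigr => i _ /=; ring.
rewrite s1 s2 s3 s4 -/a -/b -/aa -/bb; ring.
Qed.

End box_forms.

Section gauss_swap.
Context (R : realType) (d : measure_display) (T : measurableType d)
  (P : probability T R) (X : nat -> {RV P >-> R}) (s : R).
Hypotheses (s0 : 0 < s) (hX : gauss_seq X s).

Lemma std_pair (Y : nat -> {RV P >-> R}) (v : R) i j : std_seq Y v -> i != j ->
  (\int[P]_w ((Y i w + Y j w) ^+ 2)%:E = (2 * v)%:E)%E.
Proof.
move=> hY ij.
pose f : sub_space Y (pred1 i) * sub_space Y (pred1 j) -> \bar R :=
  fun z => ((Y i z.1 + Y j z.2) ^+ 2)%:E.
have mf : measurable_fun setT f.
  apply/measurable_EFinP; apply: measurable_funX; apply: measurable_funD.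
    have mi : measurable_fun setT (Y i : sub_space Y (pred1 i) -> R).
      by apply: sub_space_RV; rewrite /= eqxx.
    exact: (measurableT_comp mi measurable_fst).
  have mj : measurable_fun setT (Y j : sub_space Y (pred1 j) -> R).
    by apply: sub_space_RV; rewrite /= eqxx.
  exact: (measurableT_comp mj measurable_snd).
transitivity (\int[P]_w f (w, w))%E => //.
rewrite (decoupling hY.1 _ mf); last 2 first.
- by move=> k /= /eqP ->; rewrite eq_sym in ij *.
- by move=> z; rewrite lee_fin sqr_ge0.
transitivity (\int[P]_w ((Y i w ^+ 2)%:E + v%:E))%E.
  apply: eq_integral => w _; rewrite /f /=.
  under eq_integral do rewrite -[Y j _]mul1r.
  by rewrite (std_quad hY) expr1n mul1r EFinD.
have v0 : 0 <= v.
  by have [_ _ h] := hY.2 0%N; rewrite -lee_fin -h integral_ge0 // => w _; rewrite lee_fin sqr_ge0.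
rewrite ge0_integralD //; last 2 first.
- by move=> w _; rewrite lee_fin sqr_ge0.
- by apply/measurable_EFinP; apply: measurable_funX; exact: measurable_funP.
have [_ _ ->] := hY.2 i.
rewrite integral_cst //= probability_setT mule1 -EFinD; congr EFin; ring.
Qed.

Lemma integrable_sqr_of (f : T -> R) (v : R) : measurable_fun setT f ->
  (\int[P]_w (f w ^+ 2)%:E = v%:E)%E -> P.-integrable setT (fun w => (f w ^+ 2)%:E).
Proof.
move=> mf h; apply/integrableP; split; first by apply/measurable_EFinP; exact: measurable_funX.
under eq_integral do rewrite gee0_abs ?lee_fin ?sqr_ge0 //.
by rewrite h ltry.
Qed.

(** The third power is squeezed between even ones: (x + y)^3 <= 4 x^3 + 4 y^3 and 4 z^3 <= 2 s z^2 +
    (2 / s) z^4 for nonnegative arguments. Each variable contributes 2 + 2 * 96 = 194. *)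
Lemma gauss_third_moment i j :
  (\int[P]_w ((`|X i w| + `|X j w|) ^+ 3)%:E <= (392 * s ^+ 3)%:E)%E.
Proof.
have mX k : measurable_fun setT (X k) by exact: measurable_funP.
pose h (k : nat) (w : T) : R := 2 * s * X k w ^+ 2 + 2 / s * X k w ^+ 4.
have h0 k w : 0 <= h k w.
  apply: addr_ge0; apply: mulr_ge0; rewrite ?sqr_ge0 ?exprn_even_ge0 //.
    by rewrite mulr_ge0 // ltW.
  by rewrite divr_ge0 // ltW.
have mh k : measurable_fun setT (fun w => (h k w)%:E).
  apply/measurable_EFinP; apply: measurable_funD; apply: measurable_funM => //;
    exact: measurable_funX.
have hk k : (\int[P]_w (h k w)%:E <= (194 * s ^+ 3)%:E)%E.
  have m2 m : measurable_fun setT (fun w => (X k w ^+ m)%:E).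
    by apply/measurable_EFinP; exact: measurable_funX.
  rewrite (_ : (\int[P]_w _ = \int[P]_w ((2 * s)%:E * (X k w ^+ 2)%:E +
      (2 / s)%:E * (X k w ^+ 4)%:E))%E); last by apply: eq_integral => w _; rewrite -!EFinM.
  rewrite ge0_integralD //; last 4 first.
  - by move=> w _; rewrite -EFinM lee_fin mulr_ge0 ?sqr_ge0 // mulr_ge0 // ltW.
  - exact: emeasurable_funM.
  - by move=> w _; rewrite -EFinM lee_fin mulr_ge0 ?divr_ge0 ?(ltW s0) // exprn_even_ge0.
  - exact: emeasurable_funM.
  rewrite !ge0_integralZl //; last 4 first.
  - by move=> w _; rewrite lee_fin exprn_even_ge0.
  - by rewrite lee_fin divr_ge0 // ltW.
  - by move=> w _; rewrite lee_fin sqr_ge0.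
  - by rewrite lee_fin mulr_ge0 // ltW.
  have [_ _ ->] := (gauss_std_seq s0 hX).2 k.
  rewrite (@gauss_ge0_integral _ _ _ P X s hX k (fun x : R => (x ^+ 4)%:E)); last 2 first.
  - by apply/measurable_EFinP; exact: measurable_funX.
  - by move=> x; rewrite lee_fin exprn_even_ge0.
  apply: (@le_trans _ _ ((2 * s)%:E * (s ^+ 2)%:E + (2 / s)%:E * (96 * s ^+ 4)%:E)%E).
    apply: leeD => //; apply: lee_wpmul2l; first by rewrite lee_fin divr_ge0 // ltW.
    exact: normal_fourth_moment.
  rewrite -!EFinM -EFinD lee_fin (_ : _ + _ = 194 * s ^+ 3) //.
  by field; rewrite gt_eqF.
apply: (@le_trans _ _ (\int[P]_w ((h i w)%:E + (h j w)%:E))%E); last first.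
  rewrite ge0_integralD //; last 2 first.
  - by move=> w _; rewrite lee_fin.
  - by move=> w _; rewrite lee_fin.
  apply: (le_trans (leeD (hk i) (hk j))); rewrite -EFinD lee_fin.
  have : 0 <= s ^+ 3 by rewrite exprn_ge0 // ltW.
  lra.
apply: ge0_le_integral => //.
- apply/measurable_EFinP; apply: measurable_funX; apply: measurable_funD;
    exact: measurableT_comp.
- exact: emeasurable_funD.
move=> w _; rewrite -EFinD lee_fin /h.
have abs2 (x : R) : x ^+ 2 = `|x| ^+ 2 by rewrite real_normK // num_real.
have abs4 (x : R) : x ^+ 4 = `|x| ^+ 4.
  by rewrite -normrX ger0_norm // exprn_even_ge0.
rewrite (abs2 (X i w)) (abs2 (X j w)) (abs4 (X i w)) (abs4 (X j w)).
have := normr_ge0 (X i w); have := normr_ge0 (X j w).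
move: `|X i w| `|X j w| => x y y0 x0.
have cube z : 0 <= z -> 4 * z ^+ 3 <= 2 * s * z ^+ 2 + 2 / s * z ^+ 4.
  move=> z0; rewrite -subr_ge0 (_ : _ - _ = 2 / s * (z * (z - s)) ^+ 2); last first.
    by field; rewrite gt_eqF.
  by rewrite mulr_ge0 ?sqr_ge0 // divr_ge0 // ltW.
have := cube x x0; have := cube y y0.
have : (x + y) ^+ 3 <= 4 * x ^+ 3 + 4 * y ^+ 3.
  rewrite -subr_ge0 (_ : _ - _ = 3 * (x + y) * (x - y) ^+ 2); last by ring.
  by rewrite mulr_ge0 ?sqr_ge0 // mulr_ge0 // addr_ge0.
lra.
Qed.

(** The linear terms have mean 0. The mixed product is written as ((X_i + X_j)^2 - X_i^2 - X_j^2) /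
    2, so that its integrability and its vanishing mean both come from [std_pair]; this is the
    origin of [k3]. *)
Lemma gauss_swap n (al A B : nat -> R) (b : R) i j : i != j ->
  (forall k, `|A k| <= b) -> (forall k, `|B k| <= b) ->
  `|expect P (fun w => smooth_box n (fun k => al k + (A k * X i w + B k * X j w))) -
    (smooth_box n al + s ^+ 2 / 2 * (box_quad n al A + box_quad n al B))| <=
  392 * (16 * (n%:R * b)) ^+ 3 * s ^+ 3.
Proof.
move=> ij hA hB; have b0 : 0 <= b := le_trans (normr_ge0 _) (hA 0%N).
have mX k : measurable_fun setT (X k) by exact: measurable_funP.
have uG : unit_fun (fun w => smooth_box n (fun k => al k + (A k * X i w + B k * X j w))).
  apply: (@unit_smooth_box _ _ _ n (fun k w => al k + (A k * X i w + B k * X j w))) => k.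
  by apply: measurable_funD => //; apply: measurable_funD; apply: measurable_funM.
set G := fun w => smooth_box n _ in uG *.
have hstd := gauss_std_seq s0 hX.
pose k3 := box_cross n al A B / 4.
pose k1 := box_quad n al A / 2 - k3; pose k2 := box_quad n al B / 2 - k3.
pose Tf w : R := smooth_box n al + (box_lin n al A * X i w + (box_lin n al B * X j w +
  (k1 * X i w ^+ 2 + (k2 * X j w ^+ 2 + k3 * (X i w + X j w) ^+ 2)))).
have iX k : P.-integrable setT (fun w => (X k w)%:E) by have [] := hstd.2 k.
have iX2 k : P.-integrable setT (fun w => (X k w ^+ 2)%:E).
  by have [_ _ h] := hstd.2 k; exact: integrable_sqr_of h.
have iXX : P.-integrable setT (fun w => ((X i w + X j w) ^+ 2)%:E).
  by apply: (integrable_sqr_of _ (std_pair hstd ij)); exact: measurable_funD.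
have i5 := integrableZl measurableT k3 iXX.
have i4 := integrableD measurableT (integrableZl measurableT k2 (iX2 j)) i5.
have i3 := integrableD measurableT (integrableZl measurableT k1 (iX2 i)) i4.
have i2 := integrableD measurableT (integrableZl measurableT (box_lin n al B) (iX j)) i3.
have i1 := integrableD measurableT (integrableZl measurableT (box_lin n al A) (iX i)) i2.
have i0 := integrableD measurableT
  (finite_measure_integrable_cst P (smooth_box n al) measurableT) i1.
have iT : P.-integrable setT (fun w => (Tf w)%:E).
  by apply: eq_integrable i0 => // w _; rewrite /Tf -?EFinM -?EFinD.
have TE : (\int[P]_w (Tf w)%:E =
    (smooth_box n al + s ^+ 2 / 2 * (box_quad n al A + box_quad n al B))%:E)%E.
  rewrite (_ : (\int[P]_w _ = \int[P]_w ((smooth_box n al)%:E +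
    ((box_lin n al A)%:E * (X i w)%:E + ((box_lin n al B)%:E * (X j w)%:E +
    (k1%:E * (X i w ^+ 2)%:E + (k2%:E * (X j w ^+ 2)%:E +
     k3%:E * ((X i w + X j w) ^+ 2)%:E))))))%E); last first.
    by apply: eq_integral => w _; rewrite -?EFinM -?EFinD.
  rewrite integralD //; last exact: finite_measure_integrable_cst.
  rewrite integralD //; last exact: integrableZl.
  rewrite integralD //; last exact: integrableZl.
  rewrite integralD //; last exact: integrableZl.
  rewrite integralD //; last exact: integrableZl.
  rewrite !integralZl // (std_pair hstd ij).
  have [_ -> ->] := hstd.2 i; have [_ -> ->] := hstd.2 j.
  rewrite integral_cst //= probability_setT !mule0 mule1 !add0e -!EFinM -!EFinD.
  congr EFin; rewrite /k1 /k2 /k3; ring.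
rewrite -lee_fin -abse_EFin EFinB -TE -expectE // -integralB //; last exact: unit_fun_integrable.
apply: (le_trans (le_abse_integral _ _ _)) => //.
  apply: emeasurable_funB; [exact/measurable_EFinP/uG.1|].
  by apply/measurable_EFinP; case/integrableP: iT => /measurable_EFinP.
pose C := (16 * (n%:R * b)) ^+ 3.
have C0 : 0 <= C by apply: exprn_ge0; rewrite mulr_ge0 // mulr_ge0.
apply: (@le_trans _ _ (\int[P]_w (C%:E * ((`|X i w| + `|X j w|) ^+ 3)%:E))%E); last first.
  rewrite ge0_integralZl //; last first.
    by apply/measurable_EFinP; apply: measurable_funX; apply: measurable_funD;
      exact: measurableT_comp.
  rewrite (_ : 392 * _ * _ = C * (392 * s ^+ 3)); last by rewrite /C; ring.
  rewrite (EFinM C (392 * s ^+ 3)); apply: lee_wpmul2l; first by rewrite lee_fin.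
  exact: gauss_third_moment.
apply: ge0_le_integral => //.
- apply: measurableT_comp => //; apply: emeasurable_funB; first exact/measurable_EFinP/uG.1.
  by apply/measurable_EFinP; case/integrableP: iT => /measurable_EFinP.
- apply: emeasurable_funM => //; apply/measurable_EFinP; apply: measurable_funX.
  by apply: measurable_funD; exact: measurableT_comp.
move=> w _; rewrite -EFinB abse_EFin -EFinM lee_fin.
have hbe k : `|A k * X i w + B k * X j w| <= b * (`|X i w| + `|X j w|).
  apply: (le_trans (ler_normD _ _)); rewrite !normrM mulrDr.
  by apply: lerD; apply: ler_wpM2r.
have := smooth_box_taylor n al hbe.
rewrite box_lin_comb box_quad_comb -/(G w).
have -> : smooth_box n al + (X i w * box_lin n al A + X j w * box_lin n al B) +
  (X i w ^+ 2 * box_quad n al A + X j w ^+ 2 * box_quad n al B +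
   X i w * X j w * box_cross n al A B) / 2 = Tf w.
  by rewrite /Tf /k1 /k2 /k3; field.
rewrite (_ : 16 * (n%:R * (b * _)) = 16 * (n%:R * b) * (`|X i w| + `|X j w|)); last by ring.
by rewrite (exprMn _ (16 * (n%:R * b))).
Qed.

End gauss_swap.

Section expect_bounds.
Context (R : realType) (d : measure_display) (T : measurableType d)
  (P : probability T R).

Lemma expect_cst (c : R) : expect P (fun=> c) = c.
Proof.
by rewrite /expect (_ : (\int[P]_w _)%E = c%:E) //= integral_cst //= probability_setT mule1.
Qed.

Lemma expect_itv (f : T -> R) : unit_fun f -> 0 <= expect P f <= 1.
Proof.
move=> uf; rewrite -!lee_fin -expectE //; apply/andP; split.
  by apply: integral_ge0 => w _; rewrite lee_fin; case/andP: (uf.2 w).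
rewrite expectE // lee_fin -(expect_cst 1) -[leRHS]addr0; apply: expect_le => //.
  by split => // w; rewrite lexx ler01.
by move=> w; rewrite addr0; case/andP: (uf.2 w).
Qed.

End expect_bounds.

Section expect_independent.
Context (R : realType) (d : measure_display) (T : measurableType d)
  (P : probability T R) (X : nat -> {RV P >-> R}).
Hypothesis hX : mutually_independent P (fun i => X i : T -> R).

Lemma expect_decoupling (p q : pred nat) (f : sub_space X p * sub_space X q -> R) :
  (forall i, p i -> ~~ q i) -> unit_fun f ->
  unit_fun ((fun w => expect P (fun v => f (w, v))) : T -> R) /\
  expect P (fun w => f (w, w)) = expect P (fun w => expect P (fun v => f (w, v))).
Proof.
move=> pq uf; have mf : measurable_fun setT (fun z => (f z)%:E) by apply/measurable_EFinP; exact: uf.1.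
have f0 z : (0 <= (f z)%:E)%E by rewrite lee_fin; case/andP: (uf.2 z).
have uv w : unit_fun ((fun v => f (w, v)) : T -> R).
  split; last by move=> v; exact: uf.2.
  have := measurableT_comp uf.1 (measurable_pair1 w); rewrite /comp => h.
  exact: (measurableT_comp h (@sub_space_measurable_fun _ _ _ P X q)).
have u1 : unit_fun ((fun w => expect P (fun v => f (w, v))) : T -> R).
  split; last by move=> w; exact: expect_itv.
  apply/measurable_EFinP; rewrite (_ : _ \o _ = fun w => (\int[P]_v (f (w, v))%:E)%E).
    exact: (decoupling_measurable mf f0).
  by apply/funext => w /=; rewrite -expectE.
split => //; rewrite {1}/expect (decoupling hX pq mf f0).
by rewrite {2}/expect; congr fine; apply: eq_integral => w _; rewrite expectE.
Qed.

End expect_independent.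

Section rademacher.
Context (R : realType) (d : measure_display) (T : measurableType d)
  (P : probability T R) (e : nat -> {RV P >-> R}).

Definition sign_seq :=
  [/\ mutually_independent P (fun k => e k : T -> R),
      (forall k w, e k w = 1 \/ e k w = -1),
      (forall k, P (e k @^-1` [set 1]) = (2^-1)%:E) &
      (forall k, P (e k @^-1` [set -1]) = (2^-1)%:E)].

Hypothesis he : sign_seq.

Lemma expect_sign (p : pred nat) k (h : R -> T -> R) : ~~ p k ->
  unit_fun (h 1 : sub_space e p -> R) -> unit_fun (h (-1) : sub_space e p -> R) ->
  expect P (fun w => h (e k w) w) = (expect P (h 1) + expect P (h (-1))) / 2.
Proof.
case: he => indep eE P1 PN1 pk u1 u2.
have mt (g : T -> R) : unit_fun (g : sub_space e p -> R) -> unit_fun g.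
  by case=> mg g01; split => //; exact: (measurableT_comp mg (@sub_space_measurable_fun _ _ _ P e p)).
have half (g : T -> R) (c : R) : unit_fun (g : sub_space e p -> R) ->
    P (e k @^-1` [set c]) = (2^-1)%:E ->
    (\int[P]_w (g w * \1_(e k @^-1` [set c]) w)%:E = (expect P g / 2)%:E)%E.
  move=> ug Pc.
  have mA : measurable (e k @^-1` [set c] : set (sub_space e (pred1 k))).
    by apply: sub_sigma_algebra; apply: cyl_preim; rewrite //= eqxx.
  have mA' := sub_space_measurable mA.
  pose f (z : sub_space e p * sub_space e (pred1 k)) : \bar R :=
    (g z.1 * \1_(e k @^-1` [set c]) z.2)%:E.
  rewrite -[LHS]/(\int[P]_w f (w, w))%E (decoupling indep); last 3 first.
  - by move=> i pi /=; apply: contraTneq pi => ->.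
  - apply/measurable_EFinP; apply: measurable_funM.
      exact: (measurableT_comp ug.1 measurable_fst).
    exact: (measurableT_comp (measurable_indic mA) measurable_snd).
  - move=> z; rewrite lee_fin mulr_ge0 //; first by case/andP: (ug.2 z.1).
  transitivity (\int[P]_w ((2^-1)%:E * (g w)%:E))%E.
    apply: eq_integral => w _; rewrite /f /=.
    under eq_integral do rewrite EFinM.
    rewrite ge0_integralZl_EFin //; last 2 first.
    - by apply/measurable_EFinP; exact: measurable_indic.
    - by case/andP: (ug.2 w).
    by rewrite (integral_indic P measurableT mA') setIT muleC; congr (_ * _)%E; exact: Pc.
  rewrite ge0_integralZl //; last 2 first.
  - by apply/measurable_EFinP; exact: (mt g ug).1.
  - by move=> w _; rewrite lee_fin; case/andP: (ug.2 w).
  - by rewrite expectE; [rewrite -EFinM mulrC|exact: mt].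
apply: EFin_inj; rewrite mulrDl EFinD -(half _ 1) // -(half _ (-1)) //.
rewrite -ge0_integralD //; last 4 first.
- by move=> w _; rewrite lee_fin mulr_ge0 //; case/andP: (u1.2 w).
- apply/measurable_EFinP; apply: measurable_funM; first exact: (mt _ u1).1.
  by apply: measurable_indic; rewrite -[X in measurable X]setTI; exact: measurable_funP.
- by move=> w _; rewrite lee_fin mulr_ge0 //; case/andP: (u2.2 w).
- apply/measurable_EFinP; apply: measurable_funM; first exact: (mt _ u2).1.
  by apply: measurable_indic; rewrite -[X in measurable X]setTI; exact: measurable_funP.
have hE w : h (e k w) w = h 1 w * \1_(e k @^-1` [set 1]) w +
    h (-1) w * \1_(e k @^-1` [set -1]) w.
  have ind (c : R) : \1_(e k @^-1` [set c]) w = (e k w == c)%:R :> R.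
    rewrite indicE (_ : (w \in _) = (e k w == c)) //.
    by apply/idP/eqP => [|E]; rewrite inE.
  rewrite !ind; have n1 : (1 == -1 :> R) = false by apply/eqP; lra.
  have [->|->] := eE k w; first by rewrite eqxx n1 mulr1 mulr0 addr0.
  by rewrite eqxx (eq_sym (-1)) n1 mulr1 mulr0 add0r.
rewrite -expectE; first by apply: eq_integral => w _; rewrite hE EFinD.
split; last by move=> w; have [->|->] := eE k w; [exact: u1.2|exact: u2.2].
rewrite (funext hE); apply: measurable_funD; apply: measurable_funM;
  try exact: (mt _ u1).1; try exact: (mt _ u2).1;
  by apply: measurable_indic; rewrite -[X in measurable X]setTI; exact: measurable_funP.
Qed.

Lemma expect_sign2 (p : pred nat) i j (h : R -> R -> T -> R) : ~~ p i -> ~~ p j -> i != j ->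
  (forall x, unit_fun (h x 1 : sub_space e p -> R)) ->
  (forall x, unit_fun (h x (-1) : sub_space e p -> R)) ->
  (forall x, unit_fun (fun w : sub_space e (predU p (pred1 j)) => h x (e j w) w)) ->
  expect P (fun w => h (e i w) (e j w) w) =
  (expect P (h 1 1) + expect P (h 1 (-1)) + expect P (h (-1) 1) + expect P (h (-1) (-1))) / 4.
Proof.
move=> pi pj ij u1 u2 u.
rewrite (@expect_sign (predU p (pred1 j)) i (fun x w => h x (e j w) w)) //; last first.
  by rewrite /= negb_or pi.
rewrite (@expect_sign p j (h 1)) // (@expect_sign p j (h (-1))) //.
by field.
Qed.

End rademacher.

Lemma mean4_dist (R : realFieldType) (p1 p2 p3 p4 q1 q2 q3 q4 E M D : R) :
  `|(q1 + q2 + q3 + q4) / 4 - E| <= D -> `|p1 - q1| <= M -> `|p2 - q2| <= M ->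
  `|p3 - q3| <= M -> `|p4 - q4| <= M -> `|(p1 + p2 + p3 + p4) / 4 - E| <= M + D.
Proof.
move=> hE h1 h2 h3 h4.
have -> : (p1 + p2 + p3 + p4) / 4 - E =
    ((p1 - q1) + (p2 - q2) + (p3 - q3) + (p4 - q4)) / 4 + ((q1 + q2 + q3 + q4) / 4 - E).
  by field.
apply: (le_trans (ler_normD _ _)); apply: lerD => //.
rewrite normrM [X in _ * X]gtr0_norm ?invr_gt0 // ler_pdivrMr //.
have -> : M * 4 = M + M + M + M by ring.
by do 3 (apply: (le_trans (ler_normD _ _)); apply: lerD => //).
Qed.

Section lindeberg.
Context (R : realType) (d d' : measure_display) (T : measurableType d)
  (T' : measurableType d') (P : probability T R) (P' : probability T' R)
  (X : nat -> {RV P >-> R}) (e : nat -> {RV P' >-> R}) (s kap : R).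
Hypotheses (s0 : 0 < s) (hX : gauss_seq X s) (he : sign_seq e)
  (kap0 : 0 <= kap) (kapE : kap ^+ 2 = s ^+ 2 / 2).
Variables (n L : nat) (A B : nat -> nat -> R) (b : R).
Hypotheses (hA : forall i l, `|A i l| <= b) (hB : forall i l, `|B i l| <= b).

(* The rescaled pairs [e_(2l) + e_(2l+1)] and [e_(2l) - e_(2l+1)] are to be replaced by the
   Gaussian variables [X_l] and [X_(L + l)]. *)
Definition sign_form m (al : nat -> R) (w : T') i : R :=
  al i + \sum_(l < m) (A i l * (kap * (e l.*2 w + e l.*2.+1 w)) +
                       B i l * (kap * (e l.*2 w - e l.*2.+1 w))).

Definition gauss_form m (al : nat -> R) (w : T) i : R :=
  al i + \sum_(l < m) (A i l * X l w + B i l * X (L + l)%N w).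

Lemma measurable_gauss_form m al i : measurable_fun setT (gauss_form m al ^~ i).
Proof.
apply: measurable_funD => //; apply: measurable_sum => l; apply: measurable_funD;
  exact: measurable_funM.
Qed.

Lemma measurable_sign_form (p : pred nat) m al i : (forall j, (j < m.*2)%N -> p j) ->
  measurable_fun setT (sign_form m al ^~ i : sub_space e p -> R).
Proof.
move=> pm; have h j : (j < m.*2)%N -> measurable_fun setT (e j : sub_space e p -> R).
  by move=> /pm pj; exact: sub_space_RV.
apply: measurable_funD => //; apply: measurable_sum => l.
have l1 : (l.*2.+1 < m.*2)%N by rewrite -doubleS leq_double; exact: ltn_ord.
have h1 := h _ l1; have h0 := h _ (ltnW l1).
apply: measurable_funD; apply: measurable_funM => //; apply: measurable_funM => //.
  exact: measurable_funD.
exact: measurable_funB.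
Qed.

Let sign_box m al x y : R :=
  smooth_box n (fun i => al i + (A i m * (kap * (x + y)) + B i m * (kap * (x - y)))).

Let gauss_box m al (w : T) : R :=
  smooth_box n (fun i => al i + (A i m * X m w + B i m * X (L + m)%N w)).

(** For two signs exactly one of x + y and x - y is nonzero, so the cross term vanishes pointwise,
    and the squares of kap (x + y) and kap (x - y) average to 2 kap^2 = s^2. Second moments thus
    agree with those of two independent Gaussians although sum and difference are dependent. The
    constant is 392 from the Gaussian side plus 8 = 2^3 from the signs. *)
Lemma sign_gauss_swap m al : (m < L)%N ->
  `|(sign_box m al 1 1 + sign_box m al 1 (-1) + sign_box m al (-1) 1 +
     sign_box m al (-1) (-1)) / 4 - expect P (gauss_box m al)| <=
  400 * (16 * (n%:R * b)) ^+ 3 * s ^+ 3.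
Proof.
move=> mL; have mLm : m != (L + m)%N by lia.
have := @gauss_swap _ _ _ P X s s0 hX n al (A ^~ m) (B ^~ m) b m (L + m)%N mLm
  (hA ^~ m) (hB ^~ m).
have ks : kap <= s.
  rewrite -(@ler_pXn2r _ 2%N) ?nnegrE ?(ltW s0) // kapE.
  have := sqr_ge0 s; lra.
have tay x y : x = 1 \/ x = -1 -> y = 1 \/ y = -1 ->
  `|sign_box m al x y - (smooth_box n al +
    (kap * (x + y) * box_lin n al (A ^~ m) + kap * (x - y) * box_lin n al (B ^~ m)) +
    ((kap * (x + y)) ^+ 2 * box_quad n al (A ^~ m) +
     (kap * (x - y)) ^+ 2 * box_quad n al (B ^~ m)) / 2)| <= (16 * (n%:R * (b * (2 * s)))) ^+ 3.
  move=> hx hy.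
  have hbe i : `|A i m * (kap * (x + y)) + B i m * (kap * (x - y))| <= b * (2 * s).
    have b0 : 0 <= b := le_trans (normr_ge0 _) (hA 0%N 0%N).
    apply: (@le_trans _ _ (b * (2 * kap))); last by rewrite ler_wpM2l //; lra.
    apply: (le_trans (ler_normD _ _)); rewrite (normrM (A i m)) (normrM (B i m)).
    have k2 : `|2 * kap| = 2 * kap by rewrite ger0_norm // mulr_ge0.
    case: hx => ->; case: hy => ->;
      rewrite ?subrr ?opprK ?addNr ?mulr0 ?normr0 ?mulr0 ?addr0 ?add0r.
    - by rewrite (_ : kap * (1 + 1) = 2 * kap) ?k2; [rewrite ler_wpM2r // mulr_ge0|ring].
    - by rewrite (_ : kap * (1 + 1) = 2 * kap) ?k2; [rewrite ler_wpM2r // mulr_ge0|ring].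
    - by rewrite (_ : kap * (-1 - 1) = - (2 * kap)) ?normrN ?k2;
        [rewrite ler_wpM2r // mulr_ge0|ring].
    - by rewrite (_ : kap * (-1 - 1) = - (2 * kap)) ?normrN ?k2;
        [rewrite ler_wpM2r // mulr_ge0|ring].
  have := smooth_box_taylor n al hbe.
  rewrite box_lin_comb box_quad_comb.
  rewrite (_ : kap * (x + y) * (kap * (x - y)) = 0) ?mul0r ?addr0 //.
  by case: hx => ->; case: hy => ->; ring.
have o1 : (1 : R) = 1 \/ (1 : R) = -1 by left.
have o2 : (-1 : R) = 1 \/ (-1 : R) = -1 by right.
have := tay _ _ o1 o1; have := tay _ _ o1 o2; have := tay _ _ o2 o1; have := tay _ _ o2 o2.
rewrite -/(gauss_box m al).
rewrite (_ : (16 * (n%:R * (b * (2 * s)))) ^+ 3 = 8 * ((16 * (n%:R * b)) ^+ 3 * s ^+ 3)); last by ring.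
rewrite -!(mulrA _ ((16 * (n%:R * b)) ^+ 3)).
move: (expect P (gauss_box m al)) (_ ^+ 3 * s ^+ 3) => E D.
move: (sign_box m al 1 1) (sign_box m al 1 (-1)) (sign_box m al (-1) 1) (sign_box m al (-1) (-1)).
move=> p1 p2 p3 p4.
rewrite (_ : s ^+ 2 / 2 = kap ^+ 2) //.
move: (smooth_box n al) (box_lin n al _) (box_lin n al _) (box_quad n al _) (box_quad n al _).
move=> F la lb qa qb.
rewrite !ler_norml => /andP[a1 a2] /andP[b1 b2] /andP[c1 c2] /andP[d1 d2] /andP[g1 g2].
by apply/andP; split; lra.
Qed.

(** Induction on the number of pairs with a free offset: conditioning on the last pair moves its
    contribution into [al], the induction hypothesis applies at each of its four values, and one
    [sign_gauss_swap] is paid per pair. *)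
Lemma lindeberg m al : (m <= L)%N ->
  `|expect P' (fun w => smooth_box n (sign_form m al w)) -
    expect P (fun w => smooth_box n (gauss_form m al w))| <=
  m%:R * (400 * (16 * (n%:R * b)) ^+ 3 * s ^+ 3).
Proof.
set D := 400 * _ * _.
have ug k be : unit_fun (fun w => smooth_box n (gauss_form k be w)).
  by apply: (@unit_smooth_box _ _ _ n (fun i w => gauss_form k be w i)) => i; exact: measurable_gauss_form.
elim: m al => [|m IH] al mL.
  rewrite mul0r /sign_form /gauss_form.
  under [X in expect _ X]eq_fun do under [X in smooth_box _ X]eq_fun do rewrite big_ord0 addr0.
  under [X in _ - expect _ X]eq_fun do under [X in smooth_box _ X]eq_fun do rewrite big_ord0 addr0.
  by rewrite !expect_cst subrr normr0.
pose bal x y i := al i + (A i m * (kap * (x + y)) + B i m * (kap * (x - y))).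
pose h x y w := smooth_box n (sign_form m (bal x y) w).
have usign (p : pred nat) (f g : T' -> R) : (forall j, (j < m.*2)%N -> p j) ->
    measurable_fun setT (f : sub_space e p -> R) -> measurable_fun setT (g : sub_space e p -> R) ->
    unit_fun ((fun w => h (f w) (g w) w) : sub_space e p -> R).
  move=> pm mf mg; rewrite /h.
  apply: (@unit_smooth_box _ _ (sub_space e p) n
    (fun i w => sign_form m (bal (f w) (g w)) w i)) => i.
  have ms := measurable_sign_form (fun=> 0) i pm.
  rewrite (_ : (fun w => _) = fun w => bal (f w) (g w) i + sign_form m (fun=> 0) w i); last first.
    by apply/funext => w; rewrite /sign_form add0r.
  apply: measurable_funD => //; apply: measurable_funD => //.
  apply: measurable_funD; apply: measurable_funM => //; apply: measurable_funM => //.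
    exact: measurable_funD.
  exact: measurable_funB.
have -> : expect P' (fun w => smooth_box n (sign_form m.+1 al w)) =
    (expect P' (h 1 1) + expect P' (h 1 (-1)) + expect P' (h (-1) 1) +
     expect P' (h (-1) (-1))) / 4.
  pose p := [pred j | (j < m.*2)%N].
  rewrite -(@expect_sign2 _ _ _ P' e he p m.*2 m.*2.+1 h) /=; first last.
  - move=> x; apply: (@usign _ (fun=> x) (e m.*2.+1)) => //; first by move=> j /= ->.
    by apply: sub_space_RV; rewrite /= eqxx orbT.
  - by move=> x; exact: (@usign p (fun=> x) (fun=> -1)).
  - by move=> x; exact: (@usign p (fun=> x) (fun=> 1)).
  - by rewrite neq_ltn ltnSn.
  - by rewrite -leqNgt; exact: leqnSn.
  - by rewrite ltnn.
  congr (expect _ _); apply/funext => w; congr (smooth_box _ _); apply/funext => i.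
  rewrite /sign_form big_ord_recr /= /bal; ring.
pose q := pred2 m (L + m)%N.
have gdec : unit_fun (fun w => expect P (gauss_box m (gauss_form m al w))) /\
    expect P (fun w => smooth_box n (gauss_form m.+1 al w)) =
    expect P (fun w => expect P (gauss_box m (gauss_form m al w))).
  pose f (z : sub_space X (predC q) * sub_space X q) :=
    smooth_box n (fun i => gauss_form m al z.1 i + (A i m * X m z.2 + B i m * X (L + m)%N z.2)).
  have uf : unit_fun f.
    apply: (@unit_smooth_box _ _ _ n (fun i (z : sub_space X (predC q) * sub_space X q) =>
       gauss_form m al z.1 i + (A i m * X m z.2 + B i m * X (L + m)%N z.2))) => i.
    have m2 k : q k -> measurable_fun setT
        (fun z : sub_space X (predC q) * sub_space X q => X k z.2).
      move=> qk; have mk : measurable_fun setT (X k : sub_space X q -> R).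
        exact: sub_space_RV.
      exact: (measurableT_comp mk measurable_snd).
    apply: measurable_funD; last first.
      by apply: measurable_funD; apply: measurable_funM => //; apply: m2; rewrite /q /= eqxx ?orbT.
    apply: (@measurableT_comp _ _ _ _ _ _ (gauss_form m al ^~ i : sub_space X (predC q) -> R)
      _ fst) => //.
    have m1 (k : nat) : k != m -> k != (L + m)%N ->
        measurable_fun setT (X k : sub_space X (predC q) -> R).
      by move=> k1 k2; apply: sub_space_RV; rewrite /= negb_or k1.
    apply: measurable_funD => //; apply: measurable_sum => l; apply: measurable_funD;
      apply: measurable_funM => //; apply: m1; have := ltn_ord l; lia.
  have [u1 u2] := @expect_decoupling _ _ _ P X hX.1 (predC q) q f (fun i h => h) uf.
  split => //; rewrite -u2; congr (expect _ _); apply/funext => w; congr (smooth_box _ _).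
  by apply/funext => i; rewrite /gauss_form big_ord_recr /= addrA.
rewrite gdec.2.
have um := expect_mean4 P (ug m (bal 1 1)) (ug m (bal 1 (-1))) (ug m (bal (-1) 1)) (ug m (bal (-1) (-1))).
have step : `|expect P (fun w => (smooth_box n (gauss_form m (bal 1 1) w) +
    smooth_box n (gauss_form m (bal 1 (-1)) w) + smooth_box n (gauss_form m (bal (-1) 1) w) +
    smooth_box n (gauss_form m (bal (-1) (-1)) w)) / 4) -
    expect P (fun w => expect P (gauss_box m (gauss_form m al w)))| <= D.
  apply: expect_dist; [exact: um.1|exact: gdec.1|].
  move=> w; apply: le_trans (sign_gauss_swap (gauss_form m al w) mL).
  suff sE x y : smooth_box n (gauss_form m (bal x y) w) = sign_box m (gauss_form m al w) x y.
    by rewrite !sE.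
  by congr (smooth_box _ _); apply/funext => i; rewrite /bal /gauss_form addrAC.
move: step; rewrite um.2 (_ : m.+1%:R * D = m%:R * D + D); last by rewrite -(natr1 m) mulrDl (mul1r D).
by move/mean4_dist; apply; exact: IH (ltnW mL).
Qed.

End lindeberg.

(** * Sign polynomials and Gaussian polynomials *)

Section independent_blocks.
Context (R : realType) (d : measure_display) (T : measurableType d)
  (P : probability T R) (X : nat -> {RV P >-> R}) (p : nat -> pred nat).
Hypothesis hX : mutually_independent P (fun i => X i : T -> R).
Hypothesis p_disj : forall i j k, i != j -> p i k -> ~~ p j k.

Lemma indep_block_events (D : nat -> set T) (s : seq nat) :
  (forall i, measurable (D i : set (sub_space X (p i)))) -> uniq s ->
  P (\bigcap_(i in [set` s]) D i) = (\prod_(i <- s) P (D i))%E.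
Proof.
move=> mD; elim: s => [|a s IH] /=.
  rewrite big_nil (_ : \bigcap_(i in _) _ = setT) ?probability_setT //.
  by rewrite predeqE => w; split => // _ i.
move=> /andP[a_s us]; rewrite big_cons -IH //.
rewrite (_ : \bigcap_(i in [set` a :: s]) D i = D a `&` \bigcap_(i in [set` s]) D i).
  apply: (indep_sub_space hX (p := p a) (q := fun k => has (p ^~ k) s)) => //.
    move=> i pi; apply/hasPn => j js; apply: p_disj pi.
    by apply: contraNneq a_s => ->.
  rewrite bigcap_seq big_seq; apply: bigsetI_measurable => i i_s.
  apply: (@sub_space_le _ _ _ P X (p i)) => // k pk; apply/hasP; by exists i.
rewrite predeqE => w; split => [h|[h1 h2] i /=].
  by split => [|i i_s]; apply: h; rewrite /= in_cons ?eqxx // (i_s : i \in s) orbT.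
by rewrite in_cons => /orP[/eqP ->|i_s] //; exact: h2.
Qed.

Lemma indep_blocks (Y : nat -> {RV P >-> R}) :
  (forall i, measurable_fun setT (Y i : sub_space X (p i) -> R)) ->
  mutually_independent P (fun i => Y i : T -> R).
Proof.
move=> mY s A us mA; apply: (indep_block_events (D := fun i => Y i @^-1` A i)) => // i.
by rewrite -[X in measurable X]setTI; exact: mY.
Qed.

End independent_blocks.

Section sign_sums.
Context (R : realType) (d : measure_display) (T : measurableType d)
  (P : probability T R) (e : nat -> {RV P >-> R}).
Hypothesis he : sign_seq e.

Lemma sign_std : std_seq e 1.
Proof.
case: he => indep eE P1 PN1; split => // k.
have sq w : e k w ^+ 2 = 1 by have [->|->] := eE k w; ring.
have ek : P.-integrable setT (fun w => (e k w)%:E).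
  apply: (@le_integrable _ _ _ P setT _ _ (fun=> 1%E)) => //.
  - by apply/measurable_EFinP; exact: measurable_funP.
  - by move=> w _; rewrite /= lee_fin; have [->|->] := eE k w; rewrite ?normrN normr1.
  - exact: finite_measure_integrable_cst.
split => //; last first.
  by under eq_integral do rewrite sq; rewrite integral_cst //= probability_setT mule1.
have half (c : R) : P (e k @^-1` [set c]) = (2^-1)%:E ->
    (\int[P]_w (\1_(e k @^-1` [set c]) w)%:E = (2^-1)%:E)%E.
  by move=> <-; rewrite integral_indic ?setIT.
have ind (c : R) : P.-integrable setT (fun w => (\1_(e k @^-1` [set c]) w : R)%:E).
  have mA : measurable (e k @^-1` [set c]).
    by rewrite -[X in measurable X]setTI; exact: measurable_funP.
  exact: integrable_indic.
transitivity (\int[P]_w ((\1_(e k @^-1` [set 1]) w : R)%:E - (\1_(e k @^-1` [set -1]) w : R)%:E))%E.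
  apply: eq_integral => w _; rewrite -EFinB; congr EFin.
  have n1 : (1 == -1 :> R) = false by apply/eqP; lra.
  have E (c : R) : \1_(e k @^-1` [set c]) w = (e k w == c)%:R :> R.
    rewrite indicE (_ : (w \in _) = (e k w == c)) //.
    by apply/idP/eqP => [|E]; rewrite inE.
  by rewrite !E; have [->|->] := eE k w; rewrite eqxx ?(eq_sym (-1)) n1 ?subr0 ?sub0r.
by rewrite integralB // !half // -EFinB subrr.
Qed.

Definition pair_sum l : {RV P >-> R} := [the {mfun T >-> R} of e l.*2 \+ e l.*2.+1].
Definition pair_diff l : {RV P >-> R} := [the {mfun T >-> R} of e l.*2 \- e l.*2.+1].

Let blk (l : nat) : pred nat := fun k => k./2 == l.

Let blk_disj i j k : i != j -> blk i k -> ~~ blk j k.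
Proof. by rewrite /blk => ij /eqP E; rewrite E. Qed.

Let blk_meas l : measurable_fun setT (e l.*2 : sub_space e (blk l) -> R) /\
  measurable_fun setT (e l.*2.+1 : sub_space e (blk l) -> R).
Proof.
split; apply: sub_space_RV; first by rewrite /blk doubleK.
by rewrite /blk /= uphalf_double.
Qed.

Lemma std_pair_sum : std_seq pair_sum 2.
Proof.
have hs := sign_std; split.
  apply: (indep_blocks hs.1 blk_disj) => l; have [m0 m1] := blk_meas l.
  exact: (measurable_funD m0 m1).
move=> l; have [i0 z0 _] := hs.2 l.*2; have [i1 z1 _] := hs.2 l.*2.+1; split.
- by apply: eq_integrable (integrableD measurableT i0 i1).
- by under eq_integral do rewrite EFinD; rewrite integralD // z0 z1 adde0.
- have := @std_pair _ _ _ P e 1 l.*2 l.*2.+1 hs; rewrite mulr1; apply.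
  by rewrite neq_ltn ltnSn.
Qed.

Lemma std_pair_diff : std_seq pair_diff 2.
Proof.
have hs := sign_std; split.
  apply: (indep_blocks hs.1 blk_disj) => l; have [m0 m1] := blk_meas l.
  exact: (measurable_funB m0 m1).
move=> l; have [i0 z0 _] := hs.2 l.*2; have [i1 z1 _] := hs.2 l.*2.+1; split.
- by apply: eq_integrable (integrableB measurableT i0 i1).
- by under eq_integral do rewrite EFinB; rewrite integralB // z0 z1 sube0.
have [_ _ h2] := std_pair_sum.2 l.
have iS := integrable_sqr_of (measurable_funP (pair_sum l)) h2.
(* The squares of the sum and of the difference of two signs add up to 4. *)
rewrite (_ : (\int[P]_w _ = \int[P]_w (4%:E - (pair_sum l w ^+ 2)%:E))%E); last first.
  apply: eq_integral => w _; rewrite -EFinB /=; congr EFin.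
  case: he => _ eE _ _; have [->|->] := eE l.*2 w; have [->|->] := eE l.*2.+1 w; ring.
rewrite integralB //; last exact: finite_measure_integrable_cst.
by rewrite h2 integral_cst //= probability_setT mule1 -EFinB; congr EFin; ring.
Qed.

End sign_sums.

Section box_sandwich.
Context (R : realType).

Definition sgn_sum (i : nat) : R := if (i %% 4 == 0)%N then 1 else if (i %% 4 == 1)%N then -1 else 0.
Definition sgn_diff (i : nat) : R := if (i %% 4 == 2)%N then 1 else if (i %% 4 == 3)%N then -1 else 0.

Lemma sgn_sum_le1 i : `|sgn_sum i| <= 1.
Proof. by rewrite /sgn_sum; case: ifP => _; [|case: ifP => _]; rewrite ?normrN ?normr1 ?normr0. Qed.

Lemma sgn_diff_le1 i : `|sgn_diff i| <= 1.
Proof. by rewrite /sgn_diff; case: ifP => _; [|case: ifP => _]; rewrite ?normrN ?normr1 ?normr0. Qed.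

(* Four coordinates per point: the bounds on [u], [- u], [v] and [- v]. *)
Definition box_coord (ys : seq R) (u v : R -> R) (a eta : R) (i : nat) : R :=
  (sgn_sum i * u (nth 0 ys (i %/ 4)) + sgn_diff i * v (nth 0 ys (i %/ 4)) - a) / eta.

Variables (ys : seq R) (u v : R -> R) (a eta : R).
Hypothesis eta0 : 0 < eta.

Lemma box_coord1 : (forall y, y \in ys -> `|u y| <= a /\ `|v y| <= a) ->
  smooth_box (4 * size ys) (box_coord ys u v a eta) = 1.
Proof.
move=> h; apply: smooth_box_eq1 => i i_lt; rewrite /box_coord pmulr_lle0 ?invr_gt0 //.
have [] := h (nth 0 ys (i %/ 4)); first by rewrite mem_nth // ltn_divLR // mulnC.
rewrite !ler_norml => /andP[u1 u2] /andP[v1 v2].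
by rewrite /sgn_sum /sgn_diff; have := ltn_pmod i (isT : 0 < 4)%N;
  case: (i %% 4)%N => [|[|[|[|?]]]] //= _; lra.
Qed.

Lemma box_coord0 : ~ (forall y, y \in ys -> `|u y| <= a + eta /\ `|v y| <= a + eta) ->
  smooth_box (4 * size ys) (box_coord ys u v a eta) = 0.
Proof.
move=> /existsNP[y /not_implyP[yys hy]].
have yi : (index y ys < size ys)%N by rewrite index_mem.
have big k : (k < 4)%N ->
    a + eta <= sgn_sum k * u y + sgn_diff k * v y ->
    smooth_box (4 * size ys) (box_coord ys u v a eta) = 0.
  move=> k4 hk; apply: (@smooth_box_eq0 _ _ _ (index y ys * 4 + k)%N); first by lia.
  rewrite /box_coord divnMDl // (divn_small k4) addn0 nth_index //.
  rewrite /sgn_sum /sgn_diff modnMDl (modn_small k4) -/(sgn_sum k) -/(sgn_diff k).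
  rewrite ler_pdivlMr // mul1r; move: hk.
  by rewrite /sgn_sum /sgn_diff (modn_small k4); lra.
have [u1|u1] := leP `|u y| (a + eta); last first.
  have : a + eta <= u y \/ a + eta <= - u y.
    by case: (lerP 0 (u y)) u1 => [h|h]; [rewrite ger0_norm //|rewrite ltr0_norm //] => h2;
      [left|right]; exact: ltW.
  by case=> h; [apply: (big 0%N)|apply: (big 1%N)] => //; rewrite /sgn_sum /sgn_diff /=; lra.
have [v1|v1] := leP `|v y| (a + eta); first by case: hy.
have : a + eta <= v y \/ a + eta <= - v y.
  by case: (lerP 0 (v y)) v1 => [h|h]; [rewrite ger0_norm //|rewrite ltr0_norm //] => h2;
    [left|right]; exact: ltW.
by case=> h; [apply: (big 2%N)|apply: (big 3%N)] => //; rewrite /sgn_sum /sgn_diff /=; lra.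
Qed.

End box_sandwich.

Section expect_indicator.
Context (R : realType) (d : measure_display) (T : measurableType d)
  (P : probability T R).

Lemma pr_le_expect (A : set T) (f : T -> R) : measurable A -> unit_fun f ->
  (forall w, A w -> f w = 1) -> pr P A <= expect P f.
Proof.
move=> mA uf fA; rewrite -lee_fin -prE // -expectE // -[A]setIT -integral_indic //.
apply: ge0_le_integral => //.
- by apply/measurable_EFinP; exact: measurable_indic.
- by apply/measurable_EFinP; exact: uf.1.
move=> w _; rewrite lee_fin indicE; have [h|h] := pselect (A w); first by rewrite mem_set // fA.
by rewrite memNset //; case/andP: (uf.2 w).
Qed.

Lemma expect_le_pr (A : set T) (f : T -> R) : measurable A -> unit_fun f ->
  (forall w, ~ A w -> f w = 0) -> expect P f <= pr P A.
Proof.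
move=> mA uf fA; rewrite -lee_fin -prE // -expectE // -[A]setIT -integral_indic //.
apply: ge0_le_integral => //.
- by move=> w _; rewrite lee_fin; case/andP: (uf.2 w).
- by apply/measurable_EFinP; exact: uf.1.
- by apply/measurable_EFinP; exact: measurable_indic.
move=> w _; rewrite lee_fin indicE; have [h|h] := pselect (A w); last by rewrite memNset // fA.
by rewrite mem_set //; case/andP: (uf.2 w).
Qed.

End expect_indicator.

Section sign_gauss_grid.
Context (R : realType) (d d' : measure_display) (T : measurableType d)
  (T' : measurableType d') (P : probability T R) (P' : probability T' R)
  (X : nat -> {RV P >-> R}) (e : nat -> {RV P' >-> R}) (L : nat).
Hypotheses (L0 : (0 < L)%N) (hX : gauss_seq X (Num.sqrt L%:R^-1)) (he : sign_seq e).

Definition eval_grid d0 (T0 : measurableType d0) (Q : probability T0 R)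
    (Y : nat -> {RV Q >-> R}) (ys : seq R) (a : R) : set T0 :=
  [set w | forall y, y \in ys -> `|pev (Y ^~ w) L y| <= a].

Lemma measurable_eval_grid d0 (T0 : measurableType d0) (Q : probability T0 R)
  (Y : nat -> {RV Q >-> R}) ys a : measurable (eval_grid Y ys a).
Proof.
by apply: (@measurable_all_norm_le _ _ _ ys (fun y w => pev (Y ^~ w) L y)) => y;
  exact: measurable_pev.
Qed.

Definition sign_grid ys (a : R) : set T' :=
  eval_grid (pair_sum e) ys (a * Num.sqrt (2 * L%:R)) `&`
  eval_grid (pair_diff e) ys (a * Num.sqrt (2 * L%:R)).

Lemma measurable_sign_grid ys a : measurable (sign_grid ys a).
Proof. by apply: measurableI; exact: measurable_eval_grid. Qed.

Definition shift_seq (k : nat) : {RV P >-> R} := X (L + k)%N.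

Lemma gauss_pair_grid ys a :
  pr P (eval_grid X ys a `&` eval_grid shift_seq ys a) = pr P (eval_grid X ys a) ^+ 2.
Proof.
have shK : cancel (addn L) (subn^~ L) by move=> k; rewrite addKn.
have hi : mutually_independent P (fun i => shift_seq i : T -> R).
  exact: (indep_reindex shK hX.1).
pose A : set (L.-tuple R) := [set x | forall y, y \in ys -> `|tpev x y| <= a].
have mA : measurable A.
  by apply: (@measurable_all_norm_le _ _ _ ys (fun y (x : L.-tuple R) => tpev x y)) => y;
    exact: measurable_tpev.
have E (Y : nat -> {RV P >-> R}) : eval_grid Y ys a = sample Y L @^-1` A.
  by rewrite predeqE => w; split => h y /h; rewrite tpev_sample.
have law : pr P (sample X L @^-1` A) = pr P (sample shift_seq L @^-1` A).
  by apply: same_law => //; [exact: hX.1|move=> k C mC; rewrite !hX.2].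
have mp (p : pred nat) (Y : nat -> {RV P >-> R}) :
    (forall i, (i < L)%N -> measurable_fun setT (Y i : sub_space X p -> R)) ->
    measurable (sample Y L @^-1` A : set (sub_space X p)).
  move=> mY; rewrite -[X in measurable X]setTI.
  have : measurable_fun setT (sample Y L : sub_space X p -> _).
    apply/measurable_fun_tnthP => i.
    rewrite (_ : _ \o _ = Y i); first exact: mY.
    by apply/funext => w /=; rewrite tnth_mktuple.
  exact.
rewrite expr2 {2}E law -E !E /pr -fineM ?fin_num_measure //; try exact: measurable_sample_preim.
congr fine; rewrite muleC; apply: (indep_sub_space hX.1 (p := fun k => (k < L)%N) (q := fun k => (L <= k)%N)).
- by move=> i; rewrite -ltnNge.
- by apply: mp => i iL; exact: sub_space_RV.
- by apply: mp => i iL; apply: sub_space_RV; rewrite leq_addr.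
Qed.

(** The bound of [lindeberg] with 4 coordinates per point, hence 64 = 16 * 4: L swaps, each of order
    s^3 = L^(-3/2), leave L^(-1/2). *)
Definition grid_error (ys : seq R) (eta : R) : R :=
  400 * (64 * (size ys)%:R / eta) ^+ 3 / Num.sqrt L%:R.

Variables (ys : seq R) (eta : R).
Hypotheses (hys : forall y, y \in ys -> 0 <= y <= 1) (eta0 : 0 < eta).

Let kap : R := (Num.sqrt (2 * L%:R))^-1.
Let cA i l := sgn_sum R i * nth 0 ys (i %/ 4) ^+ l / eta.
Let cB i l := sgn_diff R i * nth 0 ys (i %/ 4) ^+ l / eta.

Let LR : 0 < L%:R :> R. Proof. by rewrite ltr0n. Qed.

Let nth_itv i : 0 <= nth 0 ys i <= 1.
Proof.
have [i_lt|i_ge] := ltnP i (size ys); first by apply: hys; exact: mem_nth.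
by rewrite nth_default // lexx ler01.
Qed.

Let coef_le (c : R) i l : `|c| <= 1 -> `|c * nth 0 ys (i %/ 4) ^+ l / eta| <= eta^-1.
Proof.
move=> c1; rewrite normrM [X in _ * X]gtr0_norm ?invr_gt0 //.
rewrite -[leRHS]mul1r ler_wpM2r ?invr_ge0 ?(ltW eta0) // normrM -[leRHS]mulr1.
have /andP[y0 y1] := nth_itv (i %/ 4).
by rewrite ler_pM // ger0_norm ?exprn_ge0 // exprn_ile1.
Qed.

Lemma sign_formE a w : sign_form e kap cA cB L (fun=> - a / eta) w =
  box_coord ys (fun y => kap * pev (pair_sum e ^~ w) L y)
    (fun y => kap * pev (pair_diff e ^~ w) L y) a eta.
Proof.
apply/funext => i; rewrite /sign_form /box_coord big_split /= /cA /cB.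
have E (c : R) (f : nat -> R) y : \sum_(l < L) c * y ^+ l / eta * (kap * f l) =
    c * (kap * pev f L y) / eta.
  rewrite /pev !mulr_sumr mulr_suml; apply: eq_bigr => l _; ring.
rewrite (E _ (pair_sum e ^~ w)) (E _ (pair_diff e ^~ w)); ring.
Qed.

Lemma gauss_formE a w : gauss_form X L cA cB L (fun=> - a / eta) w =
  box_coord ys (pev (X ^~ w) L) (pev (shift_seq ^~ w) L) a eta.
Proof.
apply/funext => i; rewrite /gauss_form /box_coord big_split /= /cA /cB.
have E (c : R) (f : nat -> R) y : \sum_(l < L) c * y ^+ l / eta * f l = c * pev f L y / eta.
  rewrite /pev !mulr_sumr mulr_suml; apply: eq_bigr => l _; ring.
rewrite (E _ (X ^~ w)) (E _ (shift_seq ^~ w)); ring.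
Qed.

Lemma sign_gauss_expect a :
  let Phi u v := smooth_box (4 * size ys) (box_coord ys u v a eta) in
  let fs w := Phi (fun y => kap * pev (pair_sum e ^~ w) L y)
                  (fun y => kap * pev (pair_diff e ^~ w) L y) in
  let fg w := Phi (pev (X ^~ w) L) (pev (shift_seq ^~ w) L) in
  [/\ unit_fun fs, unit_fun fg & `|expect P' fs - expect P fg| <= grid_error ys eta].
Proof.
move=> Phi fs fg; rewrite (_ : fs = fun w => smooth_box (4 * size ys)
    (sign_form e kap cA cB L (fun=> - a / eta) w)); last first.
  by apply/funext => w; rewrite sign_formE.
rewrite (_ : fg = fun w => smooth_box (4 * size ys)
    (gauss_form X L cA cB L (fun=> - a / eta) w)); last first.
  by apply/funext => w; rewrite gauss_formE.
split.
- apply: (@unit_smooth_box _ _ _ _ (fun i w => sign_form e kap cA cB L (fun=> - a / eta) w i)) => i.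
  have m1 : measurable_fun setT (sign_form e kap cA cB L (fun=> - a / eta) ^~ i : sub_space e predT -> R).
    exact: measurable_sign_form.
  exact: (measurableT_comp m1 (@sub_space_measurable_fun _ _ _ P' e predT)).
- apply: (@unit_smooth_box _ _ _ _ (fun i w => gauss_form X L cA cB L (fun=> - a / eta) w i)) => i.
  exact: measurable_gauss_form.
have s0 : 0 < Num.sqrt L%:R^-1 :> R by rewrite sqrtr_gt0 invr_gt0.
have kapE : kap ^+ 2 = Num.sqrt L%:R^-1 ^+ 2 / 2.
  by rewrite exprVn !sqr_sqrtr ?invr_ge0 ?mulr_ge0 ?(ltW LR) // invfM mulrC.
have := @lindeberg _ _ _ _ _ P P' X e _ kap s0 hX he _ kapE (4 * size ys) L cA cB eta^-1
  _ _ L (fun=> - a / eta) (leqnn L).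
rewrite (_ : L%:R * _ = grid_error ys eta).
  apply; first by rewrite invr_ge0 sqrtr_ge0.
    by move=> i l; apply: coef_le; exact: sgn_sum_le1.
  by move=> i l; apply: coef_le; exact: sgn_diff_le1.
rewrite /grid_error natrM sqrtrV ?(ltW LR) //.
have : 0 < Num.sqrt L%:R :> R by rewrite sqrtr_gt0.
have := sqr_sqrtr (ltW LR); move: (Num.sqrt L%:R) => q <- q0.
by field; rewrite !gt_eqF.
Qed.

Let sqrt_gt0 : 0 < Num.sqrt (2 * L%:R) :> R.
Proof. by rewrite sqrtr_gt0 mulr_gt0. Qed.

Let scaled_le (x a : R) : `|kap * x| <= a <-> `|x| <= a * Num.sqrt (2 * L%:R).
Proof.
by rewrite normrM gtr0_norm ?invr_gt0 // mulrC -/(_ / _) ler_pdivrMr.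
Qed.

(** The smooth box is 1 on the ball of radius a and 0 outside the ball of radius a + eta, so
    smoothing costs eta in the radius; the two independent Gaussian blocks produce the square. *)
Lemma sign_grid_le a :
  pr P' (sign_grid ys a) <= pr P (eval_grid X ys (a + eta)) ^+ 2 + grid_error ys eta.
Proof.
have [us ug err] := sign_gauss_expect a.
have h1 := @pr_le_expect _ _ _ P' (sign_grid ys a) _ (measurable_sign_grid ys a) us.
apply: (le_trans (h1 _)) => [w [hu hv]|].
  by apply: box_coord1 => // y yys; split; apply/scaled_le; [exact: hu|exact: hv].
move: err; rewrite ler_norml lerBlDl => /andP[_ /le_trans]; apply.
rewrite lerD2r -gauss_pair_grid.
have mG : measurable (eval_grid X ys (a + eta) `&` eval_grid shift_seq ys (a + eta)).
  by apply: measurableI; exact: measurable_eval_grid.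
apply: (@expect_le_pr _ _ _ P _ _ mG ug) => w hw; apply: box_coord0 => // h; apply: hw.
by split => y yys; have [] := h y yys.
Qed.

Lemma sign_grid_ge a :
  pr P (eval_grid X ys a) ^+ 2 <= pr P' (sign_grid ys (a + eta)) + grid_error ys eta.
Proof.
have [us ug err] := sign_gauss_expect a.
have mG : measurable (eval_grid X ys a `&` eval_grid shift_seq ys a).
  by apply: measurableI; exact: measurable_eval_grid.
rewrite -gauss_pair_grid; apply: (le_trans (@pr_le_expect _ _ _ P _ _ mG ug _)).
  by move=> w [hu hv]; apply: box_coord1 => // y yys; split; [exact: hu|exact: hv].
move: err; rewrite distrC ler_norml lerBlDl => /andP[_ /le_trans]; apply.
rewrite lerD2r; apply: (@expect_le_pr _ _ _ P' _ _ (measurable_sign_grid ys (a + eta)) us).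
move=> w hw; apply: box_coord0 => // h; apply: hw; split => y yys; have [h1 h2] := h y yys;
  exact/scaled_le.
Qed.

End sign_gauss_grid.

Lemma poly_le_expR (R : realType) (C : R) k : exists2 z0 : R, 1 <= z0 &
  forall z, z0 <= z -> C * z ^+ k <= expR (z / 2).
Proof.
pose c : R := 2 * k.+1%:R; have c0 : 0 < c by rewrite mulr_gt0 ?ltr0n.
exists (1 + `|C| * c ^+ k.+1).
  by rewrite lerDl mulr_ge0 // exprn_ge0 // ltW.
move=> z hz; have c1 : 0 < c ^+ k.+1 by exact: exprn_gt0.
have C1 : 0 <= `|C| * c ^+ k.+1 by rewrite mulr_ge0 // ltW.
have z0 : 0 < z by apply: lt_le_trans hz; rewrite ltr_pwDl.
have -> : z / 2 = k.+1%:R * (z / c).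
  by rewrite /c; have : k.+1%:R != 0 :> R by []; move: (_%:R) => q q0; field.
rewrite expRM_natl; apply: (@le_trans _ _ ((z / c) ^+ k.+1)); last first.
  rewrite lerXn2r ?nnegrE ?expR_ge0 ?divr_ge0 ?(ltW z0) ?(ltW c0) //.
  by apply: le_trans (expR_ge1Dx _); rewrite lerDr.
rewrite expr_div_n ler_pdivlMr // mulrAC (exprS z) ler_wpM2r ?exprn_ge0 ?(ltW z0) //.
apply: le_trans hz; apply: (@le_trans _ _ (`|C| * c ^+ k.+1)); last by rewrite lerDr.
by rewrite ler_wpM2r ?ler_norm // ltW.
Qed.

(** * Choice of parameters and the comparison theorem *)

Section comparison_parameters.
Context (R : realType).
Variable eps : R.
Hypothesis eps01 : 0 < eps < 1.

(** All parameters are powers of z = ln L, so the number of nodes is O(z^12), while the Lindeberg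
    error carries exp (- z / 2). The bound tau >= z^6 comes from the far-end term, of order 1 / (tau
    b^2) with b >= 1 / z. *)
Lemma comparison_parameters : exists2 z0 : R, 10 <= z0 & forall (L : nat) (z : R),
  z = ln L%:R -> z0 <= z -> exists h lam eta : R, exists J : nat,
  let tau := h * (1 + h) ^+ J in
  [/\ [/\ 0 < h, 0 < lam & 0 < eta], 2 * eta + 4 * h * lam < eps / (2 * z),
    [/\ (lam ^+ 2)^-1 <= (z ^+ 4)^-1, z ^+ 6 <= tau & z ^+ 6 <= L%:R],
    J.+2%:R * (4 * (tau / L%:R) ^+ 2 / eta ^+ 2) <= (z ^+ 4)^-1 &
    400 * (64 * J.+2%:R / eta) ^+ 3 / Num.sqrt L%:R <= (z ^+ 4)^-1].
Proof.
have /andP[e0 e1] := eps01; pose c := eps^-1; have c1 : 1 < c by rewrite invf_gt1.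
have c0 := lt_trans ltr01 c1.
have c21 : 1 <= c ^+ 2 by rewrite exprn_ege1 // ltW.
have [M ME] : exists M : R, M = (2 * 32 ^+ 2 + 3) * c ^+ 2 by eexists.
have M1 : 1 <= M by rewrite ME; lra.
have M0 := lt_le_trans ltr01 M1.
have [G1 G1E] : exists G : R, G = 400 * (8 ^+ 3 * (M * c)) ^+ 3 by eexists.
have [G2 G2E] : exists G : R, G = 4 ^+ 5 * (M * c ^+ 2) by eexists.
have Mc k : 0 <= M * c ^+ k by rewrite mulr_ge0 ?exprn_ge0 ?(ltW c0) // ltW.
have G10 : 0 <= G1.
  rewrite G1E; apply: mulr_ge0; first exact: ler0n.
  by apply: exprn_ge0; apply: mulr_ge0; [apply: exprn_ge0; exact: ler0n|exact: (Mc 1%N)].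
have G20 : 0 <= G2 by rewrite G2E; apply: mulr_ge0; [apply: exprn_ge0; exact: ler0n|exact: (Mc 2%N)].
(* With J of order z^12 and 1 / eta of order z, the Lindeberg error carries (z^13)^3 = z^39, and
   comparing it with z^-4 adds 4; the discretisation error carries only z^30. *)
have [z0 z01 hz0] := poly_le_expR (G1 + G2 + 1) 43.
exists (z0 + 10); first by rewrite lerDr (le_trans ler01).
move=> L z zE hz; have z9 : 10 <= z by apply: le_trans hz; rewrite lerDr (le_trans ler01).
have z1 : 1 <= z by apply: le_trans z9; lra.
have zp := lt_le_trans ltr01 z1.
have LR : 0 < L%:R :> R.
  rewrite ltNge; apply/negP => h; move: zE; rewrite ln0 //; lra.
have LE : L%:R = expR z by rewrite zE lnK.
have sE : Num.sqrt L%:R = expR (z / 2).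
  rewrite LE (_ : expR z = expR (z / 2) ^+ 2) ?sqrtr_sqr ?gtr0_norm ?expR_gt0 //.
  by rewrite -expRM_natl; congr expR; field.
have s1 : 1 <= expR (z / 2) by rewrite -[leLHS]expR0 ler_expR divr_ge0 // ltW.
have Ls : expR (z / 2) <= L%:R.
  by rewrite LE ler_expR; lra.
have zz0 : z0 <= z by apply: le_trans hz; rewrite lerDl ler0n.
have hG := hz0 z zz0.
have zk k m : (k <= m)%N -> z ^+ k <= z ^+ m by move=> km; rewrite ler_weXn2l.
have zk0 k : 0 < z ^+ k by exact: exprn_gt0.
have hG1 : G1 * z ^+ 43 <= expR (z / 2).
  by apply: le_trans hG; rewrite ler_wpM2r ?(ltW (zk0 _)) //; lra.
have hG2 : G2 * z ^+ 30 <= expR (z / 2).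
  apply: le_trans hG; apply: (@le_trans _ _ (G2 * z ^+ 43)); first by rewrite ler_wpM2l ?zk.
  by rewrite ler_wpM2r ?(ltW (zk0 _)) //; lra.
have hG3 : z ^+ 6 <= expR (z / 2).
  apply: le_trans hG; rewrite -[leLHS]mul1r; apply: ler_pM => //; first exact: ltW.
    by lra.
  exact: zk.
(* The total enlargement of the radius is 2 eta + 4 h lam = 3 eps / (8 z), within the allowance eps
   / (2 z), and lam^-2 = z^-4. *)
pose h := eps / (32 * z ^+ 3); pose eta := eps / (8 * z); pose lam := z ^+ 2.
have h0 : 0 < h by rewrite divr_gt0 // mulr_gt0.
have h1 : h <= 1.
  rewrite ler_pdivrMr ?mulr_gt0 //; have := zk 0%N 3%N isT; rewrite expr0; lra.
have eta0 : 0 < eta by rewrite divr_gt0 // mulr_gt0.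
have ht : h <= z ^+ 6 by apply: (le_trans h1); have := zk 0%N 6%N isT; rewrite expr0.
have [J [J1 J2 J3]] := grid_reach (introT andP (conj h0 h1)) ht.
have hJ : J.+2%:R <= M * z ^+ 12.
  rewrite -addn2 natrD.
  have l1 : ln (z ^+ 6 / h) <= z ^+ 6 / h.
    have xp : 0 < z ^+ 6 / h by rewrite divr_gt0.
    have := @le_ln1Dx _ (z ^+ 6 / h - 1); rewrite (addrC 1) subrK; move: (z ^+ 6 / h) xp => x xp.
    by move=> /(_ _)/le_trans; apply; lra.
  have l2 : 2 / h * ln (z ^+ 6 / h) <= 2 / h * (z ^+ 6 / h).
    by rewrite ler_wpM2l // divr_ge0 // ltW.
  have E : 2 / h * (z ^+ 6 / h) = 2 * 32 ^+ 2 * (c ^+ 2 * z ^+ 12).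
    by rewrite /h /c; field; rewrite !gt_eqF.
  have : 1 <= c ^+ 2 * z ^+ 12.
    have h3 := zk 0%N 12%N isT; rewrite expr0 in h3.
    by rewrite -[leLHS]mulr1 ler_pM // exprn_ege1 // ltW.
  rewrite ME -(mulrA _ (c ^+ 2)); move: J3 l2; rewrite E; move: (c ^+ 2 * z ^+ 12) (2 / h * _) => p q; lra.
exists h, lam, eta, J => tau; split => //.
- by split => //; exact: zk0.
- have -> : 2 * eta + 4 * h * lam = 3 / 4 * (eps / (2 * z)).
    by rewrite /eta /h /lam; field; rewrite gt_eqF.
  have : 0 < eps / (2 * z) by rewrite divr_gt0 // mulr_gt0.
  by lra.
- by split; [rewrite /lam -exprM|exact: J1|exact: le_trans hG3 Ls].
- have t0 : 0 <= tau by rewrite mulr_ge0 ?exprn_ge0 // ?addr_ge0 ?(ltW h0).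
  apply: (@le_trans _ _ (M * z ^+ 12 * (4 * (2 * z ^+ 6 / L%:R) ^+ 2 / eta ^+ 2))).
    apply: ler_pM => //; first by rewrite divr_ge0 ?sqr_ge0 // mulr_ge0 ?sqr_ge0.
    have k1 : 0 <= tau / L%:R by apply: divr_ge0 => //; exact: ltW.
    have k2 : tau / L%:R <= 2 * z ^+ 6 / L%:R by apply: ler_wpM2r => //; rewrite invr_ge0 ltW.
    apply: ler_wpM2r; first by rewrite invr_ge0 sqr_ge0.
    apply: ler_wpM2l; first exact: ler0n.
    by apply: lerXn2r => //; rewrite nnegrE; exact: le_trans k2.
  rewrite (_ : _ * _ = G2 * z ^+ 30 / L%:R / L%:R / z ^+ 4); last first.
    by rewrite G2E /eta /c; field; rewrite !gt_eqF.
  rewrite -[leRHS]mul1r ler_wpM2r ?invr_ge0 ?(ltW (zk0 4%N)) //.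
  have b1 : G2 * z ^+ 30 / L%:R <= 1 by rewrite ler_pdivrMr // mul1r (le_trans hG2).
  rewrite ler_pdivrMr // mul1r; apply: (le_trans b1); exact: le_trans s1 Ls.
- apply: (@le_trans _ _ (400 * (64 * (M * z ^+ 12) / eta) ^+ 3 / Num.sqrt L%:R)).
    have k1 : 0 <= 64 * J.+2%:R / eta by apply: divr_ge0; [exact: mulr_ge0|exact: ltW].
    have k2 : 64 * J.+2%:R / eta <= 64 * (M * z ^+ 12) / eta.
      by apply: ler_wpM2r; [rewrite invr_ge0 ltW|exact: ler_wpM2l].
    apply: ler_wpM2r; first by rewrite invr_ge0 sqrtr_ge0.
    apply: ler_wpM2l; first exact: ler0n.
    by apply: lerXn2r => //; rewrite nnegrE; exact: le_trans k2.
  rewrite sE (_ : _ / _ = G1 * z ^+ 43 / expR (z / 2) / z ^+ 4); last first.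
    by rewrite G1E /eta /c; field; rewrite !gt_eqF ?expR_gt0.
  rewrite -[leRHS]mul1r ler_wpM2r ?invr_ge0 ?(ltW (zk0 4%N)) //.
  by rewrite ler_pdivrMr ?expR_gt0 // mul1r.
Qed.

End comparison_parameters.

(** Since f <= 1 and the sum of the three errors is at most 1, the square grows by at most 2 * 3 D +
    3 D, and g adds one more D. *)
Lemma sqr_sum_error (R : realType) (f x y t g D : R) : 0 <= f <= 1 ->
  0 <= x <= D -> 0 <= y <= D -> 0 <= t <= D -> g <= D -> 10 * D <= 1 ->
  (f + x + y + t) ^+ 2 + g <= f ^+ 2 + 10 * D.
Proof.
move=> /andP[f0 f1] /andP[x0 lx] /andP[y0 ly] /andP[t0 lt] lg D1.
have s0 : 0 <= x + y + t by rewrite !addr_ge0.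
have h3 : (x + y + t) ^+ 2 <= x + y + t by rewrite expr2 ler_piMr //; lra.
have h4 : f * (x + y + t) <= x + y + t by rewrite ler_piMl.
rewrite (_ : (f + x + y + t) ^+ 2 = f ^+ 2 + 2 * (f * (x + y + t)) + (x + y + t) ^+ 2); last by ring.
by move: h3 h4; lra.
Qed.

Lemma sum_error (R : realType) (f x y u t g D : R) : x <= D -> y <= D -> u <= D ->
  0 <= t <= D -> g <= D -> 10 * D <= 1 ->
  f + 2 * (x + (y + u)) + g + (2 * t + t ^+ 2) <= f + 10 * D.
Proof.
move=> lx ly lu /andP[t0 lt] lg D1.
have h3 : t ^+ 2 <= t by rewrite expr2 ler_piMr //; lra.
by move: h3; lra.
Qed.

Section comparison.
Context (R : realType) (d d' : measure_display) (T : measurableType d)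
  (T' : measurableType d') (P : probability T R) (P' : probability T' R)
  (B X : R -> {RV P >-> R}) (e : nat -> {RV P' >-> R}).
Hypotheses (hB : standard_brownian_motion B) (hX : continuous_laplace_process B X)
  (he : sign_seq e).
Notation F := (sup_ball_prob X).

Definition sign_ball (L : nat) (b : R) : set T' :=
  sup_ball (pair_sum e) L b `&` sup_ball (pair_diff e) L b.

Lemma measurable_sign_ball L b : measurable (sign_ball L b).
Proof. by apply: measurableI; exact: measurable_sup_ball. Qed.

Let pts (L : nat) (s : seq R) : seq R := [seq expR (- (t / L%:R)) | t <- s].

Let pts_itv L s y : (forall t, t \in s -> 0 <= t) -> y \in pts L s -> 0 <= y <= 1.
Proof.
move=> hs /mapP[t ts ->]; rewrite expR_ge0 /= -[leRHS]expR0 ler_expR oppr_le0.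
by rewrite divr_ge0 // hs.
Qed.

Let sum_grid_pts N s a : sum_grid B N s a = eval_grid N.+1 (bm_increment B N.+1) (pts N.+1 s) a.
Proof.
rewrite predeqE => w; split => [h y /mapP[t ts ->]|h t ts]; first exact: h.
by apply: h; apply/mapP; exists t.
Qed.

Let bm_gauss N : gauss_seq (bm_increment B N.+1) (Num.sqrt N.+1%:R^-1).
Proof. exact: gauss_seq_bm_increment. Qed.

Lemma sign_ball_upper N (h lam eta a b b' : R) J :
  let tau := h * (1 + h) ^+ J in
  0 < h -> 0 < lam -> 0 < eta -> 0 < b' ->
  a + 2 * eta + 4 * h * lam < b' -> b' < b ->
  pr P' (sign_ball N.+1 (a * Num.sqrt (2 * N.+1%:R))) <=
    (F b + (lam ^+ 2)^-1 + (2 * tau)^-1 / b' ^+ 2 +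
     J.+2%:R * (4 * (tau / N.+1%:R) ^+ 2 / eta ^+ 2)) ^+ 2 +
    400 * (64 * J.+2%:R / eta) ^+ 3 / Num.sqrt N.+1%:R.
Proof.
move=> tau h0 lam0 eta0 b'0 hab b'b; pose s := grid h J.
have hs t : t \in s -> 0 <= t by exact: grid_ge0.
have hst t : t \in s -> 0 <= t <= tau by move=> ts; rewrite hs //= grid_le.
have hy y : y \in pts N.+1 s -> 0 <= y <= 1 by exact: pts_itv.
have sz : size (pts N.+1 s) = J.+2 by rewrite size_map size_grid.
apply: (@le_trans _ _ (pr P' (sign_grid e N.+1 (pts N.+1 s) a))).
  apply: pr_le; [exact: measurable_sign_ball|exact: measurable_sign_grid|].
  by move=> w [h1 h2]; split => y /hy; [exact: h1|exact: h2].
apply: (le_trans (@sign_grid_le _ _ _ _ _ _ _ _ _ N.+1 isT (bm_gauss N) he _ _ hy eta0 a)).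
rewrite /grid_error sz lerD2r lerXn2r ?nnegrE ?pr_ge0 //.
  rewrite !addr_ge0 ?fine_ge0 ?invr_ge0 ?sqr_ge0 //.
    by rewrite divr_ge0 ?sqr_ge0 // invr_ge0 mulr_ge0 // mulr_ge0 ?exprn_ge0 ?addr_ge0 ?(ltW h0).
  by rewrite mulr_ge0 // divr_ge0 ?sqr_ge0 // mulr_ge0 ?sqr_ge0.
rewrite -sum_grid_pts.
have h1 := transfer_sum_lap hB hX N eta0 (lexx (a + eta + eta)) hst.
apply: (le_trans h1); rewrite /transfer_error size_grid lerD2r.
have := @pr_grid_sup_ball_prob _ _ _ _ _ _ hB hX h lam (a + eta + eta) b b' J h0 lam0 b'0.
by rewrite !div1r; apply => //; lra.
Qed.

(** Here the passage from the grid to [0, 1] takes place on the sign side. The two sign polynomials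
    are dependent, so their exceptional events are added by the union bound, whence the factor 2. *)
Lemma sign_ball_lower N (h lam eta a b : R) J :
  let tau := h * (1 + h) ^+ J in
  let te := J.+2%:R * (4 * (tau / N.+1%:R) ^+ 2 / eta ^+ 2) in
  0 < h -> 0 < lam -> 0 < eta -> 0 < b -> a + 2 * eta + 4 * h * lam <= b ->
  F a ^+ 2 <= pr P' (sign_ball N.+1 (b * Num.sqrt (2 * N.+1%:R))) +
    2 * ((lam ^+ 2)^-1 + (N.+1%:R^-1 + (2 * tau)^-1) / b ^+ 2) +
    400 * (64 * J.+2%:R / eta) ^+ 3 / Num.sqrt N.+1%:R + (2 * te + te ^+ 2).
Proof.
move=> tau te h0 lam0 eta0 b0 hab; pose s := grid h J.
have hs t : t \in s -> 0 <= t by exact: grid_ge0.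
have hst t : t \in s -> 0 <= t <= tau by move=> ts; rewrite hs //= grid_le.
have hy y : y \in pts N.+1 s -> 0 <= y <= 1 by exact: pts_itv.
have sz : size (pts N.+1 s) = J.+2 by rewrite size_map size_grid.
have te0 : 0 <= te by rewrite mulr_ge0 // divr_ge0 ?sqr_ge0 // mulr_ge0 ?sqr_ge0.
have tau0 : 0 < tau by rewrite mulr_gt0 ?exprn_gt0 ?addr_gt0.
have F0 : 0 <= F a by exact: fine_ge0.
have h1 : F a <= pr P (sum_grid B N s (a + eta)) + te.
  apply: (le_trans (sup_ball_prob_grid hX a hs)).
  by have := transfer_lap_sum hB hX N eta0 (lexx (a + eta)) hst; rewrite /transfer_error size_grid.
have p1 : pr P (sum_grid B N s (a + eta)) <= 1 by apply: pr_le1; exact: measurable_sum_grid.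
have p0 := pr_ge0 P (sum_grid B N s (a + eta)).
have h2 := @sign_grid_ge _ _ _ _ _ _ _ _ _ N.+1 isT (bm_gauss N) he _ _ hy eta0 (a + eta).
rewrite -sum_grid_pts /grid_error sz in h2.
have [q qE] : exists q : R, q = Num.sqrt (2 * N.+1%:R) by eexists.
have q0 : 0 < q by rewrite qE sqrtr_gt0 mulr_gt0.
have q2 : q ^+ 2 = 2 * N.+1%:R by rewrite qE sqr_sqrtr // mulr_ge0.
rewrite -qE.
have hq : (a + eta + eta) * q + 4 * h * (lam * q) <= b * q.
  rewrite (_ : _ + _ = (a + 2 * eta + 4 * h * lam) * q); last by ring.
  by rewrite ler_wpM2r // ltW.
have lq : 0 < lam * q by exact: mulr_gt0.
have bq : 0 < b * q by exact: mulr_gt0.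
have [E1 [mE1 pE1 sE1]] := grid_sup_ball_exception (std_pair_sum he) J (isT : (0 < N.+1)%N) h0 lq bq hq.
have [E2 [mE2 pE2 sE2]] := grid_sup_ball_exception (std_pair_diff he) J (isT : (0 < N.+1)%N) h0 lq bq hq.
have eE : N.+1%:R * 2 / (lam * q) ^+ 2 + (1 + N.+1%:R / (2 * tau)) * 2 / (b * q) ^+ 2 =
    (lam ^+ 2)^-1 + (N.+1%:R^-1 + (2 * tau)^-1) / b ^+ 2.
  rewrite !exprMn q2; have : N.+1%:R != 0 :> R by [].
  by move: (_%:R) => n n0; field; rewrite n0 !gt_eqF.
rewrite -/tau eE in pE1 pE2.
have h3 : pr P' (sign_grid e N.+1 (pts N.+1 s) (a + eta + eta)) <=
    pr P' (sign_ball N.+1 (b * q)) + pr P' (E1 `|` E2).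
  apply: pr_subU; [exact: measurable_sign_grid|exact: measurable_sign_ball|exact: measurableU|].
  move=> w [g1 g2]; rewrite -qE in g1 g2.
  have [s1|?] : (sup_ball (pair_sum e) N.+1 (b * q) `|` E1) w.
  - by apply: sE1 => t ts; apply: g1; apply/mapP; exists t.
  - have [s2|?] : (sup_ball (pair_diff e) N.+1 (b * q) `|` E2) w.
    + by apply: sE2 => t ts; apply: g2; apply/mapP; exists t.
    + by left.
    + by right; right.
  - by right; left.
have h4 := pr_setU P' mE1 mE2.
have h5 : F a ^+ 2 <= (pr P (sum_grid B N s (a + eta)) + te) ^+ 2.
  by rewrite lerXn2r ?nnegrE // addr_ge0.
have h6 : (pr P (sum_grid B N s (a + eta)) + te) ^+ 2 <=
    pr P (sum_grid B N s (a + eta)) ^+ 2 + (2 * te + te ^+ 2).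
  move: p0 p1 te0; clear; move: (pr P _) te => p t p0 p1 t0; nra.
move: (le_trans h5 h6) h2 h3 (le_trans h4 (lerD pE1 pE2)); clear.
move: (pr P' _) (pr P' (sign_ball _ _)) (pr P' _) (pr P _ ^+ 2) (2 * te + _) => p1 p2 p3 p4 p5.
by move: (_ + _ / _) (_ / _) => p6 p7; lra.
Qed.

(** As the radius is at least 1 / ln L, the absolute enlargement eps / (2 ln L) is at most a
    relative one of eps / 2. The individual errors are at most D = (ln L)^-4, and 10 D <= (ln L)^-3
    because ln L >= 10. *)
Theorem sign_ball_comparison (eps : R) : 0 < eps < 1 -> exists2 z0 : R, 10 <= z0 &
  forall (L : nat) (a : R), z0 <= ln L%:R -> (ln L%:R)^-1 <= a ->
  pr P' (sign_ball L (a * Num.sqrt (2 * L%:R))) <= F ((1 + eps) * a) ^+ 2 + (ln L%:R ^+ 3)^-1 /\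
  F a ^+ 2 <= pr P' (sign_ball L ((1 + eps) * a * Num.sqrt (2 * L%:R))) + (ln L%:R ^+ 3)^-1.
Proof.
move=> heps; have /andP[e0 e1] := heps; have [z0 z09 hz0] := comparison_parameters heps.
exists z0 => // -[|N] a; first by rewrite ln0 // => /(le_trans z09); rewrite lern0.
move=> zz0; have [h [lam [eta [J]]]] := hz0 N.+1 _ erefl zz0.
set z := ln _ in zz0 *; set tau := h * _ => -[[h0 lam0 eta0] hsm [lam2 tau6 L6] te ge] za.
have z9 : 10 <= z := le_trans z09 zz0.
have zp : 0 < z by lra.
have a0 : 0 < a by apply: lt_le_trans za; rewrite invr_gt0.
have eza : eps / (2 * z) <= eps / 2 * a.
  by rewrite invfM mulrA ler_wpM2l // divr_ge0 // ltW.
pose D := (z ^+ 4)^-1; have D0 : 0 < D by rewrite invr_gt0 exprn_gt0.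
have D9 : 10 * D <= (z ^+ 3)^-1.
  rewrite /D exprS invfM mulrA -[leRHS]mul1r ler_wpM2r ?invr_ge0 ?exprn_ge0 ?(ltW zp) //.
  by rewrite ler_pdivrMr // mul1r.
have D1 : 10 * D <= 1.
  apply: (le_trans D9); rewrite invf_le1 ?exprn_gt0 // exprn_ege1 //; lra.
have tau0 : 0 < tau by rewrite mulr_gt0 ?exprn_gt0 ?addr_gt0.
have small b x : a <= b -> z ^+ 6 <= x -> x^-1 / b ^+ 2 <= D.
  move=> ab zx; have x0 : 0 < x by apply: lt_le_trans zx; exact: exprn_gt0.
  have -> : D = (z ^+ 6)^-1 * z ^+ 2 by rewrite /D; field; rewrite gt_eqF.
  rewrite ler_pM ?invr_ge0 ?sqr_ge0 ?(ltW x0) //; first by rewrite lef_pV2 ?posrE ?exprn_gt0.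
  rewrite -[leRHS]invrK lef_pV2 ?posrE ?invr_gt0 ?exprn_gt0 //; last exact: lt_le_trans ab.
  rewrite -exprVn lerXn2r ?nnegrE ?invr_ge0 ?(ltW zp) ?(le_trans (ltW a0)) //.
  exact: le_trans ab.
have tau2 : z ^+ 6 <= 2 * tau by move: tau0 tau6; lra.
have F01 b : 0 <= F b <= 1.
  by rewrite fine_ge0 //= sup_ball_probE pr_le1 //; exact: measurable_lap_ball hX b.
split.
  have b'0 : 0 < (1 + eps / 2) * a by rewrite mulr_gt0 // addr_gt0 // divr_gt0.
  have ab' : a <= (1 + eps / 2) * a by rewrite mulrDl mul1r lerDl mulr_ge0 ?divr_ge0 ?ltW.
  have hb' : a + 2 * eta + 4 * h * lam < (1 + eps / 2) * a.
    have -> : (1 + eps / 2) * a = a + eps / 2 * a by ring.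
    by move: hsm eza; lra.
  have hb : (1 + eps / 2) * a < (1 + eps) * a by rewrite ltr_pM2r //; lra.
  apply: (le_trans (@sign_ball_upper N h lam eta a _ _ J h0 lam0 eta0 b'0 hb' hb)).
  have te0 : 0 <= J.+2%:R * (4 * (tau / N.+1%:R) ^+ 2 / eta ^+ 2).
    by rewrite mulr_ge0 // divr_ge0 ?sqr_ge0 // mulr_ge0 ?sqr_ge0.
  apply: le_trans (_ : _ <= F ((1 + eps) * a) ^+ 2 + 10 * D) _; last by rewrite lerD2l.
  apply: sqr_sum_error => //.
  - by rewrite invr_ge0 sqr_ge0.
  - rewrite small // andbT divr_ge0 ?sqr_ge0 // invr_ge0 mulr_ge0 // ltW //.
  - by rewrite te0.
have ab : a <= (1 + eps) * a by rewrite mulrDl mul1r lerDl mulr_ge0 ?ltW.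
have b0 := lt_le_trans a0 ab.
have hb : a + 2 * eta + 4 * h * lam <= (1 + eps) * a.
  have : 0 < eps * a by exact: mulr_gt0.
  by move: hsm eza; rewrite mulrDl mul1r; lra.
apply: (le_trans (@sign_ball_lower N h lam eta a _ J h0 lam0 eta0 b0 hb)).
have te0 : 0 <= J.+2%:R * (4 * (tau / N.+1%:R) ^+ 2 / eta ^+ 2).
  by rewrite mulr_ge0 // divr_ge0 ?sqr_ge0 // mulr_ge0 ?sqr_ge0.
rewrite (mulrDl N.+1%:R^-1) -/tau.
apply: (@le_trans _ _ (pr P' (sign_ball N.+1 ((1 + eps) * a * Num.sqrt (2 * N.+1%:R))) + 10 * D));
  last by rewrite lerD2l.
by apply: sum_error => //; [exact: small|exact: small|rewrite te0].
Qed.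

End comparison.

(** * Almost sure bounds *)

Section borel_cantelli.
Context (R : realType) (d : measure_display) (T : measurableType d)
  (P : probability T R).

Lemma sum_inv_sqr_le n : \sum_(i < n.+1) (i.+1%:R ^+ 2)^-1 <= 2 - n.+1%:R^-1 :> R.
Proof.
elim: n => [|n IH]; first by rewrite big_ord_recr big_ord0 /= add0r expr1n invr1; lra.
rewrite big_ord_recr /= -lerBrDr; apply: (le_trans IH).
have n0 : 0 < n.+1%:R :> R by rewrite ltr0n.
rewrite -(natr1 n.+1); move: (n.+1%:R : R) n0 => z z0.
have z1 : 0 < z + 1 by rewrite addr_gt0.
have : ((z + 1) ^+ 2)^-1 <= z^-1 - (z + 1)^-1.
  have -> : z^-1 - (z + 1)^-1 = (z * (z + 1))^-1 by field; rewrite !gt_eqF.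
  by rewrite lef_pV2 ?posrE ?mulr_gt0 ?exprn_gt0 // expr2 ler_wpM2r ?(ltW z1) // lerDl.
by lra.
Qed.

Lemma borel_cantelli_sqr (A : nat -> set T) (C : R) i0 : (forall i, measurable (A i)) ->
  (forall i, (i0 <= i)%N -> pr P (A i) <= C / i.+1%:R ^+ 2) ->
  {ae P, forall w, exists K, forall i, (K <= i)%N -> ~ A i w}.
Proof.
move=> mA hA; pose D := Num.max `|C| (i0.+1%:R ^+ 2).
have D0 : 0 <= D by rewrite le_max normr_ge0.
have hD i : pr P (A i) <= D * (i.+1%:R ^+ 2)^-1.
  have i1 : 0 < i.+1%:R ^+ 2 :> R by rewrite exprn_gt0 // ltr0n.
  have [/hA h|i_lt] := leqP i0 i.
    apply: (le_trans h); rewrite ler_wpM2r ?invr_ge0 ?(ltW i1) //.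
    by rewrite le_max ler_norm.
  apply: (le_trans (pr_le1 P (mA i))); rewrite ler_pdivlMr // mul1r le_max.
  by rewrite orbC lerXn2r ?nnegrE // ler_nat ltnW.
have sumP : (\sum_(0 <= i <oo) P (A i) < +oo)%E.
  apply: (@le_lt_trans _ _ (D * 2)%:E); last by rewrite ltry.
  apply: lime_le; first by apply: is_cvg_nneseries => i _ _; exact: measure_ge0.
  apply: nearW => n; rewrite big_mkord (eq_bigr (fun i : 'I_n => (pr P (A i))%:E)); last first.
    by move=> i _; rewrite prE.
  rewrite sumEFin lee_fin; apply: (@le_trans _ _ (\sum_(i < n) D * (i.+1%:R ^+ 2)^-1)).
    by apply: ler_sum => i _; exact: hD.
  rewrite -mulr_sumr ler_wpM2l //; case: n => [|n]; first by rewrite big_ord0.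
  by apply: (le_trans (sum_inv_sqr_le n)); rewrite lerBlDr lerDl invr_ge0.
have h0 := lim_sup_set_cvg0 mA sumP.
exists (lim_sup_set A); split => //.
  by apply: bigcap_measurable => [|k _]; [exists 0%N|apply: bigcup_measurable].
move=> w /= h K _; apply: contrapT => hK; apply: h; exists K => i Ki Aw.
by apply: hK; exists i.
Qed.

End borel_cantelli.

(** * Ottaviani's inequality and balls of sign polynomials *)

Section ottaviani.
Context (R : realType) (d : measure_display) (T : measurableType d)
  (P : probability T R) (X : nat -> {RV P >-> R}).
Hypothesis hX : mutually_independent P (fun i => X i : T -> R).

(** Decomposition by the first index i at which [E i] occurs: that event belongs to the past of t i,
    hence is independent of [B i], and together they force [G]. The induction keeps the intersection
    of [G] with the union, so that the contributions of the disjoint first occurrences add up. *)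
Lemma ottaviani (E B : nat -> set T) (G : set T) (t : nat -> nat) n :
  {homo t : i j / (i <= j)%N} -> measurable G ->
  (forall i, (i < n)%N -> measurable (E i : set (sub_space X (fun k => (k < t i)%N)))) ->
  (forall i, (i < n)%N -> measurable (B i : set (sub_space X (fun k => (t i <= k)%N)))) ->
  (forall i, (i < n)%N -> 1 <= 2 * pr P (B i)) ->
  (forall i, (i < n)%N -> E i `&` B i `<=` G) ->
  pr P (\bigcup_(i in `I_n) E i) <= 2 * pr P G.
Proof.
move=> ht mG mE mB hB hG.
have mE' i : (i < n)%N -> measurable (E i) by move=> /mE/sub_space_measurable.
have mB' i : (i < n)%N -> measurable (B i) by move=> /mB/sub_space_measurable.
suff h k : (k <= n)%N -> measurable (\bigcup_(i in `I_k) E i) /\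
    pr P (\bigcup_(i in `I_k) E i) <= 2 * pr P (G `&` \bigcup_(i in `I_k) E i).
  have [mU hU] := h n (leqnn n); apply: (le_trans hU); rewrite ler_wpM2l //.
  by apply: pr_le => //; exact: measurableI.
elim: k => [|k IH] kn.
  by rewrite II0 bigcup_set0 setI0 /pr measure0 mulr0; split.
have [mU hU] := IH (ltnW kn).
pose U := \bigcup_(i in `I_k) E i; pose A := E k `\` U.
have UE : \bigcup_(i in `I_k.+1) E i = U `|` A.
  rewrite predeqE => w; split => [[i /= + Ei]|].
    rewrite ltnS leq_eqVlt => /orP[/eqP ik|ik]; last by left; exists i.
    by have [?|?] := pselect (U w); [left|right; split => //; rewrite -ik].
  by move=> [[i /= ik Ei]|[Ek _]]; [exists i => //=; exact: ltnW|exists k => /=].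
have mk := mE' k kn; have mA : measurable A by exact: measurableD.
have UA : U `&` A = set0 by rewrite predeqE => w; split => // -[? []].
split; first by rewrite UE; exact: measurableU.
rewrite UE setIUr !pr_setU_disjoint //; last 3 first.
- exact: measurableI.
- exact: measurableI.
- by rewrite setIACA UA setI0.
suff : pr P A <= 2 * pr P (G `&` A) by move: hU; rewrite -/U; lra.
have AB : A `&` B k `<=` G `&` A by move=> w [[? ?] ?]; split; [apply: (hG k)|].
have mAs : measurable (A : set (sub_space X (fun j => (j < t k)%N))).
  apply: measurableD; first exact: mE.
  apply: bigcup_measurable => i /= ik; apply: sub_space_le (mE i (ltn_trans ik kn)).
  by move=> j /leq_trans; apply; apply: ht; exact: ltnW.
have e : pr P (A `&` B k) = pr P A * pr P (B k).
  rewrite /pr -fineM ?fin_num_measure //; last exact: mB'.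
  congr fine; apply: (indep_sub_space hX _ mAs (mB k kn)) => i.
  by rewrite -ltnNge.
have h1 : pr P (A `&` B k) <= pr P (G `&` A).
  by apply: pr_le => //; apply: measurableI => //; exact: mB'.
have := hB k kn; have := pr_ge0 P A; move: e h1.
move: (pr P A) (pr P (B k)) (pr P (A `&` B k)) (pr P (G `&` A)) => a b c g; nra.
Qed.

End ottaviani.

Section poly_ball.
Context (R : realType).

Definition poly_le (x : nat -> R) n (b : R) : Prop :=
  forall y : R, -1 <= y <= 1 -> `|pev x n y| <= b.

Lemma measurable_poly_le d (T : measurableType d) (x : nat -> T -> R) n b :
  (forall k, (k < n)%N -> measurable_fun setT (x k)) ->
  measurable [set w | poly_le (x ^~ w) n b].
Proof.
move=> mx; have mp y : measurable_fun setT (fun w => pev (x ^~ w) n y).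
  by apply: measurable_sum => k; apply: measurable_funM => //; exact: mx.
rewrite (_ : [set w | _] = \bigcap_k [set w | -1 <= rat_point R k <= 1 ->
    `|pev (x ^~ w) n (rat_point R k)| <= b]).
  apply: bigcap_measurable => [|k _]; first by exists 0%N.
  have [h|h] := boolP (-1 <= rat_point R k <= 1).
    rewrite (_ : [set w | _] = [set w | `|pev (x ^~ w) n (rat_point R k)| <= b]).
      rewrite -[X in measurable X]setTI; apply: measurable_fun_le => //.
      exact: measurableT_comp.
    by rewrite predeqE => w; split => /= [h1|h1 _]; [exact: h1|exact: h1].
  by rewrite (_ : [set w | _] = setT) // predeqE => w; split.
rewrite predeqE => w; split => [h k _ hk|h]; first exact: h.
have ratN k : exists j, rat_point R j = - rat_point R k.
  exists (pickle (- (odflt 0 (unpickle k : option rat)))).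
  by rewrite rat_point_ratr rmorphN.
have cp := @continuous_pev R (x ^~ w) n.
have pos y : 0 <= y <= 1 -> `|pev (x ^~ w) n y| <= b.
  by apply: continuous_bound_unit => // k /andP[k0 k1]; apply: h => //; apply/andP; split; lra.
have neg y : 0 <= y <= 1 -> `|pev (x ^~ w) n (- y)| <= b.
  apply: (continuous_bound_unit (f := fun y => pev (x ^~ w) n (- y))).
    move=> z; apply: continuous_comp; first exact: opp_continuous.
    exact: cp.
  move=> k /andP[k0 k1]; have [j E] := ratN k; rewrite -E; apply: h => //; rewrite E.
  by apply/andP; split; lra.
move=> y /andP[y1 y2]; have [y0|/ltW y0] := leP 0 y; first by apply: pos; rewrite y0.
by rewrite -[y]opprK; apply: neg; apply/andP; split; lra.
Qed.

Definition tail m (x : nat -> R) k := (m <= k)%:R * x k.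

Lemma pev_tail (x : nat -> R) m n y : (m <= n)%N ->
  pev x n y = pev x m y + pev (tail m x) n y.
Proof.
move=> mn; rewrite /pev (big_ord_widen n (fun k => x k * y ^+ k) mn) [X in _ = X + _]big_mkcond.
rewrite -big_split.
apply: eq_bigr => k _ /=; rewrite /tail ltnNge.
by case: leqP => _; rewrite ?mul0r ?mul1r ?addr0 ?add0r.
Qed.

Lemma poly_le_tail (x : nat -> R) m n b c : (m <= n)%N -> poly_le x m b ->
  poly_le (tail m x) n c -> poly_le x n (b + c).
Proof.
move=> mn h1 h2 y hy; rewrite (pev_tail x y mn); apply: (le_trans (ler_normD _ _)).
by apply: lerD; [exact: h1|exact: h2].
Qed.

Lemma tail_poly_le (x : nat -> R) m n b c : (m <= n)%N -> poly_le x m b ->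
  poly_le x n c -> poly_le (tail m x) n (b + c).
Proof.
move=> mn h1 h2 y hy.
rewrite (_ : pev (tail m x) n y = pev x n y - pev x m y); last first.
  by rewrite (pev_tail x y mn) addrAC subrr add0r.
by apply: (le_trans (ler_normB _ _)); rewrite addrC; apply: lerD; [exact: h1|exact: h2].
Qed.

Lemma poly_le_mono (x : nat -> R) n b c : b <= c -> poly_le x n b -> poly_le x n c.
Proof. by move=> bc h y hy; apply: le_trans bc; exact: h. Qed.

Lemma poly_le_partial_sums (x : nat -> R) n M :
  (forall k, (k <= n)%N -> `|\sum_(i < k) x i| <= M) ->
  (forall k, (k <= n)%N -> `|\sum_(i < k) (-1) ^+ i * x i| <= M) -> poly_le x n M.
Proof.
move=> h1 h2 y /andP[y1 y2]; have [y0|/ltW y0] := leP 0 y.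
  by apply: pev_bound => //; rewrite y0.
rewrite (_ : pev x n y = pev (fun i => (-1) ^+ i * x i) n (- y)).
  by apply: pev_bound => //; apply/andP; split; lra.
by apply: eq_bigr => i _; rewrite mulrAC -exprMn mulN1r opprK mulrC.
Qed.

Lemma pev_double (x : nat -> R) L y : pev x L.*2 y =
  pev (fun l => x l.*2) L (y ^+ 2) + y * pev (fun l => x l.*2.+1) L (y ^+ 2).
Proof.
elim: L => [|L IH]; first by rewrite /pev !big_ord0 mulr0 addr0.
move: IH; rewrite /pev doubleS !big_ord_recr /= => ->; rewrite -!exprM mul2n (exprS y L.*2); ring.
Qed.

(* With even part [E] and odd part [O] the polynomial is [E (y^2) + y O (y^2)], while the
   pair sums and differences give [E + O] and [E - O]; and [(1 - |y|) |O (y^2)| <= 1]. *)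
Lemma pev_pairs (x : nat -> R) n y : (forall k, `|x k| <= 1) -> `|y| <= 1 ->
  (0 <= y -> `|pev x n y - pev (fun l => x l.*2 + x l.*2.+1) n./2 (y ^+ 2)| <= 2) /\
  (y <= 0 -> `|pev x n y - pev (fun l => x l.*2 - x l.*2.+1) n./2 (y ^+ 2)| <= 2).
Proof.
move=> hx y1; set L := n./2.
pose O := pev (fun l => x l.*2.+1) L (y ^+ 2).
have hO : `|(1 - `|y|) * O| <= 1.
  have yy : y ^+ 2 = `|y| ^+ 2 by rewrite real_normK // num_real.
  have r0 := normr_ge0 y; rewrite /O yy; move: (`|y|) r0 y1 => r r0 r1.
  have q0 : 0 <= r ^+ 2 by rewrite sqr_ge0.
  have b1 : `|pev (fun l => x l.*2.+1) L (r ^+ 2)| <= \sum_(i < L) (r ^+ 2) ^+ i.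
    apply: (le_trans (ler_norm_sum _ _ _)); apply: ler_sum => i _.
    by rewrite normrM -[leRHS]mul1r ler_pM // ger0_norm // exprn_ge0.
  rewrite normrM ger0_norm ?subr_ge0 //.
  apply: (@le_trans _ _ ((1 - r ^+ 2) * \sum_(i < L) (r ^+ 2) ^+ i)).
    apply: ler_pM => //; first by rewrite subr_ge0.
    by rewrite lerD2l lerN2 expr2 ler_piMr.
  by rewrite sum_geom lerBlDr lerDl exprn_ge0.
have odd_part : `|pev x n y - pev x L.*2 y| <= 1.
  rewrite -{1}(odd_double_half n) -/L; case: (odd n); last by rewrite add0n subrr normr0.
  rewrite add1n /pev big_ord_recr /= addrAC subrr add0r normrM normrX.
  by rewrite -[leRHS]mul1r ler_pM // exprn_ile1.
have US : pev (fun l => x l.*2 + x l.*2.+1) L (y ^+ 2) =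
    pev (fun l => x l.*2) L (y ^+ 2) + O.
  by rewrite /O /pev -big_split; apply: eq_bigr => l _; rewrite mulrDl.
have WS : pev (fun l => x l.*2 - x l.*2.+1) L (y ^+ 2) =
    pev (fun l => x l.*2) L (y ^+ 2) - O.
  by rewrite /O /pev -sumrB; apply: eq_bigr => l _; rewrite mulrBl.
move: odd_part; rewrite US WS pev_double -/O.
move: (pev x n y) (pev _ L _) hO => f E hO h; split => y0.
  rewrite (ger0_norm y0) in hO; move: hO h; rewrite !ler_norml => /andP[? ?] /andP[? ?].
  by apply/andP; split; nra.
rewrite (ler0_norm y0) in hO; move: hO h; rewrite !ler_norml => /andP[? ?] /andP[? ?].
by apply/andP; split; nra.
Qed.

End poly_ball.

Section sign_poly.
Context (R : realType) (d : measure_display) (T : measurableType d)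
  (P : probability T R) (e : nat -> {RV P >-> R}).
Hypothesis he : sign_seq e.

(** Here [n] counts coefficients, so f_n corresponds to [poly_ball n.+1]. *)
Definition poly_ball n (b : R) : set T := [set w | poly_le (e ^~ w) n b].
Definition tail_ball m n (b : R) : set T := [set w | poly_le (tail m (e ^~ w)) n b].

Lemma measurable_poly_ball n b : measurable (poly_ball n b).
Proof. by apply: measurable_poly_le => k _; exact: measurable_funP. Qed.

Lemma sub_measurable_poly_ball (p : pred nat) n b : (forall k, (k < n)%N -> p k) ->
  measurable (poly_ball n b : set (sub_space e p)).
Proof. by move=> pn; apply: (@measurable_poly_le _ _ (sub_space e p) (fun k w => e k w)) => k /pn pk; exact: sub_space_RV. Qed.

Lemma sub_measurable_tail_ball (p : pred nat) m n b :
  (forall k, (m <= k < n)%N -> p k) -> measurable (tail_ball m n b : set (sub_space e p)).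
Proof.
move=> pn; apply: (@measurable_poly_le _ _ (sub_space e p) (fun k w => tail m (e ^~ w) k)) => k kn.
rewrite /tail; case: leqP => [mk|_]; last first.
  by rewrite (_ : (fun _ => _) = cst 0) //; apply/funext => w; rewrite mul0r.
by apply: measurable_funM => //; apply: sub_space_RV; apply: pn; rewrite mk.
Qed.

Lemma measurable_tail_ball m n b : measurable (tail_ball m n b).
Proof.
apply: (@sub_space_measurable _ _ _ _ e predT).
by apply: sub_measurable_tail_ball.
Qed.

Let abs1 w k : `|e k w| <= 1.
Proof. by case: he => _ eE _ _; have [->|->] := eE k w; rewrite ?normrN normr1. Qed.

Lemma poly_ball_sign_ball n b : poly_ball n b `<=` sign_ball e n./2 (b + 2).
Proof.
move=> w h; have key r : 0 <= r <= 1 -> exists2 y : R, 0 <= y <= 1 & r = y ^+ 2.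
  move=> /andP[r0 r1]; exists (Num.sqrt r); last by rewrite sqr_sqrtr.
  by rewrite sqrtr_ge0 /= -[leRHS]sqrtr1 ler_sqrt.
split=> _ /key [y /andP[y0 y1] ->].
  have [|h1 _] := @pev_pairs _ (e ^~ w) n y (abs1 w); first by rewrite ger0_norm.
  have := h1 y0; have := h y; rewrite y1 andbT => /(_ (le_trans (lerN10 _) y0)).
  by rewrite !ler_norml => /andP[? ?] /andP[? ?]; apply/andP; split; lra.
have [|_ h1] := @pev_pairs _ (e ^~ w) n (- y) (abs1 w); first by rewrite normrN ger0_norm.
rewrite oppr_le0 sqrrN in h1; have := h1 y0.
have hy : -1 <= - y <= 1 by apply/andP; split; lra.
have := h _ hy; rewrite !ler_norml => /andP[? ?] /andP[? ?].
by apply/andP; split; lra.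
Qed.

Lemma sign_ball_poly_ball n b : sign_ball e n./2 b `<=` poly_ball n (b + 2).
Proof.
move=> w [h1 h2] y /andP[y1 y2]; have ya : `|y| <= 1 by rewrite ler_norml y1.
have y21 : 0 <= y ^+ 2 <= 1 by rewrite sqr_ge0 /= -real_normK ?num_real // exprn_ile1.
have [k1 k2] := @pev_pairs _ (e ^~ w) n y (abs1 w) ya.
have [y0|/ltW y0] := leP 0 y.
  have := k1 y0; have := h1 _ y21; rewrite !ler_norml => /andP[? ?] /andP[? ?].
  by apply/andP; split; lra.
have := k2 y0; have := h2 _ y21; rewrite !ler_norml => /andP[? ?] /andP[? ?].
by apply/andP; split; lra.
Qed.

(** Abel summation bounds the polynomial on [0, 1] by its partial sums and on [-1, 0] by the
    alternating ones; each family is controlled by Kolmogorov's inequality, whence the factor 2. *)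
Lemma pr_tail_ball m n lam : (m <= n)%N -> 0 < lam ->
  1 - 2 * ((n - m)%:R / lam ^+ 2) <= pr P (tail_ball m n lam).
Proof.
move=> mn lam0; have hs := sign_std he.
pose E (a : nat -> R) := [set w : T | exists2 j, (j <= n)%N &
  lam <= `|\sum_(i < j) a i * e i w|].
have mE a : measurable (E a).
  rewrite (_ : E a = \bigcup_(j in `I_n.+1) [set w | lam <= `|\sum_(i < j) a i * e i w|]).
    apply: bigcup_measurable => j _; apply: measurable_norm_ge.
    by apply: measurable_sum => k; apply: measurable_funM => //; exact: measurable_funP.
  by rewrite predeqE => w; split => -[j]; exists j.
have hE a : (forall i, a i ^+ 2 = (m <= i)%:R) -> pr P (E a) <= (n - m)%:R / lam ^+ 2.
  move=> ha; apply: (le_trans (kolmogorov_partial_sums hs a n lam0)).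
  rewrite mulr1 (eq_bigr (fun i : 'I_n => (m <= i)%:R)) => [|i _]; last exact: ha.
  rewrite (_ : \sum_(i < n) _ = (n - m)%:R) //; elim: (n) => [|k IH].
    by rewrite big_ord0 sub0n.
  rewrite big_ord_recr /= IH; case: leqP => mk; first by rewrite subSn // natr1.
  by rewrite addr0; congr _%:R; lia.
pose a1 i : R := (m <= i)%:R; pose a2 i : R := (-1) ^+ i * (m <= i)%:R.
have h1 : pr P (E a1) <= (n - m)%:R / lam ^+ 2.
  by apply: hE => i; rewrite /a1; case: (m <= i)%N; rewrite ?expr1n ?expr0n.
have h2 : pr P (E a2) <= (n - m)%:R / lam ^+ 2.
  by apply: hE => i; rewrite /a2 exprMn sqrr_sign mul1r; case: (m <= i)%N; rewrite ?expr1n ?expr0n.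
have h3 := pr_setU P (mE a1) (mE a2).
have h4 : pr P setT <= pr P (tail_ball m n lam) + pr P (E a1 `|` E a2).
  apply: pr_subU; [exact: measurableT|exact: measurable_tail_ball|exact: measurableU|].
  move=> w _; have [?|n1] := pselect (E a1 w); first by right; left.
  have [?|n2] := pselect (E a2 w); first by right; right.
  left; apply: poly_le_partial_sums => k kn; apply: ltW; rewrite ltNge; apply/negP => hk.
    by apply: n1; exists k.
  by apply: n2; exists k => //; under eq_bigr do rewrite -mulrA.
by rewrite prT in h4; lra.
Qed.

End sign_poly.

Lemma root8 (R : realType) (a : R) : 0 < a -> exists2 u : R, 0 < u & u ^+ 8 = a.
Proof.
move=> a0; exists (Num.sqrt (Num.sqrt (Num.sqrt a))); first by rewrite !sqrtr_gt0.
by rewrite (exprM _ 2 4) sqr_sqrtr ?sqrtr_ge0 // (exprM _ 2 2) sqr_sqrtr ?sqrtr_ge0 // sqr_sqrtr // ltW.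
Qed.

Lemma ln2_ge_half (R : realType) : 2^-1 <= ln 2 :> R.
Proof. by have := @ln_ge_half R 1; rewrite ler01 lexx mul1r => /(_ isT). Qed.

Lemma ln_pow2 (R : realType) k : ln (2 ^ k)%:R = k%:R * ln 2 :> R.
Proof. by rewrite natrX lnXn // mulr_natl. Qed.

Lemma half_double_bounds m s : (0 < s)%N ->
  (m <= (m + s)./2.*2)%N /\ (m + s <= (m + s)./2.*2.+1)%N.
Proof. by have := odd_double_half (m + s); case: (odd _) => /=; lia. Qed.

Lemma ln_half_le (R : realType) (n L : nat) (l : R) : 16 <= l -> n%:R = expR l ->
  n%:R <= 2 * L%:R :> R -> l / 2 <= ln L%:R.
Proof.
move=> l16 nE nL; have : expR (l / 2) <= L%:R.
  rewrite -(@ler_pM2l _ 2) //; apply: le_trans nL.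
  rewrite nE (_ : l = l / 2 + l / 2); last by field.
  rewrite expRD (_ : l / 2 + l / 2 = l); last by field.
  by rewrite ler_wpM2r ?expR_ge0 //; apply: le_trans (expR_ge1Dx _); lra.
by move=> h; rewrite -ler_expR lnK // posrE; exact: lt_le_trans (expR_gt0 _) h.
Qed.

Lemma inv_le_half (R : realType) (l D x : R) : 16 <= l -> 0 < D -> l^-1 <= D ^+ 2 ->
  l / 2 <= x -> x^-1 <= 2^-1 * D.
Proof.
move=> l16 D0 dsq lx; have l0 : 0 < l by lra.
apply: (@le_trans _ _ (l / 2)^-1); first by rewrite lef_pV2 ?posrE ?divr_gt0 //; lra.
have : (4 / l) ^+ 2 <= D ^+ 2.
  apply: le_trans dsq; rewrite expr_div_n ler_pdivrMr ?exprn_gt0 // expr2 mulrA mulVf ?gt_eqF // mul1r.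
  by apply: le_trans l16; lra.
rewrite ler_pXn2r ?nnegrE ?divr_ge0 ?(ltW l0) ?(ltW D0) // => h4.
by rewrite invf_div; move: h4; rewrite (_ : 4 / l = 2 * (2 / l)); [lra|ring].
Qed.

Lemma inv_cube_le (R : realType) (l x : R) : 0 < l -> l / 2 <= x -> (x ^+ 3)^-1 <= 8 / l ^+ 3.
Proof.
move=> l0 lx; have x0 : 0 < x by apply: lt_le_trans lx; rewrite divr_gt0.
rewrite -[8 / _]invrK lef_pV2 ?posrE ?invr_gt0 ?divr_gt0 ?exprn_gt0 //.
rewrite invf_div (_ : _ / 8 = (l / 2) ^+ 3); last by field.
by rewrite lerXn2r ?nnegrE ?divr_ge0 ?(ltW l0) ?(ltW x0).
Qed.

(** As eps q D >= 8, half of the relative margin eps pays for the additive 2, for the replacement of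
    s by q + 1 and for the increment eps r D / 8. *)
Lemma block_level_slack (R : realType) (eps D r q s : R) : 0 < eps < 1 -> 0 < D -> D <= 1 ->
  r <= q -> s <= q + 1 -> 8 / eps <= r * D ->
  (1 - eps) * s * D + eps / 8 * r * D + 2 <= (1 - eps / 2) * D * q.
Proof.
move=> /andP[e0 e1] d0 d1 rq sq rD.
have k1 : (1 - eps) * s * D <= (1 - eps) * (q + 1) * D.
  by rewrite ler_wpM2r ?(ltW d0) // ler_wpM2l //; lra.
have k2 : eps / 8 * r * D <= eps / 8 * (q * D).
  by rewrite -mulrA ler_wpM2l ?ler_wpM2r ?(ltW d0) //; lra.
have k3 : 8 <= eps * (q * D).
  by rewrite mulrC -ler_pdivrMr //; apply: (le_trans rD); rewrite ler_wpM2r // ltW.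
have k4 : (1 - eps) * (q + 1) * D = (1 - eps) * (q * D) + (1 - eps) * D by ring.
have k5 : (1 - eps / 2) * D * q = q * D - eps / 2 * (q * D) by ring.
have k6 : (1 - eps) * D <= 1 by rewrite -[leRHS]mulr1 ler_pM ?(ltW d0) //; lra.
by move: k1 k2 k3 k6; rewrite k4 k5; clear; move: (q * D) => p; lra.
Qed.

Lemma shrink_le (R : realType) (eps : R) :
  (1 + eps / 4) * (1 - eps / 2) <= (1 - eps / 8) ^+ 2.
Proof.
rewrite -subr_ge0 (_ : _ - _ = 9 / 64 * eps ^+ 2); last by field.
by rewrite mulr_ge0 ?sqr_ge0 // divr_ge0.
Qed.

Lemma scaled_radius_ge (R : realType) (eps D r l n : R) : 0 < eps -> 0 < D -> 0 < r -> 0 < l ->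
  l^-1 <= D ^+ 2 -> n <= r ^+ 2 -> 8 ^+ 2 / eps ^+ 2 * l <= n -> 8 / eps <= r * D.
Proof.
move=> e0 d0 r0 l0 dsq nr hn.
rewrite -(@ler_pXn2r _ 2%N) ?nnegrE ?divr_ge0 ?mulr_ge0 ?(ltW e0) ?(ltW r0) ?(ltW d0) //.
rewrite (exprMn _ r D) expr_div_n; apply: (@le_trans _ _ (r ^+ 2 * l^-1)); last first.
  by rewrite ler_wpM2l // exprn_ge0 // ltW.
by rewrite ler_pdivlMr // (le_trans hn).
Qed.

(** * Decay of the quantiles and probability of a short block *)

Section quantile.
Context (R : realType) (d : measure_display) (T : measurableType d)
  (P : probability T R) (B X : R -> {RV P >-> R}).
Hypotheses (hB : standard_brownian_motion B) (hX : continuous_laplace_process B X).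
Notation F := (sup_ball_prob X).
Variable del : nat -> R.
Hypothesis hdel : forall n, (8 <= n)%N -> 0 < del n /\ F (del n) ^+ 2 = (ln n%:R)^-1.

Let F0 a : 0 <= F a. Proof. exact: fine_ge0. Qed.

(** The origin of the threshold 8: 8 = 2^3 and ln 2 >= 1/2 give ln n >= 3/2. *)
Lemma ln_nat_gt1 n : (8 <= n)%N -> 1 < ln n%:R :> R.
Proof.
move=> n8; apply: (@lt_le_trans _ _ (ln (2 ^ 3)%:R)); last first.
  by rewrite ler_ln ?posrE ?ltr0n ?ler_nat //; lia.
by rewrite ln_pow2; have := ln2_ge_half R; lra.
Qed.

Lemma del_sqr_ge n : (8 <= n)%N -> (ln n%:R)^-1 <= del n ^+ 2.
Proof.
move=> n3; have [d0 <-] := hdel n3; rewrite lerXn2r ?nnegrE ?(ltW d0) //.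
by apply: (sup_ball_prob_le_id hB hX); exact: ltW.
Qed.

Lemma del_le n m : (8 <= n)%N -> (n <= m)%N -> del m <= del n.
Proof.
move=> n3 nm; have m3 := leq_trans n3 nm.
have [dn En] := hdel n3; have [dm Em] := hdel m3.
rewrite leNgt; apply/negP => h; have := sup_ball_prob_lt hB hX dn h.
have ln0 := lt_trans ltr01 (ln_nat_gt1 n3); have lm0 := lt_trans ltr01 (ln_nat_gt1 m3).
rewrite -(@ltr_pXn2r _ 2%N) ?nnegrE // En Em ltf_pV2 ?posrE // ltNge ler_ln ?posrE ?ltr0n //.
- by rewrite ler_nat nm.
- by lia.
- by lia.
Qed.

Lemma del_small c : 0 < c -> exists n0, forall n, (n0 <= n)%N -> (8 <= n)%N -> del n <= c.
Proof.
move=> c0; have Fc := sup_ball_prob_gt0 hB hX c0.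
exists (Num.truncn (expR (F c ^- 2))).+1 => n hn n3.
have [dn En] := hdel n3; rewrite leNgt; apply/negP => h.
have := sup_ball_prob_lt hB hX c0 h; rewrite -(@ltr_pXn2r _ 2%N) ?nnegrE // En.
have l0 := lt_trans ltr01 (ln_nat_gt1 n3).
have n0 : 0 < n%:R :> R by rewrite ltr0n; lia.
rewrite -[X in X < _]invrK ltf_pV2 ?posrE ?invr_gt0 ?exprn_gt0 // -ltr_expR lnK //.
rewrite ltNge ltW // (lt_le_trans (truncnS_gt _)) // ler_nat //.
Qed.

(** Two uses of [sup_ball_prob_ratio], at delta and at (1 - eps) delta, gain delta^4 on F and
    delta^8 on its square. A factor delta^2 is later spent on the number of blocks, and delta^6 is
    O((ln ln n)^-2), since the lower bound on F gives ln ln n <= 2 delta^(-3/2). One use would leave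
    delta^2, for which this gives only the power -4/3, short of the rate in [borel_cantelli_sqr]. *)
Lemma del_rate (eps : R) : 0 < eps < 1 -> exists n0, forall n, (n0 <= n)%N -> (8 <= n)%N ->
  F ((1 - eps) ^+ 2 * del n) ^+ 2 <= del n ^+ 8 / ln n%:R /\
  (0 <= ln (ln n%:R) :> R -> del n ^+ 6 * ln (ln n%:R) ^+ 2 <= 4).
Proof.
move=> heps; have /andP[e0 e1] := heps.
have [u0 [u01 hu]] := sup_ball_prob_ratio hB hX heps.
have [v0 [v01 hv]] := sup_ball_prob_lower hB hX.
pose U := Num.max u0 v0; have U1 : 1 <= U by rewrite le_max u01.
have Up := lt_le_trans ltr01 U1.
have [n0 hn0] := @del_small (U ^- 8) (ltac:(by rewrite invr_gt0 exprn_gt0)).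
exists n0 => n nn n3; have [dn En] := hdel n3; have dU := hn0 n nn n3.
have l0 := lt_trans ltr01 (ln_nat_gt1 n3).
have big a : 0 < a -> a <= del n -> exists2 u, U <= u & a = u ^- 8.
  move=> a0 ad; have [u u_gt0 uE] := root8 (eq_ind_r is_true a0 (invr_gt0 a)).
  exists u; last by rewrite uE invrK.
  rewrite -(@ler_pXn2r _ 8%N) ?nnegrE ?(ltW Up) ?(ltW u_gt0) // uE.
  by rewrite -[leLHS]invrK lef_pV2 ?posrE ?invr_gt0 ?exprn_gt0 // (le_trans ad).
have [u Uu dE] := big _ dn (lexx _).
have u1 := le_trans U1 Uu; have up := lt_le_trans ltr01 u1.
have d1 : del n <= 1.
  by rewrite dE invf_le1 ?exprn_gt0 // exprn_ege1.
split.
  have ed0 : 0 < (1 - eps) * del n by rewrite mulr_gt0 // subr_gt0.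
  have ed : (1 - eps) * del n <= del n by rewrite ler_piMl ?(ltW dn) //; lra.
  have [v Uv vE] := big _ ed0 ed.
  have h1 : F ((1 - eps) ^+ 2 * del n) <= ((1 - eps) * del n) ^+ 2 * F ((1 - eps) * del n).
    have := hu v (le_trans _ Uv); rewrite -vE expr2 -mulrA -exprVn (exprM _ 8 2) exprVn -vE.
    by apply; rewrite le_max lexx.
  have h2 : F ((1 - eps) * del n) <= del n ^+ 2 * F (del n).
    have := hu u (le_trans _ Uu); rewrite -dE -exprVn (exprM _ 8 2) exprVn -dE.
    by apply; rewrite le_max lexx.
  have h3 : F ((1 - eps) ^+ 2 * del n) <= del n ^+ 4 * F (del n).
    apply: (le_trans h1); rewrite (_ : del n ^+ 4 * _ = del n ^+ 2 * (del n ^+ 2 * F (del n))); last by ring.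
    apply: ler_pM; rewrite ?sqr_ge0 //.
    by rewrite lerXn2r ?nnegrE ?(ltW ed0) ?(ltW dn).
  rewrite -En (_ : del n ^+ 8 * _ = (del n ^+ 4 * F (del n)) ^+ 2); last by ring.
  by rewrite lerXn2r ?nnegrE ?mulr_ge0 ?exprn_ge0 ?(ltW dn).
move=> ll0.
have h1 : expR (- u ^+ 12) <= F (del n).
  by rewrite dE; apply: hv; apply: le_trans Uu; rewrite le_max lexx orbT.
have h2 : ln (ln n%:R) <= 2 * u ^+ 12.
  rewrite -ler_expR lnK // -[leLHS]invrK -[leRHS]invrK lef_pV2 ?posrE ?invr_gt0 ?expR_gt0 //.
  rewrite -En -expRN -mulrN expRM_natl lerXn2r ?nnegrE ?expR_ge0 //.
have h3 : ln (ln n%:R) ^+ 2 <= 4 * u ^+ 24.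
  rewrite (_ : 4 * _ = (2 * u ^+ 12) ^+ 2); last by ring.
  by rewrite lerXn2r ?nnegrE // mulr_ge0 ?exprn_ge0 // ltW.
apply: (@le_trans _ _ (del n ^+ 6 * (4 * u ^+ 24))); first by rewrite ler_wpM2l // exprn_ge0 // ltW.
rewrite dE -exprVn (_ : _ * _ = 4 * (u ^+ 24)^-1); last by field; rewrite gt_eqF.
by rewrite ler_piMr // invf_le1 ?exprn_gt0 // exprn_ege1.
Qed.

Context (d' : measure_display) (T' : measurableType d') (P' : probability T' R)
  (e : nat -> {RV P' >-> R}).
Hypothesis he : sign_seq e.

Lemma sign_ball_mono L a b : a <= b -> sign_ball e L a `<=` sign_ball e L b.
Proof. by move=> ab w [h1 h2]; split => y hy; apply: le_trans ab; [exact: h1|exact: h2]. Qed.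

(** Once some polynomial of the block is small, the at most s remaining coefficients change it by
    more than lam with probability at most 1/2; so [ottaviani] reduces the block to its last
    polynomial. The inequality (1 + eps / 4) (1 - eps / 2) <= (1 - eps / 8)^2 explains the use of
    [del_rate] at eps / 8. *)
Lemma sub_block (eps : R) : 0 < eps < 1 -> exists n0, forall n, (n0 <= n)%N -> (8 <= n)%N ->
  forall m s, (n <= m)%N -> (0 < s)%N -> s%:R <= eps ^+ 2 * del n ^+ 2 / 16 ^+ 2 * m%:R ->
  pr P' (\bigcup_(i in `I_s) poly_ball e (m + i).+1 ((1 - eps) * Num.sqrt (m + s)%:R * del n))
    <= 2 * (del n ^+ 8 / ln n%:R + 8 / ln n%:R ^+ 3).
Proof.
move=> heps; have /andP[e0 e1] := heps.
have he8 : 0 < eps / 8 < 1 by apply/andP; split; lra.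
have he4 : 0 < eps / 4 < 1 by apply/andP; split; lra.
have [n1 hn1] := del_rate he8; have [n2 hn2] := del_small (ltr01 : 0 < 1 :> R).
have [z0 z010 hz0] := sign_ball_comparison hB hX he he4.
have [z1 z11 hz1] := poly_le_expR (8 ^+ 2 / eps ^+ 2) 1.
have [n3 hn3] : exists n3, forall n, (n3 <= n)%N -> (8 <= n)%N -> 16 + 2 * z0 + z1 <= ln n%:R :> R.
  exists (Num.truncn (expR (16 + 2 * z0 + z1))).+1 => n nn n3.
  rewrite -ler_expR lnK ?posrE ?ltr0n //; last by exact: leq_trans n3.
  by apply/ltW; apply: lt_le_trans (truncnS_gt _) _; rewrite ler_nat.
exists (maxn n1 (maxn n2 n3)) => n; rewrite !geq_max => /and3P[nn1 nn2 nn3] n_3 m s nm s0 hs.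
have [h1 _] := hn1 n nn1 n_3; have d1 := hn2 n nn2 n_3; have hl := hn3 n nn3 n_3.
have [d0 _] := hdel n_3; have dsq := del_sqr_ge n_3.
move: (del n) h1 d1 d0 dsq hs => D h1 d1 d0 dsq hs.
have n_gt0 : 0 < n%:R :> R by rewrite ltr0n; exact: leq_trans n_3.
have nE : n%:R = expR (ln n%:R) :> R by rewrite lnK.
have [l lE] : exists l : R, l = ln n%:R by eexists.
rewrite -lE in h1 dsq hl nE *.
have z00 : 0 <= 2 * z0 by rewrite mulr_ge0 // (le_trans _ z010).
have z1_0 : 0 <= z1 by exact: le_trans z11.
have [l16 l2z lz1 _] : [/\ 16 <= l, 2 * z0 <= l, z1 <= l & 0 <= l].
  by apply: le_of_sum4 => //; rewrite addr0.
have l0 : 0 < l by apply: lt_le_trans l16.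
pose r : R := Num.sqrt m%:R; have m0 : 0 < m%:R :> R by apply: lt_le_trans n_gt0 _; rewrite ler_nat.
have r0 : 0 < r by rewrite sqrtr_gt0.
have r2 : r ^+ 2 = m%:R by rewrite sqr_sqrtr // ltW.
(* lam^2 is four times the bound imposed on s, so [pr_tail_ball] leaves a probability of at least 1
   - 2/4. *)
pose b := (1 - eps) * Num.sqrt (m + s)%:R * D; pose lam := eps / 8 * r * D.
have lam0 : 0 < lam by rewrite !mulr_gt0 // divr_gt0.
have hlam : 4 * s%:R <= lam ^+ 2.
  have -> : lam ^+ 2 = 4 * (eps ^+ 2 * D ^+ 2 / 16 ^+ 2 * m%:R).
    by rewrite -r2 /lam; field.
  by rewrite ler_wpM2l.
have mG : measurable (poly_ball e (m + s) (b + lam)) by exact: measurable_poly_ball.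
apply: (@le_trans _ _ (2 * pr P' (poly_ball e (m + s) (b + lam)))).
  have ind := (sign_std he).1.
  apply: (@ottaviani _ _ _ P' e ind (fun i => poly_ball e (m + i).+1 b)
    (fun i => tail_ball e (m + i).+1 (m + s) lam) _ (fun i => (m + i).+1)) => //.
  - by move=> i j ij; rewrite ltnS leq_add2l.
  - by move=> i _; apply: sub_measurable_poly_ball.
  - by move=> i _; apply: sub_measurable_tail_ball => k /andP[].
  - move=> i i_s; have mi : ((m + i).+1 <= m + s)%N by rewrite -addnS leq_add2l.
    have := pr_tail_ball he mi lam0; have : (m + s - (m + i).+1)%:R / lam ^+ 2 <= 4^-1.
      rewrite ler_pdivrMr ?exprn_gt0 // mulrC ler_pdivlMr // mulrC; apply: le_trans hlam.
      by rewrite ler_wpM2l // ler_nat -addnS subnDl leq_subr.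
    by lra.
  - move=> i i_s w [g1 g2]; have mi : ((m + i).+1 <= m + s)%N by rewrite -addnS leq_add2l.
    exact: poly_le_tail mi g1 g2.
rewrite ler_pM2l //; set L := (m + s)./2.
have [L1 L2] : (m <= L.*2)%N /\ (m + s <= L.*2.+1)%N := half_double_bounds m s0.
pose q : R := Num.sqrt (2 * L%:R).
have q0 : 0 <= q by exact: sqrtr_ge0.
have LE : (L.*2)%:R = 2 * L%:R :> R by rewrite -mul2n natrM.
have q2 : q ^+ 2 = 2 * L%:R by rewrite sqr_sqrtr // mulr_ge0.
have rq : r <= q by rewrite ler_sqrt ?mulr_ge0 // -LE ler_nat.
have msq : Num.sqrt (m + s)%:R <= q + 1.
  rewrite -[leRHS]ger0_norm ?addr_ge0 // -sqrtr_sqr ler_sqrt ?sqr_ge0 //.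
  apply: (@le_trans _ _ (2 * L%:R + 1)); first by rewrite -LE natr1 ler_nat.
  by rewrite -q2 sqrrD1 lerD2r lerDl mulrn_wge0.
have rD : 8 / eps <= r * D.
  apply: (scaled_radius_ge e0 d0 r0 l0 dsq (n := n%:R)); first by rewrite r2 ler_nat.
  have := hz1 l lz1; rewrite expr1 nE => /le_trans; apply.
  by rewrite ler_expR ler_pdivrMr // ler_peMr ?(ltW l0) // ler1n.
have main : b + lam + 2 <= (1 - eps / 2) * D * q := block_level_slack heps d0 d1 rq msq rD.
have lL : l / 2 <= ln L%:R.
  by apply: (ln_half_le l16 nE); rewrite -LE ler_nat (leq_trans nm).
have lL0 : 0 < ln L%:R :> R by apply: lt_le_trans lL; rewrite divr_gt0.
have a_ge : (ln L%:R)^-1 <= (1 - eps / 2) * D.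
  apply: (le_trans (inv_le_half l16 d0 dsq lL)); rewrite ler_wpM2r ?(ltW d0) //.
  by lra.
have zL : z0 <= ln L%:R by apply: le_trans lL; rewrite ler_pdivlMr // mulrC.
have [cmp _] := hz0 L _ zL a_ge.
apply: (@le_trans _ _ (pr P' (sign_ball e L ((1 - eps / 2) * D * q)))).
  apply: pr_le => //; first exact: measurable_sign_ball.
  by move=> w /(poly_ball_sign_ball he); exact: sign_ball_mono.
apply: (le_trans cmp); apply: lerD.
  apply: le_trans h1; rewrite lerXn2r ?nnegrE //; apply: sup_ball_prob_le hX _ _ _.
  by rewrite mulrA ler_wpM2r ?(ltW d0) // shrink_le.
exact: inv_cube_le.
Qed.

End quantile.

(** Rounding theta N down at most halves it, since theta N >= 1: this makes 2 / theta blocks, and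
    one more for the remainder. *)
Lemma ceil_steps (R : realType) (theta : R) N : 0 < theta <= 1 -> 1 <= theta * N%:R ->
  exists s, [/\ (0 < s)%N, s%:R <= theta * N%:R & (N %/ s).+1%:R <= 3 / theta].
Proof.
move=> /andP[t0 t1] tN; have x0 : 0 <= theta * N%:R by apply: le_trans tN.
pose s := Num.truncn (theta * N%:R).
have s1 : (0 < s)%N by rewrite truncn_gt0.
have sx : s%:R <= theta * N%:R by rewrite truncn_le.
have xs : theta * N%:R <= 2 * s%:R.
  have := truncnS_gt (theta * N%:R); rewrite -/s -(natr1 s).
  have : 1 <= s%:R :> R by rewrite ler1n.
  by lra.
exists s; split => //; rewrite -(natr1 (N %/ s)) ler_pdivlMr //.
have : (N %/ s)%:R * s%:R <= N%:R :> R by rewrite -natrM ler_nat leq_trunc_div.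
have s0 : 0 < s%:R :> R by rewrite ltr0n.
move: (_%:R) => k ks; have : k * theta <= 2.
  rewrite -(@ler_pM2r _ s%:R) //; nra.
by lra.
Qed.

Lemma sqr_le_pow2 i : ((i.+1 ^ 2) <= 4 * 2 ^ i)%N.
Proof.
elim: i => [|[|[|i]] IH] //; rewrite (expnS 2).
move: IH; move: (2 ^ i.+2)%N => p; rewrite -!mulnn; nia.
Qed.

(** * Almost sure lower bound *)

Section lower_bound.
Context (R : realType) (d d' : measure_display) (T : measurableType d)
  (T' : measurableType d') (P : probability T R) (P' : probability T' R)
  (B X : R -> {RV P >-> R}) (e : nat -> {RV P' >-> R}).
Hypotheses (hB : standard_brownian_motion B) (hX : continuous_laplace_process B X)
  (he : sign_seq e).
Notation F := (sup_ball_prob X).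
Variable del : nat -> R.
Hypothesis hdel : forall n, (8 <= n)%N -> 0 < del n /\ F (del n) ^+ 2 = (ln n%:R)^-1.

(** Over this range ln n varies by a factor of at most 2, so [del] can be frozen at the left end,
    where it is largest. *)
Definition super_block (eps : R) i : set T' := \bigcup_(n in `I_(2 ^ 2 ^ i.+1))
  [set w | (2 ^ 2 ^ i <= n)%N /\
    poly_ball e n.+1 ((1 - eps) * Num.sqrt n%:R * del (2 ^ 2 ^ i)) w].

Lemma measurable_super_block eps i : measurable (super_block eps i).
Proof.
apply: bigcup_measurable => n _; case: (leqP (2 ^ 2 ^ i) n) => h.
  rewrite (_ : [set w | _] = poly_ball e n.+1 ((1 - eps) * Num.sqrt n%:R * del (2 ^ 2 ^ i))).
    exact: measurable_poly_ball.
  by rewrite predeqE => w; split => // -[].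
by rewrite (_ : [set w | _] = set0) // predeqE => w; split => // -[].
Qed.

(** There are 2^i dyadic rows, each cut into at most 3 / theta blocks with theta of order delta^2,
    and each block costs 2 (delta^8 / ln n + 8 / (ln n)^3). As 2^i <= 2 ln n, the total is of order
    delta^6 + delta^-2 / (ln n)^2: [del_rate] handles the first term, and delta^2 >= 1 / ln n bounds
    the second by 1 / ln n. *)
Lemma super_block_bound (eps : R) : 0 < eps < 1 -> exists C i0, forall i, (i0 <= i)%N ->
  pr P' (super_block eps i) <= C / i.+1%:R ^+ 2.
Proof.
move=> heps; have /andP[e0 e1] := heps.
have [n1 hn1] := sub_block hB hX hdel he heps.
have he8 : 0 < eps / 8 < 1 by apply/andP; split; lra.
have [n2 hn2] := del_rate hB hX hdel he8; have [n3 hn3] := del_small hB hX hdel (ltr01 : 0 < 1 :> R).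
have [z1 z11 hz1] := poly_le_expR (16 ^+ 2 / eps ^+ 2) 1.
(* 3 * 16^2 / eps^2 comes from the number 3 / theta of blocks, 4 from Ottaviani's factor 2 and from
   2^i <= 2 ln n, and 128 = 64 + 8 * 8 from the two error terms. *)
exists (128 * (3 * (16 ^+ 2 / eps ^+ 2) * 4)), (maxn (n1 + n2 + n3) (3 + (Num.truncn (2 * z1)).+1)) => i.
rewrite geq_max => /andP[iN iz]; pose n := (2 ^ 2 ^ i)%N.
have in_ : (i <= n)%N by rewrite (leq_trans (ltnW (ltn_expl i (isT : 1 < 2)%N))) // ltnW // ltn_expl.
have i3 : (3 <= i)%N by apply: leq_trans iz; rewrite leq_addr.
have n8 : (8 <= n)%N.
  rewrite (_ : 8 = 2 ^ 3)%N // leq_exp2l //; apply: leq_trans (_ : 3 <= 2 ^ 3)%N _ => //.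
  by rewrite leq_exp2l.
have nn1 : (n1 <= n)%N by apply: leq_trans in_; apply: leq_trans iN; rewrite -addnA leq_addr.
have nn2 : (n2 <= n)%N by apply: leq_trans in_; apply: leq_trans iN; rewrite addnAC leq_addl.
have nn3 : (n3 <= n)%N by apply: leq_trans in_; apply: leq_trans iN; rewrite leq_addl.
have hsub := hn1 n nn1 n8; have [_ hrate] := hn2 n nn2 n8; have d1 := hn3 n nn3 n8.
have [d0 _] := hdel n8; have dsq := del_sqr_ge hB hX hdel n8.
have lE : ln n%:R = (2 ^ i)%:R * ln 2 :> R by rewrite ln_pow2.
have l2 := ln2_ge_half R.
have l21 : ln 2 <= 1 :> R by have := @le_ln1Dx R 1; rewrite (_ : 1 + 1 = 2) //; apply; lra.
have p0 : 0 < (2 ^ i)%:R :> R by rewrite ltr0n expn_gt0.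
have lp : (2 ^ i)%:R <= 2 * ln n%:R :> R by rewrite lE; nra.
have l_gt1 := @ln_nat_gt1 R n n8.
have isq : i.+1%:R ^+ 2 <= 4 * (2 ^ i)%:R :> R by rewrite -natrX -natrM ler_nat sqr_le_pow2.
have y8 : i.+1%:R ^+ 2 <= 8 * ln n%:R :> R by lra.
have e1' : 0 <= 1 - eps by rewrite subr_ge0 ltW.
have iR : i%:R <= (2 ^ i)%:R :> R by rewrite ler_nat ltnW // ltn_expl.
have z1l : z1 <= ln n%:R.
  have : 2 * z1 <= i%:R.
    apply: ltW; apply: lt_le_trans (truncnS_gt _) _; rewrite ler_nat.
    by apply: leq_trans iz; rewrite leq_addl.
  by lra.
(* ln ln n >= (i - 1) ln 2 >= (i - 1) / 2, which is at least (i + 1) / 4 from i = 3 on. *)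
have ll : i.+1%:R / 4 <= ln (ln n%:R) :> R.
  have i3R : 3 <= i%:R :> R by rewrite ler_nat.
  have -> : ln (ln n%:R) = i%:R * ln 2 + ln (ln 2) :> R.
    by rewrite lE lnM ?posrE // ?ln_pow2 //; lra.
  have h1 : - ln 2 <= ln (ln 2) :> R.
    by rewrite -lnV ?posrE // ler_ln ?posrE ?invr_gt0 //; lra.
  by rewrite -(natr1 i); nra.
have ll0 : 0 <= ln (ln n%:R) :> R by apply: le_trans ll; rewrite divr_ge0.
have D6 : del n ^+ 6 <= 64 / i.+1%:R ^+ 2.
  rewrite ler_pdivlMr ?exprn_gt0 ?ltr0n //.
  have : (i.+1%:R / 4) ^+ 2 <= ln (ln n%:R) ^+ 2 :> R by rewrite lerXn2r ?nnegrE ?divr_ge0.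
  have := hrate ll0; have : 0 <= del n ^+ 6 by rewrite exprn_ge0 // ltW.
  rewrite expr_div_n; move: (del n ^+ 6) (i.+1%:R ^+ 2) (ln _ ^+ 2) => x y z x0 xz yz.
  have : x * (y / 4 ^+ 2) <= x * z by rewrite ler_wpM2l.
  by lra.
pose theta := eps ^+ 2 * del n ^+ 2 / 16 ^+ 2.
have dn2 : 0 < del n ^+ 2 by exact: exprn_gt0.
have e2 : 0 < eps ^+ 2 by exact: exprn_gt0.
have theta01 : 0 < theta <= 1.
  rewrite divr_gt0 ?mulr_gt0 //= ler_pdivrMr // mul1r.
  have a1 : eps ^+ 2 <= 1 by rewrite exprn_ile1 // ltW.
  have a2 : del n ^+ 2 <= 1 by rewrite exprn_ile1 // ltW.
  by apply: (@le_trans _ _ (1 * 1)); [rewrite ler_pM // ltW|rewrite mulr1 exprn_ege1 // ler1n].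
have l0 := lt_trans ltr01 l_gt1.
have big (N : nat) : (n <= N)%N -> 1 <= theta * N%:R.
  move=> nN; have nl : 16 ^+ 2 / eps ^+ 2 * ln n%:R <= N%:R.
    apply: (@le_trans _ _ n%:R); last by rewrite ler_nat.
    have := hz1 _ z1l; rewrite expr1 => /le_trans; apply.
    by rewrite -[leRHS](@lnK R) ?posrE ?ler_expR ?ltr0n;
      [rewrite ler_pdivrMr // ler_peMr ?(ltW l0) ?ler1n|exact: leq_trans n8].
  have h1 : eps ^+ 2 / 16 ^+ 2 * (ln n%:R)^-1 <= theta.
    by rewrite /theta mulrAC ler_wpM2r // ler_wpM2l // ltW.
  apply: (@le_trans _ _ (eps ^+ 2 / 16 ^+ 2 * (ln n%:R)^-1 * N%:R)); last by rewrite ler_wpM2r.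
  apply: (@le_trans _ _ (eps ^+ 2 / 16 ^+ 2 * (ln n%:R)^-1 * (16 ^+ 2 / eps ^+ 2 * ln n%:R))).
    by rewrite le_eqVlt; apply/orP; left; apply/eqP; field; rewrite !gt_eqF.
  by rewrite ler_wpM2l // mulr_ge0 ?invr_ge0 ?(ltW l0) // divr_ge0 // ltW.
pose c := 2 * (del n ^+ 8 / ln n%:R + 8 / ln n%:R ^+ 3).
have c0 : 0 <= c.
  by rewrite mulr_ge0 // addr_ge0 // divr_ge0 ?exprn_ge0 // ltW.
pose blk m s : set T' := \bigcup_(k in `I_s)
  poly_ball e (m + k).+1 ((1 - eps) * Num.sqrt (m + s)%:R * del n).
have mblk m s : measurable (blk m s).
  by apply: bigcup_measurable => k _; exact: measurable_poly_ball.
have nJ j : (n <= 2 ^ (2 ^ i + j))%N by rewrite leq_exp2l // leq_addr.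
have stp j : exists s, [/\ (0 < s)%N, s%:R <= theta * (2 ^ (2 ^ i + j))%:R &
    (2 ^ (2 ^ i + j) %/ s).+1%:R <= 3 / theta].
  by apply: ceil_steps => //; exact: big.
have [s hs] : exists s : nat -> nat, forall j, [/\ (0 < s j)%N,
    (s j)%:R <= theta * (2 ^ (2 ^ i + j))%:R & (2 ^ (2 ^ i + j) %/ s j).+1%:R <= 3 / theta].
  by exists (fun j => projT1 (cid (stp j))) => j; exact: (projT2 (cid (stp j))).
pose row j : set T' := \bigcup_(q in `I_((2 ^ (2 ^ i + j) %/ s j).+1))
  blk (2 ^ (2 ^ i + j) + q * s j)%N (s j).
have mrow j : measurable (row j) by exact: bigcup_measurable.
have prow j : pr P' (row j) <= 3 / theta * c.
  have [s0 s1 s2] := hs j; apply: (le_trans (@pr_bigcup _ _ _ P' _ _ (fun q => mblk _ _))).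
  apply: (@le_trans _ _ ((2 ^ (2 ^ i + j) %/ s j).+1%:R * c)); last by rewrite ler_wpM2r.
  rewrite [leRHS]mulr_natl -[X in _ <= _ *+ X]card_ord -sumr_const; apply: ler_sum => q _.
  apply: hsub => //; first by rewrite (leq_trans (nJ j)) // leq_addr.
  apply: (le_trans s1); rewrite ler_wpM2l ?ler_nat ?leq_addr //.
  by case/andP: theta01 => /ltW.
have mU : measurable (\bigcup_(j in `I_(2 ^ i)) row j) by exact: bigcup_measurable.
(* With 2^t <= m < 2^(t + 1), the index m lies in row t - 2^i; division of m - 2^t by the block
   length gives the block and the offset in it. *)
have sub : super_block eps i `<=` \bigcup_(j in `I_(2 ^ i)) row j.
  move=> w [m /= m_lt [m_ge hm]].
  have m0 : (0 < m)%N by apply: leq_trans m_ge; rewrite expn_gt0.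
  pose t := trunc_log 2 m; have tm : (2 ^ t <= m)%N by exact: trunc_logP.
  have mt : (m < 2 ^ t.+1)%N by exact: trunc_log_ltn.
  have t1 : (2 ^ i <= t)%N.
    by rewrite -ltnS -(@ltn_exp2l 2) //; apply: leq_ltn_trans mt.
  have t2 : (t < 2 ^ i.+1)%N by rewrite -(@ltn_exp2l 2) //; apply: leq_ltn_trans m_lt.
  exists (t - 2 ^ i)%N => /=; first by rewrite ltn_subLR // addnn -mul2n -expnS.
  have tE : (2 ^ i + (t - 2 ^ i) = t)%N by rewrite subnKC.
  have [s0 _ _] := hs (t - 2 ^ i)%N; rewrite /row tE; move: s0; set sj := s _ => s0.
  exists ((m - 2 ^ t) %/ sj)%N => /=.
    rewrite ltnS leq_div2r // leq_subLR addnn -mul2n -expnS; exact: ltnW.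
  exists ((m - 2 ^ t) %% sj)%N => /=; first by rewrite ltn_pmod.
  have mE : (2 ^ t + (m - 2 ^ t) %/ sj * sj + (m - 2 ^ t) %% sj = m)%N.
    by rewrite -addnA -divn_eq subnKC.
  rewrite mE; apply: poly_le_mono hm; rewrite ler_wpM2r ?(ltW d0) // ler_wpM2l //.
  by rewrite ler_sqrt // ler_nat -{1}mE leq_add2l ltnW // ltn_pmod.
apply: (le_trans (pr_le P' (measurable_super_block _ _) mU sub)).
apply: (le_trans (@pr_bigcup _ _ _ P' _ _ mrow)).
apply: (@le_trans _ _ ((2 ^ i)%:R * (3 / theta * c))).
  rewrite [leRHS]mulr_natl -[X in _ <= _ *+ X]card_ord -sumr_const; apply: ler_sum => j _.
  exact: prow.
pose y : R := i.+1%:R ^+ 2; have y0 : 0 < y by rewrite exprn_gt0 // ltr0n.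
have -> : (2 ^ i)%:R * (3 / theta * c) = 3 * (16 ^+ 2 / eps ^+ 2) *
    (2 * ((2 ^ i)%:R / ln n%:R) * (del n ^+ 6 + 8 * ((del n ^+ 2)^-1 / ln n%:R ^+ 2))).
  by rewrite /theta /c; field; rewrite !gt_eqF.
have b1 : (2 ^ i)%:R / ln n%:R <= 2 :> R by rewrite ler_pdivrMr.
have b2 : (del n ^+ 2)^-1 / ln n%:R ^+ 2 <= 8 / y.
  apply: (@le_trans _ _ (ln n%:R)^-1).
    rewrite ler_pdivrMr ?exprn_gt0 // expr2 mulKf ?gt_eqF //.
    by rewrite -[leRHS]invrK lef_pV2 ?posrE ?invr_gt0.
  rewrite -[leRHS]invrK lef_pV2 ?posrE ?invr_gt0 ?divr_gt0 //.
  by rewrite invf_div ler_pdivrMr // mulrC.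
have b3 : 0 <= (2 ^ i)%:R / ln n%:R :> R by rewrite divr_ge0 // ltW.
have b4 : 0 <= del n ^+ 6 + 8 * ((del n ^+ 2)^-1 / ln n%:R ^+ 2).
  by rewrite addr_ge0 ?mulr_ge0 ?divr_ge0 ?invr_ge0 ?exprn_ge0 // ltW.
rewrite -/y in D6.
rewrite (_ : _ / y = 3 * (16 ^+ 2 / eps ^+ 2) * (2 * 2 * (64 / y + 8 * (8 / y)))); last by ring.
apply: ler_wpM2l; first by rewrite mulr_ge0 // divr_ge0 // ltW.
apply: ler_pM => //; first by rewrite mulr_ge0.
  by rewrite ler_wpM2l.
by rewrite lerD // ler_wpM2l.
Qed.

Theorem sign_poly_lower (eps : R) : 0 < eps < 1 -> {ae P', forall w, exists K, forall n,
  (K <= n)%N -> ~ poly_ball e n.+1 ((1 - eps) * Num.sqrt n%:R * del n) w}.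
Proof.
move=> heps; have /andP[e0 e1] := heps; have [C [i0 hC]] := super_block_bound heps.
have := borel_cantelli_sqr (measurable_super_block eps) hC.
apply: filterS => w [K hK]; exists (2 ^ 2 ^ (K + 3))%N => n Kn hn.
have n0 : (0 < n)%N by apply: leq_trans Kn; rewrite expn_gt0.
pose t := trunc_log 2 n; have tn : (2 ^ t <= n)%N by exact: trunc_logP.
have nt : (n < 2 ^ t.+1)%N by exact: trunc_log_ltn.
have t1 : (2 ^ (K + 3) <= t)%N.
  by rewrite -ltnS -(@ltn_exp2l 2) //; apply: leq_ltn_trans nt.
have t0 : (0 < t)%N by apply: leq_trans t1; rewrite expn_gt0.
pose i := trunc_log 2 t; have it : (2 ^ i <= t)%N by exact: trunc_logP.
have ti : (t < 2 ^ i.+1)%N by exact: trunc_log_ltn.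
have Ki : (K + 3 <= i)%N.
  by rewrite -ltnS -(@ltn_exp2l 2) //; apply: leq_ltn_trans ti.
apply: (hK i); first by apply: leq_trans Ki; rewrite leq_addr.
have n_ge : (2 ^ 2 ^ i <= n)%N by apply: leq_trans tn; rewrite leq_exp2l.
exists n => /=; first by apply: (leq_trans nt); rewrite leq_exp2l.
split => //; apply: poly_le_mono hn; rewrite ler_wpM2l //.
  by rewrite mulr_ge0 ?sqrtr_ge0 //; lra.
apply: (del_le hB hX hdel) => //; rewrite (_ : 8 = 2 ^ 3)%N // leq_exp2l //.
apply: leq_trans (_ : 3 <= 2 ^ 3)%N _ => //; rewrite leq_exp2l //.
by apply: leq_trans Ki; rewrite leq_addl.
Qed.

End lower_bound.

Lemma harmonic_tail_unbounded (R : realType) a (M : R) : exists2 b, (a <= b)%N &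
  M <= \sum_(a <= q < b) q.+1%:R^-1.
Proof.
have nd : nondecreasing_seq (series (@harmonic R)).
  by apply: nondecreasing_series => i _ _; rewrite invr_ge0.
have /cvgryPge/(_ (M + \sum_(0 <= q < a) q.+1%:R^-1)) := nondecreasing_dvgn_lt nd (@dvg_harmonic R).
move=> [N _ hN]; exists (maxn a N); first exact: leq_maxl.
have := hN (maxn a N) (leq_maxr _ _); rewrite /series /= (@big_cat_nat _ _ _ a 0%N (maxn a N)) ?leq_maxl //=.
by rewrite [X in X <= _ -> _]addrC lerD2l.
Qed.

(* The number of terms after [k] blocks: consecutive ratios exceed [k^4], while
   the logarithm is only of order [k log k]. *)
Definition block_end k := (2 ^ (4 * k * (trunc_log 2 k).+1))%N.

Lemma block_end_ratio k : (0 < k)%N ->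
  (block_end k.-1 * (2 ^ (trunc_log 2 k).+1) ^ 4 <= block_end k)%N.
Proof.
move=> k0; rewrite /block_end -expnM -expnD leq_exp2l //.
have : (trunc_log 2 k.-1 <= trunc_log 2 k)%N by apply: leq_trunc_log; exact: leq_pred.
move: (trunc_log 2 k.-1) (trunc_log 2 k) => s t st; case: k k0 => //= k _; nia.
Qed.

Lemma block_end_mono : {homo block_end : i j / (i <= j)%N}.
Proof.
move=> i j ij; rewrite /block_end leq_exp2l // leq_mul ?leq_mul2l ?ij // ltnS.
exact: leq_trunc_log.
Qed.

Lemma block_end_gt k : (0 < k)%N -> (k.+1 < block_end k)%N.
Proof.
move=> k0; apply: (@leq_ltn_trans (2 ^ k)); first exact: ltn_expl.
by rewrite /block_end ltn_exp2l //; nia.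
Qed.

(** * Almost sure upper bound along sparse blocks *)

Section upper_bound.
Context (R : realType) (d d' : measure_display) (T : measurableType d)
  (T' : measurableType d') (P : probability T R) (P' : probability T' R)
  (B X : R -> {RV P >-> R}) (e : nat -> {RV P' >-> R}).
Hypotheses (hB : standard_brownian_motion B) (hX : continuous_laplace_process B X)
  (he : sign_seq e).
Notation F := (sup_ball_prob X).
Notation pr := (pr P').
Variable del : nat -> R.
Hypothesis hdel : forall n, (8 <= n)%N -> 0 < del n /\ F (del n) ^+ 2 = (ln n%:R)^-1.

(** For odd n the n + 1 coefficients form exactly L pairs with 2 L = n + 1. The factor 3/4 leaves
    room for the comparison error, at most 8 / (ln n)^3 and so below a quarter of 1 / ln n. *)
Lemma poly_ball_ge (eps : R) : 0 < eps < 1 -> exists n0, forall n, (n0 <= n)%N -> (8 <= n)%N ->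
  odd n -> 3 / 4 / ln n%:R <= pr (poly_ball e n.+1 ((1 + eps) * Num.sqrt n%:R * del n)).
Proof.
move=> heps; have /andP[e0 e1] := heps.
have he2 : 0 < eps / 2 < 1 by apply/andP; split; lra.
have [n2 hn2] := del_small hB hX hdel (ltr01 : 0 < 1 :> R).
have [z0 z010 hz0] := sign_ball_comparison hB hX he he2.
have [z1 z11 hz1] := poly_le_expR (8 ^+ 2 / eps ^+ 2) 1.
exists (maxn n2 (Num.truncn (expR (32 + 2 * z0 + z1))).+1) => n; rewrite geq_max => /andP[nn2 nn3] n8 odd_n.
have n_gt0 : 0 < n%:R :> R by rewrite ltr0n; exact: leq_trans n8.
have hl : 32 + 2 * z0 + z1 <= ln n%:R.
  rewrite -ler_expR lnK //; apply/ltW; apply: lt_le_trans (truncnS_gt _) _.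
  by rewrite ler_nat.
have d1 := hn2 n nn2 n8; have [d0 dE] := hdel n8; have dsq := del_sqr_ge hB hX hdel n8.
move: (del n) d1 d0 dE dsq => D d1 d0 dE dsq.
have nE : n%:R = expR (ln n%:R) :> R by rewrite lnK.
have [l lE] : exists l : R, l = ln n%:R by eexists.
rewrite -lE in dE dsq hl nE *.
have z00 : 0 <= 2 * z0 by rewrite mulr_ge0 // (le_trans _ z010).
have z1_0 : 0 <= z1 by exact: le_trans z11.
have [l32 l2z lz1 _] : [/\ 32 <= l, 2 * z0 <= l, z1 <= l & 0 <= l].
  by apply: le_of_sum4 => //; rewrite addr0.
have l16 : 16 <= l by apply: le_trans l32; rewrite ler_nat.
have l0 : 0 < l by apply: lt_le_trans l16.
pose r : R := Num.sqrt n%:R; have r0 : 0 < r by rewrite sqrtr_gt0.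
have r2 : r ^+ 2 = n%:R by rewrite sqr_sqrtr // ltW.
pose L := n.+1./2; have LE : (2 * L%:R = n.+1%:R :> R).
  by rewrite -natrM mul2n /L -[in RHS](odd_double_half n.+1) /= odd_n.
pose q : R := Num.sqrt (2 * L%:R).
have qr : q <= r + 1.
  rewrite -[leRHS]ger0_norm ?addr_ge0 ?(ltW r0) // -sqrtr_sqr ler_sqrt ?sqr_ge0 //.
  by rewrite LE -natr1 -r2 sqrrD1 lerD2r lerDl mulrn_wge0 // ltW.
have rD : 8 / eps <= r * D.
  apply: (scaled_radius_ge e0 d0 r0 l0 dsq (n := n%:R)); first by rewrite r2.
  have := hz1 l lz1; rewrite expr1 nE => /le_trans; apply.
  by rewrite ler_expR ler_pdivrMr // ler_peMr ?(ltW l0) // ler1n.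
have main : (1 + eps / 2) * D * q + 2 <= (1 + eps) * r * D.
  have k1 : (1 + eps / 2) * D * q <= (1 + eps / 2) * D * (r + 1).
    by apply: ler_wpM2l => //; apply: mulr_ge0; [lra|exact: ltW].
  have k2 : 8 <= eps * (r * D) by rewrite mulrC -ler_pdivrMr.
  have k3 : (1 + eps / 2) * D <= 2.
    by rewrite -[leRHS]mulr1 ler_pM ?(ltW d0) //; lra.
  have k4 : (1 + eps / 2) * D * (r + 1) = r * D + (1 + eps / 2) * D + eps * (r * D) / 2 by field.
  have k5 : (1 + eps) * r * D = r * D + eps * (r * D) by ring.
  move: k1 k2 k3; rewrite k4 k5; move: (eps * (r * D)) => y; lra.
have lL : l / 2 <= ln L%:R by apply: (ln_half_le l16 nE); rewrite LE ler_nat.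
have lL0 : 0 < ln L%:R :> R by apply: lt_le_trans lL; rewrite divr_gt0.
have a_ge : (ln L%:R)^-1 <= D.
  apply: (le_trans (inv_le_half l16 d0 dsq lL)); rewrite ler_piMl ?(ltW d0) //.
  by lra.
have zL : z0 <= ln L%:R by apply: le_trans lL; rewrite ler_pdivlMr // mulrC.
have [_ cmp] := hz0 L _ zL a_ge.
apply: (@le_trans _ _ (pr (sign_ball e L ((1 + eps / 2) * D * q)))); last first.
  apply: pr_le; [exact: measurable_sign_ball|exact: measurable_poly_ball|].
  by move=> w /(sign_ball_poly_ball he); apply: poly_le_mono.
have := inv_cube_le l0 lL.
have : 8 / l ^+ 3 <= 4^-1 / l.
  rewrite ler_pdivrMr ?exprn_gt0 // (_ : _ * _ = l ^+ 2 / 4); last by field; rewrite gt_eqF.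
  by nra.
move: cmp; rewrite dE (_ : 3 / 4 / l = l^-1 - 4^-1 / l); last by field; rewrite gt_eqF.
by rewrite -/q; move: (4^-1 / l) (8 / _) (l^-1) => y1 y2 y3; lra.
Qed.

Let deg k := (block_end k).-1.
(** The allowance for the coefficients before block k. In units of the normalised radius, [lvl]
    exceeds 1 + eps / 4 by exactly this amount, and adding it once more stays below 1 + eps. *)
Let eta (eps : R) k := eps / 4 * (Num.sqrt (deg k)%:R * del (deg k)).
Let lvl (eps : R) k := (1 + eps / 2) * (Num.sqrt (deg k)%:R * del (deg k)).

(** The head is negligible: its length is smaller by a factor p^4 with p = 2^t > k, while eta^2
    loses only ln n <= 4 p t, so it fails with probability O(ln n / p^4) = O(k^-2). This is also at
    most a quarter of 1 / ln n; subtracted from the 3/4 of [poly_ball_ge] it leaves 1 / (2 ln n) for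
    the tail, which involves block k alone. *)
Lemma upper_block (eps : R) : 0 < eps < 1 -> exists C k0, forall k, (k0 <= k)%N ->
  let t := (trunc_log 2 k).+1 in
  pr (~` poly_ball e (block_end k.-1) (eta eps k)) <= C / k.+1%:R ^+ 2 /\
  (16 * ((2 ^ t)%:R * t%:R))^-1 <= pr (tail_ball e (block_end k.-1) (block_end k) (lvl eps k)).
Proof.
move=> heps; have /andP[e0 e1] := heps.
have he4 : 0 < eps / 4 < 1 by apply/andP; split; lra.
have [n0 hn0] := poly_ball_ge he4.
pose K : R := (2 * 8 ^+ 2) / eps ^+ 2; have K0 : 0 < K by rewrite divr_gt0 ?exprn_gt0 // mulr_gt0 // exprn_gt0.
exists (4 * K), (maxn (n0 + 8) (Num.truncn (2 * 8 ^+ 2 * K)).+1) => k.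
rewrite geq_max => /andP[k1 k2] t; pose p := (2 ^ t)%N.
have k_gt0 : (0 < k)%N by apply: leq_trans k1; rewrite addnS.
have kp : (k < p)%N by exact: trunc_log_ltn.
have tp : (t ^ 2 <= 2 * p)%N.
  by rewrite /p /t (expnS 2) mulnA; exact: sqr_le_pow2.
have tp1 : (t <= p)%N by rewrite ltnW // ltn_expl.
have Ngt := block_end_gt k_gt0.
have NE : block_end k = (deg k).+1 by rewrite /deg prednK // (leq_trans _ Ngt).
have kdeg : (k < deg k)%N by rewrite NE in Ngt; rewrite -ltnS.
have n8 : (8 <= deg k)%N by apply: leq_trans (ltnW kdeg); apply: leq_trans k1; rewrite leq_addl.
have nn0 : (n0 <= deg k)%N by apply: leq_trans (ltnW kdeg); apply: leq_trans k1; rewrite leq_addr.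
have odd_n : odd (deg k).
  have : odd (block_end k) = false.
    by rewrite /block_end oddX orbF -leqn0 leqNgt muln_gt0 /= muln_gt0 k_gt0.
  by rewrite NE /= => /negbFE.
have pb := hn0 _ nn0 n8 odd_n.
have [D0 _] := hdel n8; have Dsq := del_sqr_ge hB hX hdel n8.
have rat := block_end_ratio k_gt0; rewrite -/t -/p in rat.
have l_up : ln (deg k)%:R <= 4 * (p%:R * t%:R) :> R.
  apply: (@le_trans _ _ (ln (block_end k)%:R)).
    rewrite ler_ln ?posrE ?ltr0n ?ler_nat ?NE ?leqnSn //.
    by apply: leq_trans n8.
  have ln21 : ln 2 <= 1 :> R by have := @le_ln1Dx R 1; rewrite (_ : 1 + 1 = 2) //; apply; lra.
  rewrite /block_end ln_pow2 -/t; apply: (@le_trans _ _ ((4 * k * t)%:R * 1)).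
    by rewrite ler_wpM2l.
  by rewrite mulr1 -!natrM ler_nat -mulnA leq_mul2l /= leq_mul2r ltnW ?orbT.
have l1 := @ln_nat_gt1 R _ n8; have l0 := lt_trans ltr01 l1.
have p0 : 0 < p%:R :> R by rewrite ltr0n expn_gt0.
have t0 : 0 < t%:R :> R by rewrite ltr0n.
have n_gt0 : 0 < (deg k)%:R :> R by rewrite ltr0n (leq_trans _ n8).
have [l lE] : exists l : R, l = ln (deg k)%:R by eexists.
rewrite -lE in pb Dsq l_up l1 l0.
have eta0 : 0 < eta eps k by rewrite !mulr_gt0 ?divr_gt0 // sqrtr_gt0.
have etaE : eta eps k ^+ 2 = eps ^+ 2 / 16 * ((deg k)%:R * del (deg k) ^+ 2).
  by rewrite /eta exprMn (exprMn _ (Num.sqrt _)) sqr_sqrtr ?(ltW n_gt0) //; field.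
have pA : pr (~` poly_ball e (block_end k.-1) (eta eps k)) <= K * (l / p%:R ^+ 4).
  rewrite pr_setC; last exact: measurable_poly_ball.
  have := @pr_tail_ball _ _ _ _ _ he 0 (block_end k.-1) _ (leq0n _) eta0; rewrite subn0.
  rewrite (_ : tail_ball e 0 _ _ = poly_ball e (block_end k.-1) (eta eps k)); last first.
    by rewrite /tail_ball /poly_ball; under eq_set do under [tail _ _]funext do rewrite /tail /= mul1r.
  suff : (block_end k.-1)%:R / eta eps k ^+ 2 <= K / 2 * (l / p%:R ^+ 4).
    by rewrite (_ : K / 2 * _ = K * (l / p%:R ^+ 4) / 2); [lra|ring].
  rewrite ler_pdivrMr ?exprn_gt0 // etaE.
  have h1 : (block_end k.-1)%:R * p%:R ^+ 4 <= 2 * (deg k)%:R :> R.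
    rewrite -natrX -!natrM ler_nat; apply: (leq_trans rat); rewrite NE mul2n -addnn.
    by rewrite -addn1 leq_add2l (leq_trans _ n8).
  have h2 : 1 <= l * del (deg k) ^+ 2 by rewrite mulrC -ler_pdivrMr // div1r.
  have h3 : (block_end k.-1)%:R <= 2 * (deg k)%:R / p%:R ^+ 4 :> R.
    by rewrite ler_pdivlMr // exprn_gt0.
  apply: (le_trans h3).
  apply: (@le_trans _ _ (2 * (deg k)%:R / p%:R ^+ 4 * (2 * (l * del (deg k) ^+ 2)))).
    rewrite -[leLHS]mulr1 ler_wpM2l ?divr_ge0 ?mulr_ge0 ?exprn_ge0 ?(ltW p0) ?(ltW n_gt0) //; lra.
  rewrite le_eqVlt; apply/orP; left; apply/eqP; rewrite /K; field.
  by rewrite !gt_eqF.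
have lp2 : l ^+ 2 <= 2 * 4 ^+ 2 * p%:R ^+ 3.
  apply: (@le_trans _ _ ((4 * (p%:R * t%:R)) ^+ 2)).
    by rewrite lerXn2r ?nnegrE ?mulr_ge0 ?(ltW l0) ?(ltW p0) ?(ltW t0).
  have tpR : t%:R ^+ 2 <= 2 * p%:R :> R by rewrite -natrX -natrM ler_nat.
  rewrite (_ : (4 * _) ^+ 2 = 4 ^+ 2 * p%:R ^+ 2 * t%:R ^+ 2); last by ring.
  rewrite (_ : 2 * _ * _ = 4 ^+ 2 * p%:R ^+ 2 * (2 * p%:R)); last by ring.
  by rewrite ler_wpM2l // mulr_ge0 ?exprn_ge0 ?(ltW p0).
have lp1 : l <= 4 * p%:R ^+ 2.
  apply: (le_trans l_up); rewrite expr2 ler_wpM2l // ler_wpM2l ?(ltW p0) // ler_nat //.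
have kpR : k.+1%:R <= p%:R :> R by rewrite ler_nat.
have p4 : 0 < p%:R ^+ 4 :> R by exact: exprn_gt0.
split.
  apply: (le_trans pA); rewrite (mulrC 4) -(mulrA K) ler_pM2l //.
  apply: (@le_trans _ _ (4 / p%:R ^+ 2)).
    rewrite ler_pdivrMr // (_ : _ * _ = 4 * p%:R ^+ 2) //; field; by rewrite gt_eqF.
  have k0 : 0 < k.+1%:R ^+ 2 :> R by apply: exprn_gt0; exact: ltr0Sn.
  have pp0 : 0 < p%:R ^+ 2 :> R by exact: exprn_gt0.
  have kp2 : k.+1%:R ^+ 2 <= p%:R ^+ 2 :> R by apply: lerXn2r; rewrite ?nnegrE ?ler0n.
  by apply: ler_wpM2l => //; rewrite lef_pV2 ?posrE.
have pA4 : pr (~` poly_ball e (block_end k.-1) (eta eps k)) <= 4^-1 / l.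
  apply: (le_trans pA); rewrite mulrA ler_pdivrMr //.
  rewrite (_ : 4^-1 / l * p%:R ^+ 4 = p%:R ^+ 4 / (4 * l)); last by field; rewrite gt_eqF.
  rewrite ler_pdivlMr ?mulr_gt0 // (_ : K * l * (4 * l) = 4 * K * l ^+ 2); last by ring.
  apply: (@le_trans _ _ (4 * K * (2 * 4 ^+ 2 * p%:R ^+ 3))).
    by rewrite ler_wpM2l // mulr_ge0 // ltW.
  rewrite (exprS p%:R 3) (_ : 4 * K * _ = 2 * 8 ^+ 2 * K * p%:R ^+ 3); last by ring.
  rewrite ler_wpM2r ?exprn_ge0 ?(ltW p0) //.
  apply: ltW; apply: lt_le_trans (truncnS_gt _) _; rewrite ler_nat.
  by apply: leq_trans k2 _; exact: ltnW.
have mm : (block_end k.-1 <= block_end k)%N by apply: block_end_mono; exact: leq_pred.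
have h1 : pr (poly_ball e (block_end k) ((1 + eps / 4) * (Num.sqrt (deg k)%:R * del (deg k)))) <=
    pr (tail_ball e (block_end k.-1) (block_end k) (lvl eps k)) +
    pr (~` poly_ball e (block_end k.-1) (eta eps k)).
  apply: pr_subU; [exact: measurable_poly_ball|exact: measurable_tail_ball|
    by apply: measurableC; exact: measurable_poly_ball|].
  move=> w hw; have [h|h] := pselect (poly_ball e (block_end k.-1) (eta eps k) w); last by right.
  left; have := tail_poly_le mm h hw; apply: poly_le_mono.
  by rewrite /eta /lvl -mulrDl ler_wpM2r ?mulr_ge0 ?sqrtr_ge0 ?(ltW D0) //; lra.
rewrite -(mulrA (1 + eps / 4)) -NE in pb.
have h2 : (2 * l)^-1 <= pr (tail_ball e (block_end k.-1) (block_end k) (lvl eps k)).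
  rewrite (_ : (2 * l)^-1 = 3 / 4 / l - 4^-1 / l); last by field; rewrite gt_eqF.
  by lra.
by apply: le_trans h2; rewrite lef_pV2 ?posrE ?mulr_gt0 //; lra.
Qed.

Let D eps k := tail_ball e (block_end k.-1) (block_end k) (lvl eps k).

(** For 2^q <= k < 2^(q + 1) the bound is 1 / (32 * 2^q (q + 1)), so these 2^q independent failures
    have joint probability at most exp (- 1 / (32 (q + 1))); the divergence of the harmonic series
    in q gives 0. *)
Lemma missed_blocks (eps : R) k0 :
  (forall k, (k0 <= k)%N -> (16 * ((2 ^ (trunc_log 2 k).+1)%:R * (trunc_log 2 k).+1%:R))^-1 <=
    pr (D eps k)) ->
  forall a, (k0 <= 2 ^ a)%N -> P' (\bigcap_(k in [set k | (2 ^ a <= k)%N]) ~` D eps k) = 0%E.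
Proof.
move=> hD a ka.
have mD k : measurable (D eps k) by exact: measurable_tail_ball.
have mI (s : seq nat) : measurable (\bigcap_(k in [set` s]) ~` D eps k).
  by rewrite bigcap_seq; apply: bigsetI_measurable => k _; exact: measurableC.
pose p (i : nat) : pred nat := fun k => (block_end i.-1 <= k < block_end i)%N.
have p_disj i j k : i != j -> p i k -> ~~ p j k.
  have half x y : (x < y)%N -> p x k -> p y k -> False.
    case: y => // y; rewrite ltnS => xy /andP[_ kx] /andP[ky _].
    by have := leq_trans kx (leq_trans (block_end_mono xy) ky); rewrite ltnn.
  rewrite neq_ltn => /orP[] h pi; apply/negP => pj; first exact: half h pi pj.
  exact: half h pj pi.
have prod s : uniq s -> P' (\bigcap_(k in [set` s]) ~` D eps k) =
    (\prod_(k <- s) (1 - pr (D eps k)))%:E.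
  move=> us; rewrite (indep_block_events (sign_std he).1 p_disj _ us) => [|i]; last first.
    by apply: measurableC; apply: sub_measurable_tail_ball.
  rewrite -prodEFin; apply: eq_bigr => i _.
  by rewrite prE ?pr_setC //; exact: measurableC.
pose h (q : nat) : R := q.+1%:R^-1.
have block q : (a <= q)%N ->
    \prod_(2 ^ q <= k < 2 ^ q.+1) (1 - pr (D eps k)) <= expR (- (h q / 32)).
  move=> aq; pose c : R := (16 * ((2 ^ q.+1)%:R * q.+1%:R))^-1.
  apply: (@le_trans _ _ (\prod_(2 ^ q <= k < 2 ^ q.+1) expR (- c))).
    rewrite big_nat [leRHS]big_nat; apply: ler_prod => k /andP[k1 k2].
    have tk : trunc_log 2 k = q.
      apply/eqP; rewrite eqn_leq -ltnS -(@ltn_exp2l 2) // (leq_ltn_trans _ k2) ?trunc_logP //=.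
        by rewrite trunc_log_max.
      by rewrite (leq_trans _ k1) // expn_gt0.
    rewrite subr_ge0 pr_le1 //=; apply: le_trans (expR_ge1Dx _); rewrite lerD2l lerN2.
    have := hD k; rewrite tk; apply; apply: (leq_trans ka); apply: leq_trans k1.
    by rewrite leq_exp2l.
  rewrite prodr_const_nat (_ : (2 ^ q.+1 - 2 ^ q = 2 ^ q)%N); last by rewrite expnS mul2n -addnn addnK.
  rewrite -expRM_natl ler_expR mulrN lerN2 /h /c expnS natrM.
  have : 0 < (2 ^ q)%:R :> R by rewrite ltr0n expn_gt0.
  have : 0 < q.+1%:R :> R by [].
  move: (_%:R) (_%:R) => x y x0 y0; rewrite le_eqVlt; apply/orP; left; apply/eqP; field.
  by rewrite !gt_eqF.
have blocks b : (a <= b)%N -> \prod_(2 ^ a <= k < 2 ^ b) (1 - pr (D eps k)) <=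
    expR (- ((\sum_(a <= q < b) h q) / 32)).
  move=> /subnKC <-; elim: (b - a)%N => [|m IH].
    by rewrite addn0 !big_geq // mul0r oppr0 expR0.
  rewrite addnS (@big_cat_nat _ _ _ (2 ^ (a + m))) /=; last 2 first.
  - by rewrite leq_exp2l // leq_addr.
  - by rewrite leq_exp2l.
  rewrite big_nat_recr ?leq_addr //= mulrDl opprD expRD ler_pM //.
  - by apply: prodr_ge0 => k _; rewrite subr_ge0 pr_le1.
  - by apply: prodr_ge0 => k _; rewrite subr_ge0 pr_le1.
  - by apply: block; rewrite leq_addr.
have mA : measurable (\bigcap_(k in [set k | (2 ^ a <= k)%N]) ~` D eps k).
  by apply: bigcap_measurable => [|k _]; [exists (2 ^ a)%N => /=|exact: measurableC].
apply/eqP; rewrite eq_le measure_ge0 andbT; apply/lee_addgt0Pr => x x0; rewrite add0e.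
have [b ab hb] := harmonic_tail_unbounded a (32 * x^-1).
apply: (@le_trans _ _ (P' (\bigcap_(k in [set` index_iota (2 ^ a) (2 ^ b)]) ~` D eps k))).
  apply: le_measure; rewrite ?inE //; move=> w hw k /=.
  by rewrite mem_index_iota => /andP[k1 _]; exact: hw.
rewrite prod ?iota_uniq // lee_fin; apply: (le_trans (blocks b ab)).
apply: le_trans (expR_inv_le x0); rewrite ler_expR lerN2 ler_pdivlMr // mulrC.
exact: hb.
Qed.

Theorem sign_poly_upper (eps : R) : 0 < eps < 1 -> {ae P', forall w, forall K, exists2 n,
  (K <= n)%N & poly_ball e n.+1 ((1 + eps) * Num.sqrt n%:R * del n) w}.
Proof.
move=> heps; have /andP[e0 e1] := heps; have [C [k0 hk]] := upper_block heps.
have mA k : measurable (~` poly_ball e (block_end k.-1) (eta eps k)).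
  by apply: measurableC; exact: measurable_poly_ball.
have bc := borel_cantelli_sqr mA (fun k kk => (hk k kk).1).
have hit a : {ae P', forall w, exists2 k, (2 ^ (a + k0) <= k)%N & D eps k w}.
  exists (\bigcap_(k in [set k | (2 ^ (a + k0) <= k)%N]) ~` D eps k); split.
  - apply: bigcap_measurable => [|k _]; first by exists (2 ^ (a + k0))%N => /=.
    by apply: measurableC; exact: measurable_tail_ball.
  - apply: (missed_blocks (fun k kk => (hk k kk).2)).
    by apply: (leq_trans (ltnW (ltn_expl k0 (isT : 1 < 2)%N))); rewrite leq_exp2l // leq_addl.
  - by move=> w /= h k /= kk Dk; apply: h; exists k.
have := ae_foralln hit; apply: filterS2 bc => w [K1 hK1] hw K.
have [k kk Dk] := hw (K + K1 + 8)%N.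
have kge : (K + K1 + 8 < k)%N.
  by apply: leq_trans kk; apply: (leq_trans (ltn_expl _ (isT : 1 < 2)%N)); rewrite leq_exp2l // leq_addr.
have k_gt0 : (0 < k)%N by exact: leq_ltn_trans kge.
have Ngt := block_end_gt k_gt0.
have NE : block_end k = (deg k).+1 by rewrite /deg prednK // (leq_trans _ Ngt).
have kdeg : (k < deg k)%N by rewrite NE in Ngt; rewrite -ltnS.
have kd := leq_trans (ltnW kge) (ltnW kdeg).
exists (deg k); first by apply: leq_trans kd; rewrite -addnA leq_addr.
have K1k : (K1 <= k)%N by apply: leq_trans (ltnW kge); rewrite addnAC leq_addl.
have ng : poly_ball e (block_end k.-1) (eta eps k) w by apply: contrapT; exact: hK1 k K1k.
have mm : (block_end k.-1 <= block_end k)%N by apply: block_end_mono; exact: leq_pred.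
have n8 : (8 <= deg k)%N by apply: leq_trans kd; rewrite leq_addl.
have [del0 _] := hdel n8.
have := poly_le_tail mm ng Dk; rewrite NE; apply: poly_le_mono.
by rewrite /eta /lvl -mulrDl -(mulrA (1 + eps)) ler_wpM2r ?mulr_ge0 ?sqrtr_ge0 ?(ltW del0) //; lra.
Qed.

End upper_bound.

(** * The quantile function *)

Lemma limn_einf_eq1 (R : realType) (u : nat -> R) :
  (forall m, exists K, forall n, (K <= n)%N -> 1 - m.+2%:R^-1 <= u n) ->
  (forall m K, exists2 n, (K <= n)%N & u n <= 1 + m.+2%:R^-1) ->
  limn_einf (fun n => (u n)%:E) = 1%E.
Proof.
move=> lo up; have small (x : R) : 0 < x -> exists m : nat, m.+2%:R^-1 <= x.
  move=> x0; exists (Num.truncn x^-1); rewrite -[leRHS]invrK lef_pV2 ?posrE ?invr_gt0 ?ltr0n //.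
  by apply: ltW; apply: (lt_trans (truncnS_gt _)); rewrite ltr_nat.
rewrite limn_einf_lim; apply/eqP; rewrite eq_le; apply/andP; split.
  apply: lime_le; first exact: is_cvg_einfs.
  apply: nearW => n; apply/lee_addgt0Pr => x x0; have [m hm] := small x x0.
  have [k nk uk] := up m n; apply: (@le_trans _ _ (u k)%:E).
    by apply: ereal_inf_lbound; exists k.
  by rewrite -EFinD lee_fin; apply: (le_trans uk); rewrite lerD2l.
apply/lee_subgt0Pr => x x0; have [m hm] := small x x0.
apply: lime_ge; first exact: is_cvg_einfs.
have [K hK] := lo m; exists K => // n /= Kn.
apply: le_ereal_inf_tmp => _ [k /= nk <-]; rewrite -EFinB lee_fin.
by apply: le_trans (hK k (leq_trans Kn nk)); rewrite lerD2l lerN2.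
Qed.

Section quantile_function.
Context (R : realType) (d : measure_display) (T : measurableType d)
  (P : probability T R) (B X : R -> {RV P >-> R}).
Hypotheses (hB : standard_brownian_motion B) (hX : continuous_laplace_process B X).
Notation F := (sup_ball_prob X).

Lemma sup_ball_prob_continuous a : 0 < a -> {for a, continuous F}.
Proof.
move=> a0; apply/cvgrPdist_le => x x0.
have [w [w0 wa hw]] := sup_ball_prob_window hB hX a0 x0.
near=> b.
have : `|a - b| < w by near: b; exact: cvgr_dist_lt.
rewrite ltr_norml => /andP[b1 b2].
have le := sup_ball_prob_le hX.
have h1 : F (a - w) <= F b by apply: le; lra.
have h2 : F b <= F (a + w) by apply: le; lra.
have h3 : F (a - w) <= F a by apply: le; lra.
have h4 : F a <= F (a + w) by apply: le; lra.
by rewrite ler_norml; apply/andP; split; lra.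
Unshelve. all: by end_near.
Qed.

Lemma sup_ball_prob_itv a : 0 < a -> 0 < F a < 1.
Proof.
move=> a0; rewrite (sup_ball_prob_gt0 hB hX) //=.
apply: (lt_le_trans (sup_ball_prob_lt hB hX a0 (_ : a < a + 1))); first by rewrite ltrDl.
by rewrite sup_ball_probE; apply: pr_le1; exact: measurable_lap_ball hX _.
Qed.

Lemma sup_ball_prob_inj : {in `]0, +oo[ &, injective F}.
Proof.
move=> a b; rewrite !in_itv /= !andbT => a0 b0 ab; apply/eqP.
rewrite eq_le !leNgt; apply/andP; split; apply/negP => h.
  by have := sup_ball_prob_lt hB hX b0 h; rewrite ab ltxx.
by have := sup_ball_prob_lt hB hX a0 h; rewrite ab ltxx.
Qed.

(** Intermediate values on [y, c + 1]: F(y) <= y by [sup_ball_prob_le_id], and c is chosen so that 1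
    - c^-2 = y. *)
Lemma sup_ball_prob_onto y : 0 < y < 1 -> exists a, 0 < a /\ F a = y.
Proof.
move=> /andP[y0 y1]; pose c := Num.sqrt (1 - y)^-1.
have y2 : 0 < (1 - y)^-1 by rewrite invr_gt0 subr_gt0.
have c0 : 0 < c by rewrite sqrtr_gt0.
have c1 : y <= F (c + 1).
  have := sup_ball_prob_ge hB hX c0 (_ : c < c + 1); rewrite ltrDl => /(_ ltr01).
  by rewrite sqr_sqrtr ?(ltW y2) // invrK opprB addrC subrK.
have yF : F y <= y by apply: (sup_ball_prob_le_id hB hX); exact: ltW.
have yc : y <= c + 1 by lra.
have Fc : {within `[y, c + 1], continuous F}.
  apply: continuous_in_subspaceT => x; rewrite inE /= in_itv /= => /andP[yx _].
  by apply: sup_ball_prob_continuous; exact: lt_le_trans yx.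
have Fyc : F y <= F (c + 1) by exact: le_trans c1.
have [|a] := IVT yc Fc (v := y); first by rewrite min_l // max_r // yF.
by rewrite in_itv /= => /andP[ya _] ay; exists a; split => //; exact: lt_le_trans ya.
Qed.

Lemma sup_ball_prob_inverse : exists Finv : R -> R,
  [/\ forall y, 0 < y < 1 -> 0 < Finv y, forall y, 0 < y < 1 -> F (Finv y) = y &
      forall a, 0 < a -> Finv (F a) = a].
Proof.
have ex (y : R) : exists a, 0 < y < 1 -> 0 < a /\ F a = y.
  have [h|h] := boolP (0 < y < 1); last by exists 0.
  by have [a ?] := sup_ball_prob_onto h; exists a.
pose G y := projT1 (cid (ex y)).
have hG y : 0 < y < 1 -> 0 < G y /\ F (G y) = y := projT2 (cid (ex y)).
exists G; split => [y /hG[]//|y /hG[]//|a a0].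
have [g0 gE] := hG _ (sup_ball_prob_itv a0).
by apply: sup_ball_prob_inj => //; rewrite in_itv /= ?g0 ?a0.
Qed.

End quantile_function.

Section rademacher_signs.
Context (R : realType) (d : measure_display) (T : measurableType d)
  (P : probability T R) (eps : nat -> {RV P >-> R}).
Hypothesis heps : iid_rademacher eps.

(** [iid_rademacher] makes the variables signs only almost surely; composing with this function
    gives values 1 or -1 at every sample point, as [sign_seq] requires. *)
Definition sign_of (x : R) : R := 2 * \1_[set 1] x - 1.

Lemma measurable_sign_of : measurable_fun setT sign_of.
Proof.
by apply: measurable_funB => //; apply: measurable_funM => //; exact: measurable_indic.
Qed.

HB.instance Definition _ := isMeasurableFun.Build _ _ _ _ sign_of measurable_sign_of.

Definition sign_RV k : {RV P >-> R} := [the {mfun T >-> R} of sign_of \o eps k].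

Let sign1 x : (x = 1 -> sign_of x = 1) /\ (x <> 1 -> sign_of x = -1).
Proof.
rewrite /sign_of; split=> h; first by rewrite indicE mem_set // mulr1; lra.
by rewrite indicE memNset // mulr0 sub0r.
Qed.

Lemma sign_seq_RV : sign_seq sign_RV.
Proof.
have pre1 k : sign_RV k @^-1` [set 1] = eps k @^-1` [set 1].
  rewrite predeqE => w; split => /= h; last by have [->] := sign1 (eps k w).
  have [//|n1] := pselect (eps k w = 1).
  by have [_ /(_ n1)] := sign1 (eps k w); rewrite h; lra.
have mA k (c : R) : measurable (eps k @^-1` [set c]).
  by rewrite -[X in measurable X]setTI; exact: measurable_funP.
split.
- by apply: (indep_map (f := fun=> sign_of) heps.1) => // _; exact: measurable_sign_of.
- move=> k w; have [h|h] := pselect (eps k w = 1); [left|right].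
    by have [/(_ h)] := sign1 (eps k w).
  by have [_ /(_ h)] := sign1 (eps k w).
- by move=> k; rewrite pre1; have [] := heps.2 k.
- move=> k; rewrite (_ : _ @^-1` _ = ~` (eps k @^-1` [set 1])).
    rewrite probability_setC //; have [-> _] := heps.2 k.
    by rewrite -EFinB; congr EFin; field.
  rewrite -pre1 predeqE => w; split => /= h; first by rewrite h; lra.
  have [h1|h1] := pselect (eps k w = 1); last by have [_ /(_ h1)] := sign1 (eps k w).
  by case: h; have [/(_ h1)] := sign1 (eps k w).
Qed.

Lemma sign_RV_ae : {ae P, forall w, forall k, sign_RV k w = eps k w}.
Proof.
have mA k (c : R) : measurable (eps k @^-1` [set c]).
  by rewrite -[X in measurable X]setTI; exact: measurable_funP.
apply: ae_foralln => k; exists (~` (eps k @^-1` [set 1] `|` eps k @^-1` [set -1])); split.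
- by apply: measurableC; exact: measurableU.
- have [h1 h2] := heps.2 k.
  have mU := measurableU _ _ (mA k 1) (mA k (-1)).
  apply: (etrans (prE P (measurableC mU))).
  rewrite pr_setC; last exact: measurableU.
  rewrite pr_setU_disjoint //; last first.
    rewrite predeqE => w; split => // -[/= -> /eqP h].
    by move: h; rewrite -subr_eq0 opprK paddr_eq0 // oner_eq0.
  by rewrite /pr h1 h2 /=; congr EFin; field.
- move=> w /= h [h1|h1]; apply: h.
    by have [/(_ h1) ->] := sign1 (eps k w).
  by have [_ ->] := sign1 (eps k w); rewrite h1 //; lra.
Qed.

Lemma sup_norm_le n w b : (forall k, sign_RV k w = eps k w) ->
  poly_ball sign_RV n.+1 b w -> sup_norm (random_poly eps n w) <= b.
Proof.
move=> E h; apply: ge_sup.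
  by exists `|random_poly eps n w 0|, 0 => //=; rewrite in_itv /= lerN10 ler01.
move=> _ [x /= + <-]; rewrite in_itv /= => /h.
by rewrite (_ : pev _ _ _ = random_poly eps n w x) //; apply: eq_bigr => k _; rewrite E.
Qed.

Lemma sup_norm_ge n w b : (forall k, sign_RV k w = eps k w) ->
  ~ poly_ball sign_RV n.+1 b w -> b <= sup_norm (random_poly eps n w).
Proof.
move=> E /existsNP[y /not_implyP[hy /negP]]; rewrite -ltNge => /ltW h.
apply: (le_trans h); apply: ub_le_sup; last first.
  exists y; first by rewrite /= in_itv.
  by congr `|_|; apply: eq_bigr => k _; rewrite E.
exists n.+1%:R => _ [x /= + <-]; rewrite in_itv /= => hx.
apply: (le_trans (ler_norm_sum _ _ _)).
apply: (@le_trans _ _ (\sum_(k < n.+1) 1)); last by rewrite sumr_const card_ord.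
apply: ler_sum => k _.
have [_ e1 _ _] := sign_seq_RV.
rewrite -E normrM normrX -[leRHS]mulr1 ler_pM ?exprn_ge0 //.
  by have [->|->] := e1 k w; rewrite ?normrN normr1.
by rewrite exprn_ile1 // ler_norml.
Qed.

End rademacher_signs.

Theorem theorem1p1 (R : realType) (d : measure_display) (T : measurableType d)
    (P : probability T R) (B X : R -> {RV P >-> R})
    (hB : standard_brownian_motion B)
    (hX : continuous_laplace_process B X) :
  let F := sup_ball_prob X in
  [/\ {within `]0, +oo[, continuous F},
      {in `]0, +oo[ &, {homo F : x y / x < y}} &
      exists Finv : R -> R,
        inverse_between `]0, +oo[ `]0, 1[ F Finv /\
        forall (d' : measure_display) (T' : measurableType d')
          (P' : probability T' R) (eps : nat -> {RV P' >-> R}),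
          iid_rademacher eps ->
          {ae P', forall w,
             limn_einf (fun n : nat =>
               (sup_norm (random_poly eps n w) /
                (Num.sqrt n%:R * Finv (ln n%:R `^ (- 2^-1))))%:E) = 1%E}].
Proof.
move=> F; split.
- apply: continuous_in_subspaceT => x; rewrite inE /= in_itv /= andbT => x0.
  exact: (sup_ball_prob_continuous hB hX).
- move=> x y; rewrite !in_itv /= !andbT => x0 _; exact: (sup_ball_prob_lt hB hX).
have [G [G0 FG GF]] := sup_ball_prob_inverse hB hX; exists G; split.
  split.
  - by move=> x /=; rewrite !in_itv /= andbT => /(sup_ball_prob_itv hB hX).
  - by move=> y /=; rewrite !in_itv /= andbT => /G0.
  - by move=> x; rewrite inE /= in_itv /= andbT => /GF.
  - by move=> y; rewrite inE /= in_itv /= => /FG.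
move=> d' T' P' eps heps.
pose del n := G (ln n%:R `^ (- 2^-1)).
have hdel n : (8 <= n)%N -> 0 < del n /\ F (del n) ^+ 2 = (ln n%:R)^-1.
  move=> n8; have l1 := @ln_nat_gt1 R n n8; have l0 := lt_trans ltr01 l1.
  have pE : ln n%:R `^ (- 2^-1) = (Num.sqrt (ln n%:R))^-1 :> R.
    by rewrite powRN powR12_sqrt // ltW.
  have p01 : 0 < (ln n%:R `^ (- 2^-1) : R) < 1.
    apply/andP; split; first exact: powR_gt0.
    rewrite pE invf_lt1 ?sqrtr_gt0 //.
    by rewrite -[ltLHS]sqrtr1 ltr_sqrt.
  by split; [exact: G0|rewrite /del /F FG // pE exprVn sqr_sqrtr // ltW].
have he := sign_seq_RV heps.
(* The tolerances run over a sequence, so that the exceptional null sets can be united; starting at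
   1/2 keeps them below 1. *)
have m01 m : 0 < (m.+2%:R^-1 : R) < 1.
  by rewrite invr_gt0 ltr0n /= invf_lt1 ?ltr1n // ltr0n.
have lo := ae_foralln (fun m => sign_poly_lower hB hX he hdel (m01 m)).
have up := ae_foralln (fun m => sign_poly_upper hB hX he hdel (m01 m)).
apply: filterS3 (sign_RV_ae heps) lo up => w E hlo hup.
have pos n : (8 <= n)%N -> 0 < Num.sqrt n%:R * del n.
  move=> n8; rewrite mulr_gt0 ?sqrtr_gt0 ?ltr0n ?(leq_trans _ n8) //.
  by have [] := hdel n n8.
apply: limn_einf_eq1 => [m|m K].
  have [K hK] := hlo m; exists (maxn K 8) => n; rewrite geq_max => /andP[Kn n8].
  rewrite ler_pdivlMr ?pos // mulrA; apply: (sup_norm_ge heps E); exact: hK.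
have [n Kn hn] := hup m (maxn K 8).
move: Kn; rewrite geq_max => /andP[Kn n8]; exists n => //.
by rewrite ler_pdivrMr ?pos // mulrA; exact: (sup_norm_le E).
Qed.
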